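(* Assume that $D$ is a union of finitely many bounded Lipschitz domains $D_1,\dots,D_N$ such that $\overline D_j\cap\overline D_l=\emptyset$ if $j\neq l$. Let $k\ge 0$ be small in the following sense: $$k^2C_0(\Omega\setminus\overline D)^2\le 1\qquad\text{and}\qquad \min_j\{1-2k^2C(D_j)^2(1+1)^2\}>0.$$ Then, given $x\in\Omega$ and a needle $\sigma$ with tip at $x$, we have: (i) if $x\in\Omega\setminus\overline D$ and $\sigma(]0,1])\cap\overline D=\emptyset$, then for any needle sequence $\xi=\{v_n\}$ for $(x,\sigma)$ the sequence $\{I(x,\sigma,\xi)_n\}$ is convergent; (ii) if $x\in\Omega\setminus\overline D$ and $\sigma(]0,1])\cap D\neq\emptyset$, then for any needle sequence $\xi=\{v_n\}$ for $(x,\sigma)$ we have $\lim_{n\to\infty}I(x,\sigma,\xi)_n=\infty$; (iii) if $x\in\overline D$, then for any needle sequence $\xi=\{v_n\}$ for $(x,\sigma)$ we have $\lim_{n\to\infty}I(x,\sigma,\xi)_n=\infty$.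
   Context: Setting. $m\in\{2,3\}$, $\Omega\subset\mathbb{R}^m$ is a bounded domain with Lipschitz boundary, $D$ is an open subset of $\Omega$ with Lipschitz boundary such that $\overline D\subset\Omega$ and $\Omega\setminus\overline D$ is connected. $\nu$ is the unit outward normal relative to $\Omega\setminus\overline D$. $k\ge0$. It is always assumed that $0$ is not a Dirichlet eigenvalue of $\Delta+k^2$ in $\Omega$, and that $0$ is not an eigenvalue of the mixed problem $\Delta u+k^2u=0$ in $\Omega\setminus\overline D$, $\partial u/\partial\nu=0$ on $\partial D$, $u=0$ on $\partial\Omega$. Functions are complex valued. Dirichlet-to-Neumann maps. For $f\in H^{1/2}(\partial\Omega)$ let $u\in H^1(\Omega\setminus\overline D)$ be the weak solution of $\Delta u+k^2u=0$ in $\Omega\setminus\overline D$, $\partial u/\partial\nu=0$ on $\partial D$, $u=f$ on $\partial\Omega$, and set $\Lambda_Df=\frac{\partial u}{\partial\nu}|_{\partial\Omega}\in H^{-1/2}(\partial\Omega)$. $\Lambda_0$ denotes $\Lambda_D$ in the case $D=\emptyset$ (i.e. the equation is solved in all of $\Omega$). Integrals over $\partial\Omega$ involving $\Lambda_D,\Lambda_0$ are understood as the bilinear $H^{-1/2}$–$H^{1/2}$ duality pairing. Poincaré constants. $C_0(\Omega\setminus\overline D)>0$ is a constant such that $\int_{\Omega\setminus\overline D}|w|^2dy\le C_0(\Omega\setminus\overline D)^2\int_{\Omega\setminus\overline D}|\nabla w|^2dy$ for all $w\in H^1(\Omega\setminus\overline D)$ with $w=0$ on $\partial\Omega$. For a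 bounded Lipschitz domain $U$, $C(U)>0$ is a constant such that $\int_U|v-v_U|^2dy\le C(U)^2\int_U|\nabla v|^2dy$ for all $v\in H^1(U)$, where $v_U=\frac{1}{|U|}\int_Uv\,dy$. $G_k$ denotes the standard fundamental solution of the Helmholtz equation $\Delta u+k^2u=0$ in $\mathbb{R}^m$: $G_k(y)=\frac{e^{ik|y|}}{4\pi|y|}$ if $m=3$; $G_k(y)=\frac{i}{4}H^{(1)}_0(k|y|)$ if $m=2$, $k>0$; $G_0(y)=\frac{1}{2\pi}\log\frac{1}{|y|}$ if $m=2$, $k=0$. Needle: given $x\in\Omega$, a needle with tip at $x$ is a (continuous) piecewise linear curve $\sigma:[0,1]\to\overline\Omega$ that is injective and satisfies $\sigma(0)\in\partial\Omega$, $\sigma(1)=x$ and $\sigma(t)\in\Omega$ for all $t\in\,]0,1[$. Needle sequence: a sequence $\xi=\{v_n\}$ of $H^1(\Omega)$ solutions of $\Delta v_n+k^2v_n=0$ in $\Omega$ is a needle sequence for $(x,\sigma)$ if for each compact set $K\subset\mathbb{R}^m$ with $K\subset\Omega\setminus\sigma([0,1])$, $$\lim_{n\to\infty}\bigl(\|v_n(\cdot)-G_k(\cdot-x)\|_{L^2(K)}+\|\nabla\{v_n(\cdot)-G_k(\cdot-x)\}\|_{L^2(K)}\bigr)=0.$$ Indicator sequence: for $x\in\Omega$, a needle $\sigma$ with tip at $x$ and a needle sequence $\xi=\{v_n\}$ for $(x,\sigma)$, $$I(x,\sigma,\xi)_n=\int_{\partial\Omega}\{(\Lambda_0-\Lambda_D)\overline{f_n}\}f_n\,dS,\quad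 n=1,2,\dots,\qquad f_n=v_n|_{\partial\Omega}.$$ (These numbers are real.) *)

(* Defs.v *)
From HB Require Import structures.
From mathcomp Require Import all_boot all_order all_algebra.
From mathcomp Require Import complex.
From mathcomp Require Import all_classical all_reals all_analysis.

Set Implicit Arguments.
Unset Strict Implicit.
Unset Printing Implicit Defensive.
Import Order.TTheory GRing.Theory Num.Theory.
Import numFieldNormedType.Exports.
Local Open Scope classical_set_scope.
Local Open Scope complex_scope.
Local Open Scope ring_scope.

(* The sigma-algebra generated by the coordinates, i.e. the Borel one; same
   construction as the library's instance on n.-tuple T. *)
Definition rV_display : measure_display. Proof. by constructor. Qed.

Section measurable_rV.
Context {R : realType} (n : nat).

Let coord (i : 'I_n) (y : 'rV[R]_n) : measurableTypeR R := y ord0 i.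

Let rV_set0 : g_sigma_preimage coord set0.
Proof. exact: sigma_algebra0. Qed.

Let rV_setC A : g_sigma_preimage coord A -> g_sigma_preimage coord (~` A).
Proof. exact: sigma_algebraC. Qed.

Let rV_bigcup (F : (set 'rV[R]_n)^nat) :
  (forall i, g_sigma_preimage coord (F i)) ->
  g_sigma_preimage coord (\bigcup_i (F i)).
Proof. exact: sigma_algebra_bigcup. Qed.

HB.instance Definition _ := @isMeasurable.Build rV_display
  'rV[R]_n (g_sigma_preimage coord) rV_set0 rV_setC rV_bigcup.

Lemma measurable_coord_rV (i : 'I_n) :
  measurable_fun [set: 'rV[R]_n] (fun y : 'rV[R]_n => y ord0 i : measurableTypeR R).
Proof.
move=> _ Y mY; rewrite setTI; apply: sub_sigma_algebra => /=.
rewrite -bigcup_seq/=; exists i => /=; first by rewrite mem_index_enum.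
by exists Y => //; rewrite setTI.
Qed.

Lemma measurable_to_rV d (T : measurableType d) (f : T -> 'rV[R]_n) :
  (forall i, measurable_fun [set: T] (fun t => f t ord0 i : measurableTypeR R)) ->
  measurable_fun [set: T] f.
Proof.
move=> mf _ A mA; rewrite setTI.
suff : g_sigma_preimage coord `<=` [set B | measurable (f @^-1` B)] by exact.
apply: smallest_sub; first split => /=.
- by rewrite preimage_set0.
- by move=> B mB; rewrite setTD preimage_setC; exact: measurableC.
- by move=> F mF; rewrite preimage_bigcup; exact: bigcup_measurable.
rewrite -bigcup_seq/= => B [i _ [C mC <-]] /=.
by have := mf i measurableT C mC; rewrite !setTI.
Qed.

End measurable_rV.

Section lebesgue_rV.
Context {R : realType}.
Local Open Scope ereal_scope.

Definition cons_rV n (p : measurableTypeR R * 'rV[R]_n) : 'rV[R]_n.+1 :=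
  row_mx (p.1 : R)%:M p.2.

Definition uncons_rV n (y : 'rV[R]_n.+1) : measurableTypeR R * 'rV[R]_n :=
  (y ord0 ord0, \row_i y ord0 (lift ord0 i)).

Let cons_rV0 n p : @cons_rV n p ord0 ord0 = p.1.
Proof.
rewrite /cons_rV (_ : ord0 = lshift n (ord0 : 'I_1)); last exact/val_inj.
by rewrite (@row_mxEl _ 1 1 n) mxE eqxx mulr1n.
Qed.

Let cons_rVS n p i : @cons_rV n p ord0 (lift ord0 i) = p.2 ord0 i.
Proof.
rewrite /cons_rV (_ : lift ord0 i = rshift 1 i); last exact/val_inj.
by rewrite (@row_mxEr _ 1 1 n).
Qed.

Lemma cons_rVK n : cancel (@cons_rV n) (@uncons_rV n).
Proof.
move=> [t y]; rewrite /uncons_rV cons_rV0; congr pair.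
by apply/rowP => i; rewrite mxE cons_rVS.
Qed.

Lemma uncons_rVK n : cancel (@uncons_rV n) (@cons_rV n).
Proof.
move=> y; apply/rowP => i; case: (unliftP ord0 i) => [j|] ->.
  by rewrite cons_rVS mxE.
by rewrite cons_rV0.
Qed.

Lemma measurable_cons_rV n : measurable_fun setT (@cons_rV n).
Proof.
apply: measurable_to_rV => i; case: (unliftP ord0 i) => [j|] ->.
  apply: (eq_measurable_fun ((fun y : 'rV[R]_n => y ord0 j : measurableTypeR R) \o snd)).
    by move=> p _; rewrite cons_rVS.
  by apply: measurableT_comp => //; exact: measurable_coord_rV.
apply: (eq_measurable_fun fst) => // p _; by rewrite cons_rV0.
Qed.

Lemma measurable_uncons_rV n : measurable_fun setT (@uncons_rV n).
Proof.
apply/measurable_fun_pairP; split; first exact: measurable_coord_rV.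
apply: measurable_to_rV => i.
apply: (eq_measurable_fun
  (fun y : 'rV[R]_n.+1 => y ord0 (lift ord0 i) : measurableTypeR R)).
  by move=> y _; rewrite mxE.
exact: measurable_coord_rV.
Qed.

Definition lebesgue_cons n (mu : {sigma_finite_measure set 'rV[R]_n -> \bar R}) :
    set 'rV[R]_n.+1 -> \bar R :=
  pushforward (lebesgue_measure \x mu) (@cons_rV n).

Section lebesgue_cons_measure.
Variables (n : nat) (mu : {sigma_finite_measure set 'rV[R]_n -> \bar R}).

Let lc0 : lebesgue_cons mu set0 = 0.
Proof. by rewrite /lebesgue_cons /pushforward preimage_set0 measure0. Qed.

Let lc_ge0 A : 0 <= lebesgue_cons mu A.
Proof. by rewrite /lebesgue_cons /pushforward; exact: measure_ge0. Qed.

Let mpre A : measurable A -> measurable (@cons_rV n @^-1` A).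
Proof. by move=> mA; rewrite -[X in measurable X]setTI; exact: measurable_cons_rV. Qed.

Let lc_sigma_additive : semi_sigma_additive (lebesgue_cons mu).
Proof.
move=> F mF tF mUF; rewrite /lebesgue_cons /pushforward preimage_bigcup.
apply: measure_semi_sigma_additive.
- by move=> i; exact: mpre.
- apply/trivIsetP => /= i j _ _ ij; rewrite -preimage_setI.
  by move/trivIsetP : tF => /(_ _ _ _ _ ij) ->//; rewrite preimage_set0.
- by rewrite -preimage_bigcup; exact: mpre.
Qed.

HB.instance Definition _ := isMeasure.Build _ _ _ (lebesgue_cons mu)
  lc0 lc_ge0 lc_sigma_additive.

Let lc_sigma_finite : sigma_finite setT (lebesgue_cons mu).
Proof.
pose lam : {sigma_finite_measure set (measurableTypeR R) -> \bar R} :=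
  lebesgue_measure.
have /sigma_finiteP[F [TF ndF Foo]] := sigma_finiteT lam.
have /sigma_finiteP[G [TG ndG Goo]] := sigma_finiteT mu.
exists (fun i => @uncons_rV n @^-1` (F i `*` G i)) => [|i].
  rewrite -preimage_bigcup (_ : \bigcup_i _ = setT) ?preimage_setT//.
  apply/seteqP; split=> // -[t y] _.
  have [j _ Fjt] : (\bigcup_i F i) t by rewrite -TF.
  have [k _ Gky] : (\bigcup_i G i) y by rewrite -TG.
  exists (maxn j k) => //; split => /=.
    by move: t Fjt; exact/subsetPset/ndF/leq_maxl.
  by move: y Gky; exact/subsetPset/ndG/leq_maxr.
have [mF Fi] := Foo i; have [mG Gi] := Goo i; split.
  rewrite -[X in measurable X]setTI; apply: measurable_uncons_rV => //.
  exact: measurableX.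
rewrite /lebesgue_cons /pushforward -comp_preimage.
rewrite (_ : _ \o _ = id); last by apply/funext => p /=; rewrite cons_rVK.
by rewrite preimage_id product_measure1E// lte_mul_pinfty// ge0_fin_numE.
Qed.

HB.instance Definition _ := Measure_isSigmaFinite.Build _ _ _ (lebesgue_cons mu)
  lc_sigma_finite.

End lebesgue_cons_measure.

(* lebesgue_rV n is n-dimensional Lebesgue measure, the n-fold product of
   lebesgue_measure; on R^0 it is the point mass. *)
Fixpoint lebesgue_rV n : {sigma_finite_measure set 'rV[R]_n -> \bar R} :=
  if n isn't n'.+1 then \d_(0%R : 'rV[R]_0) else lebesgue_cons (lebesgue_rV n').

End lebesgue_rV.

Section sobolev.
Context {R : realType} {m : nat}.
Local Notation E := 'rV[R]_m.
Local Notation C := R[i].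
Local Notation leb := (@lebesgue_rV R m).
Implicit Types (A U Omega D : set E) (u v w : E -> C) (phi : E -> R).

Definition dot (y z : E) : R := \sum_i y ord0 i * z ord0 i.

(* The library norm on row vectors is the sup norm; this is the Euclidean one. *)
Definition enorm (y : E) : R := Num.sqrt (dot y y).

Definition Cmeasurable_fun A u :=
  measurable_fun A (fun y => complex.Re (u y)) /\
  measurable_fun A (fun y => complex.Im (u y)).

Definition Cintegral A u : C :=
  (\int[leb]_(y in A) complex.Re (u y)) +i* (\int[leb]_(y in A) complex.Im (u y)).

Definition sqmod (z : C) : R := complex.Re z ^+ 2 + complex.Im z ^+ 2.

Definition sqL2 A u : \bar R := (\int[leb]_(y in A) (sqmod (u y))%:E)%E.

Definition L2 U : set (E -> C) :=
  [set u | Cmeasurable_fun U u /\ (sqL2 U u < +oo)%E].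

Definition L1loc U u := forall K : set E, compact K -> K `<=` U ->
  leb.-integrable K (fun y => (complex.Re (u y))%:E) /\
  leb.-integrable K (fun y => (complex.Im (u y))%:E).

Definition partial (i : 'I_m) phi : E -> R := 'D_(delta_mx ord0 i) phi.

Fixpoint Cn (n : nat) phi : Prop :=
  continuous phi /\
  if n isn't n'.+1 then True else forall i : 'I_m,
    (forall y, derivable phi y (delta_mx ord0 i)) /\ Cn n' (partial i phi).

Definition test_function U : set (E -> R) :=
  [set phi | (forall n, Cn n phi) /\
    exists2 K, compact K & K `<=` U /\ forall y, ~ K y -> phi y = 0].

Definition Ctest_function U : set (E -> C) :=
  [set phi | test_function U (fun y => complex.Re (phi y)) /\
             test_function U (fun y => complex.Im (phi y))].

Definition is_weak_partial U (i : 'I_m) u : set (E -> C) :=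
  [set g | L1loc U g /\ forall phi, test_function U phi ->
    Cintegral U (fun y => u y * (partial i phi y)%:C) =
    - Cintegral U (fun y => g y * (phi y)%:C)].

(* A choice of the i-th distributional derivative of u in U, which is unique
   up to null subsets of U; the default value 0 is used if u has none. *)
Definition weak_partial U (i : 'I_m) u : E -> C :=
  xget (fun=> 0) (is_weak_partial U i u).

Definition H1 U : set (E -> C) :=
  [set u | L2 U u /\ forall i, exists2 g, is_weak_partial U i u g & L2 U g].

(* The integral over A of the squared modulus of the gradient of u, which is
   taken in the open set U; A is a subset of U. *)
Definition sqL2grad U A u : \bar R := (\sum_(i < m) sqL2 A (weak_partial U i u))%E.

Definition normL2 A u : \bar R := (sqL2 A u `^ 2^-1)%E.
Definition normL2grad U A u : \bar R := (sqL2grad U A u `^ 2^-1)%E.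

(* Elements of H^1(U) with zero trace on the boundary of Omega, where U is Omega
   with a compact part of its interior possibly removed: the closure in H^1(U)
   of the restrictions of C^oo functions with compact support in Omega. There is
   no condition on the part of the boundary of U inside Omega, and
   H10 Omega Omega is the usual H^1_0(Omega). *)
Definition H10 Omega U : set (E -> C) :=
  [set u | H1 U u /\ exists2 phi : nat -> E -> C,
    forall n, Ctest_function Omega (phi n) &
    (fun n => let d y := (u y - phi n y)%R in
       normL2 U d + normL2grad U U d)%E @ \oo --> 0%E].

Definition helmholtz_form (k : R) U u w : C := Cintegral U (fun y =>
  (\sum_(i < m) weak_partial U i u y * weak_partial U i w y)
  - (k ^+ 2)%:C * u y * w y).

(* Weak form of Delta u + k^2 u = 0 in U; when U is strictly smaller than Omega
   it includes the Neumann condition on the inner boundary of U. *)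
Definition weak_helmholtz (k : R) Omega U u :=
  H1 U u /\ forall w, H10 Omega U w -> helmholtz_form k U u w = 0.

Definition not_eigenvalue (k : R) Omega U := forall u,
  H10 Omega U u -> weak_helmholtz k Omega U u ->
  {ae leb, forall y, U y -> u y = 0}.

(* An element of H^{1/2}(bd Omega) is represented by a function f in H^1(Omega)
   of which it is the trace. *)
Definition is_solution (k : R) Omega U (f : E -> C) : set (E -> C) :=
  [set u | weak_helmholtz k Omega U u /\ H10 Omega U (fun y => u y - f y)].

Definition solution (k : R) Omega U f : E -> C :=
  xget (fun=> 0) (is_solution k Omega U f).

(* DN k Omega D f w is the value of the duality pairing of Lambda_D(f|bd Omega),
   an element of H^{-1/2}(bd Omega), with w|bd Omega: by definition of the weak
   normal derivative (Green's formula), the integral over Omega minus closure D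
   of (grad u . grad w - k^2 u w). *)
Definition DN (k : R) Omega D f : (E -> C) -> C :=
  helmholtz_form k (Omega `\` closure D) (solution k Omega (Omega `\` closure D) f).

(* Near each boundary point, U is the set of points lying below the graph of a
   Lipschitz function over the hyperplane orthogonal to some unit vector e;
   y - <y, e> e is the orthogonal projection of y to that hyperplane. *)
Definition lipschitz_boundary U :=
  forall p, closure U p -> ~ interior U p ->
  exists (e : E) (phi : E -> R) (L : R),
    [/\ enorm e = 1,
        forall y z, `|phi y - phi z| <= L * enorm (y - z) &
        \forall y \near p, U y <-> dot y e < phi (y - dot y e *: e)].

Definition lipschitz_domain U :=
  [/\ open U, connected U, U !=set0, bounded_set U & lipschitz_boundary U].

Definition poincare_constant0 Omega U (c : R) := 0 < c /\
  forall w, H10 Omega U w -> (sqL2 U w <= (c ^+ 2)%:E * sqL2grad U U w)%E.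

Definition mean U u : C := ((fine (leb U))^-1)%:C * Cintegral U u.

Definition poincare_constant U (c : R) := 0 < c /\
  forall v, H1 U v ->
    (sqL2 U (fun y => (v y - mean U v)%R) <= (c ^+ 2)%:E * sqL2grad U U v)%E.

End sobolev.

Section fundamental_solution.
Context {R : realType}.
Local Notation C := R[i].

Definition euler_gamma : R := limn (fun n => series harmonic n - ln n%:R).

(* Ascending series of the Bessel functions J_0 and Y_0; series harmonic j is
   1 + 1/2 + ... + 1/j. *)
Definition besselJ0 (z : R) : R :=
  limn (series (fun j => (-1) ^+ j * (z / 2) ^+ (2 * j) / (j`!%:R ^+ 2))).

Definition besselY0 (z : R) : R :=
  2 / pi * ((ln (z / 2) + euler_gamma) * besselJ0 z
    - limn (series (fun j => (-1) ^+ j * series harmonic j * (z / 2) ^+ (2 * j)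
                             / (j`!%:R ^+ 2)))).

Definition hankel0 (z : R) : C := besselJ0 z +i* besselY0 z.

(* Only the dimensions m = 2 and m = 3 are meaningful. *)
Definition fundamental_solution (m : nat) (k : R) (y : 'rV[R]_m) : C :=
  let r := enorm y in
  if m == 3%N then (cos (k * r) +i* sin (k * r)) / (4 * pi * r)%:C
  else if k == 0 then ((2 * pi)^-1 * ln r^-1)%:C
  else (0 +i* 4^-1) * hankel0 (k * r).

End fundamental_solution.

Section needles.
Context {R : realType} {m : nat}.
Local Notation E := 'rV[R]_m.
Local Notation C := R[i].
Implicit Types (Omega D : set E) (sigma : R -> E).

Definition piecewise_linear sigma :=
  exists (p : nat) (t : nat -> R),
    [/\ t 0%N = 0, t p = 1,
        forall j, (j < p)%N -> t j < t j.+1 &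
        forall j, (j < p)%N -> exists a b : E,
          {in `[t j, t j.+1], forall s, sigma s = a + s *: b}].

Definition needle Omega (x : E) sigma :=
  [/\ {within `[0, 1], continuous sigma} /\ piecewise_linear sigma,
      {in `[0, 1] &, injective sigma},
      closure Omega (sigma 0) /\ ~ interior Omega (sigma 0),
      sigma 1 = x &
      {in `]0, 1[, forall t, Omega (sigma t)}].

Definition needle_sequence (k : R) Omega (x : E) sigma (v : nat -> E -> C) :=
  (forall n, weak_helmholtz k Omega Omega (v n)) /\
  let U := Omega `\` sigma @` `[0, 1] in
  forall K : set E, compact K -> K `<=` U ->
    (fun n => let d y := (v n y - fundamental_solution k (y - x))%R in
       normL2 K d + normL2grad U K d)%E @ \oo --> 0%E.

Definition indicator (k : R) Omega D (v : nat -> E -> C) (n : nat) : C :=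
  let f := v n in let fbar y := conjc (v n y) in
  DN k Omega set0 fbar f - DN k Omega D fbar f.

End needles.

(* The sequence c consists of real numbers and converges, resp. tends to +oo. *)
Definition converges {R : realType} (c : nat -> R[i]) :=
  exists2 r : nat -> R, forall n, c n = (r n)%:C & cvgn r.

Definition diverges_to_infinity {R : realType} (c : nat -> R[i]) :=
  exists2 r : nat -> R, forall n, c n = (r n)%:C & r @ \oo --> +oo.

(* Main.v *)
(* Write a(u, w) for the integral of grad u . grad w - k^2 u w over Omega minus closure D,
   b(u, w) for the same integral over D, and treat the real and imaginary parts of v_n
   separately. If w_n vanishes on the boundary of Omega and satisfies
   a(w_n, w) = - a(v_n, w) for all such w, then v_n + w_n is the solution with the hole D and
   trace f_n, and Green's formula gives I_n = b(v_n, v_n) + a(w_n, w_n). The form a is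
   nonnegative by k C_0 <= 1; it is even coercive, because it is so up to finitely many
   linear functionals (Rellich) and has a trivial kernel.

   (i) v_n converges near closure D, and w_n depends continuously on v_n near closure D.

   (ii), (iii) The nullity of the boundary of D, the nonnegativity of a and Poincare's
   inequality on each D_j, where the mean value is controlled on a compact subset of D_j that
   avoids the needle, give I_n >= c |grad v_n|^2_{L^2(D)} - C'. If x is in closure D, the
   Lipschitz condition provides disjoint balls in D shrinking to x, on each of which G_k
   contributes at least a constant to the energy. If the needle enters D before reaching
   x, then v_n is unbounded in L^2(D): otherwise the identity int v_n (Delta + k^2) psi = 0,
   for a test function psi equal to a plane wave near the part of the needle behind D,
   would pass to the limit, whereas int G_k (Delta + k^2) psi = - psi(x).

   The real part of G_k is F(|y|^2), where only the equation 4 s F'' + 2 m F' + k^2 F = 0 and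
   bounds of F' and F'' near 0 matter. *)
Require Import Defs.
From mathcomp Require Import all_boot all_order all_algebra.
From mathcomp Require Import complex.
From mathcomp Require Import all_classical all_reals all_analysis.
From mathcomp Require Import measurable_realfun ring lra.

Set Implicit Arguments.
Unset Strict Implicit.
Unset Printing Implicit Defensive.
Import Order.TTheory GRing.Theory Num.Theory.
Import numFieldNormedType.Exports.
Local Open Scope classical_set_scope.
Local Open Scope complex_scope.
Local Open Scope ring_scope.

(** The obstacle throughout is that nothing bounds [v_n] on the needle or near it: only convergence
    on compact sets off the needle is given. This decides three choices. The functional a(v_n, .)
    must be estimated without a norm of v_n on the whole exterior domain, hence a cutoff near
    closure D. The mean value in Poincare's inequality must be read off from a compact set that
    misses the needle; since the needle is null, such a set can carry 3/4 of the measure of D_j, and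
    this turns the constant C^2 into 22/3 C^2. The smallness condition reads 8 k^2 C^2 < 1, so k^2
    |v|^2 takes at most 22/3 times 1/8, that is 11/12, of the gradient, and 1/12 remains. When the
    needle crosses D before reaching x, only the norm in L^2(D) is seen to blow up, and the same
    Poincare inequality transfers this to the gradient. Traces never appear: boundary values are
    membership in closures of test functions, so identities are checked on test functions and
    extended by continuity. *)

Lemma discriminant_le (R : realFieldType) (a c q : R) :
  (forall t, 0 <= a + 2 * t * c + t ^+ 2 * q) -> c ^+ 2 <= a * q.
Proof.
move=> h; have [q0|q0] := eqVneq q 0.
  have [->|c0] := eqVneq c 0; first by rewrite q0 mulr0 expr0n.
  have := h (- (a + 1) / (2 * c)); rewrite q0 mulr0 addr0.
  have -> : 2 * (- (a + 1) / (2 * c)) * c = - (a + 1) by field.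
  by lra.
have qgt0 : 0 < q.
  rewrite lt_neqAle eq_sym q0 /= leNgt; apply/negP => qlt0.
  have h0 := h 0; have a0 : 0 <= a by move: h0; lra.
  (* A negative [q] is excluded by two opposite values of [t]: the linear terms cancel in the sum,
     and with [u = 1 + |c| + a], [s = 1 - 1/q] one has [t^2 q = u^2 s (q - 1) <= - u < - a]. *)
  have h1 := h ((1 + `|c| + a) * (1 - q^-1)); have h2 := h (- (1 + `|c| + a) * (1 - q^-1)).
  have iq : q^-1 < 0 by rewrite invr_lt0.
  have hc : 0 <= `|c| by [].
  set s := 1 - q^-1 in h1 h2; have s1 : 1 < s by rewrite /s; lra.
  have sq : s * q = q - 1 by rewrite /s mulrBl mul1r mulVf.
  set u := 1 + `|c| + a in h1 h2; have u1 : 1 <= u by rewrite /u; lra.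
  have h3 : 0 <= a + u ^+ 2 * s * (q - 1).
    rewrite -sq; have -> : u ^+ 2 * s * (s * q) = (u * s) ^+ 2 * q by ring.
    have e : (- u * s) ^+ 2 * q = (u * s) ^+ 2 * q by ring.
    by rewrite e in h2; move: h1 h2; lra.
  have h4 : u ^+ 2 * s * (1 - q) >= u.
    have : 1 <= s * (1 - q) by nra.
    have : u <= u ^+ 2 by nra.
    by nra.
  have : a < u by rewrite /u; lra.
  by nra.
have := h (- c / q).
have -> : a + 2 * (- c / q) * c + (- c / q) ^+ 2 * q = (a * q - c ^+ 2) / q by field.
by rewrite pmulr_lge0 ?invr_gt0// subr_ge0.
Qed.

(** * Hilbert spaces *)

Section hilbert.
Context {R : realType} {X : lmodType R}.
Implicit Types (V : set X) (b : X -> X -> R) (l : X -> R).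

(** Elements are functions, not classes modulo null sets, so forms are only semidefinite and limits
    are not unique. Hence subspaces are predicates on an ambient module. *)
Definition linear_set V := V 0 /\ forall (a : R) u v, V u -> V v -> V (a *: u + v).

Definition symmetric_on V b := forall u v, V u -> V v -> b u v = b v u.

Definition linear_on V l := forall (a : R) u v, V u -> V v -> l (a *: u + v) = a * l u + l v.

Definition bilinear_form V b :=
  symmetric_on V b /\ forall w, V w -> linear_on V (b ^~ w).

Definition cauchy_for b (u : nat -> X) := forall e : R, 0 < e ->
  exists N, forall i j, (N <= i)%N -> (N <= j)%N -> b (u i - u j) (u i - u j) < e.

Definition converges_for b (u : nat -> X) w := forall e : R, 0 < e ->
  exists N, forall i, (N <= i)%N -> b (u i - w) (u i - w) < e.

Definition complete_for V b := forall u, (forall n, V (u n)) ->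
  cauchy_for b u -> exists2 w, V w & converges_for b u w.

Section forms.
Variables (V : set X) (b : X -> X -> R).
Hypotheses (linV : linear_set V) (bilb : bilinear_form V b).

Lemma lset0 : V 0. Proof. by case: linV. Qed.

Lemma lsetD u v : V u -> V v -> V (u + v).
Proof. by move=> Vu Vv; rewrite -[u]scale1r; case: linV => _; apply. Qed.

Lemma lsetZ (a : R) u : V u -> V (a *: u).
Proof. by move=> Vu; rewrite -[_ *: _]addr0; case: linV => V0; apply. Qed.

Lemma lsetB u v : V u -> V v -> V (u - v).
Proof. by move=> Vu Vv; apply: lsetD => //; rewrite -scaleN1r; exact: lsetZ. Qed.

Lemma linear_on0 l : linear_on V l -> l 0 = 0.
Proof.
move=> ll; have := ll 1 0 0 lset0 lset0.
by rewrite scale1r addr0 mul1r => h; lra.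
Qed.

Lemma linear_onD l u v : linear_on V l -> V u -> V v -> l (u + v) = l u + l v.
Proof. by move=> ll Vu Vv; rewrite -[in LHS](scale1r u) ll// mul1r. Qed.

Lemma linear_onZ l (a : R) u : linear_on V l -> V u -> l (a *: u) = a * l u.
Proof.
by move=> ll Vu; rewrite -[in LHS](addr0 (a *: u)) ll ?linear_on0 ?addr0//; exact: lset0.
Qed.

Lemma linear_onB l u v : linear_on V l -> V u -> V v -> l (u - v) = l u - l v.
Proof.
by move=> ll Vu Vv; rewrite addrC -scaleN1r ll// mulN1r addrC.
Qed.

Lemma formC u v : V u -> V v -> b u v = b v u.
Proof. by move=> Vu Vv; rewrite (bilb.1 _ _ Vu Vv). Qed.

Lemma form_linr w : V w -> linear_on V (b w).
Proof.
move=> Vw a u v Vu Vv; have Vauv : V (a *: u + v) by case: linV => _; apply.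
by rewrite !(formC Vw)//; exact: bilb.2.
Qed.

Lemma formDl u v w : V u -> V v -> V w -> b (u + v) w = b u w + b v w.
Proof. by move=> Vu Vv Vw; apply: (@linear_onD (b ^~ w)) => //; exact: bilb.2. Qed.

Lemma formBl u v w : V u -> V v -> V w -> b (u - v) w = b u w - b v w.
Proof. by move=> Vu Vv Vw; apply: (@linear_onB (b ^~ w)) => //; exact: bilb.2. Qed.

Lemma formZl (a : R) u w : V u -> V w -> b (a *: u) w = a * b u w.
Proof. by move=> Vu Vw; apply: (@linear_onZ (b ^~ w)) => //; exact: bilb.2. Qed.

Lemma formDr u v w : V u -> V v -> V w -> b w (u + v) = b w u + b w v.
Proof. by move=> Vu Vv Vw; apply: linear_onD => //; exact: form_linr. Qed.

Lemma formBr u v w : V u -> V v -> V w -> b w (u - v) = b w u - b w v.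
Proof. by move=> Vu Vv Vw; apply: linear_onB => //; exact: form_linr. Qed.

Lemma formZr (a : R) u w : V u -> V w -> b w (a *: u) = a * b w u.
Proof. by move=> Vu Vw; apply: linear_onZ => //; exact: form_linr. Qed.

Lemma form_sqrD u v : V u -> V v -> b (u + v) (u + v) = b u u + 2 * b u v + b v v.
Proof.
move=> Vu Vv; have Vuv := lsetD Vu Vv.
by rewrite formDl// !formDr// (formC Vv Vu); ring.
Qed.

Lemma form_sqrB u v : V u -> V v -> b (u - v) (u - v) = b u u - 2 * b u v + b v v.
Proof.
move=> Vu Vv; have Vuv := lsetB Vu Vv.
by rewrite formBl// !formBr// (formC Vv Vu); ring.
Qed.

Hypothesis b_ge0 : forall u, V u -> 0 <= b u u.

Lemma form_CS u v : V u -> V v -> (b u v) ^+ 2 <= b u u * b v v.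
Proof.
move=> Vu Vv; apply: discriminant_le => t.
have Vtv := lsetZ t Vv; have := b_ge0 (lsetD Vu Vtv).
rewrite form_sqrD// formZr// formZl// formZr//.
by rewrite expr2 !mulrA.
Qed.

Lemma form_sqrB_le2 u v : V u -> V v -> b (u - v) (u - v) <= 2 * b u u + 2 * b v v.
Proof.
move=> Vu Vv; have := b_ge0 (lsetD Vu Vv).
by rewrite !(form_sqrB, form_sqrD)//; lra.
Qed.

Lemma form_sqrD_le2 u v : V u -> V v -> b (u + v) (u + v) <= 2 * b u u + 2 * b v v.
Proof.
move=> Vu Vv; have := b_ge0 (lsetB Vu Vv).
by rewrite !(form_sqrB, form_sqrD)//; lra.
Qed.

(** Minimise [J u = b u u - 2 l u]. The parallelogram identity makes a minimising sequence Cauchy,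
    and its limit satisfies the Euler equation of [J]. *)
Lemma riesz_representation l (C : R) : complete_for V b -> linear_on V l ->
  (forall u, V u -> (l u) ^+ 2 <= C * b u u) ->
  exists2 g, V g & forall u, V u -> b g u = l u.
Proof.
move=> cV ll lb.
pose J u := b u u - 2 * l u; pose S := [set J u | u in V].
(* [C] carries no sign, so its absolute value is used; [J] is then bounded below by [- |C|]. *)
have C1 u : V u -> (l u) ^+ 2 <= `|C| * b u u.
  move=> Vu; apply: le_trans (lb u Vu) _; apply: ler_wpM2r; first exact: b_ge0.
  exact: ler_norm.
have infS : has_inf S.
  split; first by exists (J 0), 0 => //; exact: lset0.
  exists (- `|C|) => _ [u Vu <-]; rewrite /J.
  have := C1 u Vu; have := b_ge0 Vu; have : 0 <= `|C| by [].
  move: (l u) (b u u) `|C| => x y z z0 y0 xyz; rewrite leNgt; apply/negP => h.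
  have : 0 < (2 * x - y - z) * (2 * x + y + z) by apply: mulr_gt0; lra.
  by have := sqr_ge0 (y - z); nra.
set d := inf S.
have dJ u : V u -> d <= J u by move=> Vu; apply: (ge_inf infS.2); exists u.
have : forall n : nat, exists u, V u /\ J u < d + n.+1%:R^-1.
  move=> n; have [|_ [u Vu <-] Ju] := @inf_adherent R S n.+1%:R^-1 _ infS.
    by rewrite invr_gt0.
  by exists u.
move=> /choice[u uP].
have Vu n := (uP n).1; have Ju n := (uP n).2.
have small e : 0 < e -> exists N, forall n, (N <= n)%N -> J (u n) - d < e.
  move=> e0; exists (Num.trunc e^-1).+1 => n Nn.
  have : e^-1 < n.+1%:R.
    apply: lt_le_trans (truncnS_gt _) _; rewrite ler_nat.
    by rewrite ltnS; exact: ltnW.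
  move=> h; have := Ju n; have : n.+1%:R^-1 < e.
    by rewrite invf_plt ?posrE.
  move: (J (u n)) (n.+1%:R^-1) => y z; lra.
(* Parallelogram identity at the midpoint of [v] and [w], where [J] is at least [d]. *)
have JE v w : V v -> V w -> b (v - w) (v - w) <= 2 * (J v - d) + 2 * (J w - d).
  move=> Vv Vw; have Vvw := lsetD Vv Vw; have Vh := lsetZ 2^-1 Vvw.
  rewrite form_sqrB//; have := dJ _ Vh; rewrite /J formZl// formZr// form_sqrD//.
  rewrite (linear_onZ _ ll Vvw) (linear_onD ll Vv Vw); lra.
have [|w Vw wP] := cV u Vu.
  move=> e e0; have [N NP] := small (e / 4) (divr_gt0 e0 (ltr0n _ 4)).
  exists N => i j Ni Nj; apply: le_lt_trans (JE _ _ (Vu i) (Vu j)) _.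
  by have := NP i Ni; have := NP j Nj; lra.
exists w => // v Vv.
(* The polynomial [t |-> J (u n + t v) - d] is nonnegative; its discriminant bounds the defect in
   the Euler equation by the defect in minimality. *)
have key n : (b (u n) v - l v) ^+ 2 <= (J (u n) - d) * b v v.
  apply: discriminant_le => t; have Vtv := lsetZ t Vv.
  have := dJ _ (lsetD (Vu n) Vtv); rewrite /J form_sqrD// formZr// formZl// formZr//.
  rewrite (linear_onD ll (Vu n) Vtv) (linear_onZ _ ll Vv) expr2; lra.
have key2 n : (b (u n - w) v) ^+ 2 <= b (u n - w) (u n - w) * b v v.
  by apply: form_CS => //; exact: lsetB.
apply/eqP; rewrite -subr_eq0 -sqrf_eq0 eq_le sqr_ge0 andbT.
have bv := b_ge0 Vv.
rewrite leNgt; apply/negP => pos.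
set q := _ ^+ 2 in pos.
pose e := q / (4 * (b v v + 1)).
have e0 : 0 < e by rewrite divr_gt0// mulr_gt0//; lra.
have eb : e * (b v v + 1) = q / 4.
  by rewrite /e; field; rewrite gt_eqF//; lra.
have [N1 NP1] := small e e0; have [N2 NP2] := wP e e0.
pose n := maxn N1 N2.
have := NP1 n (leq_maxl _ _); have := NP2 n (leq_maxr _ _).
have h3 := key n; have h4 := key2 n => h1 h2.
have : q <= 2 * (b (u n) v - l v) ^+ 2 + 2 * (b (u n - w) v) ^+ 2.
  rewrite formBl// /q; have := sqr_ge0 ((b (u n) v - l v) + (b (u n) v - b w v)).
  by nra.
have : (J (u n) - d) * b v v <= e * b v v by rewrite ler_wpM2r// ltW.
have : b (u n - w) (u n - w) * b v v <= e * b v v by rewrite ler_wpM2r// ltW.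
by lra.
Qed.

End forms.

Definition positive_on V b := forall u, V u -> 0 <= b u u.

Lemma equivalent_complete V b b' (c M : R) : linear_set V ->
  complete_for V b -> 0 < c -> 0 < M ->
  (forall u, V u -> c * b u u <= b' u u) ->
  (forall u, V u -> b' u u <= M * b u u) -> complete_for V b'.
Proof.
move=> linV cV c0 M0 cb bM u Vu cu; have [|w Vw wP] := cV u Vu.
  move=> e e0; have [N NP] := cu (c * e) (mulr_gt0 c0 e0).
  exists N => i j Ni Nj; rewrite -(ltr_pM2l c0).
  by apply: le_lt_trans (cb _ _) (NP i j Ni Nj); exact: lsetB.
exists w => // e e0; have [N NP] := wP (e / M) (divr_gt0 e0 M0).
exists N => i Ni; apply: le_lt_trans (bM _ (lsetB linV (Vu i) Vw)) _.
by rewrite mulrC -ltr_pdivlMr//; exact: NP.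
Qed.

(** A kernel element is only asked to be negligible for [b0], which may be degenerate, and not to be
    0. *)
Definition trivial_kernel V b0 (a : X -> X -> R) :=
  forall g, V g -> (forall u, V u -> a g u = 0) -> b0 g g = 0.

(* If a + l (x) l is coercive then l is represented by some g in the inner
   product a + l (x) l, whose norm is at most 1 since a >= 0; when the norm is 1,
   g lies in the kernel of a. *)
Lemma coercive_remove_functional V b0 (a : X -> X -> R) l (c M L : R) : linear_set V ->
  bilinear_form V b0 -> positive_on V b0 -> complete_for V b0 ->
  bilinear_form V a -> positive_on V a -> linear_on V l ->
  trivial_kernel V b0 a -> 0 < c -> 0 < M -> 0 <= L ->
  (forall u, V u -> a u u <= M * b0 u u) ->
  (forall u, V u -> (l u) ^+ 2 <= L * b0 u u) ->
  (forall u, V u -> c * b0 u u <= a u u + l u ^+ 2) ->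
  exists2 c', 0 < c' & forall u, V u -> c' * b0 u u <= a u u.
Proof.
move=> linV bil0 pos0 comp0 bila posa ll ker c0 M0 L0 aM lL coer.
pose b u v := a u v + l u * l v.
have bilb : bilinear_form V b.
  split=> [u v Vu Vv|w Vw t u v Vu Vv]; rewrite /b.
    by rewrite bila.1// mulrC.
  by rewrite bila.2// ll//; ring.
have posb : positive_on V b by move=> u Vu; rewrite addr_ge0 ?posa// -expr2 sqr_ge0.
have compb : complete_for V b.
  have ML : 0 < M + L by rewrite ltr_pwDl.
  apply: (@equivalent_complete V b0 b c (M + L)) => // u Vu.
  have := lL u Vu; rewrite expr2 => h; by rewrite mulrDl lerD ?aM.
have [|g Vg gP] := @riesz_representation V b linV bilb posb l 1 compb ll.
  by move=> u Vu; rewrite mul1r /b -expr2 lerDr posa.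
have gg : b g g = l g by rewrite gP.
have lg1 : l g < 1.
  have := posa g Vg; have := gg; have := posb g Vg; rewrite /b => h1 h2 h3.
  have lgle : l g <= 1.
    rewrite leNgt; apply/negP => lg; nra.
  rewrite lt_neqAle lgle andbT; apply/negP => /eqP lg.
  have : b0 g g = 0.
    apply: ker => // u Vu; have := gP u Vu; rewrite /b lg mul1r; lra.
  move=> b00; have := lL g Vg; rewrite b00 mulr0 lg; lra.
have lg0 : 0 <= l g by rewrite -gg posb.
(* Cauchy-Schwarz gives [(l u)^2 <= l g (a u u + (l u)^2)], hence
   [a u u >= (1 - l g) (a u u + (l u)^2)]. *)
exists ((1 - l g) * c); first by rewrite mulr_gt0// subr_gt0.
move=> u Vu; have := form_CS linV bilb posb Vg Vu; rewrite gP// gg {1}/b => h.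
have := coer u Vu; have := posa u Vu; have := pos0 u Vu; move: h.
rewrite -expr2.
move: (l u ^+ 2) (a u u) (b0 u u) (l g) lg1 lg0 => x y z t h1 h2 h3 h4 h5 h6.
have : (1 - t) * (c * z) <= (1 - t) * (y + x) by apply: ler_wpM2l => //; lra.
by nra.
Qed.

(** Induction on the list. The form [a u v + l u l v] is again nonnegative with trivial kernel,
    since [a g g + (l g)^2 = 0] forces [l g = 0]. The tail of the list is removed from that form
    first, and [l] itself last. *)
Lemma coercive_remove_functionals V b0 (a : X -> X -> R) (ls : seq (X -> R)) (c M : R) :
  linear_set V ->
  bilinear_form V b0 -> positive_on V b0 -> complete_for V b0 ->
  bilinear_form V a -> positive_on V a ->
  trivial_kernel V b0 a -> 0 < c -> 0 < M ->
  (forall u, V u -> a u u <= M * b0 u u) ->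
  (forall i, (i < size ls)%N -> linear_on V (nth (fun=> 0) ls i) /\
     exists2 L, 0 <= L & forall u, V u -> (nth (fun=> 0) ls i u) ^+ 2 <= L * b0 u u) ->
  (forall u, V u -> c * b0 u u <= a u u + \sum_(l <- ls) l u ^+ 2) ->
  exists2 c', 0 < c' & forall u, V u -> c' * b0 u u <= a u u.
Proof.
move=> linV bil0 pos0 comp0 bila posa ker c0 M0.
elim: ls a M M0 bila posa ker => [|l ls IH] a M M0 bila posa ker aM lsP coer.
  by exists c => // u Vu; have := coer u Vu; rewrite big_nil addr0.
have [ll [L L0 lL]] := lsP 0%N isT; rewrite /= in ll lL.
have [c' c'0 c'P] : exists2 c', 0 < c' & forall u, V u -> c' * b0 u u <= a u u + l u * l u.
  apply: (IH (fun u v => a u v + l u * l v) (M + L)).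
  - by rewrite ltr_pwDl.
  - split=> [u v Vu Vv|w Vw t u v Vu Vv]; first by rewrite bila.1// mulrC.
    by rewrite bila.2// ll//; ring.
  - by move=> u Vu; rewrite addr_ge0 ?posa// -expr2 sqr_ge0.
  - move=> g Vg gP; have := gP g Vg; have := posa g Vg; rewrite -expr2 => h1 h2.
    have lg0 : l g = 0.
      apply/eqP; rewrite -sqrf_eq0 eq_le sqr_ge0 andbT; move: h1 h2; lra.
    by apply: ker => // u Vu; have := gP u Vu; rewrite lg0 mul0r addr0.
  - by move=> u Vu; rewrite mulrDl lerD ?aM// -expr2 lL.
  - by move=> i ils; exact: (lsP i.+1).
  - by move=> u Vu; have := coer u Vu; rewrite big_cons addrA -expr2.
exact: (@coercive_remove_functional V b0 a l c' M L).
Qed.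

End hilbert.

(** * The space L^2 *)

Section L2_space.
Context {d : measure_display} {T : measurableType d} {R : realType}.
Variable mu : {measure set T -> \bar R}.
Implicit Types (U : set T) (f g h : T -> R).

Definition L2r U f :=
  measurable_fun U f /\ mu.-integrable U (EFin \o (fun y => f y ^+ 2)).

Definition ip U f g : R := \int[mu]_(y in U) (f y * g y).

Section fixed_domain.
Variable U : set T.
Hypothesis mU : measurable U.

Lemma L2rP f : measurable_fun U f ->
  L2r U f <-> (\int[mu]_(y in U) (f y ^+ 2)%:E < +oo)%E.
Proof.
move=> mf; have eqa : (\int[mu]_(y in U) `|(EFin \o (fun y => f y ^+ 2)%R) y|)%E =
    (\int[mu]_(y in U) (f y ^+ 2)%:E)%E.
  by apply: eq_integral => y _ /=; rewrite ger0_norm ?sqr_ge0.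
split=> [[_ /integrableP[_]]|h]; first by rewrite eqa.
split=> //; apply/integrableP; split; last by rewrite eqa.
by apply/measurable_EFinP; exact: measurable_funX.
Qed.

Lemma L2r_integrableM f g : L2r U f -> L2r U g ->
  mu.-integrable U (EFin \o (fun y => f y * g y)).
Proof.
move=> [mf if2] [mg ig2]; apply: (le_integrable mU _ _ (integrableD mU if2 ig2)).
  by apply/measurable_EFinP; exact: measurable_funM.
move=> y _ /=; rewrite lee_fin [leRHS]ger0_norm ?addr_ge0 ?sqr_ge0//.
rewrite ler_norml; apply/andP; split.
  by have := sqr_ge0 (f y + g y); have := sqr_ge0 (f y); have := sqr_ge0 (g y); nra.
by have := sqr_ge0 (f y - g y); have := sqr_ge0 (f y); have := sqr_ge0 (g y); nra.
Qed.

Lemma L2r0 : L2r U (fun=> 0).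
Proof.
split; first exact: measurable_cst.
rewrite (_ : _ \o _ = cst 0%E); first exact: integrable0.
by apply/funext => y /=; rewrite expr0n.
Qed.

Lemma L2r_lin (a : R) f g : L2r U f -> L2r U g -> L2r U (fun y => a * f y + g y).
Proof.
move=> lf lg; split.
  by apply: measurable_funD lg.1; apply: measurable_funM lf.1; exact: measurable_cst.
have i1 := integrableZl mU (a ^+ 2) lf.2.
have i2 := integrableZl mU (2 * a) (L2r_integrableM lf lg).
apply: eq_integrable (integrableD mU i1 (integrableD mU i2 lg.2)) => //.
move=> y _ /=; rewrite -!EFinM -!EFinD; congr EFin; ring.
Qed.

Lemma L2rZ (a : R) f : L2r U f -> L2r U (fun y => a * f y).
Proof.
move=> lf; have := L2r_lin a lf L2r0.
by rewrite (_ : (fun y => _ + _) = (fun y => a * f y))//; apply/funext => y; rewrite addr0.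
Qed.

Lemma L2rD f g : L2r U f -> L2r U g -> L2r U (fun y => f y + g y).
Proof.
move=> lf lg; have := L2r_lin 1 lf lg.
by rewrite (_ : (fun y => _ + _) = (fun y => f y + g y))//; apply/funext => y; rewrite mul1r.
Qed.

Lemma L2rB f g : L2r U f -> L2r U g -> L2r U (fun y => f y - g y).
Proof.
move=> lf lg; have := L2r_lin (-1) lg lf.
rewrite (_ : (fun y => _ + _) = (fun y => f y - g y))//; apply/funext => y.
by rewrite mulN1r addrC.
Qed.

Lemma ipC f g : ip U f g = ip U g f.
Proof. by apply: eq_Rintegral => y _; rewrite mulrC. Qed.

Lemma ip_linl (a : R) f g h : L2r U f -> L2r U g -> L2r U h ->
  ip U (fun y => a * f y + g y) h = a * ip U f h + ip U g h.
Proof.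
move=> lf lg lh; rewrite /ip -RintegralZl//; last exact: L2r_integrableM.
rewrite -RintegralD//; last 2 first.
- by have := integrableZl mU a (L2r_integrableM lf lh).
- exact: L2r_integrableM.
by apply: eq_Rintegral => y _; ring.
Qed.

Lemma ip_ge0 f : 0 <= ip U f f.
Proof. by apply: Rintegral_ge0 => y _; rewrite -expr2 sqr_ge0. Qed.

Lemma ip_ereal f : L2r U f -> (\int[mu]_(y in U) (f y ^+ 2)%:E)%E = (ip U f f)%:E.
Proof.
move=> lf; rewrite /ip /Rintegral fineK//.
by apply: integrable_fin_num => //; exact: L2r_integrableM.
Qed.

Lemma ip_discr f g : L2r U f -> L2r U g -> (ip U f g) ^+ 2 <= ip U f f * ip U g g.
Proof.
move=> lf lg; apply: discriminant_le => t; have := ip_ge0 (fun y => t * g y + f y).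
have ltg := L2r_lin t lg lf.
rewrite ip_linl// !(ipC _ (fun y => t * g y + f y)) !ip_linl// (ipC g f).
by congr (_ <= _); ring.
Qed.

Lemma ipZl (a : R) f g : L2r U f -> L2r U g -> ip U (fun y => a * f y) g = a * ip U f g.
Proof.
move=> lf lg; rewrite /ip -RintegralZl//; last exact: L2r_integrableM.
by apply: eq_Rintegral => y _; ring.
Qed.

Lemma ipDl f g h : L2r U f -> L2r U g -> L2r U h ->
  ip U (fun y => f y + g y) h = ip U f h + ip U g h.
Proof.
move=> lf lg lh; rewrite -[ip U f h]mul1r -ip_linl//.
by apply: eq_Rintegral => y _; rewrite mul1r.
Qed.

Lemma ipBl f g h : L2r U f -> L2r U g -> L2r U h ->
  ip U (fun y => f y - g y) h = ip U f h - ip U g h.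
Proof.
move=> lf lg lh; rewrite [RHS]addrC -[- ip U g h]mulN1r -ip_linl//.
by apply: eq_Rintegral => y _; ring.
Qed.

Lemma ip_sqrD f g : L2r U f -> L2r U g ->
  ip U (fun y => f y + g y) (fun y => f y + g y) = ip U f f + 2 * ip U f g + ip U g g.
Proof.
move=> lf lg; have lfg := L2rD lf lg.
by rewrite ipDl// !(ipC _ (fun y => f y + g y)) !ipDl// (ipC g f); ring.
Qed.

Lemma ip_sqrB f g : L2r U f -> L2r U g ->
  ip U (fun y => f y - g y) (fun y => f y - g y) = ip U f f - 2 * ip U f g + ip U g g.
Proof.
move=> lf lg; have lfg := L2rB lf lg.
by rewrite ipBl// !(ipC _ (fun y => f y - g y)) !ipBl// (ipC g f); ring.
Qed.

Lemma ip_sqrD_le2 f g : L2r U f -> L2r U g ->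
  ip U (fun y => f y + g y) (fun y => f y + g y) <= 2 * ip U f f + 2 * ip U g g.
Proof.
move=> lf lg; have := ip_ge0 (fun y => f y - g y).
by rewrite ip_sqrB// ip_sqrD//; lra.
Qed.

Lemma ip_le_sqr f g : L2r U f -> L2r U g ->
  ip U f f <= 2 * ip U (fun y => f y - g y) (fun y => f y - g y) + 2 * ip U g g.
Proof.
move=> lf lg; apply: le_trans (ip_sqrD_le2 (L2rB lf lg) lg).
rewrite le_eqVlt; apply/orP; left; apply/eqP; apply: eq_Rintegral => y _.
by rewrite subrK.
Qed.

Lemma ae_eq_ip f g f' g' : measurable_fun U f -> measurable_fun U g ->
  measurable_fun U f' -> measurable_fun U g' ->
  ae_eq mu U f f' -> ae_eq mu U g g' -> ip U f g = ip U f' g'.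
Proof.
move=> mf mg mf' mg' ff' gg'; rewrite /ip /Rintegral; congr fine.
apply: ae_eq_integral => //.
- by apply/measurable_EFinP; exact: measurable_funM.
- by apply/measurable_EFinP; exact: measurable_funM.
by apply: filterS2 ff' gg' => y h1 h2 Uy; rewrite h1// h2.
Qed.

Lemma ae_eq_L2r f f' : measurable_fun U f' -> ae_eq mu U f f' -> L2r U f -> L2r U f'.
Proof.
move=> mf' ff' lf; apply/(L2rP mf'); move/(L2rP lf.1) : (lf).
rewrite (@ae_eq_integral _ _ _ mu U (fun y => (f y ^+ 2)%:E) (fun y => (f' y ^+ 2)%:E))//.
- by apply/measurable_EFinP; exact: measurable_funX.
- by apply/measurable_EFinP; exact: measurable_funX lf.1.
by apply: filterS ff' => y h Uy; rewrite h.
Qed.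

Lemma L2r_bounded f (M : R) : (mu U < +oo)%E -> measurable_fun U f ->
  (forall y, U y -> `|f y| <= M) -> L2r U f.
Proof.
move=> Uoo mf fM; apply/L2rP => //.
apply: (@le_lt_trans _ _ (\int[mu]_(y in U) (M ^+ 2)%:E)%E).
  apply: ge0_le_integral => //.
  - by move=> y _; rewrite lee_fin sqr_ge0.
  - by apply/measurable_EFinP; exact: measurable_funX.
  move=> y Uy; rewrite lee_fin -[f y ^+ 2]real_normK ?num_real//.
  by rewrite ler_sqr ?nnegrE ?fM// (le_trans _ (fM y Uy)).
by rewrite integral_cst// lte_mul_pinfty// lee_fin sqr_ge0.
Qed.

(** Riesz-Fischer. Along a subsequence whose successive squared distances are below [8^-k], the sum
    of [4^k |h_k|^2] is integrable; where it is finite, [|h_k|] is at most a constant times [2^-k].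
    The weights replace Minkowski's inequality, and Fatou's lemma gives convergence in the mean. *)
Lemma L2r_complete (f : nat -> T -> R) : (forall n, L2r U (f n)) ->
  (forall e : R, 0 < e -> exists N, forall i j, (N <= i)%N -> (N <= j)%N ->
    ip U (fun y => f i y - f j y) (fun y => f i y - f j y) < e) ->
  exists2 g, L2r U g & forall e : R, 0 < e -> exists N, forall i, (N <= i)%N ->
    ip U (fun y => f i y - g y) (fun y => f i y - g y) <= e.
Proof.
move=> lf cf.
have : forall k, exists N, forall i j, (N <= i)%N -> (N <= j)%N ->
    ip U (fun y => f i y - f j y) (fun y => f i y - f j y) < 8^-1 ^+ k.
  by move=> k; apply: cf; rewrite exprn_gt0// invr_gt0.
move=> /choice[N NP].
(* The partial sums make [n] nondecreasing with [n k >= N k]; the summand [k] makes it tend to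
   infinity. *)
pose n k := (\sum_(i < k.+1) N i + k)%N.
have nN k : (N k <= n k)%N by rewrite /n big_ord_recr/= -addnA addnCA leq_addr.
have nS k : (n k <= n k.+1)%N.
  by rewrite /n [X in (_ <= X + _)%N]big_ord_recr/= addnS ltnW// ltnS leq_add2r leq_addr.
have nk k : (k <= n k)%N by exact: leq_addl.
pose h k y := (f (n k.+1) y - f (n k) y).
have lh k : L2r U (h k) by exact: L2rB.
have hk k : ip U (h k) (h k) < 8^-1 ^+ k.
  by apply: NP => //; apply: leq_trans (nN k) (nS k).
pose S y := (\sum_(k <oo) (4 ^+ k * h k y ^+ 2)%:E)%E.
have mS k : measurable_fun U (fun y => (4 ^+ k * h k y ^+ 2)%:E).
  apply/measurable_EFinP; apply: measurable_funM; first exact: measurable_cst.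
  exact: measurable_funX (lh k).1.
have S0 k y : U y -> (0 <= (4 ^+ k * h k y ^+ 2)%:E)%E.
  by move=> _; rewrite lee_fin mulr_ge0 ?sqr_ge0// exprn_ge0.
have intS : (\int[mu]_(y in U) S y <= 2%:E)%E.
  rewrite integral_nneseries//; apply: lime_le.
    apply: is_cvg_nneseries => k _ _; apply: integral_ge0 => y; exact: S0.
  apply: nearW => k; rewrite (@le_trans _ _ (\sum_(0 <= i < k) (2^-1 ^+ i)%:E)%E)//.
    apply: lee_sum => i _.
    under eq_integral do rewrite EFinM.
    rewrite ge0_integralZl_EFin//; last 2 first.
    - by move=> y _; rewrite lee_fin sqr_ge0.
    - by apply/measurable_EFinP; exact: measurable_funX (lh i).1.
    rewrite ip_ereal// -EFinM lee_fin.
    have -> : 2^-1 ^+ i = 4 ^+ i * 8^-1 ^+ i :> R by rewrite -exprMn; congr (_ ^+ _); field.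
    by rewrite ler_wpM2l ?exprn_ge0// ltW.
  rewrite sumEFin lee_fin.
  have -> : \sum_(0 <= i < k) 2^-1 ^+ i = 2 - 2 * 2^-1 ^+ k :> R.
    elim: k => [|k IH]; first by rewrite big_nil expr0; lra.
    by rewrite big_nat_recr//= IH exprS; lra.
  by rewrite gerBl mulr_ge0// exprn_ge0.
have aeS : {ae mu, forall y, U y -> S y \is a fin_num}.
  apply: integrable_ae => //; apply/integrableP; split.
    by apply: ge0_emeasurable_sum => // k y Uy _; exact: S0.
  rewrite (eq_integral S) ?(le_lt_trans intS) ?ltry// => y; rewrite inE => Uy.
  by rewrite gee0_abs// nneseries_ge0// => k _ _; exact: S0.
have cvS y : U y -> S y \is a fin_num -> cvgn (fun k => f (n k) y).
  move=> Uy Sy; have hS k : 4 ^+ k * h k y ^+ 2 <= fine (S y).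
    rewrite -lee_fin fineK//; apply: le_trans (nneseries_lim_ge k.+1 _).
      rewrite big_nat_recr//= leeDr// sume_ge0// => i _; exact: S0.
    by move=> i _ _; exact: S0.
  pose M := 1 + fine (S y).
  have fS0 : 0 <= fine (S y) by rewrite fine_ge0// nneseries_ge0// => k _ _; exact: S0.
  have hM k : `|h k y| <= M * 2^-1 ^+ k.
    have p2 : 0 < 2^-1 ^+ k :> R by rewrite exprn_gt0// invr_gt0.
    have M0 : 0 <= M by rewrite /M; lra.
    rewrite -ler_sqr ?nnegrE ?(mulr_ge0 M0 (ltW p2))//.
    rewrite real_normK ?num_real// exprMn.
    have := hS k; rewrite -ler_pdivlMl ?exprn_gt0// => /le_trans; apply.
    rewrite mulrC -exprVn (_ : 4^-1 = 2^-1 * 2^-1 :> R); last by field.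
    rewrite exprMn -expr2 ler_wpM2r ?sqr_ge0// /M; nra.
  have cM : cvgn (series (fun k => `|h k y|)).
    apply: (@series_le_cvg _ _ (geometric M 2^-1)) => //.
    - by move=> k; rewrite /= mulr_ge0 ?exprn_ge0 ?invr_ge0// /M; lra.
    - by apply: is_cvg_geometric_series; rewrite ger0_norm ?invr_ge0//; lra.
  have := normed_cvg cM.
  have -> : series (h ^~ y) = (fun k => f (n k) y - f (n 0%N) y).
    apply/funext => k; rewrite /series/=; elim: k => [|k IH]; first by rewrite big_nil subrr.
    by rewrite big_nat_recr//= IH /h; ring.
  move=> c1; have c2 := is_cvgD c1 (is_cvg_cst (f (n 0%N) y)).
  rewrite (_ : (fun k => f (n k) y) =
    (fun k => f (n k) y - f (n 0%N) y) + (fun=> f (n 0%N) y)); first exact: c2.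
  by apply/funext => k; rewrite fctE subrK.
(* An upper limit, so that [g] is measurable on all of [U], including the null set where the
   subsequence may diverge. *)
pose g y := fine (limn_esup (fun k => (f (n k) y)%:E)).
have mg : measurable_fun U g.
  apply: (@measurableT_comp _ _ _ _ _ _ fine) => //.
  by apply: measurable_fun_limn_esup => k; apply/measurable_EFinP; exact: (lf _).1.
have gE : {ae mu, forall y, U y -> (fun k => f (n k) y) @ \oo --> g y}.
  apply: filterS aeS => y Sy Uy; have /cvg_ex[l fl] := cvS y Uy (Sy Uy).
  suff -> : g y = l by [].
  rewrite /g; have fl' : (fun k => (f (n k) y)%:E) @ \oo --> l%:E.
    by apply: cvg_EFin => //; exact: nearW.
  by have [_ ->] := cvg_limn_einf_sup fl'.
have key i (e : R) (N0 : nat) : 0 < e -> (forall j, (N0 <= j)%N ->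
    ip U (fun y => f i y - f j y) (fun y => f i y - f j y) < e) ->
    (\int[mu]_(y in U) ((f i y - g y) ^+ 2)%:E <= e%:E)%E.
  move=> e0 iP; pose q k y := ((f i y - f (n k) y) ^+ 2)%:E.
  have mq k : measurable_fun U (q k).
    apply/measurable_EFinP; apply: measurable_funX; exact: measurable_funB (lf _).1 (lf _).1.
  have q0 k y : U y -> (0 <= q k y)%E by move=> _; rewrite lee_fin sqr_ge0.
  apply: (@le_trans _ _ (\int[mu]_(y in U) limn_einf (q ^~ y))%E).
    apply: ae_ge0_le_integral => //.
    - by move=> y _; rewrite lee_fin sqr_ge0.
    - apply/measurable_EFinP; apply: measurable_funX; exact: measurable_funB (lf _).1 mg.
    - move=> y Uy; rewrite limn_einf_lim; apply: lime_ge; first exact: is_cvg_einfs.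
      by apply: nearW => k; apply: le_ereal_inf_tmp => _ [j _ <-]; exact: q0.
    - rewrite /limn_einf; apply: measurableT_comp => //.
      by apply: measurable_fun_limn_esup => k; exact: measurableT_comp.
    apply: filterS gE => y gy Uy.
    suff qg : q ^~ y @ \oo --> ((f i y - g y) ^+ 2)%:E.
      by have [-> _] := cvg_limn_einf_sup qg.
    apply: cvg_EFin; first exact: nearW.
    have c1 : (fun k => f i y - f (n k) y) @ \oo --> f i y - g y.
      by apply: cvgB; [exact: cvg_cst|exact: gy].
    rewrite (_ : fine \o _ = (fun k => f i y - f (n k) y) * (fun k => f i y - f (n k) y)).
      by rewrite expr2; exact: cvgM.
    by apply/funext => k; rewrite /= expr2.
  apply: le_trans (@fatou _ _ _ mu U mU q mq q0) _.
  rewrite limn_einf_lim; apply: lime_le; first exact: is_cvg_einfs.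
  apply: nearW => k; apply: (@le_trans _ _ (\int[mu]_(y in U) q (k + N0)%N y)%E).
    by apply: ereal_inf_lbound; exists (k + N0)%N => //=; exact: leq_addr.
  rewrite ip_ereal; last exact: L2rB.
  by rewrite lee_fin ltW// iP// (leq_trans _ (nk _))// leq_addl.
have lg : L2r U g.
  have [N0 NP0] := cf 1 ltr01.
  have lfg : L2r U (fun y => f N0 y - g y).
    apply/L2rP; first exact: measurable_funB (lf _).1 mg.
    by rewrite (le_lt_trans (key N0 1 N0 ltr01 _)) ?ltry// => j; exact: NP0.
  have := L2rB (lf N0) lfg; rewrite (_ : (fun y => _ - _) = g)//.
  by apply/funext => y; ring.
exists g => // e e0; have [N0 NP0] := cf e e0; exists N0 => i Ni.
rewrite -lee_fin -ip_ereal; last exact: L2rB.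
by apply: key => // j; exact: NP0.
Qed.

End fixed_domain.

Lemma L2rS U V f : measurable U -> measurable V -> V `<=` U -> L2r U f -> L2r V f.
Proof.
move=> mU mV VU [mf If]; split; first exact: measurable_funS mf.
exact: integrableS If.
Qed.

Lemma ip_subset U V f : measurable U -> measurable V -> V `<=` U -> L2r U f ->
  ip V f f <= ip U f f.
Proof.
move=> mU mV VU lf; rewrite -lee_fin -!ip_ereal//; last exact: L2rS lf.
apply: ge0_subset_integral => //; last by move=> y _; rewrite lee_fin sqr_ge0.
by apply/measurable_EFinP; exact: measurable_funX lf.1.
Qed.

Lemma ip_setU U V f g : measurable U -> measurable V -> [disjoint U & V] ->
  L2r (U `|` V) f -> L2r (U `|` V) g -> ip (U `|` V) f g = ip U f g + ip V f g.
Proof.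
move=> mU mV UV lf lg; rewrite /ip Rintegral_setU//.
by apply: L2r_integrableM => //; exact: measurableU.
Qed.

End L2_space.

(** * Topology and Lebesgue measure of R^m *)

Section euclidean_topology.
Context {R : realType} {m : nat}.
Local Notation E := 'rV[R]_m.
Implicit Types (y z s : E) (A K O : set E).

Lemma norm_coord y i : `|y ord0 i| <= `|y|.
Proof. by rewrite [leRHS]/Num.norm/= mx_normrE; apply: (le_bigmax _ (fun ij => `|y ij.1 ij.2|) (ord0, i)). Qed.

Lemma norm_leP y (r : R) : 0 <= r -> (`|y| <= r) <-> (forall i, `|y ord0 i| <= r).
Proof.
move=> r0; split=> [h i|h]; first exact: le_trans (norm_coord y i) h.
rewrite [leLHS]/Num.norm/= mx_normrE; apply/bigmax_leP; split=> // -[i j] _ /=.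
by rewrite ord1.
Qed.

Lemma norm_ltP y (r : R) : 0 < r -> (`|y| < r) <-> (forall i, `|y ord0 i| < r).
Proof.
move=> r0; split=> [h i|h]; first exact: le_lt_trans (norm_coord y i) h.
rewrite [ltLHS]/Num.norm/= mx_normrE; apply/bigmax_ltP; split=> // -[i j] _ /=.
by rewrite ord1.
Qed.

Lemma ball_rVE y (r : R) z : ball y r z = (`|y - z| < r) :> Prop.
Proof. by rewrite -ball_normE. Qed.

Lemma continuous_coord (i : 'I_m) : continuous (fun y : E => y ord0 i).
Proof. exact: coord_continuous. Qed.

Lemma open_ball_subset O y : open O -> O y -> exists2 r : R, 0 < r & ball y r `<=` O.
Proof.
by rewrite openE => oO Oy; have /nbhs_ballP[r r0 rO] := oO _ Oy; exists r.
Qed.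

Lemma compact_margin K O : compact K -> open O -> K `<=` O ->
  exists2 r : R, 0 < r & forall y, K y -> ball y r `<=` O.
Proof.
move=> cK oO KO; have/compact_near_coveringP nK := cK.
have := @nK nat \oo (fun n y => ball y n.+1%:R^-1 `<=` O) _.
case=> [y Ky|n _ nP]; last first.
  by exists n.+1%:R^-1; [rewrite invr_gt0|move=> y Ky; exact: (nP n (leqnn _))].
have [r r0 rO] := open_ball_subset oO (KO y Ky).
near=> z n => /=; apply: subset_trans rO => w zw.
rewrite [r]splitr; apply: (@ball_triangle _ _ z).
  by near: z; apply: nbhsx_ballx; rewrite divr_gt0.
apply: le_ball zw; near: n.
apply: (filterS _ (near_infty_natSinv_lt (PosNum (divr_gt0 r0 (ltr0n _ 2))))).
by move=> n /ltW.
Unshelve. all: by end_near. Qed.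

Lemma compact_closed_rV K : compact K -> closed K.
Proof. by apply: compact_closed; exact: norm_hausdorff. Qed.

Lemma compact_bounded_rV K : compact K -> exists2 M : R, 0 < M & forall y, K y -> `|y| <= M.
Proof.
move=> /compact_bounded[M [Mr MP]]; exists (`|M| + 1); first by rewrite ltr_wpDl.
by apply: MP; rewrite (le_lt_trans (ler_norm _))// ltrDl.
Qed.

Lemma bounded_setP A : bounded_set A -> exists2 M : R, 0 < M & forall y, A y -> `|y| <= M.
Proof.
move=> [M [Mr MP]]; exists (`|M| + 1); first by rewrite ltr_wpDl.
by apply: MP; rewrite (le_lt_trans (ler_norm _))// ltrDl.
Qed.

Lemma bounded_setI (M : R) A : (forall y, A y -> `|y| <= M) -> bounded_set A.
Proof.
move=> h; exists M; split; first exact: num_real.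
by move=> r Mr y Ay; apply: le_trans (h y Ay) _; exact: ltW.
Qed.

Lemma compact_rV A (M : R) : closed A -> (forall y, A y -> `|y| <= M) -> compact A.
Proof. by move=> cA AM; apply: bounded_closed_compact => //; exact: bounded_setI AM. Qed.

Lemma continuous_dist y : continuous (fun z : E => `|y - z|).
Proof.
move=> z; apply/(@cvgrPdist_lt _ _ _ (nbhs z)) => e e0; apply/nbhs_ballP; exists e => // w.
rewrite ball_rVE => zw /=; apply: le_lt_trans (ler_dist_dist _ _) _.
by rewrite opprB addrC addrA subrK distrC.
Qed.

Lemma closed_ball_rV_compact y (r : R) : compact [set z | `|y - z| <= r].
Proof.
apply: (@compact_rV _ (`|y| + r)).
  rewrite (_ : mkset _ = (fun z => `|y - z|) @^-1` [set t | t <= r])//.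
  apply: preimage_closed; last exact: closed_le.
  by move=> z _; exact: continuous_dist.
move=> z /= h; have -> : z = y - (y - z) by rewrite opprB addrC subrK.
by rewrite (le_trans (ler_normB _ _))// lerD2l.
Qed.

Definition exhaustion O (n : nat) : set E :=
  [set y | `|y| <= n%:R /\ forall z, ~ O z -> n.+1%:R^-1 <= `|y - z|].

Lemma exhaustion_compact O n : compact (exhaustion O n).
Proof.
apply: (@compact_rV _ n%:R); last by move=> y [].
have -> : exhaustion O n = [set y | `|y| <= n%:R] `&`
    \bigcap_(z in ~` O) [set y | n.+1%:R^-1 <= `|y - z|].
  by apply/seteqP; split=> y [yn yO].
apply: closedI.
  rewrite (_ : mkset _ = (fun y => `|y|) @^-1` [set t | t <= n%:R])//.
  apply: preimage_closed; last exact: closed_le.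
  by move=> z _; exact: norm_continuous.
apply: closed_bigI => z _.
rewrite (_ : mkset _ = (fun y => `|y - z|) @^-1` [set t | n.+1%:R^-1 <= t])//.
apply: preimage_closed; last exact: closed_ge.
by move=> y _; under eq_fun do rewrite distrC; exact: continuous_dist.
Qed.

Lemma exhaustion_subset O n : exhaustion O n `<=` O.
Proof.
move=> y [_ h]; apply: contrapT => /h; rewrite subrr normr0 leNgt invr_gt0 ltr0n.
by [].
Qed.

Lemma exhaustionS O i j : (i <= j)%N -> exhaustion O i `<=` exhaustion O j.
Proof.
move=> ij y [yi h]; split; first by rewrite (le_trans yi)// ler_nat.
by move=> z /h; apply: le_trans; rewrite lef_pV2 ?posrE// ler_nat ltnS.
Qed.

Lemma compact_exhaustion O K : open O -> compact K -> K `<=` O ->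
  exists n, K `<=` exhaustion O n.
Proof.
move=> oO cK KO; have [r r0 rO] := compact_margin cK oO KO.
have [M M0 KM] := compact_bounded_rV cK.
exists (maxn (Num.trunc M).+1 (Num.trunc r^-1)).
move=> y Ky; split.
  rewrite (le_trans (KM y Ky))// (le_trans (ltW (truncnS_gt _)))// ler_nat.
  exact: leq_maxl.
move=> z nOz; rewrite leNgt; apply/negP => yz; apply: nOz; apply: (rO y) => //.
rewrite ball_rVE (lt_le_trans yz)// invf_ple ?posrE ?ltr0n//.
by rewrite (le_trans (ltW (truncnS_gt _)))// ler_nat ltnS leq_maxr.
Qed.

Lemma bigcup_exhaustion O : open O -> \bigcup_n exhaustion O n = O.
Proof.
move=> oO; apply/seteqP; split=> [y [n _ /exhaustion_subset]//|y Oy].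
have [|n nP] := @compact_exhaustion O [set y] oO (@compact_set1 _ _).
  by move=> _ ->.
by exists n => //; exact: nP.
Qed.

End euclidean_topology.

(** * Lebesgue measure of R^m: boxes, translations, null sets *)

Section euclidean_measure.
Context {R : realType}.
Local Notation leb := (@lebesgue_rV R _).

Section any_dimension.
Context {m : nat}.
Local Notation E := 'rV[R]_m.
Implicit Types (y z s : E) (A K O : set E).

Definition box (I : 'I_m -> set R) : set E := [set y | forall i, I i (y ord0 i)].

Lemma measurable_box (I : 'I_m -> set (measurableTypeR R)) :
  (forall i, measurable (I i)) -> measurable (box I).
Proof.
move=> mI; have -> : box I = \bigcap_(i in [set: 'I_m]) ((fun y : E => y ord0 i) @^-1` I i).
  by apply/seteqP; split=> [y yI i _|y yI i]; apply: yI.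
apply: fin_bigcap_measurable => // i _; rewrite -[X in measurable X]setTI.
exact: measurable_coord_rV.
Qed.

Lemma ball_box y (r : R) : 0 < r -> ball y r = box (fun i => `]y ord0 i - r, y ord0 i + r[%classic).
Proof.
move=> r0; apply/seteqP; split=> z; rewrite ball_rVE.
  move=> /(norm_ltP _ r0) h i; have := h i; rewrite !mxE /= in_itv/= ltr_norml.
  by move=> /andP[h1 h2]; apply/andP; split; lra.
move=> h; apply/(norm_ltP _ r0) => i; have := h i; rewrite !mxE /= in_itv/= ltr_norml.
by move=> /andP[h1 h2]; apply/andP; split; lra.
Qed.

Lemma measurable_ball_rV y (r : R) : measurable (ball y r).
Proof.
have [r0|r0] := ltP 0 r; first by rewrite ball_box//; exact: measurable_box.
rewrite (_ : ball y r = set0)//; apply/seteqP; split=> // z.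
by rewrite ball_rVE ltNge (le_trans r0).
Qed.

(** Measurability refers to the sigma-algebra generated by the coordinates. Balls of the sup norm
    are boxes, hence measurable, and an open set is a countable union of such balls with rational
    centres. *)
Lemma open_measurable_rV O : open O -> measurable O.
Proof.
move=> oO.
pose q (p : 'rV[rat]_m * nat) : set E :=
  ball (map_mx (@ratr R) p.1 : E) p.2.+1%:R^-1.
have -> : O = \bigcup_p (if `[< q p `<=` O >] then q p else set0).
  apply/seteqP; split=> [y Oy|y [p _]]; last by case: asboolP => // pO; exact: pO.
  have [r r0 rO] := open_ball_subset oO Oy.
  have [n nr] : exists n : nat, n.+1%:R^-1 < r / 2.
    exists (Num.trunc (r / 2)^-1); rewrite invf_plt ?posrE ?divr_gt0//.
    exact: truncnS_gt.
  have : forall i, exists t : rat, `|y ord0 i - ratr t| < n.+1%:R^-1.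
    move=> i; move: (n.+1%:R^-1 : R) (invr_gt0 (n.+1%:R : R)) => e; rewrite ltr0n => e0.
    have [|t] := @rat_in_itvoo R (y ord0 i - e) (y ord0 i + e).
      by rewrite ltrD2l gtrN// e0.
    by rewrite in_itv/= => /andP[h1 h2]; exists t; rewrite ltr_norml; lra.
  move=> /choice[t tP]; exists (\row_i t i, n) => //.
  have yt : `|y - map_mx (@ratr R) (\row_i t i)| < n.+1%:R^-1.
    by apply/norm_ltP; [rewrite invr_gt0|move=> i; rewrite !mxE].
  rewrite asboolT.
    by rewrite /q ball_rVE distrC.
  move=> z; rewrite /q ball_rVE/= => tz; apply: rO; rewrite ball_rVE.
  rewrite -(subrK (map_mx (@ratr R) (\row_i t i)) y) -addrA.
  by rewrite (le_lt_trans (ler_normD _ _))// [r]splitr ltrD// (lt_trans _ nr).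
apply: countable_bigcupT_measurable => [|p]; first exact: countableP.
case: ifPn => // _.
exact: measurable_ball_rV.
Qed.

Lemma closed_measurable_rV A : closed A -> measurable A.
Proof.
by move=> cA; rewrite -[A]setCK; apply: measurableC; apply: open_measurable_rV; exact: closed_openC.
Qed.

Lemma compact_measurable_rV K : compact K -> measurable K.
Proof. by move=> /compact_closed_rV; exact: closed_measurable_rV. Qed.

Lemma continuous_measurable_rV O (f : E -> R) : open O ->
  (forall y, O y -> {for y, continuous f}) -> measurable_fun O f.
Proof.
move=> oO cf; apply: (measurability _ (RGenOpens.measurableE R)).
move=> _ [_ [a [b ->]] <-]; apply: open_measurable_rV.
rewrite openE => y [Oy fy]; apply: filterI; first exact: open_nbhs_nbhs.
apply: (cf y Oy); apply: open_nbhs_nbhs; split=> //; exact: interval_open.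
Qed.

Lemma continuous_measurable_rVT (f : E -> R) : continuous f -> measurable_fun setT f.
Proof. by move=> cf; apply: (@continuous_measurable_rV setT f (@openT E)) => y _; exact: cf. Qed.

Lemma measurable_shift s : measurable_fun setT (fun y => y + s).
Proof.
apply: measurable_to_rV => i.
apply: (eq_measurable_fun (fun y : E => (y ord0 i + s ord0 i)%R : measurableTypeR R)).
  by move=> y _; rewrite !mxE.
apply: measurable_funD; last exact: measurable_cst.
exact: measurable_coord_rV.
Qed.

End any_dimension.

(** The image measure has the right value on half-open intervals, which determine Lebesgue
    measure. *)
Lemma lebesgue_measure_shift (s : R) (A : set (measurableTypeR R)) : measurable A ->
  lebesgue_measure ((fun t : measurableTypeR R => t + s : measurableTypeR R) @^-1` A) = lebesgue_measure A.
Proof.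
move=> mA; rewrite -/(pushforward lebesgue_measure
  (fun t : measurableTypeR R => t + s : measurableTypeR R) A).
apply/esym/lebesgue_measure_unique => //=.
  by apply: measurable_funD => //; exact: measurable_cst.
move=> mf _ [[a b]] _ <-; rewrite /pushforward.
have -> : (fun t => t + s) @^-1` `]a, b] = `]a - s, b - s]%classic.
  by apply/seteqP; split=> t /=; rewrite !in_itv/= ltrBlDr lerBrDr.
rewrite !lebesgue_measure_itv/= !lte_fin ltrD2r.
by case: ifP => // _; rewrite -!EFinB; congr EFin; ring.
Qed.

Lemma cons_rV_head m (p : measurableTypeR R * 'rV[R]_m) : cons_rV p ord0 ord0 = p.1.
Proof. by have /(congr1 fst) := cons_rVK p. Qed.

Lemma cons_rV_tail m (p : measurableTypeR R * 'rV[R]_m) i :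
  cons_rV p ord0 (lift ord0 i) = p.2 ord0 i.
Proof. by have /(congr1 snd)/rowP/(_ i) := cons_rVK p; rewrite mxE. Qed.

(** Induction on the dimension: [cons_rV] conjugates the translation to a translation [f] of the
    product, whose image measure is the product measure by uniqueness on rectangles. *)
Lemma lebesgue_rV_shift m (s : 'rV[R]_m) (A : set 'rV[R]_m) : measurable A ->
  leb ((fun y => y + s) @^-1` A) = leb A.
Proof.
elim: m s A => [|m IH] s A mA.
  by congr (leb _); apply/seteqP; split=> y /=; rewrite [y + s]thinmx0 [y]thinmx0.
pose us := uncons_rV s.
pose f (p : measurableTypeR R * 'rV[R]_m) : measurableTypeR R * 'rV[R]_m :=
  (p.1 + us.1, p.2 + us.2).
have consD p : cons_rV (f p) = cons_rV p + s.
  apply/rowP => i; rewrite [RHS]mxE; case: (unliftP ord0 i) => [j|] ->.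
    by rewrite !cons_rV_tail mxE [us.2 _ _]mxE.
  by rewrite !cons_rV_head.
have mf : measurable_fun setT f.
  rewrite (_ : f = @uncons_rV R m \o ((fun y => y + s) \o @cons_rV R m)).
    apply: measurableT_comp; first exact: measurable_uncons_rV.
    by apply: measurableT_comp; [exact: measurable_shift|exact: measurable_cons_rV].
  by apply/funext => p /=; rewrite -consD cons_rVK.
have mB : measurable (@cons_rV R m @^-1` A).
  by rewrite -[X in measurable X]setTI; exact: measurable_cons_rV.
rewrite /= /lebesgue_cons /pushforward.
have -> : @cons_rV R m @^-1` ((fun y => y + s) @^-1` A) = f @^-1` (@cons_rV R m @^-1` A).
  by apply/seteqP; split=> p /=; rewrite consD.
rewrite -[LHS]/(pushforward (lebesgue_measure \x (lebesgue_rV m))%E f _).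
apply/esym/product_measure_unique => //= B C mB' mC.
rewrite /pushforward.
have -> : f @^-1` (B `*` C) = ((fun t => t + us.1) @^-1` B) `*` ((fun y => y + us.2) @^-1` C) by [].
rewrite product_measure1E; first by congr (_ * _)%E; [exact: lebesgue_measure_shift|exact: IH].
  rewrite -[X in measurable X]setTI; apply: (@measurable_funD _ _ _ _ idfun (cst us.1)) => //.
  exact: measurable_id.
by rewrite -[X in measurable X]setTI; exact: measurable_shift.
Qed.

Lemma lebesgue_rV_box m (I : 'I_m -> set (measurableTypeR R)) :
  (forall i, measurable (I i)) ->
  leb (box I) = (\prod_(i < m) lebesgue_measure (I i))%E.
Proof.
elim: m I => [|m IH] I mI.
  rewrite big_ord0 /= diracE mem_set//; by case.
rewrite big_ord_recl/= /lebesgue_cons /pushforward.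
have -> : @cons_rV R m @^-1` box I = I ord0 `*` box (I \o lift ord0).
  apply/seteqP; split=> p /= => [h|[h1 h2] i].
    by split=> [|i]; [rewrite -cons_rV_head; exact: h|rewrite -cons_rV_tail; exact: h].
  case: (unliftP ord0 i) => [j|] ->; last by rewrite cons_rV_head.
  by rewrite cons_rV_tail; exact: h2.
rewrite product_measure1E//; last by apply: measurable_box => i; exact: mI.
by congr (_ * _)%E; apply: IH => i; exact: mI.
Qed.

Section any_dimension2.
Context {m : nat}.
Local Notation E := 'rV[R]_m.
Local Notation mu := (@lebesgue_rV R m).
Implicit Types (y z s : E) (A K O : set E).

Lemma lebesgue_rV_ball y (r : R) : 0 < r -> mu (ball y r) = ((2 * r) ^+ m)%:E.
Proof.
move=> r0; rewrite ball_box// lebesgue_rV_box//.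
transitivity (\prod_(i < m) (2 * r)%:E)%E.
  apply: eq_bigr => i _; rewrite lebesgue_measure_itv/= lte_fin.
  rewrite ltrD2l gtrN// -EFinB; congr EFin; lra.
by rewrite prodEFin big_const_ord iter_mulr_1.
Qed.

Lemma lebesgue_rV_bounded A (M : R) : measurable A -> (forall y, A y -> `|y| <= M) ->
  (mu A < +oo)%E.
Proof.
move=> mA AM; have M0 : 0 < `|M| + 1 by rewrite ltr_wpDl.
apply: (@le_lt_trans _ _ (mu (ball 0 (`|M| + 1)))).
  apply: le_measure; rewrite ?inE//; first exact: measurable_ball_rV.
  move=> y /AM yM; rewrite ball_rVE sub0r normrN (le_lt_trans yM)//.
  by rewrite (le_lt_trans (ler_norm _))// ltrDl.
by rewrite lebesgue_rV_ball// ltry.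
Qed.

Lemma lebesgue_rV_compact K : compact K -> (mu K < +oo)%E.
Proof.
move=> cK; have [M _ KM] := compact_bounded_rV cK.
by apply: lebesgue_rV_bounded KM; exact: compact_measurable_rV.
Qed.

Lemma ge0_integral_shift s (f : E -> \bar R) : measurable_fun setT f ->
  (forall y, 0 <= f y)%E -> (\int[mu]_y f (y + s)%R = \int[mu]_y f y)%E.
Proof.
move=> mf f0; have ms := @measurable_shift m s.
transitivity (\int[pushforward mu (fun y => y + s)%R]_y f y)%E.
  by rewrite ge0_integral_pushforward.
by apply: eq_measure_integral => A mA _; exact: lebesgue_rV_shift.
Qed.

(* The translates of A by the s n all have the measure of A and fit disjointly
   in a bounded set. *)
Lemma disjoint_translates_null A (s : nat -> E) (M M' : R) : measurable A ->
  (forall y, A y -> `|y| <= M) -> (forall n, `|s n| <= M') ->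
  (forall i j y, (i < j)%N -> A y -> ~ A (y + s i - s j)) -> mu A = 0%E.
Proof.
move=> mA AM sM' dA; pose B n := (fun y => y + - s n) @^-1` A.
have mB n : measurable (B n) by rewrite -[B n]setTI; exact: measurable_shift.
have tB : trivIset setT B.
  have main i j : (i < j)%N -> B i `&` B j = set0.
    move=> ij; apply/seteqP; split=> // y [Bi Bj]; apply: (dA i j (y - s i) ij) => //.
    by rewrite subrK.
  apply/trivIsetP => i j _ _ ij; case: (ltngtP i j) ij => // [ij|ji] _; first exact: main.
  by rewrite setIC; exact: main.
have Boo : (mu (\bigcup_n B n) < +oo)%E.
  apply: (@lebesgue_rV_bounded _ (M + M')); first exact: bigcup_measurable.
  move=> y [n _ By]; rewrite -(subrK (s n) y) (le_trans (ler_normD _ _))//.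
  by rewrite lerD//; exact: AM.
apply/eqP; rewrite -measure_le0 leNgt; apply/negP => A0.
have h (n : nat) : (n%:R%:E * mu A <= mu (\bigcup_n B n))%E.
  have -> : (n%:R%:E * mu A = \sum_(i < n) mu (B i))%E.
    rewrite (eq_bigr (fun=> mu A)); last by move=> i _; exact: lebesgue_rV_shift.
    by rewrite sumr_const card_ord mule_natl.
  rewrite -measure_bigsetU//.
    apply: le_measure; rewrite ?inE//; first exact: bigsetU_measurable.
      exact: bigcup_measurable.
    by rewrite -bigcup_mkord => y [i _ Bi]; exists i.
have := h 1%N; rewrite mul1e => /le_lt_trans/(_ Boo) => Aoo.
move: h Aoo; rewrite -(@fineK _ (mu (\bigcup_n B n))); last by rewrite ge0_fin_numE.
move=> {}h Aoo; move: (fine (mu (\bigcup_n B n))) h => c h.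
have Afin : mu A \is a fin_num by rewrite ge0_fin_numE.
have a0 : 0 < fine (mu A) by rewrite fine_gt0// A0.
move: h; rewrite -(fineK Afin); set a := fine (mu A) => h.
have := h (Num.trunc (c / a)).+1.
rewrite -EFinM lee_fin -ler_pdivlMr// leNgt truncnS_gt.
by [].
Qed.

Lemma nondecreasing_measure_diff (F : nat -> set E) A (e : R) :
  (forall n, measurable (F n)) -> {homo F : n p / (n <= p)%N >-> n `<=` p} ->
  measurable A -> A `<=` \bigcup_n F n -> (mu A < +oo)%E -> 0 < e ->
  exists n, (mu (A `\` F n) < e%:E)%E.
Proof.
move=> mF ndF mA AF Aoo e0.
have mAF n : measurable (A `\` F n) by exact: measurableD.
have cv : mu (A `\` F n) @[n --> \oo] --> mu (\bigcap_n (A `\` F n)).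
  apply: nonincreasing_cvg_mu => //.
  - by rewrite (le_lt_trans _ Aoo)// le_measure ?inE.
  - exact: bigcapT_measurable.
  - by move=> i j ij; apply/subsetPset => y [Ay nF]; split=> // /(ndF _ _ ij).
have I0 : \bigcap_n (A `\` F n) = set0.
  apply/seteqP; split=> // y h; have [Ay _] := h 0%N I.
  by have [n _ Fn] := AF y Ay; have [_] := h n I.
rewrite I0 measure0 in cv.
have /cv[n _ nP] : nbhs (0%E : \bar R) [set t | (t < e%:E)%E].
  by apply: open_nbhs_nbhs; split; [exact: open_ereal_lt_ereal|rewrite /= lte_fin].
by exists n; exact: nP n (leqnn n).
Qed.

End any_dimension2.

End euclidean_measure.

(** * Continuity of real functions at a point *)

Section pointwise_continuity.
Context {R : realType} {T : topologicalType}.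
Implicit Types (f g : T -> R) (x : T).

Lemma cont_cst (a : R) x : {for x, continuous (fun=> a)}.
Proof. exact: cvg_cst. Qed.

Lemma contD f g x : {for x, continuous f} -> {for x, continuous g} ->
  {for x, continuous (fun y => f y + g y)}.
Proof. exact: continuousD. Qed.

Lemma contB f g x : {for x, continuous f} -> {for x, continuous g} ->
  {for x, continuous (fun y => f y - g y)}.
Proof. exact: continuousB. Qed.

Lemma contM f g x : {for x, continuous f} -> {for x, continuous g} ->
  {for x, continuous (fun y => f y * g y)}.
Proof. exact: continuousM. Qed.

Lemma contX f n x : {for x, continuous f} -> {for x, continuous (fun y => f y ^+ n)}.
Proof.
move=> cf; elim: n => [|n IH]; first exact: cont_cst.
by rewrite (_ : (fun _ => _) = (fun y => f y * f y ^+ n));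
  [exact: contM|apply/funext => y; rewrite exprS].
Qed.

Lemma cont_sum (I : Type) (r : seq I) (P : pred I) (F : I -> T -> R) x :
  (forall i, P i -> {for x, continuous (F i)}) ->
  {for x, continuous (fun y => \sum_(i <- r | P i) F i y)}.
Proof.
move=> cF; elim: r => [|i r IH].
  by rewrite (_ : (fun _ => _) = (fun=> 0)); [exact: cont_cst|apply/funext => y; rewrite big_nil].
rewrite (_ : (fun _ => _) = (fun y => (if P i then F i y else 0) + \sum_(i <- r | P i) F i y)).
  apply: contD => //; case Pi: (P i); [exact: cF|exact: cont_cst].
by apply/funext => y; rewrite big_cons; case: ifP; rewrite ?add0r.
Qed.

Lemma cont_comp (g : R -> R) f x : {for x, continuous f} -> {for f x, continuous g} ->
  {for x, continuous (fun y => g (f y))}.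
Proof. exact: continuous_comp. Qed.

End pointwise_continuity.

(** * Smooth functions *)

Section directional_derivatives.
Context {R : realType} {m : nat}.
Local Notation E := 'rV[R]_m.
Local Notation e_ i := (delta_mx ord0 i : E).
Implicit Types (f g : E -> R) (y v : E).

Lemma line_quotientE f y v (t : R) :
  (fun h : R => h^-1 *: ((f \o shift (y + t *: v)) (h *: v) - f (y + t *: v))) =
  (fun h : R => h^-1 *: (((fun s : R => f (y + s *: v)) \o shift t) (h *: 1) - f (y + t *: v))).
Proof.
apply/funext => h /=; congr (_ *: (f _ - _)).
by rewrite scalerDl [h%:A]mulr1 addrCA addrA.
Qed.

Lemma derivable_lineP f y v (t : R) :
  derivable f (y + t *: v) v <-> derivable (fun s : R => f (y + s *: v)) t 1.
Proof. by rewrite /derivable line_quotientE. Qed.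

Lemma derive_line f y v (t : R) :
  'D_v f (y + t *: v) = 'D_1 (fun s : R => f (y + s *: v)) t.
Proof. by rewrite /derive line_quotientE. Qed.

Lemma is_derive_line f y v (t a : R) :
  is_derive (y + t *: v) v f a <-> is_derive t 1 (fun s : R => f (y + s *: v)) a.
Proof.
split=> -[h1 h2]; split.
- exact/derivable_lineP.
- by rewrite -derive_line.
- exact/derivable_lineP.
- by rewrite derive_line.
Qed.

Lemma is_derive_line0 f y v (a : R) :
  is_derive y v f a <-> is_derive (0 : R) 1 (fun s : R => f (y + s *: v)) a.
Proof. by rewrite -is_derive_line scale0r addr0. Qed.

Lemma is_derive1_comp_real (g u : R -> R) (t a b : R) :
  is_derive (u t) 1 g a -> is_derive t 1 u b -> is_derive t 1 (fun s => g (u s)) (a * b).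
Proof.
move=> [dg ga] [du ub]; split.
  by apply/derivable1_diffP/(@differentiable_comp _ _ _ _ u g); exact/derivable1_diffP.
by rewrite -derive1E (derive1_comp du dg) !derive1E ga ub.
Qed.

(** Restriction to the line through [y] reduces the chain rule to one variable, so a derivative of
    [f] in the single direction [v] is enough. *)
Lemma is_derive_comp (g : R -> R) f y v (a b : R) :
  is_derive (f y) 1 g a -> is_derive y v f b -> is_derive y v (fun z => g (f z)) (a * b).
Proof.
move=> dg /is_derive_line0 df; apply/is_derive_line0.
by apply: is_derive1_comp_real df; rewrite scale0r addr0.
Qed.

Lemma is_derive_coord y v i : is_derive y v (fun z : E => z ord0 i) (v ord0 i).
Proof.
apply/is_derive_line0; rewrite (_ : (fun _ => _) = (fun s : R => y ord0 i + s * v ord0 i)).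
  by apply: is_derive_eq; rewrite /GRing.scale/=; ring.
by apply/funext => s; rewrite !mxE.
Qed.

Definition smooth f := forall n, Cn n f.

Lemma Cn_continuous n f : Cn n f -> continuous f.
Proof. by case: n => [|n] []. Qed.

Lemma CnW n f : Cn n.+1 f -> Cn n f.
Proof.
elim: n f => [|n IH] f [cf h]; first by split.
by split=> // i; split=> [y|]; [exact: (h i).1|apply: IH; exact: (h i).2].
Qed.

Lemma smooth_derivable f i y : smooth f -> derivable f y (e_ i).
Proof. by move=> sf; have [_ /(_ i)[]] := sf 1%N. Qed.

Lemma smooth_partial f i : smooth f -> smooth (partial i f).
Proof. by move=> sf n; have [_ /(_ i)[]] := sf n.+1. Qed.

Lemma smooth_continuous f : smooth f -> continuous f.
Proof. by move=> sf; exact: Cn_continuous (sf 0%N). Qed.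

Lemma partial_cst i (a : R) : partial i (fun=> a : R) = (fun=> 0 : R) :> (E -> R).
Proof. by apply/funext => y; rewrite /partial derive_cst. Qed.

Lemma Cn_cst n (a : R) : Cn n (fun _ : E => a).
Proof.
elim: n a => [|n IH] a; first by split=> // y; exact: cont_cst.
split=> [y|i]; first exact: cont_cst.
by split=> [y|]; [exact: derivable_cst|rewrite partial_cst].
Qed.

Lemma CnD n f g : Cn n f -> Cn n g -> Cn n (fun y => f y + g y).
Proof.
elim: n f g => [|n IH] f g [cf hf] [cg hg].
  by split=> // y; exact: contD (cf y) (cg y).
split=> [y|i]; first by exact: contD (cf y) (cg y).
have [df pf] := hf i; have [dg pg] := hg i.
split=> [y|]; first by apply: derivableD.
rewrite (_ : partial i _ = (fun y => partial i f y + partial i g y)); first exact: IH.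
by apply/funext => y; rewrite /partial -deriveD.
Qed.

Lemma CnM n f g : Cn n f -> Cn n g -> Cn n (fun y => f y * g y).
Proof.
elim: n f g => [|n IH] f g cnf cng; have [cf hf] := cnf; have [cg hg] := cng.
  by split=> // y; exact: contM (cf y) (cg y).
split=> [y|i]; first by exact: contM (cf y) (cg y).
have [df pf] := hf i; have [dg pg] := hg i.
split=> [y|]; first by apply: derivableM.
rewrite (_ : partial i _ = (fun y => f y * partial i g y + g y * partial i f y)).
  by apply: CnD; apply: IH => //; exact: CnW.
by apply/funext => y; rewrite /partial -[LHS]/('D_(e_ i) (f * g) y) deriveM.
Qed.

Lemma Cn_eq n f g : f =1 g -> Cn n f -> Cn n g.
Proof. by move=> /funext ->. Qed.

Lemma CnZ n (a : R) f : Cn n f -> Cn n (fun y => a * f y).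
Proof. by move=> cf; apply: CnM => //; exact: Cn_cst. Qed.

Lemma CnV n f : (forall y, f y != 0) -> Cn n f -> Cn n (fun y => (f y)^-1).
Proof.
move=> f0; elim: n => [|n IH] cnf; have [cf hf] := cnf.
  by split=> // y; exact: continuousV (f0 y) (cf y).
split=> [y|i]; first by exact: continuousV (f0 y) (cf y).
have [df pf] := hf i; split=> [y|]; first by apply: derivableV.
rewrite (_ : partial i _ = (fun y => -1 * ((f y)^-1 * (f y)^-1 * partial i f y))).
  by apply: CnZ; apply: CnM => //; apply: CnM; apply: IH; exact: CnW.
apply/funext => y; rewrite /partial deriveV// mulN1r -invfM -expr2.
by rewrite scaleNr.
Qed.

Lemma smoothD f g : smooth f -> smooth g -> smooth (fun y => f y + g y).
Proof. by move=> sf sg n; exact: CnD. Qed.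

Lemma smoothM f g : smooth f -> smooth g -> smooth (fun y => f y * g y).
Proof. by move=> sf sg n; exact: CnM. Qed.

Lemma smoothZ (a : R) f : smooth f -> smooth (fun y => a * f y).
Proof. by move=> sf n; exact: CnZ. Qed.

Lemma smooth_cst (a : R) : smooth (fun=> a).
Proof. by move=> n; exact: Cn_cst. Qed.

Lemma smoothN f : smooth f -> smooth (fun y => - f y).
Proof. by move=> sf n; apply: Cn_eq (CnZ (-1) (sf n)) => y; rewrite mulN1r. Qed.

Lemma smoothB f g : smooth f -> smooth g -> smooth (fun y => f y - g y).
Proof. by move=> sf sg; apply: smoothD => //; exact: smoothN. Qed.

Lemma smooth_prod (I : Type) (s : seq I) (F : I -> E -> R) :
  (forall j, smooth (F j)) -> smooth (fun y => \prod_(j <- s) F j y).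
Proof.
move=> sF; elim: s => [|j s IH] n.
  by apply: Cn_eq (@Cn_cst n 1) => y; rewrite big_nil.
apply: Cn_eq (CnM (sF j n) (IH n)) => y; by rewrite big_cons.
Qed.

(** [Cn] speaks of iterated partial derivatives, so the induction runs over a whole family [S]
    stable under differentiation; the affine function of a coordinate only brings constant
    factors. *)
Lemma smooth_coord (S : set (R -> R)) (g : R -> R) i (c d : R) :
  (forall h, S h -> continuous h /\ (forall t, derivable h t 1) /\ S (derive1 h)) ->
  S g -> smooth (fun y => g (c * y ord0 i + d)).
Proof.
move=> hS Sg n; elim: n g Sg => [|n IH] g Sg; have [cg [dg Sg']] := hS g Sg.
all: have cont : continuous (fun y : E => g (c * y ord0 i + d)) by
  move=> y; apply: (@cont_comp _ _ g (fun y : E => c * y ord0 i + d)); [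
    apply: contD; [apply: contM; [exact: cont_cst|exact: continuous_coord]|exact: cont_cst]
  | exact: cg].
  by split.
split=> // j; have dj y : is_derive y (e_ j) (fun y => g (c * y ord0 i + d))
    (derive1 g (c * y ord0 i + d) * (c * (e_ j) ord0 i)).
  apply: (@is_derive_comp g (fun y : E => c * y ord0 i + d)).
    by rewrite derive1E; exact/derivableP.
  have h := is_derive_coord y (e_ j) i; apply: is_derive_eq.
  by rewrite /GRing.scale/=; ring.
split=> [y|]; first by have [] := dj y.
rewrite (_ : partial j _ =
  (fun y => c * (e_ j) ord0 i * (fun y : E => derive1 g (c * y ord0 i + d)) y)).
  by apply: CnZ; exact: IH.
by apply/funext => y; rewrite /partial derive_val mulrC.
Qed.

Lemma smooth_trig i (c d : R) :
  smooth (fun y => cos (c * y ord0 i + d)) /\ smooth (fun y => sin (c * y ord0 i + d)).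
Proof.
pose S : set (R -> R) := [set g | exists a b : R, g = (fun t => a * cos t + b * sin t)].
have hS h : S h -> continuous h /\ (forall t, derivable h t 1) /\ S (derive1 h).
  move=> [a [b ->]].
  have da (t : R) : is_derive t 1 (fun t => a * cos t + b * sin t) (b * cos t + - a * sin t).
    by apply: is_derive_eq; rewrite /GRing.scale/=; ring.
  split; last split.
  - by move=> t; apply: (@contD _ _ (fun t => a * cos t) (fun t => b * sin t)); apply: contM;
      [exact: cont_cst|exact: continuous_cos|exact: cont_cst|exact: continuous_sin].
  - by move=> t; have [] := da t.
  - by exists b, (- a); apply/funext => t; rewrite derive1E derive_val.
split.
  apply: (@smooth_coord S cos i c d hS).
  by exists 1, 0; apply/funext => t; rewrite mul1r mul0r addr0.
apply: (@smooth_coord S sin i c d hS).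
by exists 0, 1; apply/funext => t; rewrite mul1r mul0r add0r.
Qed.

End directional_derivatives.

(** * Smooth bumps and cutoffs *)

Section bump_functions.
Context {R : realType}.

(** The functions [p(1/t) exp(-1/t)], extended by zero, are stable under differentiation, which
    replaces [p] by [X^2 (p - p')]. The case [p = 1] is the classical flat function. *)
Definition flat (p : {poly R}) (t : R) : R := if 0 < t then p.[t^-1] * expR (- t^-1) else 0.

(** The order 2 makes the derivative at 0 vanish. With [n = size p + 2], the bound
    [exp u >= u^n / n!] at [u = 1/t] absorbs the polynomial, of degree below [size p], and leaves
    [t^2]. *)
Lemma flat_le (p : {poly R}) : exists2 C : R, 0 <= C &
  forall t, 0 < t -> t <= 1 -> `|flat p t| <= C * t ^+ 2.
Proof.
pose C0 := \sum_(i < size p) `|p`_i|.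
exists (C0 * (size p).+2`!%:R).
  by rewrite mulr_ge0// sumr_ge0.
move=> t t0 t1; rewrite /flat t0 normrM.
have u1 : 1 <= t^-1 by rewrite invf_ge1.
have u0 : 0 <= t^-1 by rewrite ltW// invr_gt0.
have h1 : `|p.[t^-1]| <= C0 * t^-1 ^+ size p.
  rewrite horner_coef (le_trans (ler_norm_sum _ _ _))// mulr_suml ler_sum// => i _.
  rewrite normrM ler_wpM2l// normrX ger0_norm//.
  by rewrite ler_weXn2l// ltnW.
have h2 : expR (- t^-1) * t^-1 ^+ (size p).+2 <= (size p).+2`!%:R.
  rewrite expRN -ler_pdivlMr; last by rewrite exprn_gt0// invr_gt0.
  have f0 : 0 < ((size p).+2`!%:R : R) by rewrite ltr0n fact_gt0.
  rewrite invf_ple ?posrE ?expR_gt0 ?divr_gt0 ?exprn_gt0 ?invr_gt0//.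
  rewrite invf_div; apply: le_trans (expR_ge1Dxn (size p).+1 u0).
  by rewrite lerDr.
rewrite (ger0_norm (expR_ge0 _)).
apply: (@le_trans _ _ (C0 * t^-1 ^+ size p * expR (- t^-1))).
  by rewrite ler_wpM2r// expR_ge0.
rewrite -mulrA -[leRHS]mulrA ler_wpM2l ?sumr_ge0//.
rewrite -ler_pdivrMr ?exprn_gt0//.
apply: le_trans h2; rewrite -exprVn !exprS expr0 mulr1.
by rewrite le_eqVlt; apply/orP; left; apply/eqP; ring.
Qed.

Lemma flat_derive0 (p : {poly R}) : is_derive (0 : R) 1 (flat p) 0.
Proof.
have [C C0 CP] := flat_le p.
have lim0 : (fun h : R => h^-1 *: ((flat p \o shift 0) (h *: 1) - flat p 0)) @ 0^' --> (0 : R).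
  apply/cvgrPdist_le => e e0; near=> h.
  rewrite sub0r normrN /= addr0 [h%:A]mulr1 /flat ltxx subr0.
  case: ifPn => h0; last by rewrite scaler0 normr0 ltW.
  rewrite normrZ normfV (gtr0_norm h0).
  have h1 : h <= 1.
    by rewrite (le_trans (ler_norm _))//; near: h; apply: dnbhs0_le.
  have := CP h h0 h1; rewrite {1}/flat h0 => hC.
  rewrite ler_pdivrMl// (le_trans hC)// expr2 mulrA mulrC ler_wpM2l ?(ltW h0)//.
  have : h <= e / (C + 1).
    rewrite (le_trans (ler_norm _))//; near: h; apply: dnbhs0_le.
    by rewrite divr_gt0// ltr_wpDl.
  rewrite ler_pdivlMr ?ltr_wpDl//; apply: le_trans.
  by rewrite mulrC ler_wpM2l ?lerDl// (ltW h0).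
split; last exact: cvg_lim.
by apply/cvg_ex; exists 0.
Unshelve. all: by end_near. Qed.

Lemma flat_derive (p : {poly R}) (t : R) :
  is_derive t 1 (flat p) (flat ('X^2 * (p - p^`())) t).
Proof.
case: (ltgtP 0 t) => [t0|t0|<-]; last first.
- by rewrite {2}/flat ltxx; exact: flat_derive0.
- apply: (@near_eq_is_derive _ _ _ (cst 0) (flat p)) => //.
    near=> s; rewrite /flat ifF//; apply/negbTE; rewrite -leNgt ltW//; near: s.
    exact: lt_nbhsl.
  rewrite /flat ifF; last by apply/negbTE; rewrite -leNgt ltW.
  exact: is_derive_cst.
apply: (near_eq_is_derive (f := fun s : R => p.[s^-1] * expR (- s^-1))).
  near=> s; rewrite /flat ifT//; near: s; exact: lt_nbhsr.
have t0' : t != 0 by rewrite gt_eqF.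
have dV : is_derive t 1 (fun s : R => s^-1) (- t ^- 2).
  apply: is_derive_eq; first exact: is_deriveV.
  by rewrite [_ *: 1]mulr1.
have d1 : is_derive t 1 (fun s : R => p.[s^-1]) (p^`().[t^-1] * - t ^- 2).
  by apply: (@is_derive1_comp_real R (horner p)).
have d2 : is_derive t 1 (fun s : R => expR (- s^-1)) (expR (- t^-1) * t ^- 2).
  apply: (@is_derive1_comp_real R expR (fun s => - s^-1)).
  by apply: is_derive_eq; rewrite opprK.
apply: is_derive_eq; rewrite /flat t0 !hornerE /GRing.scale/=.
by rewrite exprVn; ring.
Unshelve. all: by end_near. Qed.

Lemma continuous_flat (p : {poly R}) : continuous (flat p).
Proof.
move=> t; apply/differentiable_continuous/derivable1_diffP.
by have [] := flat_derive p t.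
Qed.

Lemma flat1_gt0 (t : R) : 0 < t -> 0 < flat 1 t.
Proof. by move=> t0; rewrite /flat t0 hornerE mul1r expR_gt0. Qed.

Lemma flat1_ge0 (t : R) : 0 <= flat 1 t.
Proof. by have [t0|t0] := ltP 0 t; [exact/ltW/flat1_gt0|rewrite /flat ltNge t0]. Qed.

Lemma flat1_eq0 (t : R) : t <= 0 -> flat 1 t = 0.
Proof. by move=> t0; rewrite /flat ltNge t0. Qed.

Definition step (t : R) : R := flat 1 t / (flat 1 t + flat 1 (1 - t)).

Lemma step_denom_gt0 (t : R) : 0 < flat 1 t + flat 1 (1 - t).
Proof.
have [t0|t0] := ltP 0 t; first by rewrite ltr_pwDl ?flat1_gt0 ?flat1_ge0.
by rewrite ltr_wpDl ?flat1_ge0// flat1_gt0//; lra.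
Qed.

Lemma step_ge0 (t : R) : 0 <= step t.
Proof. by rewrite divr_ge0 ?flat1_ge0// ltW// step_denom_gt0. Qed.

Lemma step_le1 (t : R) : step t <= 1.
Proof. by rewrite ler_pdivrMr ?step_denom_gt0// mul1r lerDl flat1_ge0. Qed.

Lemma step_eq0 (t : R) : t <= 0 -> step t = 0.
Proof. by move=> t0; rewrite /step flat1_eq0// mul0r. Qed.

Lemma step_eq1 (t : R) : 1 <= t -> step t = 1.
Proof.
move=> t1; rewrite /step (@flat1_eq0 (1 - t)) ?subr_le0// addr0 divff//.
by rewrite gt_eqF// flat1_gt0//; lra.
Qed.

Context {m : nat}.
Local Notation E := 'rV[R]_m.
Implicit Types (y z c : E).

Lemma smooth_flat_coord (p : {poly R}) i (a b : R) :
  smooth (fun y : E => flat p (a * y ord0 i + b)).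
Proof.
apply: (@smooth_coord _ _ [set flat q | q in setT] (flat p) i a b); last by exists p.
move=> _ [q _ <-]; split; first exact: continuous_flat.
split=> [t|]; first by have [] := flat_derive q t.
exists ('X^2 * (q - q^`())) => //; apply/funext => t.
by have dq := flat_derive q t; rewrite derive1E derive_val.
Qed.

Lemma smooth_step_coord i (a b : R) : smooth (fun y : E => step (a * y ord0 i + b)).
Proof.
have s1 := @smooth_flat_coord 1 i a b.
have s2 : smooth (fun y : E => flat 1 (1 - (a * y ord0 i + b))).
  move=> n; apply: Cn_eq (@smooth_flat_coord 1 i (- a) (1 - b) n) => y.
  by congr flat; ring.
move=> n; apply: CnM => //; apply: CnV => [y|]; last exact: CnD.
by rewrite gt_eqF// step_denom_gt0.
Qed.

Lemma prod_le1 (I : Type) (s : seq I) (F : I -> R) :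
  (forall i, 0 <= F i <= 1) -> \prod_(i <- s) F i <= 1.
Proof.
move=> F01; elim: s => [|i s IH]; first by rewrite big_nil.
rewrite big_cons mulr_ile1//; have /andP[//] := F01 i.
by move=> _ _; apply: prodr_ge0 => j _; have /andP[] := F01 j.
Qed.

(** For each coordinate the arguments of [step] are [2 - (2/r)(y_i - c_i)] and
    [2 + (2/r)(y_i - c_i)]: both are at least 1 if [|y_i - c_i| <= r/2], and one of them is at most
    0 if [|y_i - c_i| >= r]. *)
Definition cube_bump c (r : R) y : R :=
  \prod_(i <- enum 'I_m) (step (- (2 / r) * y ord0 i + (2 / r * c ord0 i + 2)) *
                    step (2 / r * y ord0 i + (- (2 / r) * c ord0 i + 2))).

Lemma smooth_cube_bump c (r : R) : smooth (cube_bump c r).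
Proof.
by apply: smooth_prod => i; apply: smoothM; exact: smooth_step_coord.
Qed.

Lemma cube_bump_ge0 c (r : R) y : 0 <= cube_bump c r y.
Proof. by apply: prodr_ge0 => i _; rewrite mulr_ge0 ?step_ge0. Qed.

Lemma cube_bump_le1 c (r : R) y : cube_bump c r y <= 1.
Proof.
by apply: prod_le1 => i; rewrite mulr_ge0 ?step_ge0//= mulr_ile1 ?step_ge0 ?step_le1.
Qed.

Lemma cube_bump_eq1 c (r : R) y : 0 < r -> `|c - y| <= r / 2 -> cube_bump c r y = 1.
Proof.
move=> r0 /norm_leP h; have r20 : 0 <= r / 2 by rewrite divr_ge0// ltW.
apply: big1 => i _; have := h r20 i; rewrite !mxE ler_norml => /andP[h1 h2].
have e1 : 2 / r * (r / 2) = 1 by field; exact: lt0r_neq0.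
have q0 : 0 < 2 / r by rewrite divr_gt0.
have h3 : 2 / r * (c ord0 i - y ord0 i) <= 1 by rewrite -[leRHS]e1 ler_wpM2l// ltW.
have h4 : -1 <= 2 / r * (c ord0 i - y ord0 i)
  by have := ler_wpM2l (ltW q0) h1; rewrite mulrN e1.
by rewrite !step_eq1 ?mulr1//; nra.
Qed.

Lemma cube_bump_eq0 c (r : R) y : 0 < r -> ~ (`|c - y| <= r) -> cube_bump c r y = 0.
Proof.
move=> r0; rewrite norm_leP; last exact: ltW.
move=> h'; have [i hi] : exists i, r < `|(c - y) ord0 i|.
  apply: contrapT => hn; apply: h' => i; rewrite leNgt; apply/negP => hi.
  by apply: hn; exists i.
move: hi; rewrite !mxE lter_normr => {h'}h.
rewrite /cube_bump (bigD1_seq i) ?enum_uniq ?mem_enum//=.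
have e1 : 2 / r * r = 2 by field; exact: lt0r_neq0.
have q0 : 0 < 2 / r by rewrite divr_gt0.
case/orP: h => h.
  rewrite [step (2 / r * y ord0 i + _)]step_eq0 ?mulr0 ?mul0r//.
  have : 2 / r * r < 2 / r * (c ord0 i - y ord0 i) by rewrite ltr_pM2l.
  by nra.
rewrite [step (- (2 / r) * y ord0 i + _)]step_eq0 ?mul0r//.
have : 2 / r * r < 2 / r * - (c ord0 i - y ord0 i) by rewrite ltr_pM2l.
by nra.
Qed.

Lemma finite_ball_cover (K : set E) (r : R) : compact K -> 0 < r ->
  exists2 s : seq E, (forall c, c \in s -> K c) &
    forall y, K y -> exists2 c, c \in s & `|c - y| < r.
Proof.
move=> cK r0; move: (cK); rewrite compact_cover => /(_ E K (fun c => ball c r)).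
case=> [c _|y Ky|D DK KD].
- exact: ball_open.
- by exists y => //; exact: ballxx.
exists (finmap.enum_fset D) => [c cD|y /KD[c cD cy]].
  by have := DK c cD; rewrite inE.
by exists c => //; rewrite -ball_rVE.
Qed.

Lemma compact_bigU (s : seq E) (F : E -> set E) : (forall c, compact (F c)) ->
  compact [set y | exists2 c, c \in s & F c y].
Proof.
move=> cF; elim: s => [|c s IH].
  rewrite (_ : mkset _ = set0); first exact: compact0.
  by apply/seteqP; split=> // y [].
rewrite (_ : mkset _ = F c `|` [set y | exists2 c, c \in s & F c y]); first exact: compactU.
apply/seteqP; split=> y.
  move=> [c']; rewrite inE => /orP[/eqP ->|cs] Fy; [by left|right].
  by exists c'.
case=> [Fy|[c' cs Fy]]; first by exists c; rewrite ?mem_head.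
by exists c'; rewrite ?inE ?cs ?orbT.
Qed.

(** One minus the product of the [1 - bump] equals 1 as soon as one bump does, so no partition of
    unity has to be normalised. The value 1 is kept on a neighbourhood of [K] of uniform radius,
    where the derivatives therefore vanish. *)
Lemma smooth_cutoff (K O : set E) : compact K -> open O -> K `<=` O ->
  exists2 chi : E -> R, smooth chi &
    [/\ forall y, 0 <= chi y <= 1,
        exists2 r : R, 0 < r & forall y z, K y -> `|y - z| < r -> chi z = 1 &
        exists2 L : set E, compact L & L `<=` O /\ forall y, ~ L y -> chi y = 0].
Proof.
move=> cK oO KO; have [r r0 rO] := compact_margin cK oO KO.
(* The centres are [r/8]-dense in [K], the bumps are 1 up to distance [r/4] and 0 beyond [r/2]: the
   neighbourhood has radius [r/8], and the support stays within the margin [r]. *)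
have r8 : 0 < r / 8 by rewrite divr_gt0.
have [s sK Ks] := finite_ball_cover cK r8.
exists (fun y => 1 - \prod_(c <- s) (1 - cube_bump c (r / 2) y)).
  apply: smoothB; first exact: smooth_cst.
  apply: smooth_prod => c; apply: smoothB; first exact: smooth_cst.
  exact: smooth_cube_bump.
have b01 y : 0 <= \prod_(c <- s) (1 - cube_bump c (r / 2) y) <= 1.
  apply/andP; split; first by apply: prodr_ge0 => c _; rewrite subr_ge0 cube_bump_le1.
  by apply: prod_le1 => c; rewrite subr_ge0 cube_bump_le1/= gerBl cube_bump_ge0.
split.
- by move=> y; have := b01 y; lra.
- exists (r / 8) => // y z /Ks[c cs cy] yz.
  rewrite (big_rem c)//= cube_bump_eq1 ?subrr ?mul0r ?subr0//; first by rewrite divr_gt0.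
  rewrite (_ : c - z = (c - y) + (y - z)); last by rewrite addrA subrK.
  by rewrite (le_trans (ler_normD _ _))//; lra.
exists [set y | exists2 c, c \in s & [set z | `|c - z| <= r / 2] y].
  by apply: compact_bigU => c; exact: closed_ball_rV_compact.
split=> [y [c /sK Kc cy]|y nL].
  by apply: (rO c Kc); rewrite ball_rVE (le_lt_trans cy)// ltr_pdivrMr//; lra.
rewrite big_seq big1 ?subrr// => c cs; rewrite cube_bump_eq0 ?subr0 ?divr_gt0//.
by move=> cy; apply: nL; exists c.
Qed.

End bump_functions.

(** * The mean value theorem and directional derivatives of C^1 functions *)

Section mean_value.
Context {R : realType} {m : nat}.
Local Notation E := 'rV[R]_m.
Local Notation e_ i := (delta_mx ord0 i : E).
Implicit Types (f g h : E -> R) (y v s : E).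

Lemma is_deriveZv f y v (c a : R) : is_derive y v f a -> is_derive y (c *: v) f (c * a).
Proof.
move=> /is_derive_line0 df; apply/is_derive_line0.
rewrite (_ : (fun t => _) = (fun t : R => (fun u : R => f (y + u *: v)) (c * t))); last first.
  by apply/funext => t; rewrite scalerA mulrC.
rewrite mulrC; apply: (@is_derive1_comp_real _ (fun u : R => f (y + u *: v)) (fun t => c * t)).
  by rewrite mulr0.
by apply: is_derive_eq; rewrite /GRing.scale/=; ring.
Qed.

Lemma line_MVT f (df : E -> R) y v :
  (forall z, is_derive z v f (df z)) ->
  exists2 t : R, 0 <= t <= 1 & f (y + v) - f y = df (y + t *: v).
Proof.
move=> fd; have dF (t : R) : is_derive t 1 (fun u : R => f (y + u *: v)) (df (y + t *: v)).
  exact/is_derive_line.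
have [|t] := @MVT_segment R (fun u => f (y + u *: v)) (fun t => df (y + t *: v)) 0 1 ler01.
  by apply: derivable_within_continuous => t _; have [] := dF t.
rewrite in_itv/= => t01; rewrite scale1r scale0r addr0 subr0 mulr1 => ->.
by exists t.
Qed.

Definition C1 f := forall i, (forall y, derivable f y (e_ i)) /\ continuous (partial i f).

Lemma smooth_C1 f : smooth f -> C1 f.
Proof.
move=> sf i; split=> [y|]; first exact: smooth_derivable.
by apply: smooth_continuous; exact: smooth_partial.
Qed.

(** The base point [h s + y] moves with [h], so differentiability at [y] would not do: the mean
    value theorem on the last coordinate leg is combined with continuity of the partial derivative
    at [y]. *)
Lemma partial_increment f i y s (u : E) : C1 f ->
  (fun h : R => h^-1 *: (f (h *: (s + u ord0 i *: e_ i) + y) - f (h *: s + y))) @ 0^'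
    --> u ord0 i * partial i f y.
Proof.
move=> Cf; have [df cp] := Cf i; set c := u ord0 i.
apply/cvgrPdist_le => e e0.
pose e' := e / (`|c| + 1); have e'0 : 0 < e' by rewrite divr_gt0// ltr_wpDl.
have /cvgrPdist_le/(_ _ e'0)/nbhs_ballP[d /= d0 dP] := cp y.
near=> h; have h0 : h != 0 by near: h; exact: nbhs_dnbhs_neq.
have [t /andP[t0 t1] tP] := @line_MVT f (fun z => (h * c) * partial i f z) (h *: s + y)
  ((h * c) *: e_ i) (fun z => is_deriveZv (h * c) (derivableP (df z))).
have -> : h *: (s + c *: e_ i) + y = (h *: s + y) + (h * c) *: e_ i.
  by rewrite scalerDr scalerA addrAC.
rewrite tP; set w := h *: s + y + t *: _.
have -> : h^-1 *: (h * c * partial i f w) = c * partial i f w.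
  by rewrite -[LHS]/(h^-1 * (h * c * partial i f w)); field.
rewrite -mulrBr normrM.
apply: (@le_trans _ _ (`|c| * e')).
  rewrite ler_wpM2l//; apply: dP; rewrite ball_rVE /w.
  have -> : y - (h *: s + y + t *: ((h * c) *: e_ i)) = - (h *: (s + (t * c) *: e_ i)).
    by rewrite scalerDr !scalerA [t * _]mulrCA opprD addrA [h *: s + y]addrC opprD addrA subrr sub0r -opprD.
  rewrite normrN normrZ.
  have hB : `|s + (t * c) *: e_ i| <= `|s| + `|c| * `|e_ i|.
    rewrite (le_trans (ler_normD _ _))// lerD2l normrZ ler_wpM2r// normrM.
    by rewrite ger0_norm// ler_piMl.
  have B0 : 0 < `|s| + `|c| * `|e_ i| + 1 by rewrite ltr_wpDl// addr_ge0// mulr_ge0.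
  apply: (@le_lt_trans _ _ (`|h| * (`|s| + `|c| * `|e_ i|))); first by rewrite ler_wpM2l.
  have : `|h| * (`|s| + `|c| * `|e_ i| + 1) < d.
    by rewrite -ltr_pdivlMr//; near: h; apply: dnbhs0_lt; rewrite divr_gt0.
  by apply: le_lt_trans; rewrite ler_wpM2l// lerDl.
rewrite /e' mulrCA ger_pMr// ler_pdivrMr ?ltr_wpDl// mul1r lerDl.
by [].
Unshelve. all: by end_near. Qed.

(** The increment is telescoped over the coordinates, one leg at a time, along the partial sums of
    [s]. *)
Lemma C1_is_derive f y s : C1 f ->
  is_derive y s f (\sum_i s ord0 i * partial i f y).
Proof.
move=> Cf; pose sk (r : seq 'I_m) : E := \sum_(i <- r) s ord0 i *: e_ i.
have key (r : seq 'I_m) : (fun h : R => h^-1 *: (f (h *: sk r + y) - f y)) @ 0^' -->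
    \sum_(i <- r) s ord0 i * partial i f y.
  elim: r => [|i r IH].
    rewrite /sk !big_nil [X in X @ _](_ : _ = (fun=> 0)); first exact: cvg_cst.
    by apply/funext => h; rewrite scaler0 add0r subrr scaler0.
  rewrite big_cons [X in X @ _](_ : _ = (fun h : R =>
    h^-1 *: (f (h *: (sk r + s ord0 i *: e_ i) + y) - f (h *: sk r + y)) +
    h^-1 *: (f (h *: sk r + y) - f y))).
    by apply: cvgD => //; exact: partial_increment.
  apply/funext => h; rewrite -scalerDr /sk big_cons [X in h *: X]addrC.
  by congr (_ *: _); rewrite addrA subrK.
have sE : sk (index_enum 'I_m) = s.
  rewrite /sk; apply/rowP => j; rewrite summxE (bigD1 j)//= big1 => [|i ij].
    by rewrite !mxE !eqxx mulr1 addr0.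
  by rewrite !mxE eqxx/= eq_sym (negbTE ij) mulr0.
have := key (index_enum 'I_m); rewrite sE => lim0.
by split; [apply/cvg_ex; eexists; exact: lim0|exact: cvg_lim lim0].
Qed.

Lemma sum_CS (a b : 'I_m -> R) :
  (\sum_i a i * b i) ^+ 2 <= (\sum_i a i ^+ 2) * \sum_i b i ^+ 2.
Proof.
apply: discriminant_le => t.
have -> : \sum_i a i ^+ 2 + 2 * t * (\sum_i a i * b i) + t ^+ 2 * (\sum_i b i ^+ 2) =
    \sum_i (a i + t * b i) ^+ 2.
  rewrite !mulr_sumr -!big_split; apply: eq_bigr => i _ /=; ring.
by apply: sumr_ge0 => i _; exact: sqr_ge0.
Qed.

Lemma partial_near0 f (K : set E) i y : closed K -> (forall z, ~ K z -> f z = 0) -> ~ K y ->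
  is_derive y (e_ i) f 0.
Proof.
move=> cK f0 nKy; apply: near_eq_is_derive (is_derive_cst (0 : R) y (e_ i)).
have : nbhs y (~` K) by apply: open_nbhs_nbhs; split=> //; exact: closed_openC.
by apply: filterS => z /f0 ->.
Qed.

Lemma continuous_zero_off f (K O : set E) : closed K -> (forall z, ~ K z -> f z = 0) ->
  K `<=` O -> (forall y, O y -> {for y, continuous f}) -> continuous f.
Proof.
move=> cK f0 KO cf y; have [/cf//|nOy] := pselect (O y).
have nKy : ~ K y by move=> /KO.
have nK : nbhs y (~` K) by apply: open_nbhs_nbhs; split=> //; exact: closed_openC.
rewrite /continuous_at f0// => A A0; have A0' := nbhs_singleton A0.
by apply: (filterS _ nK) => z /f0 /= ->.
Qed.

End mean_value.

(** * Integration by parts *)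

Section integration_by_parts.
Context {R : realType} {m : nat}.
Local Notation E := 'rV[R]_m.
Local Notation e_ i := (delta_mx ord0 i : E).
Local Notation mu := (@lebesgue_rV R m).
Implicit Types (f g h phi : E -> R) (y v s : E) (K O A B : set E).

Lemma integral_shift s (f : E -> \bar R) : measurable_fun setT f ->
  (\int[mu]_y f (y + s)%R = \int[mu]_y f y)%E.
Proof.
move=> mf; rewrite integralE [RHS]integralE; congr (_ - _)%E.
  have <- := ge0_integral_shift s (measurable_funepos mf) => //.
  by rewrite funepos_comp.
have <- := ge0_integral_shift s (measurable_funeneg mf) => //.
by rewrite funeneg_comp.
Qed.

Lemma continuous_bounded_on K h : compact K -> continuous h ->
  exists2 M : R, 0 < M & forall y, K y -> `|h y| <= M.
Proof.
move=> cK ch; have : compact (h @` K).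
  by apply: continuous_compact => //; apply: continuous_subspaceT => y; exact: ch.
move=> /compact_bounded[M [Mr MP]]; exists (`|M| + 1); first by rewrite ltr_wpDl.
move=> y Ky; apply: (MP (`|M| + 1)); last by exists y.
by rewrite (le_lt_trans (ler_norm _))// ltrDl.
Qed.

Lemma zero_off_restrict (h : E -> R) K : (forall y, ~ K y -> h y = 0) -> h \_ K = h.
Proof.
move=> h0; apply/funext => y; rewrite patchE; case: ifPn => // /negP; rewrite inE.
by move=> /h0 ->.
Qed.

Lemma zero_off_Rintegral K h : (forall y, ~ K y -> h y = 0) ->
  \int[mu]_(y in K) h y = \int[mu]_y h y.
Proof. by move=> h0; rewrite Rintegral_mkcond zero_off_restrict. Qed.

Lemma zero_off_integrable K h : measurable K -> (forall y, ~ K y -> h y = 0) ->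
  mu.-integrable K (EFin \o h) <-> mu.-integrable setT (EFin \o h).
Proof.
move=> mK h0; rewrite integrable_mkcond//.
suff -> : (EFin \o h) \_ K = EFin \o h by [].
apply/funext => y; rewrite patchE; case: ifPn => // /negP; rewrite inE.
by move=> /h0 /= ->.
Qed.

Lemma integrable_bounded_on K h (M : R) : measurable K -> (mu K < +oo)%E ->
  measurable_fun K h -> (forall y, K y -> `|h y| <= M) -> mu.-integrable K (EFin \o h).
Proof.
move=> mK Koo mh hM; apply: measurable_bounded_integrable => //.
exists M; split; first exact: num_real.
by move=> N MN y Ky /=; rewrite (le_trans (hM y Ky))// ltW.
Qed.

Lemma integrable_compact_support K h : compact K -> continuous h ->
  (forall y, ~ K y -> h y = 0) -> mu.-integrable setT (EFin \o h).
Proof.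
move=> cK ch h0; have [M M0 hM] := continuous_bounded_on cK ch.
apply/(zero_off_integrable (compact_measurable_rV cK) h0).
apply: integrable_bounded_on hM; first exact: compact_measurable_rV.
  exact: lebesgue_rV_compact.
by apply: measurable_funS (continuous_measurable_rVT ch).
Qed.

Lemma norm_delta i : `|e_ i : E| <= 1.
Proof.
apply/norm_leP => // j; rewrite mxE eqxx/=.
by case: (j == i); rewrite ?normr1 ?normr0.
Qed.

Lemma partial_zero_off i h K : closed K -> (forall y, ~ K y -> h y = 0) ->
  forall y, ~ K y -> partial i h y = 0.
Proof. by move=> cK h0 y nKy; have [] := partial_near0 i cK h0 nKy. Qed.

(* The integrals of the difference quotients vanish by translation invariance. *)
Lemma integral_partial_eq0 i h K : compact K -> continuous h ->
  (forall y, derivable h y (e_ i)) -> continuous (partial i h) ->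
  (forall y, ~ K y -> h y = 0) -> \int[mu]_y partial i h y = 0.
Proof.
move=> cK ch dh cp h0.
have clK := compact_closed_rV cK.
have p0 := partial_zero_off i clK h0.
have [M M0 pM] := continuous_bounded_on cK cp.
have pMT y : `|partial i h y| <= M.
  by have [/pM//|/p0 ->] := pselect (K y); rewrite normr0 ltW.
have [B B0 KB] := compact_bounded_rV cK.
(* The translations have length at most 1, so every difference quotient vanishes outside [L]; by the
   mean value theorem it is bounded by [M], and [M] times the indicator of [L] dominates. *)
pose L : set E := [set y | `|0 - y| <= B + 1].
have cL : compact L by exact: closed_ball_rV_compact.
have mL := compact_measurable_rV cL.
pose s (n : nat) : E := n.+1%:R^-1 *: e_ i.
pose f n y := n.+1%:R * (h (y + s n) - h y).
have ih := integrable_compact_support cK ch h0.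
have mh := continuous_measurable_rVT ch.
have s1 n : `|s n| <= 1.
  rewrite normrZ ger0_norm ?invr_ge0//.
  by rewrite -[leRHS]mulr1 ler_pM ?invr_ge0 ?norm_delta// invf_le1 ?ler1n.
have mhs n : measurable_fun setT (fun y => h (y + s n)).
  apply: (@measurableT_comp _ _ _ _ _ _ h) => //; exact: measurable_shift.
have ihs n : mu.-integrable setT (EFin \o (fun y => h (y + s n))).
  apply/integrableP; split; first exact/measurable_EFinP.
  rewrite (@integral_shift (s n) (fun y => `|(EFin \o h) y|%E)).
    by have /integrableP[] := ih.
  by do 2 apply: measurableT_comp => //.
have f0 n : \int[mu]_y f n y = 0.
  rewrite /f RintegralZl//; last first.
    by have := integrableB measurableT (ihs n) ih.
  rewrite RintegralB// /Rintegral (integral_shift (s n) (f := EFin \o h)) ?subrr ?mulr0//.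
  exact/measurable_EFinP.
have fM n y : `|f n y| <= M.
  have [t _ tP] := @line_MVT _ _ h (fun z => n.+1%:R^-1 * partial i h z) y (s n)
    (fun z => is_deriveZv n.+1%:R^-1 (derivableP (dh z))).
  by rewrite /f tP mulVKf.
have fL n y : ~ L y -> f n y = 0.
  move=> nL; have nK1 : ~ K y.
    by move=> /KB yB; apply: nL; rewrite /L/= sub0r normrN (le_trans yB)// lerDl.
  have nK2 : ~ K (y + s n).
    move=> /KB yB; apply: nL; rewrite /L/= sub0r normrN -(addrK (s n) y).
    by rewrite (le_trans (ler_normB _ _))// lerD.
  by rewrite /f !h0// subrr mulr0.
pose g y : R := M * \1_L y.
have ig : mu.-integrable setT (EFin \o g).
  apply/(zero_off_integrable mL); first by move=> y nL; rewrite /g indicE memNset ?mulr0.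
  apply: (@integrable_bounded_on L g M) => //; first exact: lebesgue_rV_compact.
    by apply: measurable_funM => //; exact: measurable_indic.
  move=> y Ly; rewrite /g indicE mem_set// mulr1 gtr0_norm//.
have [||||_ _] := @dominated_convergence _ _ _ mu setT measurableT
  (fun n => EFin \o f n) (EFin \o partial i h) (EFin \o g) _ _ _ ig _.
- move=> n; apply/measurable_EFinP; apply: measurable_funM => //.
  exact: measurable_funB.
- by apply/measurable_EFinP; exact: continuous_measurable_rVT.
- apply: aeW => y _; apply: cvg_EFin; first exact: nearW.
  have /cvg_ex[l hl] := dh y.
  have l' : partial i h y = l by exact: cvg_lim hl.
  have hr := cvg_dnbhs_at_right hl.
  have sn : (forall n : nat, 0 < n.+1%:R^-1 :> R) /\ (fun n : nat => n.+1%:R^-1 : R) @ \oo --> 0.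
    by split=> [n|]; [rewrite invr_gt0|exact: cvg_harmonic].
  rewrite l'; have := (iffLR (cvg_at_rightP _ _ _) hr) _ sn.
  apply: cvg_trans; apply: near_eq_cvg; apply: nearW => n /=.
  by rewrite invrK /f [y + _]addrC.
- by apply: aeW => y n _; rewrite /= lee_fin; have [Ly|nLy] := pselect (L y);
    [rewrite /g indicE mem_set// mulr1|rewrite fL// normr0 /g indicE memNset// mulr0].
rewrite (_ : (fun n => _) = (fun=> 0%E)); last first.
  apply/funext => n /=; have := f0 n; rewrite /Rintegral => fn0.
  rewrite -[LHS]fineK; first by rewrite fn0.
  apply: integrable_fin_num => //.
  by have := integrableZl measurableT n.+1%:R (integrableB measurableT (ihs n) ih).
move=> /cvg_lim h1; rewrite /Rintegral -h1//.
by rewrite lim_cst.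
Qed.

Lemma partial_mul i f g y : derivable f y (e_ i) -> derivable g y (e_ i) ->
  is_derive y (e_ i) (fun z => f z * g z) (f y * partial i g y + g y * partial i f y).
Proof.
move=> df dg; split; first exact: derivableM.
exact: deriveM df dg.
Qed.

Definition C1_on O f i := forall y, O y ->
  [/\ {for y, continuous f}, derivable f y (e_ i) & {for y, continuous (partial i f)}].

(** [f] is regular only in [O], but [phi] vanishes off a compact subset of [O]: the product [f phi]
    has a continuous partial derivative on the whole space, with integral zero by
    [integral_partial_eq0]. *)
Lemma integration_by_parts O i f phi : open O -> C1_on O f i -> test_function O phi ->
  \int[mu]_(y in O) (f y * partial i phi y) = - \int[mu]_(y in O) (partial i f y * phi y).
Proof.
move=> oO Cf [sphi [K cK [KO phi0]]].
have clK := compact_closed_rV cK.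
have cphi : continuous phi := smooth_continuous sphi.
have pphi := smooth_partial i sphi.
have cpphi : continuous (partial i phi) := smooth_continuous pphi.
have pphi0 := partial_zero_off i clK phi0.
pose h1 y := f y * partial i phi y; pose h2 y := partial i f y * phi y.
pose h y := f y * phi y.
have h10 y : ~ K y -> h1 y = 0 by move=> nK; rewrite /h1 pphi0 ?mulr0.
have h20 y : ~ K y -> h2 y = 0 by move=> nK; rewrite /h2 phi0 ?mulr0.
have h0 y : ~ K y -> h y = 0 by move=> nK; rewrite /h phi0 ?mulr0.
have ch1 : continuous h1.
  apply: (continuous_zero_off clK h10 KO) => y Oy; have [cf _ _] := Cf y Oy.
  exact: contM cf (cpphi y).
have ch2 : continuous h2.
  apply: (continuous_zero_off clK h20 KO) => y Oy; have [_ _ cf] := Cf y Oy.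
  exact: contM cf (cphi y).
have ch : continuous h.
  apply: (continuous_zero_off clK h0 KO) => y Oy; have [cf _ _] := Cf y Oy.
  exact: contM cf (cphi y).
have dh y : is_derive y (e_ i) h (h1 y + h2 y).
  have [Oy|nOy] := pselect (O y).
    have [_ df _] := Cf y Oy; have := partial_mul df (@smooth_derivable _ _ phi i y sphi).
    by rewrite [phi y * _]mulrC.
  have nKy : ~ K y by move=> /KO.
  by rewrite h10// h20// addr0; exact: partial_near0 clK h0 nKy.
have ph : partial i h = (fun y => h1 y + h2 y).
  by apply/funext => y; have [] := dh y.
have i1 := integrable_compact_support cK ch1 h10.
have i2 := integrable_compact_support cK ch2 h20.
have : \int[mu]_y (h1 y + h2 y) = 0.
  rewrite -ph; apply: (@integral_partial_eq0 i h K) => //.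
  by rewrite ph => y; exact: contD (ch1 y) (ch2 y).
rewrite RintegralD// => /eqP; rewrite addr_eq0 => /eqP.
have off (q : E -> R) : (forall y, ~ K y -> q y = 0) -> forall y, ~ O y -> q y = 0.
  by move=> q0 y nO; apply: q0 => /KO.
by rewrite -(zero_off_Rintegral (off _ h10)) -(zero_off_Rintegral (off _ h20)).
Qed.

Lemma measurable_line s : measurable_fun setT
  (fun p : measurableTypeR R * E => p.2 + (p.1 : R) *: s).
Proof.
apply: measurable_to_rV => j.
apply: (eq_measurable_fun (fun p : measurableTypeR R * E =>
    (p.2 ord0 j + p.1 * s ord0 j)%R : measurableTypeR R)).
  by move=> p _; rewrite !mxE.
apply: measurable_funD.
  apply: (@measurableT_comp _ _ _ _ _ _ (fun y : E => y ord0 j : measurableTypeR R)) => //.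
  exact: measurable_coord_rV.
by apply: measurable_funM => //; exact: measurable_cst.
Qed.

(** With [c = F 1 - F 0], integrate [2 c F' - c^2 <= F'^2] over the unit interval. *)
Lemma sqr_integral_bound (F dF : R -> R) :
  (forall t : R, is_derive t 1 F (dF t)) -> continuous dF ->
  (((F 1 - F 0) ^+ 2)%:E <= \int[lebesgue_measure]_(t in `[0%R, 1%R]) (dF t ^+ 2)%:E)%E.
Proof.
move=> dFP cdF; set c := F 1 - F 0.
have mI : measurable (`[0, 1]%classic : set (measurableTypeR R)) by [].
have m1 : lebesgue_measure (`[0, 1]%classic : set (measurableTypeR R)) = 1%E.
  by rewrite lebesgue_measure_itv/= lte_fin ltr01 -EFinB subr0.
have ftc : (\int[lebesgue_measure]_(t in `[0%R, 1%R]) (dF t)%:E = c%:E)%E.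
  rewrite (@continuous_FTC2 _ dF F 0 1)// -?EFinB//.
  - by apply: continuous_subspaceT => t; exact: cdF.
  - have cF : continuous F.
      by move=> t; apply/differentiable_continuous/derivable1_diffP; have [] := dFP t.
    split; first by move=> t _; have [] := dFP t.
      by apply: cvg_at_right_filter; exact: cF.
    by apply: cvg_at_left_filter; exact: cF.
  - by move=> t _; rewrite derive1E; have [] := dFP t.
have mdF : measurable_fun (`[0, 1]%classic : set (measurableTypeR R)) dF.
  by apply: measurable_funTS; exact: continuous_measurable_fun.
have idF : lebesgue_measure.-integrable `[0, 1]%classic (EFin \o dF).
  by apply: continuous_compact_integrable; [exact: segment_compact|exact: continuous_subspaceT].
have i2 : lebesgue_measure.-integrable `[0, 1]%classic (EFin \o (fun t => 2 * c * dF t)).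
  by have := integrableZl mI (2 * c) idF.
have i3 : lebesgue_measure.-integrable `[0, 1]%classic
    (EFin \o (fun _ : measurableTypeR R => c ^+ 2)).
  apply: measurable_bounded_integrable => //; first by rewrite [X in (X < _)%E]m1 ltry.
  exact: bounded_cst.
have -> : ((c ^+ 2)%:E = \int[lebesgue_measure]_(t in `[0%R, 1%R])
    (2 * c * dF t - c ^+ 2)%:E)%E.
  rewrite integralB_EFin// integral_cst// [X in (_ * X)%E]m1 mule1.
  under eq_integral do rewrite EFinM.
  rewrite integralZl// ftc -EFinM -EFinB; congr EFin; ring.
apply: le_integral => //.
- by have := integrableB mI i2 i3.
- apply: continuous_compact_integrable; first exact: segment_compact.
  by apply: continuous_subspaceT => t; exact: contX (cdF t).
by move=> t _; rewrite lee_fin; have := sqr_ge0 (dF t - c); nra.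
Qed.

Local Notation lam := (@lebesgue_measure R).

Definition gradsq f y : R := \sum_i partial i f y ^+ 2.

Lemma gradsq_ge0 f y : 0 <= gradsq f y.
Proof. by apply: sumr_ge0 => i _; exact: sqr_ge0. Qed.

Lemma continuous_gradsq f : C1 f -> continuous (gradsq f).
Proof. by move=> Cf y; apply: cont_sum => i _; exact: contX ((Cf i).2 y). Qed.

(* Fundamental theorem of calculus along the segments, then Tonelli. *)
Lemma shift_estimate f s A B : continuous f -> C1 f -> measurable A -> measurable B ->
  (forall y t, A y -> 0 <= t <= 1 -> B (y + t *: s)) ->
  (\int[mu]_(y in A) ((f (y + s) - f y) ^+ 2)%:E <=
   (dot s s)%:E * \int[mu]_(y in B) (gradsq f y)%:E)%E.
Proof.
move=> cf Cf mA mB AB; pose N := gradsq f; have cN : continuous N := continuous_gradsq Cf.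
have mN := continuous_measurable_rVT cN.
pose I01 : set (measurableTypeR R) := `[0, 1]%classic.
have mI : measurable I01 by exact: measurable_itv.
(* The squared gradient at [y + t s], cut off to [t] in the unit interval and [y] in [A], so that
   Tonelli's theorem applies on the full product. *)
pose g (p : measurableTypeR R * E) : R :=
  \1_(I01 `*` A) p * N (p.2 + (p.1 : R) *: s).
have g1 t y : I01 t -> A y -> g (t, y) = N (y + t *: s).
  by move=> It Ay; rewrite /g indicE mem_set// mul1r.
have gN p : ~ (I01 p.1 /\ A p.2) -> g p = 0.
  by move=> np; rewrite /g indicE memNset// mul0r.
have mg : measurable_fun setT (EFin \o g).
  apply/measurable_EFinP; apply: measurable_funM.
    by apply: measurable_indic; exact: measurableX.
  by apply: (@measurableT_comp _ _ _ _ _ _ N) => //; exact: measurable_line.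
have g0 p : (0 <= (EFin \o g) p)%E.
  by rewrite /= lee_fin !mulr_ge0// gradsq_ge0.
have dss : 0 <= dot s s by apply: sumr_ge0 => i _; rewrite -expr2 sqr_ge0.
have point y : A y -> (((f (y + s) - f y) ^+ 2)%:E <=
    (dot s s)%:E * \int[lam]_t (EFin \o g) (t, y))%E.
  move=> Ay; pose dF (t : R) := \sum_i s ord0 i * partial i f (y + t *: s).
  have dFP (t : R) : is_derive t 1 (fun u : R => f (y + u *: s)) (dF t).
    by apply/is_derive_line; exact: C1_is_derive.
  have cline : continuous (fun t : R => y + t *: s).
    move=> t; apply: cvgD; first exact: cvg_cst.
    by apply: cvgZ; [exact: cvg_id|exact: cvg_cst].
  have cdF : continuous dF.
    move=> t; apply: cont_sum => i _; apply: contM; first exact: cont_cst.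
    by apply: (@continuous_comp _ _ _ (fun t : R => y + t *: s) (partial i f));
      [exact: cline|exact: (Cf i).2].
  have := sqr_integral_bound dFP cdF; rewrite scale1r scale0r addr0 => h1.
  apply: (le_trans h1).
  rewrite -ge0_integralZl//; last exact: measurableT_comp mg (measurable_pair2 _).
  have mgy : measurable_fun setT (fun t => (dot s s)%:E * (EFin \o g) (t, y))%E.
    by apply: measurable_funeM; exact: measurableT_comp mg (measurable_pair2 _).
  apply: (@le_trans _ _ (\int[lam]_(t in I01) ((dot s s)%:E * (EFin \o g) (t, y)))%E).
    apply: (@ge0_le_integral _ _ _ lam I01 mI).
    - by move=> t _; rewrite lee_fin sqr_ge0.
    - by apply/measurable_EFinP/measurable_funX/measurable_funTS; exact: continuous_measurable_fun.
    - exact: measurable_funTS mgy.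
    move=> t It; rewrite -EFinM lee_fin g1//.
    have -> : dot s s = \sum_i s ord0 i ^+ 2 by apply: eq_bigr => i _; rewrite expr2.
    exact: sum_CS.
  apply: (@ge0_subset_integral _ _ _ lam I01 setT mI measurableT) => //.
  by move=> t _; rewrite mule_ge0// lee_fin.
have mG : measurable_fun setT (fun y => \int[lam]_t (EFin \o g) (t, y))%E.
  exact: (measurable_fun_fubini_tonelli_G (m1 := lam)) mg g0.
apply: (@le_trans _ _ ((dot s s)%:E * \int[mu]_(y in A) \int[lam]_t (EFin \o g) (t, y))%E).
  rewrite -ge0_integralZl//; last 2 first.
  - exact: measurable_funTS mG.
  - by move=> y _; apply: integral_ge0 => t _; exact: g0.
  apply: ge0_le_integral => //.
  - by move=> y _; rewrite lee_fin sqr_ge0.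
  - apply/measurable_EFinP/measurable_funX/measurable_funTS; apply: measurable_funB.
      apply: (@measurableT_comp _ _ _ _ _ _ f); last exact: measurable_shift.
      exact: continuous_measurable_rVT.
    exact: continuous_measurable_rVT.
  - by apply: measurable_funeM; exact: measurable_funTS mG.
apply: lee_pmul => //.
  by apply: integral_ge0 => y _; apply: integral_ge0 => t _; exact: g0.
apply: (@le_trans _ _ (\int[mu]_y \int[lam]_t (EFin \o g) (t, y))%E).
  apply: ge0_subset_integral => //.
  by move=> y _; apply: integral_ge0 => t _; exact: g0.
rewrite -(fubini_tonelli (m1 := lam) (m2 := mu) (EFin \o g) mg g0).
set J := (\int[mu]_(y in B) (gradsq f y)%:E)%E.
apply: (@le_trans _ _ (\int[lam]_(t in I01) J)%E); last first.
  have l1 : lam I01 = 1%E by rewrite lebesgue_measure_itv/= lte_fin ltr01 -EFinB subr0.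
  by rewrite integral_cst// [X in (_ * X)%E]l1 mule1.
rewrite [leRHS]integral_mkcond; apply: ge0_le_integral => //.
- by move=> t _; apply: integral_ge0 => y _; exact: g0.
- exact: (measurable_fun_fubini_tonelli_F (m2 := mu)) mg g0.
- by apply/(measurable_restrict _ _ _) => //; exact: measurable_cst.
move=> t _; rewrite patchE; case: ifPn => It; last first.
  rewrite integral0_eq// => y _; rewrite /= gN// => -[/mem_set]; rewrite (negbTE It).
  by [].
(* For fixed [t], translation by [t s] maps [A] into [B] and preserves the measure. *)
rewrite /J [leRHS]integral_mkcond -(@ge0_integral_shift R m (t *: s) ((fun y => (gradsq f y)%:E) \_ B)).
- apply: ge0_le_integral => //.
  + exact: measurableT_comp mg (measurable_pair1 _).
  + apply: (@measurableT_comp _ _ _ _ _ _ ((fun y => (gradsq f y)%:E) \_ B));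
      last exact: measurable_shift.
    by apply/(measurable_restrict _ _ _) => //; apply/measurable_funTS/measurable_EFinP.
  move=> y _; have [Ay|nAy] := pselect (A y); last first.
    rewrite /= gN; last by case.
    by rewrite patchE; case: ifP => // _; rewrite lee_fin gradsq_ge0.
  rewrite /= g1//; last exact: set_mem.
  rewrite patchE ifT//; apply/mem_set/AB => //.
  by move: It; rewrite inE /I01/= in_itv.
- by apply/(measurable_restrict _ _ _) => //; apply/measurable_funTS/measurable_EFinP.
by move=> y; rewrite patchE; case: ifP => // _; rewrite lee_fin gradsq_ge0.
Qed.

End integration_by_parts.

(** * The fundamental lemma of the calculus of variations *)

Section du_bois_reymond.
Context {R : realType} {m : nat}.
Local Notation E := 'rV[R]_m.
Local Notation mu := (@lebesgue_rV R m).
Implicit Types (f g phi : E -> R) (K U A : set E).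

(** Closed sets are stable under intersection, as Dynkin's theorem requires; the coordinate
    preimages that generate the sigma-algebra need not be. *)
Lemma measurable_sub_sigma_closed A : measurable A -> <<s [set C : set E | closed C] >> A.
Proof.
pose T := g_sigma_algebraType [set C : set E | closed C].
move: A; apply: smallest_sub => /=; first exact: smallest_sigma_algebra.
rewrite -bigcup_seq => B [i _ [C mC <-]]; rewrite setTI.
have mc : measurable_fun [set: T] ((fun y : E => y ord0 i) : T -> measurableTypeR R).
  apply: (measurability _ (RGenCInfty.measurableE R)) => _ [_ [a ->] <-].
  rewrite setTI; apply: sub_sigma_algebra => /=.
  apply: (@preimage_closed _ _ (fun y : E => y ord0 i)) => [y _|].
    exact: continuous_coord.
  exact: interval_closed.
by have := mc measurableT C mC; rewrite setTI.
Qed.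

(** The measurable sets over whose intersection with [K] the integral vanishes form a lambda-system
    containing the closed sets. *)
Lemma integral_eq0_measurable K g : compact K -> mu.-integrable K (EFin \o g) ->
  (forall C, closed C -> \int[mu]_(y in C `&` K) g y = 0) ->
  forall A, measurable A -> \int[mu]_(y in A `&` K) g y = 0.
Proof.
move=> cK iK g0; have mK := compact_measurable_rV cK.
pose H := [set A : set E | measurable A /\ \int[mu]_(y in A `&` K) g y = 0].
have intI A : measurable A -> mu.-integrable (A `&` K) (EFin \o g).
  by move=> mA; apply: integrableS iK => //; exact: measurableI.
have dynH : dynkin H.
  split.
  - by split=> //; exact: g0 closedT.
  - move=> A [mA A0]; split; first exact: measurableC.
    have := g0 setT closedT; rewrite setTI -{1}[K](setTI K) -(setUv A) setIUl.
    rewrite Rintegral_setU ?A0 ?add0r//.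
    + exact: measurableI.
    + by apply: measurableI => //; exact: measurableC.
    + by rewrite -setIUl; apply: intI; apply: measurableU => //; exact: measurableC.
    by apply/disj_setPS => y [[Ay _] [nAy _]].
  - move=> F tF HF; have mF n : measurable (F n) by have [] := HF n.
    split; first exact: bigcup_measurable.
    rewrite setI_bigcupl /Rintegral integral_bigcup.
    + rewrite (eq_eseriesr (g := fun=> 0%E)); first by rewrite eseries0.
      move=> n _; have [_ Fn0] := HF n; rewrite -[LHS]fineK.
        by rewrite -[X in X%:E]/(Rintegral _ _ _) Fn0.
      by apply: integrable_fin_num => //; [exact: measurableI|exact: intI].
    + have /trivIsetP tF' := tF.
      by apply/trivIsetP => i j _ _ ij; rewrite setIACA tF'// set0I.
    + by move=> n; exact: measurableI.
    by rewrite -setI_bigcupl; apply: intI; exact: bigcup_measurable.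
have lamH := (dynkin_lambda_system H).1 dynH.
move=> A /measurable_sub_sigma_closed.
have clI : setI_closed [set C : set E | closed C] by move=> B C; exact: closedI.
have sub : [set C : set E | closed C] `<=` H.
  by move=> C cC; split; [exact: closed_measurable_rV|exact: g0].
by move=> /(lambda_system_subset clI lamH sub (fun X _ => @subsetT _ X))[].
Qed.

Definition L1c U g := forall K, compact K -> K `<=` U -> mu.-integrable K (EFin \o g).

Lemma measurable_L1c U g : open U -> L1c U g -> measurable_fun U g.
Proof.
move=> oU ig; rewrite -(bigcup_exhaustion oU); apply/measurable_fun_bigcup => [n|n].
  exact: compact_measurable_rV (@exhaustion_compact _ _ _ _).
apply/measurable_EFinP; apply: (measurable_int mu).
by apply: ig; [exact: exhaustion_compact|exact: exhaustion_subset].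
Qed.

(** Cutoffs equal to 1 on [K] and supported in shrinking neighbourhoods of [K] converge to its
    indicator. All supports lie in one compact set [L], which makes the convergence dominated. *)
Lemma test_function_eq0_compact U g K : open U -> L1c U g ->
  (forall phi, test_function U phi -> \int[mu]_(y in U) (g y * phi y) = 0) ->
  compact K -> K `<=` U -> \int[mu]_(y in K) g y = 0.
Proof.
move=> oU ig g0 cK KU.
have [chi _ [_ [r r0 chi1] [L cL [LU chi0]]]] := smooth_cutoff cK oU KU.
have mL := compact_measurable_rV cL; have mK := compact_measurable_rV cK.
(* The radii are at most [r], so every [O n] lies where [chi = 1], hence in [L]. *)
pose O n : set E := \bigcup_(y in K) ball y (r / n.+1%:R).
have rn n : 0 < r / n.+1%:R by rewrite divr_gt0.
have oO n : open (O n) by apply: bigcup_open => y _; exact: ball_open.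
have KO n : K `<=` O n by move=> y Ky; exists y => //; exact: ballxx.
have OL n : O n `<=` L.
  move=> z [y Ky]; rewrite ball_rVE => yz; apply: contrapT => /chi0.
  rewrite (chi1 y z Ky) => [/eqP|]; first by rewrite oner_eq0.
  by rewrite (lt_le_trans yz)// ler_pdivrMr// ler_peMr ?ler1n// ltW.
have : forall n, exists q : E -> R, [/\ smooth q, forall y, 0 <= q y <= 1,
    forall y, K y -> q y = 1 & exists2 L' : set E, compact L' &
      L' `<=` O n /\ forall y, ~ L' y -> q y = 0].
  move=> n; have [q sq [q01 [s s0 q1] qL]] := smooth_cutoff cK (oO n) (KO n).
  by exists q; split=> // y Ky; apply: (q1 y y Ky); rewrite subrr normr0.
move=> /choice[q qP].
have LUsub : L `<=` U := LU.
have qL n y : ~ L y -> q n y = 0.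
  by have [_ _ _ [L' _ [L'O q0]]] := qP n; move=> nL; apply: q0 => /L'O /OL.
have q01 n y : 0 <= q n y <= 1 by have [] := qP n.
have tq n : test_function U (q n).
  have [sq _ _ [L' cL' [L'O q0]]] := qP n; split=> //.
  by exists L' => //; split=> // y /L'O /OL /LU.
have iL := ig L cL LU; have mgL : measurable_fun L g.
  by apply/measurable_EFinP; exact: measurable_int iL.
have qn0 n : \int[mu]_(y in L) (g y * q n y) = 0.
  rewrite -(g0 _ (tq n)) [LHS]Rintegral_mkcond [RHS]Rintegral_mkcond; congr Rintegral; apply/funext => y.
  rewrite !patchE; have [Ly|nLy] := pselect (L y).
    by rewrite !mem_set//; exact: LU.
  by rewrite (memNset nLy) qL// mulr0; case: ifP.
have mq n : measurable_fun L (q n).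
  have [sq _ _ _] := qP n; apply: measurable_funTS.
  exact: continuous_measurable_rVT (smooth_continuous sq).
have lim y : (fun n => q n y) @ \oo --> (\1_K y : R).
  have [Ky|nKy] := pselect (K y).
    rewrite indicE mem_set//; rewrite (_ : (fun n => q n y) = fun=> 1); first exact: cvg_cst.
    by apply/funext => n; have [_ _ q1 _] := qP n; exact: q1.
  rewrite indicE memNset//.
  have [d d0 dK] := open_ball_subset (closed_openC (compact_closed_rV cK)) nKy.
  apply: (@cvg_trans _ ((fun=> 0 : R) @ \oo)); last exact: cvg_cst.
  apply: near_eq_cvg; exists (Num.trunc (r / d)) => // n /= nN; symmetry.
  have [_ _ _ [L' _ [L'O q0]]] := qP n; apply: q0 => /L'O[z Kz]; rewrite ball_rVE => zy.
  apply: (dK z) => //; rewrite ball_rVE distrC (lt_le_trans zy)//.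
  rewrite ler_pdivrMr// mulrC -ler_pdivrMr// (le_trans (ltW (truncnS_gt _)))// ler_nat.
  by rewrite ltnS.
have [||||_ _] := @dominated_convergence _ _ _ mu L mL
  (fun n => EFin \o (fun y => g y * q n y)) (EFin \o (fun y => g y * \1_K y))
  (EFin \o (fun y => `|g y|)) _ _ _ (integrable_norm iL) _.
- by move=> n; apply/measurable_EFinP; exact: measurable_funM.
- by apply/measurable_EFinP; apply: measurable_funM => //; exact: measurable_indic.
- apply: aeW => y _; apply: cvg_EFin; first exact: nearW.
  by apply: cvgM; [exact: cvg_cst|exact: lim].
- apply: aeW => y n _ /=; rewrite lee_fin normrM ler_piMr//.
  by have /andP[h1 h2] := q01 n y; rewrite ger0_norm.
rewrite (_ : (fun n => _) = (fun=> 0%E)); last first.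
  apply/funext => n /=; have := qn0 n; rewrite /Rintegral => h.
  rewrite -[LHS]fineK; first by rewrite h.
  apply: integrable_fin_num => //; apply: (le_integrable mL _ _ iL).
    by apply/measurable_EFinP; exact: measurable_funM.
  move=> y _ /=; rewrite lee_fin normrM ler_piMr//.
  by have /andP[h1 h2] := q01 n y; rewrite ger0_norm.
move=> /cvg_lim h1.
have : \int[mu]_(y in L) (g y * \1_K y) = 0.
  by rewrite /Rintegral -h1// lim_cst.
move=> <-; rewrite [LHS]Rintegral_mkcond [RHS]Rintegral_mkcond; congr Rintegral; apply/funext => y.
rewrite !patchE indicE; have [Ky|nKy] := pselect (K y).
  by rewrite !mem_set ?mulr1//; apply/(OL 0%N)/KO.
by rewrite (memNset nKy) mulr0; case: ifP.
Qed.

(** On each compact set of an exhaustion of [U] the integrals over all measurable subsets vanish, so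
    [g] does almost everywhere; there are countably many such sets. *)
Lemma test_function_ae_eq0 U g : open U -> L1c U g ->
  (forall phi, test_function U phi -> \int[mu]_(y in U) (g y * phi y) = 0) ->
  ae_eq mu U g (fun=> 0).
Proof.
move=> oU ig g0.
have key n : ae_eq mu (exhaustion U n) (EFin \o g) (EFin \o (fun=> 0)).
  have cK := @exhaustion_compact _ _ U n; have KU := @exhaustion_subset _ _ U n.
  have mK := compact_measurable_rV cK.
  apply: (integral_ae_eq mK (ig _ cK KU)).
    by apply/measurable_EFinP; exact: measurable_cst.
  move=> A AK mA; have iA : mu.-integrable A (EFin \o g) by exact: integrableS (ig _ cK KU).
  rewrite [RHS]integral0_eq//.
  rewrite -[LHS]fineK; last exact: integrable_fin_num.
  rewrite -[X in X%:E]/(Rintegral _ _ _) -(setIidl AK).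
  rewrite (@integral_eq0_measurable _ g cK (ig _ cK KU))// => C cC.
  apply: (test_function_eq0_compact oU ig g0); last by move=> y [_ /KU].
  apply: (subclosed_compact _ cK) => [|y []//].
  by apply: closedI => //; exact: compact_closed_rV.
have := ae_foralln key; apply: filterS => y h Uy.
have [n _ yn] : (\bigcup_n exhaustion U n) y by rewrite bigcup_exhaustion.
by have /= [] := h n yn.
Qed.

End du_bois_reymond.

(** * Weak derivatives *)

Section jets.
Context {R : realType} {m : nat}.
Local Notation E := 'rV[R]_m.
Local Notation mu := (@lebesgue_rV R m).
Local Notation J := ('I_m.+1 -> E -> R).
Implicit Types (f g phi psi : E -> R) (K U A Omega : set E) (W Z : J).

(** A function is carried along with its first derivatives: index 0 is the value, the lifted index
    of [i] the [i]-th partial derivative. H^1 thus becomes a subspace of [m + 1] copies of L^2. *)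
Definition jet phi : J := fun j => if unlift ord0 j is Some i then partial i phi else phi.

Lemma jet_ord0 phi : jet phi ord0 = phi.
Proof. by rewrite /jet unlift_none. Qed.

Lemma jet_lift phi i : jet phi (lift ord0 i) = partial i phi.
Proof. by rewrite /jet liftK. Qed.

Definition L2jet U : set J := [set W | forall j, L2r mu U (W j)].

(** The inner product of H^1 for [c = 1], the Helmholtz form for [c = - k^2], the Dirichlet form for
    [c = 0]. *)
Definition jform (c : R) U W Z : R :=
  c * ip mu U (W ord0) (Z ord0) + \sum_(i < m) ip mu U (W (lift ord0 i)) (Z (lift ord0 i)).

Local Notation b0 := (jform 1).

Lemma linear_L2jet U : measurable U -> linear_set (L2jet U).
Proof.
move=> mU; split=> [j|a W Z lW lZ j]; first exact: L2r0.
exact: L2r_lin (lW j) (lZ j).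
Qed.

Lemma bilinear_jform c U : measurable U -> bilinear_form (L2jet U) (jform c U).
Proof.
move=> mU; split=> [W Z lW lZ|Z lZ a W W' lW lW'].
  by rewrite /jform ipC; congr (_ + _); apply: eq_bigr => i _; rewrite ipC.
rewrite /jform [ip _ _ ((a *: W + W') _) _]ip_linl//.
have -> : \sum_(i < m) ip mu U ((a *: W + W') (lift ord0 i)) (Z (lift ord0 i)) =
    a * (\sum_(i < m) ip mu U (W (lift ord0 i)) (Z (lift ord0 i))) +
    \sum_(i < m) ip mu U (W' (lift ord0 i)) (Z (lift ord0 i)).
  by rewrite mulr_sumr -big_split/=; apply: eq_bigr => i _; exact: ip_linl.
by ring.
Qed.

Lemma jform_ge0 U W : 0 <= b0 U W W.
Proof. by rewrite /jform mul1r addr_ge0 ?ip_ge0// sumr_ge0// => i _; exact: ip_ge0. Qed.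

Lemma ip_le_jform U W j : ip mu U (W j) (W j) <= b0 U W W.
Proof.
rewrite /jform mul1r; case: (unliftP ord0 j) => [i|] ->.
  rewrite (bigD1 i)//= addrCA lerDl addr_ge0 ?ip_ge0// sumr_ge0// => l _.
  exact: ip_ge0.
by rewrite lerDl sumr_ge0// => i _; exact: ip_ge0.
Qed.

Lemma complete_L2jet U : measurable U -> complete_for (L2jet U) (b0 U).
Proof.
move=> mU u lu cu.
have : forall j, exists g, L2r mu U g /\ forall e : R, 0 < e -> exists N, forall n, (N <= n)%N ->
    ip mu U (fun y => u n j y - g y) (fun y => u n j y - g y) <= e.
  move=> j; have [|e e0|g lg gP] := @L2r_complete _ _ _ mu U mU (fun n => u n j).
  - by move=> n; exact: lu.
  - have [N NP] := cu e e0; exists N => p q Np Nq.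
    by apply: le_lt_trans (ip_le_jform U (u p - u q) j) (NP p q Np Nq).
  by exists g.
move=> /choice[w wP]; exists w; first by move=> j; have [] := wP j.
(* There are [m + 1] components and each limit comes with a weak inequality; dividing by [m + 2]
   makes the sum strictly smaller than [e]. *)
move=> e e0; pose e' := e / m.+2%:R.
have e'0 : 0 < e' by rewrite divr_gt0.
have : forall j, exists N, forall n, (N <= n)%N ->
    ip mu U (fun y => u n j y - w j y) (fun y => u n j y - w j y) <= e'.
  by move=> j; have [_] := wP j; apply.
move=> /choice[N NP]; exists (\max_j N j)%N => n nN.
have h j : ip mu U ((u n - w) j) ((u n - w) j) <= e'.
  by apply: NP; apply: leq_trans nN; exact: leq_bigmax.
rewrite /jform mul1r; apply: (@le_lt_trans _ _ (e' + \sum_(i < m) e')).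
  by rewrite lerD ?ler_sum.
rewrite sumr_const card_ord -mulrS /e' -[X in X < _]mulr_natr mulrAC -mulrA gtr_pMr//.
by rewrite ltr_pdivrMr// mul1r ltr_nat.
Qed.

(* The real-valued elements of H10 Omega U, with their weak partial derivatives. *)
Definition Vjet Omega U : set J := [set W | L2jet U W /\ forall e : R, 0 < e ->
  exists2 phi, test_function Omega phi & b0 U (W - jet phi) (W - jet phi) < e].

Lemma test_function0 Omega : test_function Omega (fun=> 0).
Proof.
split=> [n|]; first exact: Cn_cst.
by exists set0; [exact: compact0|split=> // y []].
Qed.

Lemma test_function_lin Omega (a : R) phi psi : test_function Omega phi ->
  test_function Omega psi -> test_function Omega (fun y => a * phi y + psi y).
Proof.
move=> [s1 [K1 c1 [K1O h1]]] [s2 [K2 c2 [K2O h2]]]; split.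
  by apply: smoothD => //; exact: smoothZ.
exists (K1 `|` K2); first exact: compactU.
split=> [y [/K1O//|/K2O//]|y /not_orP[n1 n2]].
by rewrite h1// h2// mulr0 addr0.
Qed.

Lemma jet_lin (a : R) phi psi : smooth phi -> smooth psi ->
  jet (fun y => a * phi y + psi y) = a *: jet phi + jet psi.
Proof.
move=> s1 s2; apply/funext => j; rewrite /jet !fctE.
case: unliftP => [i|] _ //=; apply/funext => y.
rewrite /partial; apply: (@derive_val _ _ _ _ _ _ _ _).
have d1 := derivableP (smooth_derivable (i := i) (y := y) s1).
have d2 := derivableP (smooth_derivable (i := i) (y := y) s2).
have := is_deriveD (is_deriveZ a d1) d2.
by [].
Qed.

Lemma L2r_compact_support U f : measurable U -> continuous f ->
  (exists2 K, compact K & forall y, ~ K y -> f y = 0) -> L2r mu U f.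
Proof.
move=> mU cf [K cK f0]; split.
  by apply: measurable_funTS; exact: continuous_measurable_rVT.
apply: (@integrableS _ _ _ _ setT) => //.
apply: (integrable_compact_support cK) => [y|y nK]; first exact: contX (cf y).
by rewrite f0// expr0n.
Qed.

Lemma L2jet_jet Omega U phi : measurable U -> test_function Omega phi -> L2jet U (jet phi).
Proof.
move=> mU [sp [K cK [_ p0]]] j; rewrite /jet; case: unliftP => [i|] _.
  apply: L2r_compact_support => //; first exact: smooth_continuous (smooth_partial i sp).
  by exists K => //; apply: partial_zero_off => //; exact: compact_closed_rV.
by apply: L2r_compact_support => //; [exact: smooth_continuous sp|exists K].
Qed.

Lemma Vjet_jet Omega U phi : measurable U -> test_function Omega phi -> Vjet Omega U (jet phi).
Proof.
move=> mU tp; split=> [|e e0]; first exact: L2jet_jet tp.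
exists phi => //; rewrite subrr.
have linL := linear_L2jet mU; have [_ h] := bilinear_jform 1 mU.
by rewrite (linear_on0 linL (h 0 (lset0 linL))).
Qed.

Lemma linear_Vjet Omega U : measurable U -> linear_set (Vjet Omega U).
Proof.
move=> mU; have linL := linear_L2jet mU; have bil := bilinear_jform 1 mU.
have pos W : L2jet U W -> 0 <= b0 U W W by move=> _; exact: jform_ge0.
split.
  have := Vjet_jet mU (test_function0 Omega).
  suff -> : jet (fun=> 0) = 0 :> J by [].
  by apply/funext => j; rewrite /jet; case: unliftP => // i _; rewrite partial_cst.
move=> a W Z [lW hW] [lZ hZ]; split; first by have [_ h] := linL; exact: h.
move=> e e0; pose c := 4 * (a ^+ 2 + 1).
have c0 : 0 < c by rewrite mulr_gt0// ltr_wpDl// sqr_ge0.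
have ec : 0 < e / c by rewrite divr_gt0.
have [p tp hp] := hW _ ec; have [q tq hq] := hZ _ ec.
exists (fun y => a * p y + q y); first exact: test_function_lin.
rewrite jet_lin; [|by case: tp|by case: tq].
have lp := L2jet_jet mU tp; have lq := L2jet_jet mU tq.
rewrite (_ : _ - _ = a *: (W - jet p) + (Z - jet q)); last first.
  by rewrite scalerBr opprD addrACA.
have lWp := lsetB linL lW lp; have lZq := lsetB linL lZ lq.
apply: le_lt_trans (form_sqrD_le2 linL bil pos (lsetZ linL a lWp) lZq) _.
rewrite (formZl linL bil a lWp (lsetZ linL a lWp)) (formZr linL bil a lWp lWp).
have ec' : e = c * (e / c) by rewrite mulrC divfK// gt_eqF.
have h1 : a * (a * b0 U (W - jet p) (W - jet p)) <= a ^+ 2 * (e / c).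
  by rewrite mulrA -expr2 ler_wpM2l ?sqr_ge0// ltW.
have a2 : 0 <= a ^+ 2 * (e / c) by rewrite mulr_ge0 ?sqr_ge0// ltW.
rewrite [ltRHS]ec' (_ : c * _ = 4 * (a ^+ 2 * (e / c)) + 4 * (e / c)); last first.
  by rewrite {1}/c; ring.
by move: (e / c) (a ^+ 2 * (e / c)) a2 h1 hq ec => x y *; lra.
Qed.

Lemma Vjet_L2jet Omega U W : Vjet Omega U W -> L2jet U W.
Proof. by case. Qed.

Lemma bilinear_Vjet c Omega U : measurable U -> bilinear_form (Vjet Omega U) (jform c U).
Proof.
move=> mU; have [h1 h2] := bilinear_jform c mU.
split=> [W Z /Vjet_L2jet lW /Vjet_L2jet lZ|Z /Vjet_L2jet lZ a W W' /Vjet_L2jet lW /Vjet_L2jet lW'].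
  exact: h1.
exact: h2.
Qed.

Lemma complete_Vjet Omega U : measurable U -> complete_for (Vjet Omega U) (b0 U).
Proof.
move=> mU u Vu cu; have linL := linear_L2jet mU; have bil := bilinear_jform 1 mU.
have pos W : L2jet U W -> 0 <= b0 U W W by move=> _; exact: jform_ge0.
have lu n : L2jet U (u n) := (Vu n).1.
have [w lw uw] := complete_L2jet mU lu cu.
exists w => //; split=> // e e0; have e4 : 0 < e / 4 by rewrite divr_gt0.
have [N NP] := uw _ e4; have [p tp hp] := (Vu N).2 _ e4; exists p => //.
have lp := L2jet_jet mU tp; have lunp := lsetB linL (lu N) lp.
have lunw := lsetB linL (lu N) lw.
rewrite (_ : w - jet p = (u N - jet p) - (u N - w)); last by rewrite opprB [RHS]addrC addrA subrK.
apply: le_lt_trans (form_sqrB_le2 linL bil pos lunp lunw) _.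
by have := NP N (leqnn _); lra.
Qed.

(** This is how identities checked on test functions of [Omega] pass to their closure in H^1(U). *)
Lemma Vjet_ind_continuous Omega U (l : J -> R) (C : R) : measurable U ->
  linear_on (Vjet Omega U) l ->
  (forall W, Vjet Omega U W -> (l W) ^+ 2 <= C * b0 U W W) ->
  (forall phi, test_function Omega phi -> l (jet phi) = 0) ->
  forall W, Vjet Omega U W -> l W = 0.
Proof.
move=> mU ll lC l0 W VW; have linV := linear_Vjet Omega mU.
apply/eqP; rewrite -sqrf_eq0 eq_le sqr_ge0 andbT leNgt; apply/negP => lpos.
have e0 : 0 < (l W) ^+ 2 / (`|C| + 1) by rewrite divr_gt0// ltr_wpDl.
have [phi tphi hphi] := VW.2 _ e0; have Vphi := Vjet_jet mU tphi.
have := lC _ (lsetB linV VW Vphi).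
rewrite (linear_onB ll)// l0// subr0 leNgt => /negP; apply.
have b := jform_ge0 U (W - jet phi).
move: hphi; rewrite ltr_pdivlMr ?ltr_wpDl// => h.
by have := ler_norm C; nra.
Qed.

Definition weak_gradient U W := forall i psi, test_function U psi ->
  \int[mu]_(y in U) (W ord0 y * partial i psi y) = - \int[mu]_(y in U) (W (lift ord0 i) y * psi y).

Lemma test_functionS U Omega : U `<=` Omega -> test_function U `<=` test_function Omega.
Proof. by move=> UO phi [s [K cK [KU h]]]; split=> //; exists K => //; split=> // y /KU/UO. Qed.

Lemma smooth_C1_on O i f : smooth f -> C1_on O f i.
Proof.
move=> sf y _; split; [exact: smooth_continuous|exact: smooth_derivable|].
exact: smooth_continuous (smooth_partial i sf) y.
Qed.

(** Both sides are continuous in the norm of H^1(U) and agree on test functions of [Omega]. The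
    latter need not vanish near the boundary of [U] inside [Omega], but [psi] does. *)
Lemma Vjet_weak_gradient Omega U W : open U -> Vjet Omega U W -> weak_gradient U W.
Proof.
move=> oU VW i psi tpsi; have mU := open_measurable_rV oU.
have [spsi [K cK [KU psi0]]] := tpsi.
have ltpsi := L2jet_jet mU tpsi.
pose l (Z : J) := ip mu U (Z ord0) (partial i psi) + ip mu U (Z (lift ord0 i)) psi.
have lpsi : L2r mu U psi by have := ltpsi ord0; rewrite jet_ord0.
have lppsi : L2r mu U (partial i psi) by have := ltpsi (lift ord0 i); rewrite jet_lift.
suff : l W = 0 by move=> /eqP; rewrite addr_eq0 => /eqP.
pose C := 2 * ip mu U (partial i psi) (partial i psi) + 2 * ip mu U psi psi.
apply: (@Vjet_ind_continuous Omega U l C mU) => //.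
- move=> a Z Z' [lZ _] [lZ' _]; rewrite /l [ip _ _ ((_ *: _ + _) ord0) _]ip_linl//.
  by rewrite [ip _ _ ((_ *: _ + _) (lift _ _)) _]ip_linl//; ring.
- move=> Z [lZ _].
  have h1 := ip_discr mU (lZ ord0) lppsi; have h2 := ip_discr mU (lZ (lift ord0 i)) lpsi.
  have h3 := ip_le_jform U Z ord0; have h4 := ip_le_jform U Z (lift ord0 i).
  have p1 := ip_ge0 mu U psi; have p2 := ip_ge0 mu U (partial i psi).
  rewrite /l /C; apply: (@le_trans _ _ (2 * ip mu U (Z ord0) (partial i psi) ^+ 2 +
     2 * ip mu U (Z (lift ord0 i)) psi ^+ 2)).
    by have := sqr_ge0 (ip mu U (Z ord0) (partial i psi) - ip mu U (Z (lift ord0 i)) psi); nra.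
  by nra.
- move=> phi [sphi _]; rewrite /l jet_ord0 jet_lift.
  by rewrite /ip (integration_by_parts oU (smooth_C1_on i sphi) tpsi) addNr.
Qed.

End jets.

(** * Complex functions in H^1 as pairs of real jets *)

Section real_and_imaginary_parts.
Context {R : realType} {m : nat}.
Local Notation E := 'rV[R]_m.
Local Notation C := R[i].
Local Notation mu := (@lebesgue_rV R m).
Local Notation J := ('I_m.+1 -> E -> R).
Local Notation Re := (@complex.Re R).
Local Notation Im := (@complex.Im R).
Implicit Types (f g phi psi : E -> R) (K U A Omega : set E) (W Z : J) (u v w : E -> C).

Lemma ReM (x y : C) : Re (x * y) = Re x * Re y - Im x * Im y.
Proof. by case: x y => a b [c d]. Qed.

Lemma ImM (x y : C) : Im (x * y) = Re x * Im y + Im x * Re y.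
Proof. by case: x y => a b [c d]. Qed.

Lemma ReD (x y : C) : Re (x + y) = Re x + Re y.
Proof. by case: x y => a b [c d]. Qed.

Lemma ImD (x y : C) : Im (x + y) = Im x + Im y.
Proof. by case: x y => a b [c d]. Qed.

Lemma ReN (x : C) : Re (- x) = - Re x. Proof. by case: x. Qed.

Lemma ImN (x : C) : Im (- x) = - Im x. Proof. by case: x. Qed.

Lemma Re_sum (I : Type) (s : seq I) (F : I -> C) : Re (\sum_(i <- s) F i) = \sum_(i <- s) Re (F i).
Proof. by elim: s => [|i s IH]; rewrite ?big_nil// !big_cons ReD IH. Qed.

Lemma Im_sum (I : Type) (s : seq I) (F : I -> C) : Im (\sum_(i <- s) F i) = \sum_(i <- s) Im (F i).
Proof. by elim: s => [|i s IH]; rewrite ?big_nil// !big_cons ImD IH. Qed.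

Lemma Cintegral_real_weight U u f :
  Cintegral U (fun y => u y * (f y)%:C) =
  (\int[mu]_(y in U) (Re (u y) * f y)) +i* (\int[mu]_(y in U) (Im (u y) * f y)).
Proof.
by rewrite /Cintegral; congr Complex; apply: eq_Rintegral => y _;
  rewrite ?ReM ?ImM /= mulr0 ?subr0 ?add0r.
Qed.

Lemma is_weak_partialP U i u (g : E -> C) : is_weak_partial U i u g <->
  L1loc U g /\ forall phi, test_function U phi ->
    (\int[mu]_(y in U) (Re (u y) * partial i phi y)) = - (\int[mu]_(y in U) (Re (g y) * phi y)) /\
    (\int[mu]_(y in U) (Im (u y) * partial i phi y)) = - (\int[mu]_(y in U) (Im (g y) * phi y)).
Proof.
split=> -[lg h]; split=> // phi tphi; have := h phi tphi.
  by rewrite !Cintegral_real_weight => /eqP; rewrite eq_complex /= => /andP[/eqP-> /eqP->].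
by rewrite !Cintegral_real_weight => -[-> ->].
Qed.

Lemma L1locP U (g : E -> C) : L1loc U g <-> L1c U (Re \o g) /\ L1c U (Im \o g).
Proof.
split=> [h|[h1 h2] K cK KU]; last by split; [exact: h1|exact: h2].
by split=> K cK KU; have [] := h K cK KU.
Qed.

Lemma L1c_test_integrable U g phi : open U -> L1c U g -> test_function U phi ->
  mu.-integrable U (EFin \o (fun y => g y * phi y)).
Proof.
move=> oU ig [sphi [K cK [KU phi0]]].
have mK := compact_measurable_rV cK; have mU := open_measurable_rV oU.
have cphi := smooth_continuous sphi.
have [M M0 pM] := continuous_bounded_on cK cphi.
have g0 y : ~ K y -> g y * phi y = 0 by move=> nK; rewrite phi0 ?mulr0.
apply: (@integrableS _ _ _ _ setT) => //.
apply/(zero_off_integrable mK g0).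
have mphi : measurable_fun K phi by exact: measurable_funTS (continuous_measurable_rVT cphi).
have iM := integrableZl mK M (integrable_norm (ig K cK KU)).
apply: le_integrable iM => //.
  apply/measurable_EFinP; apply: measurable_funM => //.
  by apply/measurable_EFinP; exact: measurable_int (ig K cK KU).
move=> y Ky; rewrite /= lee_fin normrM [leRHS]ger0_norm ?mulr_ge0 ?(ltW M0)// mulrC.
by rewrite ler_wpM2r// pM.
Qed.

Lemma L2r_L1c U g : L2r mu U g -> measurable U -> L1c U g.
Proof.
move=> lg mU K cK KU; have mK := compact_measurable_rV cK.
have lgK := L2rS mU mK KU lg.
have l1 : L2r mu K (fun=> 1).
  apply: (@L2r_bounded _ _ _ _ K mK _ 1) => //; first exact: lebesgue_rV_compact.
  by move=> y _; rewrite normr1.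
have := L2r_integrableM mK lgK l1.
by rewrite (_ : (fun y => g y * 1) = g)//; apply/funext => y; rewrite mulr1.
Qed.

Lemma test_function_ae_eq U f g : open U -> L1c U f -> L1c U g ->
  (forall phi, test_function U phi ->
    \int[mu]_(y in U) (f y * phi y) = \int[mu]_(y in U) (g y * phi y)) ->
  ae_eq mu U f g.
Proof.
move=> oU lf lg fg; have mU := open_measurable_rV oU.
have lfg : L1c U (fun y => f y - g y).
  move=> K cK KU; have mK := compact_measurable_rV cK.
  by have := integrableB mK (lf K cK KU) (lg K cK KU).
have := @test_function_ae_eq0 _ _ U (fun y => f y - g y) oU lfg.
move=> h; apply: filterS (h _) => [y h1 Uy|phi tphi].
  by apply/eqP; rewrite -subr_eq0; apply/eqP; exact: h1.
under eq_Rintegral do rewrite mulrBl.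
rewrite RintegralB//; [|exact: L1c_test_integrable|exact: L1c_test_integrable].
by rewrite fg// subrr.
Qed.

Definition cplx f g : E -> C := fun y => f y +i* g y.

(** The derivatives are a choice made on [U]. Identities between such jets therefore hold only
    almost everywhere, and passing to a smaller open set may change the representatives. *)
Definition Rej U u : J := fun j =>
  if unlift ord0 j is Some i then Re \o weak_partial U i u else Re \o u.

Definition Imj U u : J := fun j =>
  if unlift ord0 j is Some i then Im \o weak_partial U i u else Im \o u.

Lemma Rej0 U u : Rej U u ord0 = Re \o u. Proof. by rewrite /Rej unlift_none. Qed.
Lemma Imj0 U u : Imj U u ord0 = Im \o u. Proof. by rewrite /Imj unlift_none. Qed.
Lemma RejS U u i : Rej U u (lift ord0 i) = Re \o weak_partial U i u.
Proof. by rewrite /Rej liftK. Qed.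
Lemma ImjS U u i : Imj U u (lift ord0 i) = Im \o weak_partial U i u.
Proof. by rewrite /Imj liftK. Qed.

Definition ae_jet U W Z := forall j, ae_eq mu U (W j) (Z j).

Lemma ae_eq_jform c U W Z W' Z' : L2jet U W -> L2jet U Z -> L2jet U W' -> L2jet U Z' ->
  measurable U ->
  ae_jet U W W' -> ae_jet U Z Z' -> jform c U W Z = jform c U W' Z'.
Proof.
move=> lW lZ lW' lZ' mU h1 h2; rewrite /jform.
have e j : ip mu U (W j) (Z j) = ip mu U (W' j) (Z' j).
  by apply: ae_eq_ip => //; [exact: (lW j).1|exact: (lZ j).1|exact: (lW' j).1|exact: (lZ' j).1].
by rewrite e; congr (_ + _); apply: eq_bigr => i _.
Qed.

Lemma weak_partialP U i u (g : E -> C) : is_weak_partial U i u g -> is_weak_partial U i u (weak_partial U i u).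
Proof. by move=> h; apply: xgetPex; exists g. Qed.

Lemma weak_partial_ae_eq U i u (g : E -> C) : open U -> is_weak_partial U i u g ->
  ae_eq mu U (Re \o weak_partial U i u) (Re \o g) /\
  ae_eq mu U (Im \o weak_partial U i u) (Im \o g).
Proof.
move=> oU /[dup] /is_weak_partialP[/L1locP[l1 l2] h] /weak_partialP.
move=> /is_weak_partialP[/L1locP[l1' l2'] h'].
by split; apply: test_function_ae_eq => // phi tphi; apply: oppr_inj;
  have [h1 h2] := h phi tphi; have [h3 h4] := h' phi tphi; rewrite -?h1 -?h2 -?h3 -?h4.
Qed.

Lemma L2P U u : measurable U -> L2 U u <-> L2r mu U (Re \o u) /\ L2r mu U (Im \o u).
Proof.
move=> mU; have split_int : Cmeasurable_fun U u -> sqL2 U u =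
    (\int[mu]_(y in U) ((Re \o u) y ^+ 2)%:E + \int[mu]_(y in U) ((Im \o u) y ^+ 2)%:E)%E.
  move=> [mr mi]; rewrite -ge0_integralD//.
  - by move=> y _; rewrite lee_fin sqr_ge0.
  - by apply/measurable_EFinP/measurable_funX.
  - by move=> y _; rewrite lee_fin sqr_ge0.
  - by apply/measurable_EFinP/measurable_funX.
split=> [[mu' uoo]|[lr li]].
  move: (uoo); rewrite split_int// => h; have [mr mi] := mu'.
  have p1 : (0 <= \int[mu]_(y in U) ((Re \o u) y ^+ 2)%:E)%E.
    by apply: integral_ge0 => y _; rewrite lee_fin sqr_ge0.
  have p2 : (0 <= \int[mu]_(y in U) ((Im \o u) y ^+ 2)%:E)%E.
    by apply: integral_ge0 => y _; rewrite lee_fin sqr_ge0.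
  split.
    refine ((@L2rP _ _ _ mu U (Re \o u) mr).2 _).
    by apply: le_lt_trans h; rewrite leeDl.
  refine ((@L2rP _ _ _ mu U (Im \o u) mi).2 _).
  by apply: le_lt_trans h; rewrite leeDr.
have mU' : Cmeasurable_fun U u by split; [exact: lr.1|exact: li.1].
split=> //; rewrite split_int// lte_add_pinfty//.
  exact: (@L2rP _ _ _ mu U (Re \o u) lr.1).1.
exact: (@L2rP _ _ _ mu U (Im \o u) li.1).1.
Qed.

Lemma sqL2E A u : measurable A -> L2r mu A (Re \o u) -> L2r mu A (Im \o u) ->
  sqL2 A u = (ip mu A (Re \o u) (Re \o u) + ip mu A (Im \o u) (Im \o u))%:E.
Proof.
move=> mA lr li; rewrite EFinD -!ip_ereal// -ge0_integralD//.
- by move=> y _; rewrite lee_fin sqr_ge0.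
- by apply/measurable_EFinP/measurable_funX; exact: lr.1.
- by move=> y _; rewrite lee_fin sqr_ge0.
- by apply/measurable_EFinP/measurable_funX; exact: li.1.
Qed.

Lemma H1_jets U u : open U -> H1 U u ->
  [/\ L2jet U (Rej U u), L2jet U (Imj U u), weak_gradient U (Rej U u) & weak_gradient U (Imj U u)].
Proof.
move=> oU [lu hu]; have mU := open_measurable_rV oU; have [lr li] := (L2P u mU).1 lu.
have wp i : is_weak_partial U i u (weak_partial U i u).
  by have [g hg _] := hu i; exact: weak_partialP hg.
have mwp i : measurable_fun U (Re \o weak_partial U i u) /\ measurable_fun U (Im \o weak_partial U i u).
  have [/L1locP[l1 l2] _] := (is_weak_partialP _ _ _ _).1 (wp i).
  by split; exact: measurable_L1c.
have lwp i : L2r mu U (Re \o weak_partial U i u) /\ L2r mu U (Im \o weak_partial U i u).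
  have [g hg lg] := hu i; have [l1 l2] := (L2P g mU).1 lg.
  have [e1 e2] := weak_partial_ae_eq oU hg; have [m1 m2] := mwp i.
  by split; [apply: ae_eq_L2r (ae_eq_sym e1) l1|apply: ae_eq_L2r (ae_eq_sym e2) l2].
split.
- by move=> j; rewrite /Rej; case: unliftP => [i|] _ //; exact: (lwp i).1.
- by move=> j; rewrite /Imj; case: unliftP => [i|] _ //; exact: (lwp i).2.
- move=> i psi tpsi; rewrite Rej0 RejS.
  by have [_ h] := (is_weak_partialP _ _ _ _).1 (wp i); have [] := h psi tpsi.
- move=> i psi tpsi; rewrite Imj0 ImjS.
  by have [_ h] := (is_weak_partialP _ _ _ _).1 (wp i); have [] := h psi tpsi.
Qed.

(** The way back from real jets to H^1: the given components form a weak derivative, with which the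
    chosen one agrees almost everywhere by uniqueness. *)
Lemma jets_H1 U u W Z : open U -> L2jet U W -> L2jet U Z -> weak_gradient U W ->
  weak_gradient U Z -> W ord0 = Re \o u -> Z ord0 = Im \o u ->
  [/\ H1 U u, ae_jet U (Rej U u) W & ae_jet U (Imj U u) Z].
Proof.
move=> oU lW lZ wW wZ Wu Zu; have mU := open_measurable_rV oU.
have wp i : is_weak_partial U i u (cplx (W (lift ord0 i)) (Z (lift ord0 i))).
  apply/is_weak_partialP; split.
    apply/L1locP; split.
      exact: L2r_L1c (lW (lift ord0 i)) mU.
    exact: L2r_L1c (lZ (lift ord0 i)) mU.
  move=> phi tphi; have := wW i phi tphi; have := wZ i phi tphi.
  by rewrite Wu Zu.
have lu : L2 U u by apply/(L2P u mU); rewrite -Wu -Zu.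
split.
- split=> // i; exists (cplx (W (lift ord0 i)) (Z (lift ord0 i))) => //.
  by apply/(L2P _ mU); split; [exact: (lW (lift ord0 i))|exact: (lZ (lift ord0 i))].
- move=> j; case: (unliftP ord0 j) => [i|] ->; last by rewrite Rej0 Wu; exact: ae_eq_refl.
  by rewrite RejS; have [] := weak_partial_ae_eq oU (wp i).
- move=> j; case: (unliftP ord0 j) => [i|] ->; last by rewrite Imj0 Zu; exact: ae_eq_refl.
  by rewrite ImjS; have [] := weak_partial_ae_eq oU (wp i).
Qed.

Lemma cplx_H1 U W Z : open U -> L2jet U W -> L2jet U Z -> weak_gradient U W ->
  weak_gradient U Z -> let u := cplx (W ord0) (Z ord0) in
  [/\ H1 U u, ae_jet U (Rej U u) W & ae_jet U (Imj U u) Z].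
Proof. by move=> oU lW lZ wW wZ u; exact: jets_H1. Qed.

Lemma weak_gradient_lin U (a : R) W Z : open U -> L2jet U W -> L2jet U Z ->
  weak_gradient U W -> weak_gradient U Z -> weak_gradient U (a *: W + Z).
Proof.
move=> oU lW lZ wW wZ i psi tpsi; have mU := open_measurable_rV oU.
have lt := L2jet_jet mU tpsi.
have l1 : L2r mu U psi by have := lt ord0; rewrite jet_ord0.
have l2 : L2r mu U (partial i psi) by have := lt (lift ord0 i); rewrite jet_lift.
rewrite -[LHS]/(ip mu U (fun y => a * W ord0 y + Z ord0 y) (partial i psi)) ip_linl//.
rewrite -[X in - X]/(ip mu U (fun y => a * W (lift ord0 i) y + Z (lift ord0 i) y) psi) ip_linl//.
by rewrite /ip wW// wZ//; ring.
Qed.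

Lemma weak_gradientB U W Z : open U -> L2jet U W -> L2jet U Z ->
  weak_gradient U W -> weak_gradient U Z -> weak_gradient U (W - Z).
Proof.
by move=> oU lW lZ wW wZ; rewrite addrC -scaleN1r; exact: weak_gradient_lin.
Qed.

Lemma weak_gradient_jet U phi : open U -> smooth phi -> weak_gradient U (jet phi).
Proof.
move=> oU sphi i psi tpsi; rewrite jet_ord0 jet_lift.
by rewrite (integration_by_parts oU (smooth_C1_on i sphi) tpsi).
Qed.

Lemma sqL2gradE U A u : measurable A -> L2jet A (Rej U u) -> L2jet A (Imj U u) ->
  sqL2grad U A u = (\sum_(i < m) (ip mu A (Rej U u (lift ord0 i)) (Rej U u (lift ord0 i)) +
    ip mu A (Imj U u (lift ord0 i)) (Imj U u (lift ord0 i))))%:E.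
Proof.
move=> mA lR lI; rewrite /sqL2grad -sumEFin; apply: eq_bigr => i _.
have := lR (lift ord0 i); have := lI (lift ord0 i); rewrite RejS ImjS => l1 l2.
by rewrite sqL2E.
Qed.

Lemma poweR_half (r : R) : 0 <= r -> (r%:E `^ 2^-1)%E = (Num.sqrt r)%:E.
Proof. by move=> r0; rewrite poweR_EFin powR12_sqrt. Qed.

Lemma jform1E A W : jform 1 A W W = ip mu A (W ord0) (W ord0) +
  \sum_(i < m) ip mu A (W (lift ord0 i)) (W (lift ord0 i)).
Proof. by rewrite /jform mul1r. Qed.

(** The norms are square roots in the extended reals, with the gradient taken in [U] and the
    integrals over [A]. The condition on squares is the form in which Hilbert space arguments use
    the convergence. *)
Lemma norms_cvg0P U A (d : nat -> E -> C) : measurable A ->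
  (forall n, L2jet A (Rej U (d n)) /\ L2jet A (Imj U (d n))) ->
  (fun n => normL2 A (d n) + normL2grad U A (d n))%E @ \oo --> 0%E <->
  forall e : R, 0 < e -> exists N, forall n, (N <= n)%N ->
    jform 1 A (Rej U (d n)) (Rej U (d n)) + jform 1 A (Imj U (d n)) (Imj U (d n)) < e.
Proof.
move=> mA hd; pose s n := ip mu A (Rej U (d n) ord0) (Rej U (d n) ord0) + ip mu A (Imj U (d n) ord0) (Imj U (d n) ord0).
pose g n := \sum_(i < m) (ip mu A (Rej U (d n) (lift ord0 i)) (Rej U (d n) (lift ord0 i)) +
    ip mu A (Imj U (d n) (lift ord0 i)) (Imj U (d n) (lift ord0 i))).
have s0 n : 0 <= s n by rewrite addr_ge0 ?ip_ge0.
have g0 n : 0 <= g n by rewrite sumr_ge0// => i _; rewrite addr_ge0 ?ip_ge0.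
have sg n : jform 1 A (Rej U (d n)) (Rej U (d n)) + jform 1 A (Imj U (d n)) (Imj U (d n)) = s n + g n.
  by rewrite !jform1E /s /g big_split/=; ring.
have nE : (fun n => normL2 A (d n) + normL2grad U A (d n))%E =
    EFin \o (fun n => Num.sqrt (s n) + Num.sqrt (g n)).
  apply/funext => n; have [lR lI] := hd n.
  have := lR ord0; have := lI ord0; rewrite Rej0 Imj0 => lI0 lR0.
  rewrite /normL2 /normL2grad sqL2gradE// sqL2E//.
  have -> : ip mu A (Re \o d n) (Re \o d n) + ip mu A (Im \o d n) (Im \o d n) = s n by rewrite /s Rej0 Imj0.
  by rewrite !poweR_half// ?g0 ?s0.
rewrite nE; split=> [h e e0|h].
  have /fine_cvgP[_ /= {}h] := h.
  have e2 : 0 < Num.sqrt (e / 2) by rewrite sqrtr_gt0 divr_gt0.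
  have /cvgrPdist_lt/(_ _ e2)[N _ NP] := h; exists N => n nN.
  have := NP n nN; rewrite /= sub0r normrN ger0_norm ?addr_ge0 ?sqrtr_ge0// => hn.
  rewrite sg; have q1 : Num.sqrt (s n) < Num.sqrt (e / 2).
    by apply: le_lt_trans hn; rewrite lerDl sqrtr_ge0.
  have q2 : Num.sqrt (g n) < Num.sqrt (e / 2).
    by apply: le_lt_trans hn; rewrite lerDr sqrtr_ge0.
  move: q1 q2; rewrite !ltr_sqrt ?divr_gt0// => q1 q2; lra.
apply: cvg_EFin; first exact: nearW.
rewrite /comp/=; apply/cvgrPdist_lt => e e0.
have e2 : 0 < (e / 2) ^+ 2 by rewrite exprn_gt0// divr_gt0.
have [N NP] := h _ e2; exists N => // n /= nN; have := NP n nN; rewrite sg => hn.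
rewrite sub0r normrN ger0_norm ?addr_ge0 ?sqrtr_ge0//.
have key r : 0 <= r -> r <= s n + g n -> Num.sqrt r < e / 2.
  move=> r0 rs; rewrite -[ltRHS]ger0_norm ?divr_ge0 ?(ltW e0)// -sqrtr_sqr ltr_sqrt//.
  exact: le_lt_trans hn.
rewrite [e]splitr ltrD// key//; first by rewrite lerDl.
by rewrite lerDr.
Qed.

End real_and_imaginary_parts.

(** * The weak Helmholtz equation *)

Section weak_formulation.
Context {R : realType} {m : nat}.
Local Notation E := 'rV[R]_m.
Local Notation C := R[i].
Local Notation mu := (@lebesgue_rV R m).
Local Notation J := ('I_m.+1 -> E -> R).
Local Notation Re := (@complex.Re R).
Local Notation Im := (@complex.Im R).
Implicit Types (f g phi psi : E -> R) (K U A Omega : set E) (W Z : J) (u v w : E -> C).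

Definition jdensity (c : R) W Z (y : E) : R :=
  c * (W ord0 y * Z ord0 y) + \sum_(i < m) W (lift ord0 i) y * Z (lift ord0 i) y.

Lemma integrable_sumR U (I : Type) (s : seq I) (F : I -> E -> R) : measurable U ->
  (forall i, mu.-integrable U (EFin \o F i)) ->
  mu.-integrable U (EFin \o (fun y => \sum_(i <- s) F i y)) /\
  \int[mu]_(y in U) (\sum_(i <- s) F i y) = \sum_(i <- s) \int[mu]_(y in U) F i y.
Proof.
move=> mU iF; elim: s => [|i s [IH1 IH2]].
  split; last by under eq_Rintegral do rewrite big_nil; rewrite big_nil Rintegral_cst// mul0r.
  apply: (eq_integrable mU (cst 0%E)) => [y _|]; first by rewrite /= big_nil.
  exact: integrable0.
have iD : mu.-integrable U (EFin \o (fun y => F i y + \sum_(j <- s) F j y)).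
  by have := integrableD mU (iF i) IH1.
have e : (fun y => \sum_(j <- i :: s) F j y) = (fun y => F i y + \sum_(j <- s) F j y).
  by apply/funext => y; rewrite big_cons.
split; first by rewrite e.
by under eq_Rintegral do rewrite big_cons; rewrite RintegralD// IH2 big_cons.
Qed.

Lemma jform_Rintegral (c : R) U W Z : measurable U -> L2jet U W -> L2jet U Z ->
  mu.-integrable U (EFin \o jdensity c W Z) /\
  \int[mu]_(y in U) jdensity c W Z y = jform c U W Z.
Proof.
move=> mU lW lZ.
have iP j : mu.-integrable U (EFin \o (fun y => W j y * Z j y)).
  by apply: L2r_integrableM.
have [i1 e1] := integrable_sumR (index_enum 'I_m) mU (fun i => iP (lift ord0 i)).
have i0 : mu.-integrable U (EFin \o (fun y => c * (W ord0 y * Z ord0 y))).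
  by have := integrableZl mU c (iP ord0).
split; first by have := integrableD mU i0 i1.
by rewrite /jdensity RintegralD// e1 RintegralZl.
Qed.

Lemma Cintegral_eq U u f g : (forall y, U y -> u y = f y +i* g y) ->
  Cintegral U u = (\int[mu]_(y in U) f y) +i* (\int[mu]_(y in U) g y).
Proof.
by move=> h; rewrite /Cintegral; congr Complex; apply: eq_Rintegral => y /set_mem/h ->.
Qed.

(** The form is bilinear rather than sesquilinear, whence the minus sign in the real part. *)
Lemma helmholtz_formE k U u w : open U -> H1 U u -> H1 U w ->
  helmholtz_form k U u w =
  (jform (- k ^+ 2) U (Rej U u) (Rej U w) - jform (- k ^+ 2) U (Imj U u) (Imj U w)) +i*
  (jform (- k ^+ 2) U (Rej U u) (Imj U w) + jform (- k ^+ 2) U (Imj U u) (Rej U w)).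
Proof.
move=> oU hu hw; have mU := open_measurable_rV oU.
have [lr li _ _] := H1_jets oU hu; have [lr' li' _ _] := H1_jets oU hw.
have [i1 e1] := jform_Rintegral (- k ^+ 2) mU lr lr'.
have [i2 e2] := jform_Rintegral (- k ^+ 2) mU li li'.
have [i3 e3] := jform_Rintegral (- k ^+ 2) mU lr li'.
have [i4 e4] := jform_Rintegral (- k ^+ 2) mU li lr'.
rewrite -e1 -e2 -e3 -e4 -RintegralB// -RintegralD//.
apply: Cintegral_eq => y _; apply/eqP; rewrite eq_complex /=; apply/andP; split; apply/eqP.
  rewrite ReD ReN !ReM ImM Re_sum /jdensity !Rej0 !Imj0 /=.
  rewrite (eq_bigr (fun i => Rej U u (lift ord0 i) y * Rej U w (lift ord0 i) y
    - Imj U u (lift ord0 i) y * Imj U w (lift ord0 i) y)); last first.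
    by move=> i _; rewrite ReM !RejS !ImjS.
  by rewrite sumrB; ring.
rewrite ImD ImN !ImM ReM Im_sum /jdensity !Rej0 !Imj0 /=.
rewrite (eq_bigr (fun i => Rej U u (lift ord0 i) y * Imj U w (lift ord0 i) y
    + Imj U u (lift ord0 i) y * Rej U w (lift ord0 i) y)); last first.
  by move=> i _; rewrite ImM !RejS !ImjS.
by rewrite big_split /=; ring.
Qed.

Lemma jform0l c U W : measurable U -> jform c U 0 W = 0.
Proof.
move=> mU; have ip0 f : ip mu U (fun=> 0) f = 0.
  by rewrite /ip; under eq_Rintegral do rewrite mul0r; rewrite Rintegral_cst// mul0r.
by rewrite /jform ip0 mulr0 big1 ?addr0// => i _; exact: ip0.
Qed.

Lemma L2jet0 U : measurable U -> L2jet U (0 : J).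
Proof. by move=> mU; exact: (lset0 (@linear_L2jet R m U mU)). Qed.

Lemma ae_jet_Vjet Omega U W Z : measurable U -> L2jet U Z -> ae_jet U W Z -> Vjet Omega U W ->
  Vjet Omega U Z.
Proof.
move=> mU lZ WZ [lW hW]; split=> // e /hW[phi tphi hphi]; exists phi => //.
have linL := @linear_L2jet R m U mU.
have lp := L2jet_jet mU tphi.
rewrite -(@ae_eq_jform _ _ 1 U (W - jet phi) (W - jet phi))//; try exact: (lsetB linL).
- by move=> j; apply: filterS (WZ j) => y h Uy; rewrite !fctE h.
- by move=> j; apply: filterS (WZ j) => y h Uy; rewrite !fctE h.
Qed.

Lemma ae_jetB U W W' Z Z' : ae_jet U W W' -> ae_jet U Z Z' -> ae_jet U (W - Z) (W' - Z').
Proof.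
move=> h1 h2 j; apply: filterS2 (h1 j) (h2 j) => y e1 e2 Uy.
by rewrite !fctE e1// e2.
Qed.

Lemma H1B U u w : open U -> H1 U u -> H1 U w ->
  [/\ H1 U (fun y => u y - w y), ae_jet U (Rej U (fun y => u y - w y)) (Rej U u - Rej U w) &
      ae_jet U (Imj U (fun y => u y - w y)) (Imj U u - Imj U w)].
Proof.
move=> oU hu hw; have mU := open_measurable_rV oU; have linL := @linear_L2jet R m U mU.
have [lr li gr gi] := H1_jets oU hu; have [lr' li' gr' gi'] := H1_jets oU hw.
apply: jets_H1 => //; try exact: (lsetB linL); try exact: weak_gradientB.
- by rewrite !fctE; apply/funext => y /=; rewrite !Rej0 ReD ReN.
- by rewrite !fctE; apply/funext => y /=; rewrite !Imj0 ImD ImN.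
Qed.

Lemma Ctest_H1 Omega U u : open U -> Ctest_function Omega u ->
  [/\ H1 U u, ae_jet U (Rej U u) (jet (Re \o u)) & ae_jet U (Imj U u) (jet (Im \o u))].
Proof.
move=> oU [tr ti]; have mU := open_measurable_rV oU.
apply: jets_H1 => //; try (by rewrite ?jet_ord0); try exact: (L2jet_jet mU tr); try exact: (L2jet_jet mU ti).
- by apply: weak_gradient_jet => //; case: tr.
- by apply: weak_gradient_jet => //; case: ti.
Qed.

(** A complex approximating sequence splits into real ones. Conversely, for each [n] both parts are
    approximated within half of [1 / (n + 1)] and put together. *)
Lemma H10P Omega U u : open U ->
  H10 Omega U u <-> [/\ H1 U u, Vjet Omega U (Rej U u) & Vjet Omega U (Imj U u)].
Proof.
move=> oU; have mU := open_measurable_rV oU; have linL := @linear_L2jet R m U mU.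
have distE (p : E -> C) : H1 U u -> Ctest_function Omega p ->
    H1 U (fun y => u y - p y) /\
    jform 1 U (Rej U (fun y => u y - p y)) (Rej U (fun y => u y - p y)) +
    jform 1 U (Imj U (fun y => u y - p y)) (Imj U (fun y => u y - p y)) =
    jform 1 U (Rej U u - jet (Re \o p)) (Rej U u - jet (Re \o p)) +
    jform 1 U (Imj U u - jet (Im \o p)) (Imj U u - jet (Im \o p)).
  move=> hu tp; have [hp e1 e2] := Ctest_H1 oU tp; have [hup e3 e4] := H1B oU hu hp.
  have [lr li _ _] := H1_jets oU hu; have [lr' li' _ _] := H1_jets oU hp.
  have [lr2 li2 _ _] := H1_jets oU hup.
  have lj1 := L2jet_jet mU tp.1; have lj2 := L2jet_jet mU tp.2.
  have ej W W' Z : ae_jet U W (W' - Z) -> forall Y, ae_jet U Z Y -> ae_jet U W (W' - Y).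
    move=> h Y ZY j; apply: filterS2 (h j) (ZY j) => y h1 h2 Uy.
    by rewrite h1// !fctE h2.
  split=> //; congr (_ + _); apply: ae_eq_jform => //; try exact: (lsetB linL).
  - exact: ej e3 _ e1.
  - exact: ej e3 _ e1.
  - exact: ej e4 _ e2.
  - exact: ej e4 _ e2.
have lH w : H1 U w -> L2jet U (Rej U w) /\ L2jet U (Imj U w).
  by move=> hw; have [] := H1_jets oU hw.
split=> [[hu [p tp /(norms_cvg0P mU) h]]|[hu Vr Vi]].
  have {}h := h (fun n => lH _ (distE _ hu (tp n)).1).
  have [lr li _ _] := H1_jets oU hu.
  split=> //; split=> // e e0; have [N hN] := h _ e0; have := hN N (leqnn N);
    rewrite (distE _ hu (tp N)).2 => hlt.
    exists (Re \o p N); first exact: (tp N).1.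
    by apply: le_lt_trans hlt; rewrite lerDl jform_ge0.
  exists (Im \o p N); first exact: (tp N).2.
  by apply: le_lt_trans hlt; rewrite lerDr jform_ge0.
split=> //.
have ex n : exists p : E -> C, Ctest_function Omega p /\
    jform 1 U (Rej U u - jet (Re \o p)) (Rej U u - jet (Re \o p)) +
    jform 1 U (Imj U u - jet (Im \o p)) (Imj U u - jet (Im \o p)) < n.+1%:R^-1.
  have e0 : 0 < (n.+1%:R^-1 / 2 : R) by rewrite divr_gt0.
  have [p tp hp] := Vr.2 _ e0; have [q tq hq] := Vi.2 _ e0.
  exists (cplx p q); split; first by split.
  by rewrite [ltRHS]splitr ltrD.
pose p n := projT1 (cid (ex n)).
have pP n : Ctest_function Omega (p n) /\
    jform 1 U (Rej U u - jet (Re \o p n)) (Rej U u - jet (Re \o p n)) +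
    jform 1 U (Imj U u - jet (Im \o p n)) (Imj U u - jet (Im \o p n)) < n.+1%:R^-1.
  exact: (projT2 (cid (ex n))).
exists p => [n|]; first exact: (pP n).1.
apply/(norms_cvg0P mU); first by move=> n; apply: lH; exact: (distE _ hu (pP n).1).1.
move=> e e0; have [N hN] : exists N : nat, N.+1%:R^-1 < e.
  have := near_infty_natSinv_lt (PosNum e0) => -[N _ h]; exists N; exact: (h N (leqnn N)).
exists N => n nN; rewrite (distE _ hu (pP n).1).2; apply: lt_le_trans (pP n).2 _.
by apply: le_trans (ltW hN); rewrite lef_pV2 ?posrE// ler_nat.
Qed.

Lemma weak_gradient0 U : measurable U -> weak_gradient U (0 : J).
Proof.
move=> mU i psi _; have e g : \int[mu]_(y in U) ((0 : J) ord0 y * g y) = 0.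
  by under eq_Rintegral do rewrite mul0r; rewrite Rintegral_cst// mul0r.
by rewrite e -(oppr0 R) -[X in - X](e psi).
Qed.

(** Lets the hypotheses on complex functions be applied to a real jet, completed by a zero imaginary
    part. *)
Lemma real_H10 Omega U Z : open U -> Vjet Omega U Z -> let w := cplx (Z ord0) (fun=> 0) in
  [/\ H10 Omega U w, ae_jet U (Rej U w) Z & ae_jet U (Imj U w) 0].
Proof.
move=> oU VZ w; have mU := open_measurable_rV oU.
have wg0 : weak_gradient U (0 : J).
  exact: weak_gradient0.
have [hw er ei] := @cplx_H1 _ _ U Z 0 oU (Vjet_L2jet VZ) (L2jet0 mU) (Vjet_weak_gradient oU VZ) wg0.
split=> //; apply/(H10P _ _ oU); have [lr li _ _] := H1_jets oU hw.
split=> //.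
  by apply: (@ae_jet_Vjet _ U Z) => // j; exact: ae_eq_sym.
apply: (@ae_jet_Vjet _ U 0) => //; first by move=> j; exact: ae_eq_sym.
exact: lset0 (linear_Vjet Omega mU).
Qed.

(** As [k] is real, testing with real-valued functions separates the equation into the same equation
    for the real and for the imaginary part. *)
Lemma weak_helmholtzP k Omega U u : open U -> weak_helmholtz k Omega U u <->
  H1 U u /\ forall Z, Vjet Omega U Z ->
    jform (- k ^+ 2) U (Rej U u) Z = 0 /\ jform (- k ^+ 2) U (Imj U u) Z = 0.
Proof.
move=> oU; have mU := open_measurable_rV oU; split=> -[hu h]; split=> //.
  move=> Z VZ; have [hw er ei] := real_H10 oU VZ.
  have := h _ hw; have hw1 := hw.1; rewrite helmholtz_formE//.
  have [lr li _ _] := H1_jets oU hu; have [lr' li' _ _] := H1_jets oU hw1.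
  have lZ := Vjet_L2jet VZ.
  have r W : ae_jet U W W by move=> j; exact: ae_eq_refl.
  have zr W : L2jet U W -> jform (- k ^+ 2) U W 0 = 0.
    move=> lW; have [h1 h2] := bilinear_jform (- k ^+ 2) mU.
    by rewrite h1// ?jform0l//; exact: L2jet0.
  have l0 := L2jet0 mU.
  set W := Rej U (cplx _ _) in er lr' *; set Y := Imj U (cplx _ _) in ei li' *.
  rewrite (@ae_eq_jform _ _ _ U (Rej U u) W (Rej U u) Z)//.
  rewrite (@ae_eq_jform _ _ _ U (Imj U u) Y (Imj U u) 0)//.
  rewrite (@ae_eq_jform _ _ _ U (Rej U u) Y (Rej U u) 0)//.
  rewrite (@ae_eq_jform _ _ _ U (Imj U u) W (Imj U u) Z)//.
  by rewrite !zr// subr0 add0r => /eqP; rewrite eq_complex /= => /andP[/eqP -> /eqP ->].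
move=> w /(H10P _ _ oU)[hw Vr Vi]; rewrite helmholtz_formE//.
by have [-> ->] := h _ Vr; have [-> ->] := h _ Vi; rewrite subrr addr0.
Qed.

Lemma weak_gradient_ae0 U Z : open U -> L2jet U Z -> weak_gradient U Z ->
  ae_eq mu U (Z ord0) (fun=> 0) -> ae_jet U Z 0.
Proof.
move=> oU lZ wZ Z0 j; case: (unliftP ord0 j) => [i|] -> //.
have mU := open_measurable_rV oU.
apply: filterS (test_function_ae_eq0 oU (L2r_L1c (lZ (lift ord0 i)) mU) _) => [y h Uy|psi tpsi].
  by rewrite h.
have lp := L2jet_jet mU tpsi.
apply/eqP; rewrite -oppr_eq0 -(wZ _ _ tpsi).
rewrite -[X in X == _]/(ip mu U (Z ord0) (partial i psi)).
have l1 : L2r mu U (partial i psi) by have := lp (lift ord0 i); rewrite jet_lift.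
have l0 : L2r mu U (fun=> 0) := L2r0 mu U.
rewrite (@ae_eq_ip _ _ _ mu U mU _ _ (fun=> 0) (partial i psi))//; try exact: (lZ ord0).1; try exact: l1.1; try exact: l0.1.
  by rewrite /ip; under eq_Rintegral do rewrite mul0r; rewrite Rintegral_cst// mul0r.
exact: ae_eq_refl.
Qed.

(** A real kernel element is an eigenfunction with zero imaginary part. Its value vanishes almost
    everywhere, and then so does its weak gradient. *)
Lemma not_eigenvalue_kernel k Omega U : open U -> not_eigenvalue k Omega U ->
  trivial_kernel (Vjet Omega U) (jform 1 U) (jform (- k ^+ 2) U).
Proof.
move=> oU ne Z VZ hZ; have mU := open_measurable_rV oU.
have [hw er ei] := real_H10 oU VZ; have hw1 := hw.1.
have [lr li _ _] := H1_jets oU hw1; have lZ := Vjet_L2jet VZ; have l0 := L2jet0 mU.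
have [h1 h2] := bilinear_jform (- k ^+ 2) mU.
have /ne : weak_helmholtz k Omega U (cplx (Z ord0) (fun=> 0)).
  apply/(weak_helmholtzP _ _ _ oU); split=> // Y VY; have lY := Vjet_L2jet VY.
  have r : ae_jet U Y Y by move=> j; exact: ae_eq_refl.
  rewrite (@ae_eq_jform _ _ _ U (Rej _ _) Y Z Y)// (@ae_eq_jform _ _ _ U (Imj _ _) Y 0 Y)//.
  split; first by rewrite hZ.
  exact: jform0l.
move=> /(_ hw) w0.
have Z0 : ae_eq mu U (Z ord0) (fun=> 0).
  by apply: filterS w0 => y h /h /eqP; rewrite eq_complex /= => /andP[/eqP].
have aZ := weak_gradient_ae0 oU lZ (Vjet_weak_gradient oU VZ) Z0.
rewrite (@ae_eq_jform _ _ 1 U _ _ 0 0)//.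
exact: jform0l.
Qed.

Definition gradip U W : R := \sum_(i < m) ip mu U (W (lift ord0 i)) (W (lift ord0 i)).

Lemma gradip_ge0 U W : 0 <= gradip U W.
Proof. by apply: sumr_ge0 => i _; exact: ip_ge0. Qed.

Lemma jformE c U W : jform c U W W = c * ip mu U (W ord0) (W ord0) + gradip U W.
Proof. by []. Qed.

Lemma ae_jet_gradip U W Z : L2jet U W -> L2jet U Z -> measurable U -> ae_jet U W Z ->
  gradip U W = gradip U Z.
Proof.
move=> lW lZ mU WZ; apply: eq_bigr => i _.
by apply: ae_eq_ip => //; [exact: (lW _).1|exact: (lW _).1|exact: (lZ _).1|exact: (lZ _).1].
Qed.

Lemma gradip0 U : measurable U -> gradip U 0 = 0.
Proof.
move=> mU; rewrite /gradip big1// => i _; rewrite /ip.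
by under eq_Rintegral do rewrite mul0r; rewrite Rintegral_cst// mul0r.
Qed.

Lemma poincare0_real Omega U (c : R) Z : open U -> poincare_constant0 Omega U c ->
  Vjet Omega U Z -> ip mu U (Z ord0) (Z ord0) <= c ^+ 2 * gradip U Z.
Proof.
move=> oU [c0 hc] VZ; have mU := open_measurable_rV oU; have lZ := Vjet_L2jet VZ.
have [hw er ei] := real_H10 oU VZ; have hw1 := hw.1; have [lr li _ _] := H1_jets oU hw1.
have l0 : L2r mu U (fun=> 0) := L2r0 mu U.
have := hc _ hw; rewrite sqL2gradE// sqL2E//; last exact: (lZ ord0).
rewrite -EFinM lee_fin big_split /= -/(gradip _ _) -/(gradip _ _).
rewrite (ae_jet_gradip lr lZ mU er) (ae_jet_gradip li (L2jet0 mU) mU ei) gradip0// addr0.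
by apply: le_trans; rewrite lerDl ip_ge0.
Qed.

Lemma poincare_real U (c : R) Z : open U -> (mu U < +oo)%E -> poincare_constant U c ->
  L2jet U Z -> weak_gradient U Z ->
  let M := (fine (mu U))^-1 * \int[mu]_(y in U) Z ord0 y in
  ip mu U (fun y => Z ord0 y - M) (fun y => Z ord0 y - M) <= c ^+ 2 * gradip U Z.
Proof.
move=> oU Ufin [c0 hc] lZ wZ; set M := _ * _; have mU := open_measurable_rV oU.
have wg0 : weak_gradient U (0 : J).
  exact: weak_gradient0.
have [hw er ei] := @cplx_H1 _ _ U Z 0 oU lZ (L2jet0 mU) wZ wg0.
have [lr li _ _] := H1_jets oU hw.
have l1 : L2r mu U (fun=> M).
  by apply: (@L2r_bounded _ _ _ _ U mU _ `|M|).
have := hc _ hw; set mn := mean U _.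
have -> : mn = M%:C.
  apply/eqP; rewrite eq_complex; apply/andP; split; apply/eqP.
    by rewrite /mn /mean ReM /= mul0r subr0.
  by rewrite /mn /mean ImM /= mul0r addr0 Rintegral_cst// mul0r mulr0.
rewrite sqL2gradE// sqL2E//.
- rewrite -EFinM lee_fin big_split /= -/(gradip _ _) -/(gradip _ _).
  rewrite (ae_jet_gradip lr lZ mU er) (ae_jet_gradip li (L2jet0 mU) mU ei) gradip0// addr0.
  by apply: le_trans; rewrite lerDl ip_ge0.
- exact: L2rB (lZ ord0) l1.
- rewrite (_ : _ \o _ = fun=> 0); first exact: L2r0.
  by apply/funext => y /=; rewrite subrr.
Qed.

End weak_formulation.

(** * Rellich's theorem *)

Section finite_rank_estimate.
Context {R : realType} {m : nat}.
Local Notation E := 'rV[R]_m.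
Local Notation mu := (@lebesgue_rV R m).
Implicit Types (f phi : E -> R) (A B K O U Q : set E) (y s : E).

Local Notation tf := (@test_function R m setT).

Lemma test_functionT Omega phi : test_function Omega phi -> tf phi.
Proof. exact: test_functionS. Qed.

Lemma tf_continuous f : tf f -> continuous f.
Proof. by case=> sf _; exact: smooth_continuous. Qed.

Lemma tf_L2r A f : measurable A -> tf f -> L2r mu A f.
Proof. by move=> mA tff; have := L2jet_jet mA tff ord0; rewrite jet_ord0. Qed.

Lemma tf_measurable A f : tf f -> measurable_fun A f.
Proof. by move=> /tf_continuous cf; apply: measurable_funTS; exact: continuous_measurable_rVT. Qed.

Lemma tf_partial_L2r A f i : measurable A -> tf f -> L2r mu A (partial i f).
Proof. by move=> mA tff; have := L2jet_jet mA tff (lift ord0 i); rewrite jet_lift. Qed.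

Lemma tf_shift f s : tf f -> continuous (fun y => f (y + s)) /\
  exists2 K, compact K & forall y, ~ K y -> f (y + s) = 0.
Proof.
move=> [sf [K cK [_ f0]]]; have cf := smooth_continuous sf.
have cs (t : E) : continuous (fun y : E => y + t).
  by move=> y; apply: (@cvgD _ _ _ (nbhs y) _ id (fun=> t) y t); [exact: cvg_id|exact: cvg_cst].
split; first by move=> y; apply: (@continuous_comp _ _ _ (fun y : E => y + s) f); [exact: cs|exact: cf].
exists ((fun y => y - s) @` K).
  by apply: continuous_compact => //; apply: continuous_subspaceT; exact: cs.
move=> y nKy; apply: f0 => Kys; apply: nKy; exists (y + s) => //; exact: addrK.
Qed.

Lemma tf_shift_L2r A f s : measurable A -> tf f -> L2r mu A (fun y => f (y + s)).
Proof. by move=> mA /(tf_shift s)[c1 c2]; exact: L2r_compact_support. Qed.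

Lemma gradsq_gradip A f : measurable A -> tf f ->
  (\int[mu]_(y in A) (gradsq f y)%:E)%E = (gradip A (jet f))%:E.
Proof.
move=> mA tff; have mp i : measurable_fun A (partial i f) := (tf_partial_L2r i mA tff).1.
transitivity (\int[mu]_(y in A) \sum_i ((partial i f y) ^+ 2)%:E)%E.
  by apply: eq_integral => y _; rewrite /gradsq sumEFin.
rewrite ge0_integral_sum//; last by move=> i y _; rewrite lee_fin sqr_ge0.
  rewrite /gradip -sumEFin; apply: eq_bigr => i _; rewrite jet_lift -ip_ereal//.
  exact: tf_partial_L2r.
by move=> i; apply/measurable_EFinP/measurable_funX.
Qed.

Lemma shift_estimate_ip f s A B : tf f -> measurable A -> measurable B ->
  (forall y (t : R), A y -> 0 <= t <= 1 -> B (y + t *: s)) ->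
  ip mu A (fun y => f (y + s) - f y) (fun y => f (y + s) - f y) <= dot s s * gradip B (jet f).
Proof.
move=> tff mA mB AB; have cf := tf_continuous tff; have [sf _] := tff.
rewrite -lee_fin -ip_ereal//; last by apply: L2rB => //; [exact: tf_shift_L2r|exact: tf_L2r].
by rewrite EFinM -gradsq_gradip//; apply: shift_estimate => //; exact: smooth_C1.
Qed.

Lemma dot_sup_bound s (h : R) : `|s| <= h -> dot s s <= m%:R * h ^+ 2.
Proof.
move=> sh; rewrite /dot.
apply: (@le_trans _ _ (\sum_(i < m) h ^+ 2)); last by rewrite sumr_const card_ord mulr_natl.
apply: ler_sum => i _; rewrite -expr2 -real_normK ?num_real// lerXn2r ?nnegrE ?(le_trans _ sh)//.
exact: norm_coord.
Qed.

Lemma ip_shift_le A K s f : tf f -> measurable A -> measurable K ->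
  (forall y, A y -> K (y + s)) ->
  ip mu A (fun y => f (y + s)) (fun y => f (y + s)) <= ip mu K f f.
Proof.
move=> tff mA mK AK; have mf : measurable_fun setT f by exact: tf_measurable.
rewrite -lee_fin -!ip_ereal//; [|exact: tf_L2r|exact: tf_shift_L2r].
rewrite [leRHS]integral_mkcond [leLHS]integral_mkcond.
have mfK : measurable_fun setT ((fun y => (f y ^+ 2)%:E) \_ K).
  by apply/(measurable_restrict _ _ _) => //; apply/measurable_EFinP/measurable_funX/measurable_funTS.
rewrite -(@ge0_integral_shift R m s ((fun y => (f y ^+ 2)%:E) \_ K))//; last first.
  by move=> y; rewrite patchE; case: ifP => // _; rewrite lee_fin sqr_ge0.
apply: ge0_le_integral => //.
- by move=> y _; rewrite patchE; case: ifP => // _; rewrite lee_fin sqr_ge0.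
- apply/(measurable_restrict _ _ _) => //.
  apply/measurable_EFinP/measurable_funX/measurable_funTS.
  by apply: (@measurableT_comp _ _ _ _ _ _ f) => //; exact: measurable_shift.
- by apply: (measurableT_comp mfK); exact: measurable_shift.
move=> y _; rewrite !patchE; case: ifPn => [/set_mem/AK Ky|_]; first by rewrite mem_set.
by case: ifP => // _; rewrite lee_fin sqr_ge0.
Qed.

(** Half-open, so that the cubes of a grid are disjoint and leave no gaps. *)
Definition cube (a : E) (h : R) : set E := box (fun i => `[a ord0 i, a ord0 i + h[%classic).

Lemma measurable_cube a h : measurable (cube a h).
Proof. by apply: measurable_box => i; exact: measurable_itv. Qed.

Lemma lebesgue_rV_cube a h : 0 < h -> mu (cube a h) = (h ^+ m)%:E.
Proof.
move=> h0; rewrite lebesgue_rV_box//.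
transitivity (\prod_(i < m) h%:E)%E.
  apply: eq_bigr => i _; rewrite lebesgue_measure_itv/= lte_fin.
  by rewrite ltrDl h0 -EFinB; congr EFin; lra.
by rewrite prodEFin prodr_const card_ord.
Qed.

Lemma cube_diff a (h : R) y z : 0 < h -> cube a h y -> cube a h z -> `|y - z| < h.
Proof.
move=> h0 cy cz; apply/(norm_ltP _ h0) => i; have := cy i; have := cz i.
rewrite !mxE /= !in_itv /= ltr_norml => /andP[z1 z2] /andP[y1 y2].
by apply/andP; split; lra.
Qed.

(* The double integral of (f y - f z)^2 over the cube, computed directly and bounded,
   after the change of variables z = y + s, by the gradient. *)
Lemma cube_poincare f a (h : R) : tf f -> 0 < h ->
  ip mu (cube a h) f f <= (h ^+ m)^-1 * (\int[mu]_(y in cube a h) f y) ^+ 2 +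
    (2 ^+ m * m%:R * h ^+ 2) * gradip (cube a h) (jet f).
Proof.
move=> tff h0; set Q := cube a h; set I := \int[mu]_(y in Q) f y; set S := ip mu Q f f.
set G := gradip Q (jet f); have mQ : measurable Q by exact: measurable_cube.
have muQ : mu Q = (h ^+ m)%:E by exact: lebesgue_rV_cube.
have hm0 : 0 < h ^+ m by rewrite exprn_gt0.
have Qfin : (mu Q < +oo)%E by rewrite muQ ltry.
have mf : measurable_fun setT f by exact: tf_measurable.
have lf : L2r mu Q f by exact: tf_L2r.
have lc c : L2r mu Q (fun=> c) by apply: (@L2r_bounded _ _ _ _ Q mQ _ `|c|).
have intc c : \int[mu]_(y in Q) c = c * h ^+ m by rewrite Rintegral_cst// /= muQ.
have ipc g c : L2r mu Q g -> ip mu Q g (fun=> c) = c * \int[mu]_(y in Q) g y.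
  move=> lg; rewrite ipC -[X in _ = c * X](_ : ip mu Q (fun=> 1) g = _); last first.
    by apply: eq_Rintegral => y _; rewrite mul1r.
  by rewrite -ipZl//; apply: eq_Rintegral => y _; rewrite mulr1.
have inner y : \int[mu]_(z in Q) ((f z - f y) ^+ 2) = S - 2 * f y * I + f y ^+ 2 * h ^+ m.
  transitivity (ip mu Q (fun z => f z - f y) (fun z => f z - f y)).
    by apply: eq_Rintegral => z _; rewrite expr2.
  by rewrite ip_sqrB// !ipc// intc -/S -/I; ring.
(* The variables are [(y, s)] with [z = y + s]; the two indicators keep [y] and [z] in the cube. *)
pose g (p : E * E) : \bar R := (\1_Q p.1 * (\1_Q (p.1 + p.2)) * (f (p.1 + p.2) - f p.1) ^+ 2)%:E.
have madd : measurable_fun setT (fun p : E * E => p.1 + p.2).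
  apply: measurable_to_rV => i.
  apply: (eq_measurable_fun (fun p : E * E => (p.1 ord0 i + p.2 ord0 i)%R : measurableTypeR R)).
    by move=> p _; rewrite mxE.
  apply: measurable_funD.
    by apply: (@measurableT_comp _ _ _ _ _ _ (fun y : E => y ord0 i : measurableTypeR R)) => //;
      exact: measurable_coord_rV.
  by apply: (@measurableT_comp _ _ _ _ _ _ (fun y : E => y ord0 i : measurableTypeR R)) => //;
    exact: measurable_coord_rV.
have mg : measurable_fun setT g.
  apply/measurable_EFinP; apply: measurable_funM.
    apply: measurable_funM.
      by apply: (@measurableT_comp _ _ _ _ _ _ (\1_Q : E -> R)) => //; exact: measurable_indic.
    by apply: (@measurableT_comp _ _ _ _ _ _ (\1_Q : E -> R)) => //; exact: measurable_indic.
  apply: measurable_funX; apply: measurable_funB.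
    exact: (@measurableT_comp _ _ _ _ _ _ f).
  exact: (@measurableT_comp _ _ _ _ _ _ f).
have g0 p : (0 <= g p)%E.
  by rewrite /g lee_fin; apply: mulr_ge0; [apply: mulr_ge0; rewrite indicE ler0n|exact: sqr_ge0].
have gE y s : g (y, s) = if (y \in Q) && (y + s \in Q) then ((f (y + s) - f y) ^+ 2)%:E else 0%E.
  by rewrite /g !indicE /=; case: (y \in Q) (y + s \in Q) => -[]; rewrite ?(mul0r, mul1r).
have lhs : (\int[mu]_y \int[mu]_s g (y, s) = (2 * h ^+ m * S - 2 * I ^+ 2)%:E)%E.
  transitivity (\int[mu]_(y in Q) (S - 2 * f y * I + f y ^+ 2 * h ^+ m)%:E)%E.
    rewrite [RHS]integral_mkcond; apply: eq_integral => y _; rewrite patchE; case: ifPn => Qy; last first.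
      by rewrite integral0_eq// => s _; rewrite gE (negbTE Qy).
    transitivity (\int[mu]_s ((fun z => ((f z - f y) ^+ 2)%:E) \_ Q) (s + y)%R)%E.
      by apply: eq_integral => s _; rewrite gE Qy /= patchE addrC.
    have lfy : L2r mu Q (fun z => f z - f y) by exact: L2rB.
    rewrite ge0_integral_shift.
    - by rewrite -integral_mkcond ip_ereal// -inner; congr EFin; apply: eq_Rintegral => z _; rewrite expr2.
    - by apply/(measurable_restrictT _ mQ); apply/measurable_EFinP/measurable_funX; exact: lfy.1.
    - by move=> z; rewrite patchE; case: ifP => // _; rewrite lee_fin sqr_ge0.
  have i0 : mu.-integrable Q (EFin \o (fun y => S * 1)) := L2r_integrableM mQ (lc S) (lc 1).
  have if1 : mu.-integrable Q (EFin \o (fun y => f y * 1)) := L2r_integrableM mQ lf (lc 1).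
  have i1 : mu.-integrable Q (EFin \o (fun y => - (2 * I) * (f y * 1))).
    by have := integrableZl mQ (- (2 * I)) if1.
  have i2 : mu.-integrable Q (EFin \o (fun y => h ^+ m * (f y * f y))).
    by have := integrableZl mQ (h ^+ m) (L2r_integrableM mQ lf lf).
  have i01 : mu.-integrable Q (EFin \o (fun y => S * 1 + - (2 * I) * (f y * 1))).
    by have := integrableD mQ i0 i1.
  have i012 : mu.-integrable Q
      (EFin \o (fun y => S * 1 + - (2 * I) * (f y * 1) + h ^+ m * (f y * f y))).
    by have := integrableD mQ i01 i2.
  transitivity (\int[mu]_(y in Q)
      (S * 1 + - (2 * I) * (f y * 1) + h ^+ m * (f y * f y))%:E)%E.
    by apply: eq_integral => y _; congr EFin; ring.
  rewrite -[LHS]fineK; last exact: integrable_fin_num i012.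
  congr EFin; rewrite -/(Rintegral _ _ _) RintegralD// RintegralD//.
  rewrite [X in _ + X](_ : _ = h ^+ m * S); last by rewrite RintegralZl//; exact: L2r_integrableM.
  rewrite [X in _ + X + _](_ : _ = - (2 * I) * I); last first.
    by rewrite RintegralZl//; congr (_ * _); apply: eq_Rintegral => y _; rewrite mulr1.
  by rewrite intc; ring.
have G0 : 0 <= G by exact: gradip_ge0.
pose B0 : set E := ball (0 : E) h.
have mB0 : measurable B0 by exact: measurable_ball_rV.
have muB0 : mu B0 = ((2 * h) ^+ m)%:E by exact: lebesgue_rV_ball.
(* Only [|s| < h] contributes, a set of measure [(2 h)^m]. Segments between points of the cube stay
   in it, so the translation estimate bounds the inner integral by [m h^2 G]. *)
have bound s : (\int[mu]_y g (y, s) <= ((cst (m%:R * h ^+ 2 * G)%:E) \_ B0) s)%E.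
  rewrite patchE; case: ifPn => [/set_mem|/negP bs]; last first.
    rewrite integral0_eq// => y _; rewrite gE; case: ifP => // /andP[/set_mem Qy /set_mem Qys].
    exfalso; apply: bs; apply/mem_set; rewrite /B0 ball_rVE sub0r normrN.
    by have := cube_diff h0 Qys Qy; rewrite addrAC subrr add0r.
  rewrite /B0 ball_rVE sub0r normrN => sh; set A := Q `&` (fun y => y + s) @^-1` Q.
  have mA : measurable A.
    by apply: measurableI => //; rewrite -[X in measurable X]setTI; exact: measurable_shift.
  have -> : (\int[mu]_y g (y, s) = (ip mu A (fun y => f (y + s) - f y) (fun y => f (y + s) - f y))%:E)%E.
    rewrite -ip_ereal//; last by apply: L2rB => //; [exact: tf_shift_L2r|exact: tf_L2r].
    rewrite [RHS]integral_mkcond; apply: eq_integral => y _; rewrite gE patchE.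
    have -> // : (y \in A) = (y \in Q) && (y + s \in Q).
    apply/idP/andP => [/set_mem[? ?]|[/set_mem ? /set_mem ?]]; last by apply/mem_set; split.
    by split; apply/mem_set.
  rewrite lee_fin; apply: (@le_trans _ _ (dot s s * G)).
    apply: shift_estimate_ip => // y t [Qy Qys] /andP[t0 t1] i.
    have := Qy i; have := Qys i; rewrite !mxE /= !in_itv /= => /andP[a1 a2] /andP[a3 a4].
    by have [s0|s0] := leP 0 (s ord0 i); apply/andP; split; nra.
  by rewrite ler_wpM2r// dot_sup_bound// ltW.
have mG : measurable_fun setT (fun s => \int[mu]_y g (y, s))%E.
  exact: (measurable_fun_fubini_tonelli_G (m1 := mu)) mg g0.
have : (\int[mu]_s \int[mu]_y g (y, s) <= ((2 * h) ^+ m * (m%:R * h ^+ 2 * G))%:E)%E.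
  apply: (@le_trans _ _ (\int[mu]_s ((cst (m%:R * h ^+ 2 * G)%:E) \_ B0) s)%E).
    apply: ge0_le_integral => //.
    - by move=> s _; apply: integral_ge0.
    - by apply/(measurable_restrictT _ mB0); exact: measurable_cst.
  rewrite -integral_mkcond integral_cst//.
  by rewrite [X in (_ * X <= _)%E]muB0 -EFinM lee_fin mulrC.
rewrite -(fubini_tonelli g mg g0) lhs lee_fin exprMn => key.
have p2 : 0 < h ^+ m by [].
rewrite -(ler_pM2l p2) mulrDr mulrA mulfV ?gt_eqF// mul1r.
set c2 := 2 ^+ m in key *; set hm := h ^+ m in key p2 *.
have c20 : 0 <= c2 by rewrite exprn_ge0.
have t0 : 0 <= c2 * hm * (m%:R * h ^+ 2 * G).
  by rewrite !mulr_ge0 ?sqr_ge0// ltW.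
rewrite (_ : hm * (_ * _) = c2 * hm * (m%:R * h ^+ 2 * G)); last by ring.
by lra.
Qed.

Lemma ip_cover (I : eqType) (s : seq I) (P : pred I) (A : I -> set E) B U f : L2r mu B f ->
  measurable B -> U `<=` B -> (forall i, A i `<=` B) -> measurable U ->
  (forall i, measurable (A i)) ->
  (forall y, U y -> exists i, [/\ i \in s, P i & A i y]) ->
  ip mu U f f <= \sum_(i <- s | P i) ip mu (A i) f f.
Proof.
move=> lf mB UB AB mU mA; elim: s U UB mU => [|i s IH] U UB mU cov.
  rewrite big_nil (_ : U = set0) ?/ip ?Rintegral_set0//.
  by apply/seteqP; split=> // y /cov [j []].
rewrite big_cons; case: ifP => Pi; last first.
  apply: IH => // y /cov [j []]; rewrite inE => /orP[/eqP ->|js Pj Aj]; first by rewrite Pi.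
  by exists j.
have mD : measurable (U `\` A i) by exact: measurableD.
apply: (@le_trans _ _ (ip mu (A i) f f + ip mu (U `\` A i) f f)); last first.
  rewrite lerD2l; apply: IH => // [y []/UB//|] y [/cov [j []]]; rewrite inE => /orP[/eqP ->//|js Pj Aj _].
  by exists j.
have lU : L2r mu (A i `|` U `\` A i) f.
  by apply: L2rS lf => //; [exact: measurableU|move=> y [/AB|[/UB]]].
rewrite -ip_setU//.
  apply: ip_subset => //; first exact: measurableU.
  by move=> y Uy; have [Ay|nAy] := pselect (A i y); [left|right].
by apply/disj_set2P/seteqP; split=> // y [? []].
Qed.

Lemma ip_disjoint_le (I : finType) (P : pred I) (A : I -> set E) B f : L2r mu B f -> measurable B ->
  (forall i, measurable (A i)) -> (forall i, P i -> A i `<=` B) ->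
  (forall i j y, P i -> P j -> A i y -> A j y -> i = j) ->
  \sum_(i | P i) ip mu (A i) f f <= ip mu B f f.
Proof.
move=> lf mB mA AB dA.
pose s := [seq i <- index_enum I | P i]; pose D := \big[setU/set0]_(i <- s) A i.
have mD : measurable D by apply: bigsetU_measurable => i _.
have DB : D `<=` B.
  by rewrite /D big_filter -bigcup_seq_cond => y [i /= /andP[_ Pi] Ai]; exact: AB Ai.
apply: (@le_trans _ _ (ip mu D f f)); last exact: ip_subset.
have lD : L2r mu D f by exact: L2rS lf.
rewrite -lee_fin -ip_ereal// ge0_integral_bigsetU//.
- rewrite -sumEFin big_filter; apply: lee_sum => i Pi; rewrite ip_ereal//.
  by apply: L2rS lf => //; exact: AB.
- by rewrite filter_uniq// index_enum_uniq.
- apply/trivIsetP => i j /=; rewrite !mem_filter => /andP[Pi _] /andP[Pj _] ij.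
  by apply/seteqP; split=> // y [Ai Aj]; move/eqP: ij; apply; exact: dA Ai Aj.
- by apply/measurable_EFinP/measurable_funX; exact: lD.1.
- by move=> y _; rewrite lee_fin sqr_ge0.
Qed.

Lemma gradip_disjoint_le (I : finType) (P : pred I) (A : I -> set E) B (W : 'I_m.+1 -> E -> R) :
  L2jet B W -> measurable B ->
  (forall i, measurable (A i)) -> (forall i, P i -> A i `<=` B) ->
  (forall i j y, P i -> P j -> A i y -> A j y -> i = j) ->
  \sum_(i | P i) gradip (A i) W <= gradip B W.
Proof.
move=> lW mB mA AB dA; rewrite /gradip exchange_big /=; apply: ler_sum => j _.
exact: ip_disjoint_le.
Qed.

(** A quantitative form of Rellich's theorem: the sum of [cube_poincare] over a fine grid leaves a
    small multiple of the gradient and finitely many integrals over cubes. *)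
Lemma interior_estimate K O (e : R) : compact K -> open O -> K `<=` O -> 0 < e ->
  exists (I : finType) (P : pred I) (Q : I -> set E) (C : R),
  [/\ 0 <= C, forall i, measurable (Q i), forall i, (mu (Q i) < +oo)%E,
      forall i, P i -> Q i `<=` O &
      forall f, tf f -> ip mu K f f <= e * gradip O (jet f) +
        C * \sum_(i | P i) (\int[mu]_(y in Q i) f y) ^+ 2].
Proof.
move=> cK oO KO e0; have [r r0 rO] := compact_margin cK oO KO.
have [M M0 KM] := compact_bounded_rV cK.
have mK := compact_measurable_rV cK; have mO := open_measurable_rV oO.
pose c : R := 2 ^+ m * m%:R + 1; have c0 : 0 < c by rewrite ltr_wpDl// mulr_ge0.
(* A side below [r] keeps the cubes that meet [K] inside [O]; a side below 1 and [e / c] gives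
   [2^m m h^2 <= c h <= e]. *)
pose d := Num.min r (Num.min 1 (e / c)).
have d0 : 0 < d by rewrite !lt_min r0 ltr01 divr_gt0.
(* Half the width of the grid. The extra 1 puts [K] strictly inside, so that the index of the cube
   containing a point of [K] is below [n + 1]. *)
pose L := M + 1; have L0 : 0 < L by rewrite addr_gt0.
pose n := Num.truncn (2 * L / d).
have n0 : 0 < n.+1%:R :> R by [].
pose h := 2 * L / n.+1%:R; have h0 : 0 < h by rewrite divr_gt0 ?mulr_gt0.
have hd : h < d.
  have := truncnS_gt (2 * L / d); rewrite ltr_pdivrMr// => t.
  by rewrite /h ltr_pdivrMr// [d * _]mulrC.
have hr : h < r by apply: lt_le_trans hd _; rewrite ge_min lexx.
have h1 : h <= 1 by rewrite ltW// (lt_le_trans hd)// !ge_min lexx orbT.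
have he : h <= e / c by rewrite ltW// (lt_le_trans hd)// !ge_min lexx !orbT.
pose I : finType := {ffun 'I_m -> 'I_n.+1}.
pose a (p : I) : E := \row_i (- L + (p i)%:R * h).
pose Q p := cube (a p) h.
pose P (p : I) : bool := `[< exists2 y, K y & Q p y >].
have QO p : P p -> Q p `<=` O.
  move=> /asboolP[y Ky Qy] z Qz; apply: (rO y Ky).
  rewrite ball_rVE; apply: lt_trans hr; exact: cube_diff Qy Qz.
have cov y : K y -> exists2 p, P p & Q p y.
  move=> Ky; have yb i : 0 <= (y ord0 i + L) / h < n.+1%:R.
    have := norm_coord y i; have := KM y Ky; rewrite ler_norml => yM /andP[y1 y2].
    apply/andP; split; first by rewrite divr_ge0 ?(ltW h0)//; rewrite /L; lra.
    rewrite ltr_pdivrMr// /h mulrC divfK ?gt_eqF//; rewrite /L; lra.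
  have tn i : (Num.truncn ((y ord0 i + L) / h) < n.+1)%N.
    have /andP[y1 y2] := yb i; have /andP[t1 t2] := truncn_itv y1.
    by rewrite -(ltr_nat R); apply: le_lt_trans t1 y2.
  pose p : I := [ffun i => Ordinal (tn i)].
  have Qy : Q p y.
    move=> i; rewrite /a !mxE /= in_itv /= ffunE /=.
    have /andP[y1 y2] := yb i; have /andP[t1 t2] := truncn_itv y1.
    move: t1 t2; rewrite ler_pdivlMr// ltr_pdivrMr// -natr1 => t1 t2.
    by apply/andP; split; lra.
  by exists p => //; apply/asboolP; exists y.
have dQ p q y : P p -> P q -> Q p y -> Q q y -> p = q.
  move=> _ _ Qp Qq; apply/ffunP => i; apply/val_inj => /=.
  have := Qp i; have := Qq i; rewrite /a !mxE /= !in_itv /= => /andP[q1 q2] /andP[p1 p2].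
  have ltn (k l : 'I_n.+1) : - L + k%:R * h <= y ord0 i -> y ord0 i < - L + l%:R * h + h -> (k <= l)%N.
    move=> k1 l1; rewrite -ltnS -(ltr_nat R) -natr1 -(ltr_pM2r h0); lra.
  by apply/eqP; rewrite eqn_leq !ltn.
have mQ p : measurable (Q p) by exact: measurable_cube.
exists I, P, Q, (h ^+ m)^-1; split=> //.
- by rewrite invr_ge0 exprn_ge0// ltW.
- by move=> p; rewrite /Q lebesgue_rV_cube// ltry.
move=> f tff.
apply: (@le_trans _ _ (\sum_(p | P p) ip mu (Q p) f f)).
  apply: (@ip_cover _ _ _ _ setT) => //; first exact: tf_L2r.
  move=> y /cov[p Pp Qy]; exists p; split=> //; exact: mem_index_enum.
apply: (@le_trans _ _ (\sum_(p | P p) ((h ^+ m)^-1 * (\int[mu]_(y in Q p) f y) ^+ 2 +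
    (2 ^+ m * m%:R * h ^+ 2) * gradip (Q p) (jet f)))).
  by apply: ler_sum => p _; exact: cube_poincare.
rewrite big_split /= -!mulr_sumr addrC lerD2r.
have g0 := gradip_ge0 O (jet f).
apply: (@le_trans _ _ ((2 ^+ m * m%:R * h ^+ 2) * gradip O (jet f))).
  apply: ler_wpM2l.
    by apply: mulr_ge0; [apply: mulr_ge0 => //; exact: exprn_ge0|exact: sqr_ge0].
  by apply: gradip_disjoint_le => //; apply: L2jet_jet tff.
rewrite ler_wpM2r//; apply: (@le_trans _ _ (c * h)); last by rewrite mulrC -ler_pdivlMr.
apply: ler_pM; [|exact: sqr_ge0|by rewrite /c lerDl|].
  by apply: mulr_ge0 => //; exact: exprn_ge0.
by rewrite expr2 ler_piMr// ltW.
Qed.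

Lemma dot_enorm (y : E) : dot y y = enorm y ^+ 2.
Proof. by rewrite /enorm sqr_sqrtr// sumr_ge0// => i _; rewrite -expr2 sqr_ge0. Qed.

Lemma dotDl (y z e : E) : dot (y + z) e = dot y e + dot z e.
Proof. by rewrite /dot -big_split; apply: eq_bigr => i _ /=; rewrite mxE mulrDl. Qed.

Lemma dotZl (t : R) (y e : E) : dot (t *: y) e = t * dot y e.
Proof. by rewrite /dot mulr_sumr; apply: eq_bigr => i _; rewrite mxE mulrA. Qed.

Lemma continuous_dot (e : E) : continuous (fun y : E => dot y e).
Proof.
move=> y; apply: cont_sum => i _; apply: contM; [exact: continuous_coord|exact: cont_cst].
Qed.

Lemma enorm1_norm (e : E) : enorm e = 1 -> `|e| <= 1.
Proof.
move=> e1; apply/norm_leP => // i; have := dot_enorm e; rewrite e1 expr1n => h.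
have : e ord0 i ^+ 2 <= 1.
  rewrite -h /dot (bigD1 i)//= expr2 lerDl sumr_ge0// => j _.
  by rewrite -expr2 sqr_ge0.
by rewrite -real_normK ?num_real// expr_le1.
Qed.

Lemma lipschitz_continuous_rV (phi : E -> R) (L : R) :
  (forall y z, `|phi y - phi z| <= L * enorm (y - z)) -> continuous phi.
Proof.
move=> h; have hm y z : `|phi y - phi z| <= `|L| * Num.sqrt m%:R * `|y - z|.
  apply: le_trans (h y z) _; apply: (@le_trans _ _ (`|L| * enorm (y - z))).
    by rewrite ler_wpM2r ?sqrtr_ge0// ler_norm.
  rewrite -mulrA ler_wpM2l// /enorm.
  rewrite -[`|y - z|]ger0_norm// -sqrtr_sqr -sqrtrM// ler_wsqrtr//.
  exact: dot_sup_bound.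
move=> y; apply/(@cvgrPdist_lt _ _ _ (nbhs y)) => e e0.
set c := `|L| * Num.sqrt m%:R in hm; have c0 : 0 <= c by rewrite mulr_ge0// sqrtr_ge0.
have d0 : 0 < e / (c + 1) by rewrite divr_gt0// ltr_wpDl.
apply/nbhs_ballP; exists (e / (c + 1)) => // z; rewrite ball_rVE => yz.
apply: le_lt_trans (hm y z) _; move: yz; rewrite ltr_pdivlMr ?ltr_wpDl// => yz.
by apply: le_lt_trans yz; rewrite mulrC ler_wpM2l// lerDl.
Qed.

Definition height (e : E) (phi : E -> R) (z : E) : R := dot z e - phi (z - dot z e *: e).

Lemma continuous_height (e : E) (phi : E -> R) : continuous phi -> continuous (height e phi).
Proof.
move=> cphi z; have cP : {for z, continuous (fun z : E => phi (z - dot z e *: e))}.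
  apply: (@continuous_comp _ _ _ (fun z : E => z - dot z e *: e) phi); last exact: cphi.
  apply: (@cvgB _ _ _ (nbhs z) _ id (fun z : E => dot z e *: e)); first exact: cvg_id.
  by apply: cvgZ; [exact: continuous_dot|exact: cvg_cst].
exact: (contB (@continuous_dot e z) cP).
Qed.

(** The points strictly above the graph form an open set free of points of [D], so the closure lies
    on or below the graph. *)
Lemma lipschitz_boundary_above D p : open D -> lipschitz_boundary D -> closure D p -> ~ D p ->
  exists (e : E) (phi : E -> R) (r : R), [/\ enorm e = 1, continuous phi, 0 < r,
    forall y, ball p r y -> (D y <-> dot y e < phi (y - dot y e *: e)) &
    forall y, ball p r y -> (closure D y -> dot y e <= phi (y - dot y e *: e))].
Proof.
move=> oD lip clDp nDp; have [|e [phi [L [e1 /lipschitz_continuous_rV cphi]]]] := lip p clDp.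
  by move=> /interior_subset.
move=> /nbhs_ballP[r /= r0 hr]; exists e, phi, r; split=> // y py clDy.
rewrite leNgt; apply/negP => hy.
pose F := height e phi; have cF : continuous F by exact: continuous_height.
have : nbhs y ([set z | 0 < F z] `&` ball p r).
  apply: filterI; last by apply: open_nbhs_nbhs; split=> //; exact: ball_open.
  apply: (cF y [set t | 0 < t]); apply: open_nbhs_nbhs; split; first exact: open_gt.
  by rewrite /= /F /height subr_gt0.
move=> /clDy[z [Dz [/= Fz pz]]]; have := (hr z pz).1 Dz.
by move: Fz; rewrite /F /height subr_gt0 => h1 h2; have := lt_trans h1 h2; rewrite ltxx.
Qed.

Lemma dot_shift (e y : E) (t : R) : enorm e = 1 ->
  dot (y + t *: e) e = dot y e + t /\
  (y + t *: e) - dot (y + t *: e) e *: e = y - dot y e *: e.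
Proof.
move=> e1; have -> : dot (y + t *: e) e = dot y e + t.
  by rewrite dotDl dotZl dot_enorm e1 expr1n mulr1.
by split=> //; rewrite scalerDl opprD addrACA subrr addr0.
Qed.

(** No boundary condition holds at the hole. A point [y] beside it is compared with [y + tau e],
    which has height at least [tau] over the graph and so lies in a compact set away from
    [closure D]; the difference costs [tau^2] times the gradient. *)
Lemma boundary_estimate D p : open D -> lipschitz_boundary D -> closure D p -> ~ D p ->
  exists2 r : R, 0 < r & forall tau : R, 0 < tau -> tau < r ->
    exists2 K, compact K /\ K `<=` ~` closure D &
    forall f, tf f -> ip mu (ball p r `\` closure D) f f <=
      2 * tau ^+ 2 * gradip (~` closure D) (jet f) + 2 * ip mu K f f.
Proof.
move=> oD lip clDp nDp.
have [e [phi [r [e1 cphi r0 rD rclD]]]] := lipschitz_boundary_above oD lip clDp nDp.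
have en := enorm1_norm e1.
exists (r / 4); first by rewrite divr_gt0.
move=> tau tau0 taur; pose F := height e phi; have cF : continuous F by exact: continuous_height.
have Fs y t : F (y + t *: e) = F y + t.
  by rewrite /F /height; have [-> ->] := dot_shift y t e1; rewrite addrAC.
pose K := [set z : E | `|p - z| <= r / 2] `&` [set z | tau <= F z].
have Kcl : K `<=` ~` closure D.
  move=> z [/= pz tF] /rclD; rewrite ball_rVE => h.
  have : dot z e <= phi (z - dot z e *: e) by apply: h; apply: le_lt_trans pz _; lra.
  by move=> h'; have : F z <= 0 by [rewrite /F /height subr_le0]; lra.
have cK : compact K.
  apply: compact_closedI; first exact: closed_ball_rV_compact.
  rewrite (_ : mkset _ = F @^-1` [set t | tau <= t])//.
  apply: preimage_closed; last exact: closed_ge.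
  by move=> z _; exact: cF.
exists K => // f tff; set A := _ `\` _.
have mclD : measurable (closure D) by apply: closed_measurable_rV; exact: closed_closure.
have mA : measurable A by apply: measurableD => //; exact: measurable_ball_rV.
have FA y : A y -> 0 <= F y.
  move=> [py ncl]; rewrite /F /height subr_ge0 leNgt; apply/negP => /(rD y _).2 h; apply: ncl.
  apply: subset_closure; apply: h; apply: le_ball py; lra.
have pA y t : A y -> 0 <= t <= tau -> `|p - (y + t *: e)| <= r / 2.
  move=> [py _] /andP[t0 t1]; move: py; rewrite ball_rVE => py.
  rewrite opprD addrA; apply: le_trans (ler_normB _ _) _.
  rewrite normrZ ger0_norm//; have : t * `|e| <= tau * 1 by apply: ler_pM.
  lra.
have h1 := @shift_estimate_ip f (tau *: e) A (~` closure D) tff mA (measurableC mclD).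
have /h1 {}h1 : forall y (t : R), A y -> 0 <= t <= 1 -> (~` closure D) (y + t *: (tau *: e)).
  move=> y t Ay /andP[t0 t1]; rewrite scalerA.
  have tt : 0 <= t * tau <= tau by rewrite mulr_ge0 ?(ltW tau0)// ler_piMl// ltW.
  have [->|tn0] := eqVneq t 0; first by rewrite mul0r scale0r addr0; case: Ay.
  have tp : 0 < t * tau by rewrite mulr_gt0// lt_def tn0.
  move=> /rclD h; have : dot (y + (t * tau) *: e) e <= phi (y + (t * tau) *: e - dot (y + (t * tau) *: e) e *: e).
    by apply: h; rewrite ball_rVE; apply: le_lt_trans (pA _ _ Ay tt) _; lra.
  move=> h'; have : F (y + (t * tau) *: e) <= 0 by rewrite /F /height subr_le0.
  by rewrite Fs; have := FA y Ay; lra.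
have h2 := @ip_shift_le A K (tau *: e) f tff mA (compact_measurable_rV cK).
have /h2 {}h2 : forall y, A y -> K (y + tau *: e).
  move=> y Ay; split=> /=; first by apply: pA => //; rewrite lexx ltW.
  by rewrite Fs; have := FA y Ay; lra.
have l1 := tf_L2r mA tff; have l2 := tf_shift_L2r (tau *: e) mA tff.
have h3 := @ip_le_sqr _ _ _ mu A mA f _ l1 l2.
have h4 : ip mu A (fun y => f y - f (y + tau *: e)) (fun y => f y - f (y + tau *: e)) =
    ip mu A (fun y => f (y + tau *: e) - f y) (fun y => f (y + tau *: e) - f y).
  by apply: eq_Rintegral => y _; ring.
rewrite h4 in h3.
have h5 : dot (tau *: e) (tau *: e) = tau ^+ 2.
  by rewrite dotZl {1}/dot; under eq_bigr do rewrite mxE mulrCA;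
     rewrite -mulr_sumr -/(dot e e) dot_enorm e1 expr1n mulr1 expr2.
rewrite h5 in h1; apply: (le_trans h3); rewrite -mulrA lerD// ler_pM2l//.
Qed.

Lemma compact_ball_cover K (rad : E -> R) : compact K -> (forall p, 0 < rad p) ->
  exists2 s : seq E, (forall p, p \in s -> K p) &
    forall y, K y -> exists2 p, p \in s & ball p (rad p) y.
Proof.
move=> cK rad0; move: (cK); rewrite compact_cover => /(_ E K (fun p => ball p (rad p))).
case=> [p _|y Hy|S SP KS]; first exact: ball_open.
  by exists y => //; apply: ballxx.
exists (finmap.enum_fset S) => [p /SP|y /KS[p /= pS py]]; first by rewrite inE.
by exists p.
Qed.

(** Finitely many collars cover the boundary of [D]; the rest is compact and off [closure D], where
    [interior_estimate] applies. At the outer boundary, test functions of [Omega] extend by zero. *)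
Lemma finite_rank_estimate Omega D (e : R) : open Omega -> bounded_set Omega ->
  open D -> lipschitz_boundary D -> closure D `<=` Omega -> 0 < e ->
  exists (I : finType) (P : pred I) (Q : I -> set E) (C : R),
  [/\ 0 <= C, forall i, measurable (Q i), forall i, (mu (Q i) < +oo)%E,
      forall i, P i -> Q i `<=` Omega `\` closure D &
      forall f, test_function Omega f ->
        ip mu (Omega `\` closure D) f f <= e * gradip (Omega `\` closure D) (jet f) +
        C * \sum_(i | P i) (\int[mu]_(y in Q i) f y) ^+ 2].
Proof.
move=> oO bO oD lip DO e0; set U := _ `\` _.
have [M M0 OM] := bounded_setP bO.
have clD : closed (closure D) by exact: closed_closure.
have mclD := closed_measurable_rV clD.
have mU : measurable U by apply: measurableD => //; exact: open_measurable_rV.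
have cD : compact (closure D) by apply: (@compact_rV _ _ _ M) => // y /DO/OM.
pose bd := closure D `&` ~` D.
have cbd : compact bd.
  by apply: compact_closedI => //; exact: open_closedC.
have ex_rad p : exists r : R, 0 < r /\ (bd p -> forall tau : R, 0 < tau -> tau < r ->
    exists2 K, compact K /\ K `<=` ~` closure D &
    forall f, tf f -> ip mu (ball p r `\` closure D) f f <=
      2 * tau ^+ 2 * gradip (~` closure D) (jet f) + 2 * ip mu K f f).
  have [[h1 h2]|nb] := pselect (bd p); last by exists 1; split=> // /nb.
  by have [r r0 h] := boundary_estimate oD lip h1 h2; exists r; split=> // _.
have [rad radP] := choice ex_rad.
have [s sbd bds] := compact_ball_cover cbd (fun p => (radP p).1).
have [d d0 dP] : exists2 d : R, 0 < d & forall p, p \in s -> d <= rad p.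
  elim: (s) => [|p s' [d d0 dP]]; first by exists 1.
  exists (Num.min d (rad p)); first by rewrite lt_min d0 (radP p).1.
  move=> q; rewrite inE => /orP[/eqP ->|/dP h]; first by rewrite ge_min lexx orbT.
  by rewrite ge_min h.
pose N : R := (size s)%:R; have N0 : 0 <= N by [].
(* The [N] collars cost [2 N tau^2] times the gradient, at most [e / 2]. The compact sets enter with
   total weight [1 + 2 N] and are estimated with [e / (2 (1 + 2 N))]. *)
pose tau := Num.min (d / 2) (Num.min 1 (e / (4 * (N + 1)))).
have N1 : 0 < N + 1 by rewrite ltr_wpDl.
have tau0 : 0 < tau by rewrite !lt_min ltr01 !divr_gt0// mulr_gt0.
have taud : tau < d by rewrite !gt_min gtr_pMr// invf_lt1// ltr1n.
have tau2 : 4 * (N + 1) * tau ^+ 2 <= e.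
  have t1 : tau <= 1 by rewrite !ge_min lexx orbT.
  have t2 : tau <= e / (4 * (N + 1)) by rewrite !ge_min lexx !orbT.
  move: t2; rewrite ler_pdivlMr ?mulr_gt0// => t2; apply: le_trans t2.
  by rewrite mulrC ler_pM2r ?mulr_gt0// expr2 ler_piMl// ltW.
have ex_K p : exists K, (compact K /\ K `<=` ~` closure D) /\ (p \in s ->
    forall f, tf f -> ip mu (ball p (rad p) `\` closure D) f f <=
      2 * tau ^+ 2 * gradip (~` closure D) (jet f) + 2 * ip mu K f f).
  have [ps|nps] := boolP (p \in s); last by exists set0; split; [split=> //; exact: compact0|].
  have [K KP h] := (radP p).2 (sbd p ps) tau tau0 (lt_le_trans taud (dP p ps)).
  by exists K.
have [Kf KfP] := choice ex_K.
pose balls := \bigcup_(p in [set p | p \in s]) ball p (rad p).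
pose K0 := [set y : E | `|0 - y| <= M] `&` ~` (D `|` balls).
have cK0 : compact K0.
  apply: compact_closedI; first exact: closed_ball_rV_compact.
  apply: open_closedC; apply: openU => //; apply: bigcup_open => p _; exact: ball_open.
have K0D : K0 `<=` ~` closure D.
  move=> y [_ nDb] clDy; apply: nDb; have [Dy|nDy] := pselect (D y); first by left.
  by right; have [p ps py] := bds y (conj clDy nDy); exists p.
pose K := K0 `|` [set y | exists2 p, p \in s & Kf p y].
have cK : compact K by apply: compactU => //; apply: compact_bigU => p; exact: (KfP p).1.1.
have KD : K `<=` ~` closure D by move=> y [/K0D//|[p _ /(KfP p).1.2]].
have mK := compact_measurable_rV cK.
have oDc : open (~` closure D) by exact: closed_openC.
have e'0 : 0 < e / (2 * (1 + 2 * N)) by rewrite divr_gt0// mulr_gt0// ltr_wpDr// mulr_ge0.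
have [I [P [Q [C [C0 mQ Qfin QD hQ]]]]] := interior_estimate cK oDc KD e'0.
exists I, P, (fun i => Q i `&` Omega), ((1 + 2 * N) * C).
have mO := open_measurable_rV oO.
split.
- by rewrite mulr_ge0// addr_ge0// mulr_ge0.
- by move=> i; exact: measurableI.
- move=> i; apply: le_lt_trans (Qfin i); apply: le_measure; rewrite ?inE//.
  exact: measurableI.
- by move=> i Pi y [/(QD i Pi)].
move=> f tfO; have tff := test_functionT tfO.
have [sf [L cL [LO f0]]] := tfO.
have zero_off (A : set E) (g : E -> R) : (forall y, ~ L y -> g y = 0) ->
    \int[mu]_(y in A) g y = \int[mu]_(y in A `&` Omega) g y.
  move=> g0; rewrite [LHS]Rintegral_mkcond [RHS]Rintegral_mkcond; apply: eq_Rintegral => y _.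
  rewrite !patchE in_setI; case: (y \in A) => //=; case: ifPn => // /negP yO.
  by apply: g0 => /LO Oy; apply: yO; apply/mem_set.
have gE : gradip (~` closure D) (jet f) = gradip U (jet f).
  have UE : U = ~` closure D `&` Omega by rewrite /U setDE setIC.
  apply: eq_bigr => i _; rewrite jet_lift /ip UE; apply: zero_off.
  by move=> y nL; rewrite (partial_zero_off i (compact_closed_rV cL) f0 nL) mul0r.
pose A (o : option E) := if o is Some p then ball p (rad p) `\` closure D else K0.
have mA o : measurable (A o).
  case: o => [p|]; last exact: compact_measurable_rV.
  by apply: measurableD => //; exact: measurable_ball_rV.
apply: (@le_trans _ _ (\sum_(o <- None :: map Some s | true) ip mu (A o) f f)).
  apply: (@ip_cover _ _ _ _ setT) => //; first exact: tf_L2r.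
  move=> y [Oy ncl]; have [[p ps py]|nb] := pselect (balls y).
    by exists (Some p); split=> //; rewrite inE /= mem_map// => a b [].
  exists None; split=> //; split; first by rewrite /= sub0r normrN; exact: OM.
  by move=> [/subset_closure|].
rewrite big_cons big_map.
have i0 : ip mu (A None) f f <= ip mu K f f.
  have KK : A None `<=` K by move=> y; left.
  exact: ip_subset mK (mA None) KK (tf_L2r mK tff).
have i1 : \sum_(p <- s) ip mu (A (Some p)) f f <=
    N * (2 * tau ^+ 2 * gradip U (jet f) + 2 * ip mu K f f).
  apply: (@le_trans _ _ (\sum_(p <- s) (2 * tau ^+ 2 * gradip U (jet f) + 2 * ip mu K f f))).
    rewrite big_seq [leRHS]big_seq; apply: ler_sum => p ps.
    have := (KfP p).2 ps f tff; rewrite gE => /le_trans; apply; rewrite lerD2l ler_pM2l//.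
    have KK : Kf p `<=` K by move=> y; right; exists p.
    exact: ip_subset mK (compact_measurable_rV (KfP p).1.1) KK (tf_L2r mK tff).
  set t := 2 * tau ^+ 2 * _ + _; rewrite /N; elim: (s) => [|p s' IH].
    by rewrite big_nil mul0r.
  by rewrite big_cons /= -natr1 mulrDl mul1r addrC lerD2r.
apply: (le_trans (lerD i0 i1)).
have := hQ f tff; rewrite gE.
rewrite [X in _ <= _ + _ * X](_ : _ = \sum_(i | P i) (\int[mu]_(y in Q i `&` Omega) f y) ^+ 2); last first.
  by apply: eq_bigr => i _; rewrite zero_off.
set S := \sum_(i | P i) _; set G := gradip U _; set X := ip mu K f f => hX.
have G0 : 0 <= G by exact: gradip_ge0.
have h1 : (1 + 2 * N) * X <= e / 2 * G + (1 + 2 * N) * C * S.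
  have NN : 0 < 1 + 2 * N by rewrite ltr_wpDr// mulr_ge0.
  have := ler_wpM2l (ltW NN) hX; rewrite mulrDr !mulrA.
  by rewrite (_ : (1 + 2 * N) * e / (2 * (1 + 2 * N)) = e / 2)//; field; rewrite gt_eqF.
have h2 : N * (2 * tau ^+ 2 * G) <= e / 2 * G.
  rewrite mulrA ler_wpM2r//; have := sqr_ge0 tau; lra.
have -> : X + N * (2 * tau ^+ 2 * G + 2 * X) = (1 + 2 * N) * X + N * (2 * tau ^+ 2 * G) by ring.
lra.
Qed.

End finite_rank_estimate.

(** * Null sets *)

Section null_sets.
Context {R : realType} {m : nat}.
Local Notation E := 'rV[R]_m.
Local Notation mu := (@lebesgue_rV R m).
Implicit Types (A K O U Q D Omega : set E) (y s : E).

Lemma finite_union_null (I : eqType) (s : seq I) (F : I -> set E) A : measurable A ->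
  (forall i, measurable (F i)) -> (forall i, i \in s -> mu (F i) = 0%E) ->
  (forall y, A y -> exists2 i, i \in s & F i y) -> mu A = 0%E.
Proof.
move=> mA mF F0; elim: s F0 A mA => [|i s IH] F0 A mA cov.
  rewrite (_ : A = set0) ?measure0//; apply/seteqP; split=> // y Ay.
  by have [j] := cov y Ay; rewrite in_nil.
have mD : measurable (A `\` F i) by exact: measurableD.
apply/eqP; rewrite eq_le measure_ge0 andbT.
apply: (@le_trans _ _ (mu (F i `|` (A `\` F i)))).
  apply: le_measure; rewrite ?inE//; first exact: measurableU.
  by move=> y Ay; have [Fy|nFy] := pselect (F i y); [left|right].
apply: (@le_trans _ _ (mu (F i) + mu (A `\` F i))%E); first exact: measureU2.
rewrite F0 ?mem_head// add0e (IH _ (A `\` F i))//.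
  by move=> j js; apply: F0; rewrite inE js orbT.
move=> y [/cov [j]]; rewrite inE => /orP[/eqP -> //|js Fj _].
by exists j.
Qed.

(** Near one of its points the boundary lies where [height] is 0, and translation by [t e] raises
    the height by [t]. The translates by [e / (n + 1)] are therefore disjoint. *)
Lemma boundary_null D : open D -> bounded_set D -> lipschitz_boundary D ->
  mu (closure D `\` D) = 0%E.
Proof.
move=> oD bD lip; have [M M0 DM] := bounded_setP bD.
have clD : closed (closure D) by exact: closed_closure.
have clDM y : closure D y -> `|y| <= M.
  have cM : closed [set z : E | `|0 - z| <= M].
    by apply: compact_closed_rV; exact: closed_ball_rV_compact.
  have : closure D `<=` [set z : E | `|0 - z| <= M].
    by apply: subset_trans (closure_subset _) cM => z /DM; rewrite /= sub0r normrN.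
  by move=> h /h /=; rewrite sub0r normrN.
pose bd := closure D `\` D.
have cbd : compact bd.
  rewrite /bd setDE; apply: compact_closedI; first by apply: (@compact_rV _ _ _ M).
  exact: open_closedC.
have ex_rad p : exists r : R, 0 < r /\ (bd p -> mu (bd `&` ball p r) = 0%E).
  have [[h1 h2]|nb] := pselect (bd p); last by exists 1; split=> // /nb.
  have [e [phi [r [e1 cphi r0 rD rclD]]]] := lipschitz_boundary_above oD lip h1 h2.
  exists r; split=> // _.
  pose t n : R := n.+1%:R^-1.
  have bdh y : bd y -> ball p r y -> height e phi y = 0.
    move=> [cy ny] py; apply/eqP; rewrite /height subr_eq0 eq_le rclD//= leNgt.
    by apply/negP => /(rD y py).2.
  apply: (@disjoint_translates_null _ _ _ (fun n => t n *: e) M 1).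
  - apply: measurableI; [exact: compact_measurable_rV|exact: measurable_ball_rV].
  - by move=> y [[/clDM]].
  - move=> n; rewrite normrZ ger0_norm; last by rewrite invr_ge0.
    rewrite -[leRHS]mulr1; apply: ler_pM => //; first by rewrite invr_ge0.
      by rewrite invf_le1// ler1n.
    exact: enorm1_norm.
  - move=> i j y ij [by1 py1] [by2 py2].
    have := bdh _ by2 py2; rewrite -addrA -scalerBl /height.
    have [-> ->] := dot_shift y (t i - t j) e1.
    have := bdh _ by1 py1; rewrite /height => h0.
    rewrite addrAC h0 add0r => /eqP; rewrite subr_eq0 => /eqP/invr_inj/eqP.
    by rewrite eqr_nat eqSS ltn_eqF.
have [rad radP] := choice ex_rad.
have [s sbd bds] := compact_ball_cover cbd (fun p => (radP p).1).
have mb p : measurable (bd `&` ball p (rad p)).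
  by apply: measurableI; [exact: compact_measurable_rV|exact: measurable_ball_rV].
apply: (@finite_union_null _ s _ _ (compact_measurable_rV cbd) mb).
  by move=> p ps; exact: (radP p).2 (sbd p ps).
by move=> y bdy; have [p ps py] := bds y bdy; exists p.
Qed.

(** In dimension at least 2 some coordinate vector [e] is not a multiple of [b], and distinct
    translates of the segment along [e] are disjoint. *)
Lemma segment_null (a b : E) (t t' : R) : (1 < m)%N ->
  let S := (fun s : R => a + s *: b) @` `[t, t'] in compact S /\ mu S = 0%E.
Proof.
move=> m1 S.
have cS : compact S.
  apply: continuous_compact; last exact: segment_compact.
  apply: continuous_subspaceT => s; apply: cvgD; first exact: cvg_cst.
  by apply: cvgZ; [exact: cvg_id|exact: cvg_cst].
split=> //.
have [M M0 SM] := compact_bounded_rV cS.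
have [e e1 eb] : exists2 e : E, `|e| <= 1 & forall c : R, c *: b <> e /\ e <> 0.
  pose i0 := Ordinal (ltnW m1); pose i1 := Ordinal m1.
  have [b0|b0] := eqVneq (b ord0 i0) 0.
    exists (delta_mx ord0 i0) => [|c]; first exact: norm_delta.
    split=> /(congr1 (fun z : E => z ord0 i0)); rewrite !mxE ?b0 ?mulr0 eqxx /=.
      by move/eqP; rewrite eq_sym oner_eq0.
    by move/eqP; rewrite oner_eq0.
  exists (delta_mx ord0 i1) => [|c]; first exact: norm_delta.
  split=> [h|/(congr1 (fun z : E => z ord0 i1))]; last first.
    by rewrite !mxE eqxx /= => /eqP; rewrite oner_eq0.
  have := congr1 (fun z : E => z ord0 i0) h; rewrite !mxE eqxx /= => /eqP.
  rewrite mulf_eq0 (negbTE b0) orbF => /eqP c0.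
  have := congr1 (fun z : E => z ord0 i1) h; rewrite !mxE eqxx /= c0 mul0r => /eqP.
  by rewrite eq_sym oner_eq0.
apply: (@disjoint_translates_null _ _ _ (fun n => n.+1%:R^-1 *: e) M 1).
- exact: compact_measurable_rV.
- exact: SM.
- move=> n; rewrite normrZ ger0_norm ?invr_ge0// -[leRHS]mulr1; apply: ler_pM => //.
  by rewrite invf_le1// ler1n.
move=> i j y ij [s _ <-] [s' _ /eqP].
rewrite -(addrA (a + s *: b)) -scalerBl -addrA (inj_eq (addrI _)) => /eqP.
set c := _ - _ => h; have c0 : c != 0.
  rewrite subr_eq0; apply/eqP => /invr_inj/eqP.
  by rewrite eqr_nat eqSS ltn_eqF.
have := (eb (c^-1 * (s' - s))).1; apply.
by rewrite -scalerA scalerBl h addrAC subrr add0r scalerA mulVf// scale1r.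
Qed.

Lemma needle_null (sigma : R -> E) : (1 < m)%N -> {within `[0, 1], continuous sigma} ->
  piecewise_linear sigma ->
  compact (sigma @` `[0, 1]) /\ mu (sigma @` `[0, 1]) = 0%E.
Proof.
move=> m1 cs [p [t [t0 tp tS lin]]].
have cS : compact (sigma @` `[0, 1]).
  by apply: continuous_compact => //; exact: segment_compact.
split=> //.
have ex_ab j : exists ab : E * E, (j < p)%N -> {in `[t j, t j.+1], forall s : R, sigma s = ab.1 + s *: ab.2}.
  have [jp|jp] := ltnP j p; last by exists (0, 0).
  by have [a [b h]] := lin j jp; exists (a, b).
have [ab abP] := choice ex_ab.
pose F j := (fun s : R => (ab j).1 + s *: (ab j).2) @` `[t j, t j.+1].
have FP j := segment_null (ab j).1 (ab j).2 (t j) (t j.+1) m1.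
have cov n (u : R) : (n <= p)%N -> t 0%N <= u -> u <= t n -> (0 < n)%N ->
    exists2 j, (j < n)%N & t j <= u <= t j.+1.
  elim: n => // n IH np u0 un _; have [h|h] := leP (t n) u; first by exists n => //; rewrite h.
  have [n0|n0] := posnP n; first by move: h; rewrite n0 ltNge u0.
  by have [j jn jP] := IH (ltnW np) u0 (ltW h) n0; exists j => //; exact: ltnW.
have p0 : (0 < p)%N by rewrite lt0n; apply/eqP => p0; move: tp; rewrite p0 t0 => /eqP; rewrite eq_sym oner_eq0.
apply: (@finite_union_null _ (iota 0 p) F).
- exact: compact_measurable_rV.
- by move=> j; exact: compact_measurable_rV (FP j).1.
- by move=> j _; exact: (FP j).2.
move=> y [u /=]; rewrite in_itv /= => /andP[u0 u1] <-{y}.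
have [|||j jp uj] := cov p u (leqnn p); rewrite ?t0 ?tp//.
exists j; first by rewrite mem_iota.
by exists u; [rewrite /= in_itv|rewrite (abP j jp)].
Qed.

End null_sets.

(** * The indicator as an energy *)

Section correction.
Context {R : realType} {m : nat}.
Local Notation E := 'rV[R]_m.
Local Notation C := R[i].
Local Notation mu := (@lebesgue_rV R m).
Local Notation J := ('I_m.+1 -> E -> R).
Implicit Types (f g phi psi : E -> R) (K U A Omega D : set E) (W Z : J) (u v w : E -> C).

Lemma nth_map_prop (I T : Type) (f : I -> T) (x0 : T) (P : T -> Prop) (s : seq I) n :
  (forall i, P (f i)) -> (n < size [seq f i | i <- s])%N -> P (nth x0 [seq f i | i <- s] n).
Proof. by move=> Pf; elim: s n => [|i s IH] [|n] //= /IH. Qed.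

Lemma jform0E U W : jform 0 U W W = gradip U W.
Proof. by rewrite /jform mul0r add0r. Qed.

Lemma le_of_le_eps (x y M : R) : (forall e : R, 0 < e -> x <= y + M * e) -> x <= y.
Proof.
move=> h; apply/ler_addgt0Pr => e e0.
have M1 : 0 < `|M| + 1 by rewrite ltr_wpDl.
apply: le_trans (h (e / (`|M| + 1)) (divr_gt0 e0 M1)) _; rewrite lerD2l.
rewrite mulrA ler_pdivrMr// mulrC ler_pM2l//.
by have := ler_norm M; lra.
Qed.

(** Density of test functions. The inequality [(a + b)^2 <= 2 a^2 + 2 b^2] is used twice on the way,
    which is why the estimate is taken with [e / 4] and the functionals carry the factor
    [sqrt (4 C)]. *)
Lemma finite_rank_estimate_Vjet Omega D (e : R) : open Omega -> bounded_set Omega ->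
  open D -> lipschitz_boundary D -> closure D `<=` Omega -> 0 < e ->
  let U := Omega `\` closure D in
  exists (ls : seq (J -> R)),
    (forall i, (i < size ls)%N -> linear_on (Vjet Omega U) (nth (fun=> 0) ls i) /\
      exists2 L, 0 <= L & forall W, Vjet Omega U W ->
        (nth (fun=> 0) ls i W) ^+ 2 <= L * jform 1 U W W) /\
    forall W, Vjet Omega U W ->
      ip mu U (W ord0) (W ord0) <= e * gradip U W + \sum_(l <- ls) l W ^+ 2.
Proof.
move=> oO bO oD lip DO e0 U.
have e4 : 0 < e / 4 by rewrite divr_gt0.
have [I [P [Q [C [C0 mQ Qfin QU est]]]]] := finite_rank_estimate oO bO oD lip DO e4.
have clD : closed (closure D) by exact: closed_closure.
have mU : measurable U.
  by apply: measurableD; [exact: open_measurable_rV|exact: closed_measurable_rV].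
have [M M0 OM] := bounded_setP bO.
have Ufin : (mu U < +oo)%E by apply: (@lebesgue_rV_bounded _ _ _ M) => // y [/OM].
have lQ i : L2r mu U (\1_(Q i)).
  have mi : measurable_fun U (\1_(Q i) : E -> R) by apply: measurable_indic.
  apply: (@L2r_bounded _ _ _ _ U mU _ 1 Ufin mi) => y _.
  by rewrite indicE ger0_norm// lern1 leq_b1.
pose l i (W : J) := Num.sqrt (4 * C) * ip mu U (W ord0) (\1_(Q i)).
have linV := linear_Vjet Omega mU.
have ll i : linear_on (Vjet Omega U) (l i).
  move=> a W Z [lW _] [lZ _]; rewrite /l [ip _ _ ((a *: W + Z) _) _]ip_linl//; ring.
have C4 : 0 <= 4 * C by rewrite mulr_ge0.
have lE i W : l i W ^+ 2 = 4 * C * ip mu U (W ord0) (\1_(Q i)) ^+ 2.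
  by rewrite exprMn sqr_sqrtr.
pose L i := 4 * C * ip mu U (\1_(Q i)) (\1_(Q i)).
have L0 i : 0 <= L i by rewrite mulr_ge0// ip_ge0.
have lL i W : Vjet Omega U W -> l i W ^+ 2 <= L i * jform 1 U W W.
  move=> [lW _]; rewrite lE /L -[leRHS]mulrA ler_wpM2l//.
  apply: le_trans (ip_discr mU (lW ord0) (lQ i)) _.
  by rewrite mulrC ler_wpM2l ?ip_ge0// ip_le_jform.
exists [seq l i | i <- enum P]; split.
  move=> n; apply: (@nth_map_prop _ _ l (fun=> 0) (fun l => linear_on (Vjet Omega U) l /\
    exists2 L, 0 <= L & forall W, Vjet Omega U W -> l W ^+ 2 <= L * jform 1 U W W)).
  by move=> i; split=> //; exists (L i) => // W; exact: lL.
move=> W VW; rewrite big_map big_enum /=.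
apply: (@le_of_le_eps _ _ (2 + e + \sum_(i | P i) L i)) => d d0.
have [phi tphi hphi] := VW.2 _ d0; have Vphi := Vjet_jet mU tphi.
have Vd := lsetB linV VW Vphi; set d' := W - jet phi in hphi Vd.
have h1 : ip mu U (W ord0) (W ord0) <= 2 * ip mu U (d' ord0) (d' ord0) + 2 * ip mu U phi phi.
  have := ip_le_sqr mU (VW.1 ord0) (Vphi.1 ord0); rewrite jet_ord0.
  by rewrite /d' !fctE jet_ord0.
have h2 := est phi tphi.
have pos0 Y : L2jet U Y -> 0 <= jform 0 U Y Y by move=> _; rewrite jform0E gradip_ge0.
have h3 : gradip U (jet phi) <= 2 * gradip U W + 2 * gradip U d'.
  rewrite -!jform0E (_ : jet phi = W - d'); last by rewrite /d' opprB addrC subrK.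
  exact: (form_sqrB_le2 (linear_L2jet mU) (bilinear_jform 0 mU) pos0 VW.1 Vd.1).
have h4 i : P i -> 4 * C * (\int[mu]_(y in Q i) phi y) ^+ 2 <= 2 * l i W ^+ 2 + 2 * (L i * jform 1 U d' d').
  move=> Pi; have -> : \int[mu]_(y in Q i) phi y = ip mu U (jet phi ord0) (\1_(Q i)).
    rewrite jet_ord0 /ip [LHS]Rintegral_mkcond [RHS]Rintegral_mkcond.
    apply: eq_Rintegral => y _; rewrite !patchE indicE.
    case: ifPn => [yQ|yQ]; last by case: ifP => // _; rewrite mulr0.
    by rewrite mem_set ?mulr1//; apply: (QU i Pi); exact: set_mem.
  rewrite -lE (_ : jet phi = W - d'); last by rewrite /d' opprB addrC subrK.
  rewrite (linear_onB (ll i) VW Vd); have := lL i _ Vd.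
  by have := sqr_ge0 (l i W + l i d'); nra.
have h5 : 2 * (C * \sum_(i | P i) (\int[mu]_(y in Q i) phi y) ^+ 2) <=
    \sum_(i | P i) l i W ^+ 2 + (\sum_(i | P i) L i) * jform 1 U d' d'.
  rewrite mulr_suml -big_split /= mulrA mulr_sumr; apply: ler_sum => i /h4; lra.
have h6 : gradip U d' <= jform 1 U d' d' by rewrite jformE lerDr mul1r ip_ge0.
have h7 := ip_le_jform U d' ord0.
have LL : 0 <= \sum_(i | P i) L i by apply: sumr_ge0.
set S := \sum_(i | P i) l i W ^+ 2 in h5 *; set T := \sum_(i | P i) L i in LL h5 *.
have h8 : T * jform 1 U d' d' <= T * d by rewrite ler_wpM2l// ltW.
have h9 : e * gradip U d' <= e * d by rewrite ler_pM2l//; apply: le_trans h6 (ltW hphi).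
have h10 : e / 4 * gradip U (jet phi) <= e / 4 * (2 * gradip U W + 2 * gradip U d').
  by rewrite ler_pM2l.
have gW := gradip_ge0 U W; have : 0 <= e * gradip U W by rewrite mulr_ge0// ltW.
lra.
Qed.

Lemma helmholtz_nonneg Omega U (k C0 : R) W : open U -> poincare_constant0 Omega U C0 ->
  k ^+ 2 * C0 ^+ 2 <= 1 -> Vjet Omega U W -> 0 <= jform (- k ^+ 2) U W W.
Proof.
move=> oU hC kC VW; have h := poincare0_real oU hC VW; rewrite jformE.
have := ler_wpM2l (sqr_ge0 k) h; have g := gradip_ge0 U W.
have : k ^+ 2 * C0 ^+ 2 * gradip U W <= 1 * gradip U W by rewrite ler_wpM2r.
lra.
Qed.

(** With [e = 1 / (2 (k^2 + 1))] the finite rank estimate reads [(k^2 + 1) |w|^2 <= |grad w|^2 / 2 +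
    (k^2 + 1) sum l^2]. The Helmholtz form with the functionals added is thus coercive with constant
    1/2, and the functionals are removed since the kernel is trivial. *)
Lemma helmholtz_coercive Omega D (k C0 : R) : open Omega -> bounded_set Omega ->
  open D -> lipschitz_boundary D -> closure D `<=` Omega ->
  let U := Omega `\` closure D in
  not_eigenvalue k Omega U -> poincare_constant0 Omega U C0 -> k ^+ 2 * C0 ^+ 2 <= 1 ->
  exists2 c, 0 < c & forall W, Vjet Omega U W -> c * jform 1 U W W <= jform (- k ^+ 2) U W W.
Proof.
move=> oO bO oD lip DO U ne hC kC.
have oU : open U by rewrite /U setDE; apply: openI => //; apply: closed_openC; exact: closed_closure.
have mU := open_measurable_rV oU; have linV := linear_Vjet Omega mU.
have K0 : 0 < k ^+ 2 + 1 by rewrite ltr_wpDl// sqr_ge0.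
have e0 : 0 < (2 * (k ^+ 2 + 1))^-1 by rewrite invr_gt0 mulr_gt0.
have [ls [lsP est]] := finite_rank_estimate_Vjet oO bO oD lip DO e0.
pose s := Num.sqrt (k ^+ 2 + 1).
have sE : s ^+ 2 = k ^+ 2 + 1 by rewrite sqr_sqrtr// ltW.
have half : 0 < 2^-1 :> R by rewrite invr_gt0.
have M0 : 0 < k ^+ 2 + 1 by [].
apply: (@coercive_remove_functionals _ _ (Vjet Omega U) (jform 1 U) (jform (- k ^+ 2) U)
  [seq (fun W => s * l W) | l <- ls] 2^-1 (k ^+ 2 + 1)) => //.
- exact: bilinear_Vjet.
- by move=> W _; exact: jform_ge0.
- exact: complete_Vjet.
- exact: bilinear_Vjet.
- by move=> W VW; exact: helmholtz_nonneg oU hC kC VW.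
- exact: not_eigenvalue_kernel.
- move=> W _; rewrite !jformE mul1r; have := gradip_ge0 U W; have := ip_ge0 mu U (W ord0).
  by have := sqr_ge0 k; nra.
- move=> i; rewrite size_map => ils; rewrite (nth_map (fun=> 0))//.
  have [li [L L0 lL]] := lsP i ils; split.
    by move=> a W Z VW VZ; rewrite li//; ring.
  exists ((k ^+ 2 + 1) * L) => [|W VW]; first by rewrite mulr_ge0// ltW.
  by rewrite exprMn sE -mulrA ler_wpM2l ?(ltW K0)// lL.
move=> W VW; rewrite big_map /=.
rewrite (eq_bigr (fun l : J -> R => (k ^+ 2 + 1) * l W ^+ 2)); last first.
  by move=> l _; rewrite exprMn sE.
rewrite -mulr_sumr !jformE mul1r.
have := ler_wpM2l (ltW K0) (est W VW).
rewrite mulrDr mulrA (_ : (k ^+ 2 + 1) * (2 * (k ^+ 2 + 1))^-1 = 2^-1); last first.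
  by field; rewrite gt_eqF.
have := ip_ge0 mu U (W ord0).
move: (ip mu U _ _) (gradip U W) (\sum_(l <- ls) _) => p g S p0 h.
have := sqr_ge0 k; nra.
Qed.

(** The form is the inner product of H^1 plus [c - 1] times that of L^2; both obey
    Cauchy-Schwarz. *)
Lemma jform_CS (c : R) U W Z : measurable U -> L2jet U W -> L2jet U Z ->
  jform c U W Z ^+ 2 <= (`|c - 1| + 1) ^+ 2 * (jform 1 U W W * jform 1 U Z Z).
Proof.
move=> mU lW lZ.
have bil := bilinear_jform 1 mU; have linL := @linear_L2jet R m U mU.
have pos Y : L2jet U Y -> 0 <= jform 1 U Y Y by move=> _; exact: jform_ge0.
have h1 := form_CS linL bil pos lW lZ.
have h2 := ip_discr mU (lW ord0) (lZ ord0).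
have p1 := ip_le_jform U W ord0; have p2 := ip_le_jform U Z ord0.
have h3 : ip mu U (W ord0) (Z ord0) ^+ 2 <= jform 1 U W W * jform 1 U Z Z.
  by apply: le_trans h2 _; apply: ler_pM => //; exact: ip_ge0.
have -> : jform c U W Z = (c - 1) * ip mu U (W ord0) (Z ord0) + jform 1 U W Z.
  by rewrite /jform; ring.
move: h1 h3; move: (ip mu U _ _) (jform 1 U W Z) (_ * _) => a b P h1 h3; set y := c - 1.
have P0 : 0 <= P by apply: le_trans h1; exact: sqr_ge0.
have yy : y ^+ 2 = `|y| ^+ 2 by rewrite real_normK// num_real.
have : y * (2 * a * b) <= `|y| * (2 * P).
  apply: le_trans (ler_norm _) _; rewrite normrM ler_wpM2l// ler_norml.
  by have := sqr_ge0 (a - b); have := sqr_ge0 (a + b); move=> ? ?; apply/andP; split; nra.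
have x0 : 0 <= `|y| by [].
have : `|y| ^+ 2 * a ^+ 2 <= `|y| ^+ 2 * P by rewrite ler_wpM2l// sqr_ge0.
rewrite sqrrD exprMn yy; nra.
Qed.

(** On [Vjet] the Helmholtz form is an inner product equivalent to that of H^1, so Riesz's theorem
    applies. *)
Lemma correction_exists Omega U (k c : R) : measurable U -> 0 < c ->
  (forall W, Vjet Omega U W -> c * jform 1 U W W <= jform (- k ^+ 2) U W W) ->
  forall W, L2jet U W -> exists2 w, Vjet Omega U w &
    forall Z, Vjet Omega U Z -> jform (- k ^+ 2) U w Z = - jform (- k ^+ 2) U W Z.
Proof.
move=> mU c0 coer W lW; have linV := linear_Vjet Omega mU.
have K0 : 0 < k ^+ 2 + 1 by rewrite ltr_wpDl// sqr_ge0.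
have [bilc1 bilc2] := bilinear_jform (- k ^+ 2) mU.
have ll : linear_on (Vjet Omega U) (fun Z => - jform (- k ^+ 2) U W Z).
  move=> a Z Z' VZ VZ'; have := form_linr (linear_L2jet mU) (bilinear_jform (- k ^+ 2) mU) lW.
  by move=> ->; [ring|exact: VZ.1|exact: VZ'.1].
pose CC := (`|- k ^+ 2 - 1| + 1) ^+ 2 * jform 1 U W W / c.
have [|||w Vw wP] := @riesz_representation _ _ (Vjet Omega U) (jform (- k ^+ 2) U) linV
    (bilinear_Vjet _ _ mU) _ _ CC _ ll.
- by move=> Z VZ; apply: le_trans (coer Z VZ); rewrite mulr_ge0 ?jform_ge0// ltW.
- apply: (@equivalent_complete _ _ _ (jform 1 U) _ c (k ^+ 2 + 1)) => //.
    exact: complete_Vjet.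
  move=> Z _; rewrite !jformE mul1r; have := gradip_ge0 U Z; have := ip_ge0 mu U (Z ord0).
  by have := sqr_ge0 k; nra.
- move=> Z VZ; rewrite sqrrN; apply: le_trans (jform_CS _ mU lW VZ.1) _.
  rewrite /CC [leLHS]mulrA -[leRHS]mulrA ler_wpM2l ?mulr_ge0 ?sqr_ge0 ?jform_ge0//.
  by rewrite mulrC ler_pdivlMr// mulrC; exact: coer.
by exists w.
Qed.

Lemma weak_gradientS Omega U W : U `<=` Omega -> weak_gradient Omega W -> weak_gradient U W.
Proof.
move=> UO wW i psi tpsi; have := wW i psi (test_functionS UO tpsi).
have [spsi [K cK [KU psi0]]] := tpsi.
have restr (g : E -> R) : (forall y, ~ K y -> g y = 0) ->
    \int[mu]_(y in U) g y = \int[mu]_(y in Omega) g y.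
  move=> g0; rewrite [LHS]Rintegral_mkcond [RHS]Rintegral_mkcond; apply: eq_Rintegral => y _.
  rewrite !patchE; case: ifPn => [yU|yU]; first by rewrite mem_set//; apply: UO; exact: set_mem.
  case: ifP => // _; rewrite g0// => /KU; move/negP: yU => h Uy; apply: h.
  exact: mem_set.
rewrite -!restr// => y nK; [by rewrite psi0 ?mulr0|].
by rewrite (partial_zero_off i (compact_closed_rV cK) psi0 nK) mulr0.
Qed.

Lemma L2jetS U A W : measurable U -> measurable A -> A `<=` U -> L2jet U W -> L2jet A W.
Proof. by move=> mU mA AU lW j; exact: L2rS (lW j). Qed.

Lemma H1S Omega U u : open Omega -> open U -> U `<=` Omega -> H1 Omega u ->
  [/\ H1 U u, ae_jet U (Rej U u) (Rej Omega u) & ae_jet U (Imj U u) (Imj Omega u)].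
Proof.
move=> oO oU UO hu; have mO := open_measurable_rV oO; have mU := open_measurable_rV oU.
have [lr li gr gi] := H1_jets oO hu.
apply: jets_H1 => //; try exact: (L2jetS mO mU UO); try exact: (weak_gradientS UO).
  by rewrite Rej0.
by rewrite Imj0.
Qed.

Lemma conjc_H1 U u : open U -> H1 U u ->
  [/\ H1 U (fun y => conjc (u y)), ae_jet U (Rej U (fun y => conjc (u y))) (Rej U u) &
      ae_jet U (Imj U (fun y => conjc (u y))) (- Imj U u)].
Proof.
move=> oU hu; have mU := open_measurable_rV oU.
have linL := @linear_L2jet R m U mU.
have [lr li gr gi] := H1_jets oU hu.
have nI : - Imj U u = 0 - Imj U u by rewrite sub0r.
apply: jets_H1 => //.
- by rewrite nI; apply: (lsetB linL) => //; exact: L2jet0.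
- by rewrite nI; apply: weak_gradientB => //; [exact: L2jet0|exact: weak_gradient0].
- by rewrite Rej0; apply/funext => y /=; case: (u y).
- by rewrite !fctE Imj0; apply/funext => y /=; case: (u y).
Qed.

(* With [R], [I] the jets of the real and imaginary parts of [v], the solution with
   data [conj v] is [(R + wR) - i (I + wI)]. *)
Lemma DN_energy k Omega U v wR wI : open U -> H1 U v ->
  Vjet Omega U wR -> Vjet Omega U wI ->
  (forall Z, Vjet Omega U Z -> jform (- k ^+ 2) U wR Z = - jform (- k ^+ 2) U (Rej U v) Z) ->
  (forall Z, Vjet Omega U Z -> jform (- k ^+ 2) U wI Z = - jform (- k ^+ 2) U (Imj U v) Z) ->
  let a := jform (- k ^+ 2) U in
  helmholtz_form k U (solution k Omega U (fun y => conjc (v y))) v =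
  (a (Rej U v) (Rej U v) - a wR wR + (a (Imj U v) (Imj U v) - a wI wI))%:C.
Proof.
move=> oU hv VR VI hR hI a; have mU := open_measurable_rV oU.
have linL := @linear_L2jet R m U mU; have bil := bilinear_jform (- k ^+ 2) mU.
have linV := linear_Vjet Omega mU.
have [lr li gr gi] := H1_jets oU hv; have lR := VR.1; have lI := VI.1.
set f := fun y => conjc (v y); have [hf fr fi] := conjc_H1 oU hv.
have [lfr lfi gfr gfi] := H1_jets oU hf.
(* A solution must be exhibited before [solution] is known to choose one. Afterwards only the
   defining properties of the chosen one are used. *)
have [u [wu hu]] : exists u, is_solution k Omega U f u.
  have lW : L2jet U (Rej U v + wR) by exact: (lsetD linL).
  have lZ : L2jet U (0 - (Imj U v + wI)).
    by apply: (lsetB linL); [exact: L2jet0|exact: (lsetD linL)].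
  have gW : weak_gradient U (Rej U v + wR).
    by rewrite -[X in X + _]scale1r; apply: weak_gradient_lin => //; exact: (Vjet_weak_gradient oU VR).
  have gZ : weak_gradient U (0 - (Imj U v + wI)).
    apply: weak_gradientB => //; [exact: L2jet0|exact: (lsetD linL)|exact: weak_gradient0|].
    by rewrite -[X in X + _]scale1r; apply: weak_gradient_lin => //; exact: (Vjet_weak_gradient oU VI).
  have [hu ur ui] := cplx_H1 oU lW lZ gW gZ; set u := cplx _ _ in hu ur ui.
  have [lur lui _ _] := H1_jets oU hu.
  have rfl (Y : J) : ae_jet U Y Y by move=> j; exact: ae_eq_refl.
  exists u; split.
    apply/(weak_helmholtzP _ _ _ oU); split=> // Z VZ; have lZ' := VZ.1.
    rewrite (ae_eq_jform _ lur lZ' lW lZ' mU ur (rfl Z)) (ae_eq_jform _ lui lZ' lZ lZ' mU ui (rfl Z)).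
    rewrite (formBl bil (L2jet0 mU))//; last exact: (lsetD linL).
    rewrite !(formDl bil)// jform0l// hR// hI//; split; ring.
  have [huf ufr ufi] := H1B oU hu hf; have [l1 l2 _ _] := H1_jets oU huf.
  apply/(H10P _ _ oU); split=> //.
    apply: (@ae_jet_Vjet _ _ Omega U wR) => // j; apply: ae_eq_sym.
    apply: filterS3 (ufr j) (ur j) (fr j) => y e1 e2 e3 Uy.
    by rewrite e1// !fctE e2// e3// !fctE; ring.
  apply: (@ae_jet_Vjet _ _ Omega U (0 - wI)) => //; last first.
    by apply: (lsetB linV) => //; exact: lset0.
  move=> j; apply: ae_eq_sym.
  apply: filterS3 (ufi j) (ui j) (fi j) => y e1 e2 e3 Uy.
  by rewrite e1// !fctE e2// e3// !fctE; ring.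
have [{}wu {}hu] : is_solution k Omega U f (solution k Omega U f).
  by apply: (xgetPex (fun=> 0)); exists u.
move: (solution k Omega U f) wu hu => {}u wu hu.
have [hu1 orth] := (weak_helmholtzP _ _ _ oU).1 wu.
have [lur lui _ _] := H1_jets oU hu1.
have [huf Vr Vi] := (H10P _ _ oU).1 hu.
have [_ ufr ufi] := H1B oU hu1 hf.
(* The differences between the solution and its datum, whose imaginary part is minus that of [v];
   hence the plus sign in [ZI]. *)
pose ZR := Rej U u - Rej U v; pose ZI := Imj U u + Imj U v.
have lZR : L2jet U ZR by exact: (lsetB linL).
have lZI : L2jet U ZI by exact: (lsetD linL).
have VZR : Vjet Omega U ZR.
  apply: (ae_jet_Vjet mU lZR _ Vr) => j.
  by apply: filterS2 (ufr j) (fr j) => y e1 e2 Uy; rewrite e1// !fctE e2.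
have VZI : Vjet Omega U ZI.
  apply: (ae_jet_Vjet mU lZI _ Vi) => j.
  by apply: filterS2 (ufi j) (fi j) => y e1 e2 Uy; rewrite e1// !fctE e2// !fctE opprK.
have uR : Rej U u = Rej U v + ZR by rewrite /ZR addrC subrK.
have uI : Imj U u = ZI - Imj U v by rewrite /ZI addrK.
have o1 := (orth _ VZR).1; have o2 := (orth _ VZI).1; have o3 := (orth _ VZR).2; have o4 := (orth _ VZI).2.
have o5 := (orth _ VR).1; have o6 := (orth _ VI).2.
rewrite helmholtz_formE//; apply/eqP; rewrite eq_complex /=; apply/andP; split; apply/eqP.
  (* [ZR] is not identified with [wR]: the orthogonality relations give [a(ZR, wR) = a(wR, wR)] and
     [a(ZR, Re v) = - a(wR, wR)], and the same with opposite signs for [ZI], [wI] and [Im v]. *)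
  have e1 := hR _ VZR; have e2 := hR _ VR; have e3 := hI _ VZI; have e4 := hI _ VI.
  move: o5 o6; rewrite uR uI (formDl bil lr lZR lR) (formBl bil lZI li lI) => o5 o6.
  rewrite (formDl bil lr lZR lr) (formBl bil lZI li li).
  have c1 := formC bil lZR lr; have c2 := formC bil lZI li.
  have c3 := formC bil lZR lR; have c4 := formC bil lZI lI.
  have c5 := formC bil lR lr; have c6 := formC bil lI li.
  rewrite /a; lra.
(* The imaginary part of the pairing is zero: with [v] written through [u] and the differences,
   orthogonality leaves two terms that cancel by symmetry. *)
have -> : Imj U v = ZI - Imj U u by rewrite uI opprB addrC subrK.
have -> : Rej U v = Rej U u - ZR by rewrite {1}uR addrK.
by rewrite (formBr linL bil lZI lui lur) (formBr linL bil lur lZR lui) o2 o3 (formC bil lui lur); ring.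
Qed.

Lemma jform_split (c : R) U A W Z : measurable U -> measurable A -> [disjoint U & A] ->
  L2jet (U `|` A) W -> L2jet (U `|` A) Z ->
  jform c (U `|` A) W Z = jform c U W Z + jform c A W Z.
Proof.
move=> mU mA UA lW lZ; rewrite /jform ip_setU//.
rewrite (eq_bigr (fun i => ip mu U (W (lift ord0 i)) (Z (lift ord0 i)) +
  ip mu A (W (lift ord0 i)) (Z (lift ord0 i)))); last by move=> i _; rewrite ip_setU.
by rewrite big_split /=; ring.
Qed.

(** Both maps are evaluated by [DN_energy]. Without the hole [v n] itself solves the problem, so the
    corrections are zero there; splitting [Omega] into [U] and [closure D] then cancels the exterior
    energy of [v n]. *)
Lemma indicatorE k Omega D (v : nat -> E -> C) n wR wI : open Omega -> closure D `<=` Omega ->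
  let U := Omega `\` closure D in let a := jform (- k ^+ 2) U in
  weak_helmholtz k Omega Omega (v n) -> Vjet Omega U wR -> Vjet Omega U wI ->
  (forall Z, Vjet Omega U Z -> a wR Z = - a (Rej Omega (v n)) Z) ->
  (forall Z, Vjet Omega U Z -> a wI Z = - a (Imj Omega (v n)) Z) ->
  let b := jform (- k ^+ 2) (closure D) in
  indicator k Omega D v n =
  (b (Rej Omega (v n)) (Rej Omega (v n)) + a wR wR +
   (b (Imj Omega (v n)) (Imj Omega (v n)) + a wI wI))%:C.
Proof.
move=> oO DO U a hv VR VI hR hI b; have mO := open_measurable_rV oO.
have clD : closed (closure D) by exact: closed_closure.
have mD := closed_measurable_rV clD.
have oU : open U by rewrite /U setDE; apply: openI => //; exact: closed_openC.
have mU := open_measurable_rV oU; have UO : U `<=` Omega by move=> y [].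
have [hv1 orth] := (weak_helmholtzP _ _ _ oO).1 hv.
have [hvU er ei] := H1S oO oU UO hv1.
have [lr li _ _] := H1_jets oO hv1; have [lr' li' _ _] := H1_jets oU hvU.
have lrU := L2jetS mO mU UO lr; have liU := L2jetS mO mU UO li.
have rfl (Y : J) : ae_jet U Y Y by move=> j; exact: ae_eq_refl.
have V0 : Vjet Omega Omega (0 : J) by exact: lset0 (linear_Vjet Omega mO).
rewrite /indicator /DN closure0 setD0 -/U.
rewrite (@DN_energy k Omega Omega (v n) 0 0 oO hv1 V0 V0); last 2 first.
- by move=> Z VZ; rewrite jform0l// (orth _ VZ).1 oppr0.
- by move=> Z VZ; rewrite jform0l// (orth _ VZ).2 oppr0.
rewrite (@DN_energy k Omega U (v n) wR wI oU hvU VR VI); last 2 first.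
- by move=> Z VZ; rewrite (ae_eq_jform _ lr' VZ.1 lrU VZ.1 mU er (rfl Z)); exact: hR.
- by move=> Z VZ; rewrite (ae_eq_jform _ li' VZ.1 liU VZ.1 mU ei (rfl Z)); exact: hI.
rewrite -rmorphB; congr (_%:C).
rewrite (ae_eq_jform _ lr' lr' lrU lrU mU er er) (ae_eq_jform _ li' li' liU liU mU ei ei).
have OE : Omega = U `|` closure D.
  apply/seteqP; split=> [y Oy|y [[]//|/DO//]].
  by have [h|h] := pselect (closure D y); [right|left].
have dUD : [disjoint U & closure D] by apply/disj_set2P/seteqP; split=> // y [[]].
rewrite !jform0l//.
have -> : jform (- k ^+ 2) Omega (Rej Omega (v n)) (Rej Omega (v n)) =
   a (Rej Omega (v n)) (Rej Omega (v n)) + b (Rej Omega (v n)) (Rej Omega (v n)).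
  by rewrite {1}OE jform_split// -OE.
have -> : jform (- k ^+ 2) Omega (Imj Omega (v n)) (Imj Omega (v n)) =
   a (Imj Omega (v n)) (Imj Omega (v n)) + b (Imj Omega (v n)) (Imj Omega (v n)).
  by rewrite {1}OE jform_split// -OE.
rewrite /a /b; ring.
Qed.

End correction.

(** * Radial solutions of the Helmholtz equation *)

Section radial_functions.
Context {R : realType} {m : nat}.
Local Notation E := 'rV[R]_m.
Local Notation e_ i := (delta_mx ord0 i : E).
Local Notation mu := (@lebesgue_rV R m).
Implicit Types (f psi : E -> R) (x y z : E) (F : R -> R) (O : set E).

(** Radial functions are written in the squared distance, a polynomial in [y] and so smooth even at
    [x]. *)
Definition sqdist x y : R := dot (y - x) (y - x).

Lemma sqdist_ge0 x y : 0 <= sqdist x y.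
Proof. by apply: sumr_ge0 => i _; rewrite -expr2 sqr_ge0. Qed.

Lemma norm_le_sqdist x y : `|y - x| ^+ 2 <= sqdist x y.
Proof.
have -> : `|y - x| ^+ 2 = Num.sqrt (`|y - x| ^+ 2) ^+ 2 by rewrite sqr_sqrtr ?sqr_ge0.
rewrite -[leRHS]sqr_sqrtr ?sqdist_ge0// lerXn2r ?nnegrE ?sqrtr_ge0//.
rewrite sqrtr_sqr normr_id; apply/norm_leP; first exact: sqrtr_ge0.
move=> i; rewrite -sqrtr_sqr ler_wsqrtr// /sqdist /dot (bigD1 i)//= expr2 lerDl.
by apply: sumr_ge0 => j _; rewrite -expr2 sqr_ge0.
Qed.

Lemma sqdist_gt0 x y : y <> x -> 0 < sqdist x y.
Proof.
move=> yx; apply: lt_le_trans (norm_le_sqdist x y); rewrite exprn_gt0// normr_gt0 subr_eq0.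
exact/eqP.
Qed.

Lemma sqdist_le x y : sqdist x y <= m%:R * `|y - x| ^+ 2.
Proof. exact: dot_sup_bound. Qed.

Lemma continuous_sqdist x : continuous (sqdist x).
Proof.
move=> y; apply: cont_sum => i _.
have c : {for y, continuous (fun z : E => (z - x) ord0 i)}.
  rewrite (_ : (fun z => _) = (fun z : E => z ord0 i - x ord0 i)).
    by apply: contB; [exact: continuous_coord|exact: cont_cst].
  by apply/funext => z; rewrite !mxE.
exact: (contM c c).
Qed.

Lemma is_derive_sqdist x y i : is_derive y (e_ i) (sqdist x) (2 * (y ord0 i - x ord0 i)).
Proof.
have -> : sqdist x = (fun z => \sum_(j < m) (z ord0 j - x ord0 j) ^+ 2).
  by apply/funext => z; apply: eq_bigr => j _; rewrite !mxE expr2.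
have h j : is_derive y (e_ i) (fun z : E => (z ord0 j - x ord0 j) ^+ 2)
    (2 * (y ord0 j - x ord0 j) * (i == j)%:R).
  have d := @is_derive_coord _ _ y (e_ i) j.
  have d2 : is_derive y (e_ i) (fun z : E => z ord0 j - x ord0 j) ((e_ i) ord0 j - 0).
    exact: is_deriveB.
  have := @is_derive_comp _ _ (fun t : R => t ^+ 2) (fun z : E => z ord0 j - x ord0 j) y (e_ i)
    (2 * (y ord0 j - x ord0 j)) _ _ d2.
  rewrite mxE eqxx subr0 eq_sym /=; apply.
  by apply: is_derive_eq; rewrite /GRing.scale/=; ring.
have := @is_derive_sum R _ _ m (fun j (z : E) => (z ord0 j - x ord0 j) ^+ 2) y (e_ i)
  (fun j => 2 * (y ord0 j - x ord0 j) * (i == j)%:R) h.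
have -> : \sum_(j < m) 2 * (y ord0 j - x ord0 j) * (i == j)%:R = 2 * (y ord0 i - x ord0 i).
  rewrite (bigD1 i)//= eqxx mulr1 big1 ?addr0// => j ji.
  by rewrite eq_sym (negbTE ji) mulr0.
by rewrite fct_sumE.
Qed.

Lemma is_derive_radial F (d e : R) x y i : is_derive (sqdist x y + e) 1 F d ->
  is_derive y (e_ i) (fun z => F (sqdist x z + e)) (d * (2 * (y ord0 i - x ord0 i))).
Proof.
move=> dF; apply: (@is_derive_comp _ _ F (fun z => sqdist x z + e)) => //.
have := is_deriveD (is_derive_sqdist x y i) (is_derive_cst e y (e_ i)).
by rewrite addr0.
Qed.

Lemma continuous_radial F (e : R) x y : {for sqdist x y + e, continuous F} ->
  {for y, continuous (fun z => F (sqdist x z + e))}.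
Proof.
move=> cF; have cq : {for y, continuous (fun z => sqdist x z + e)}.
  by apply: contD; [exact: continuous_sqdist|exact: cont_cst].
exact: (@cont_comp _ _ F (fun z => sqdist x z + e) y cq cF).
Qed.

Lemma is_derive_continuous F (t d : R) : is_derive t 1 F d -> {for t, continuous F}.
Proof. by case=> dF _; apply: differentiable_continuous; exact/derivable1_diffP. Qed.

Lemma continuous_near_eq f g y : (\forall z \near y, f z = g z) -> {for y, continuous g} ->
  {for y, continuous f}.
Proof.
move=> fg cg; rewrite /prop_for /continuous_at (nbhs_singleton fg) => A /cg h.
by apply: (filterS2 _ _ fg h) => z /= ->.
Qed.

(** The shift [e] covers both the regularised functions, with [e > 0] on the whole space, and the
    singular one, with [e = 0] away from [x]. *)
Lemma C1_on_radial F F1 (e : R) x O i : 0 <= e ->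
  (forall s : R, 0 < s -> is_derive s 1 F (F1 s)) -> (forall s : R, 0 < s -> {for s, continuous F1}) ->
  (forall y, O y -> 0 < sqdist x y + e) ->
  C1_on O (fun y => F (sqdist x y + e)) i /\
  forall y, O y -> partial i (fun y => F (sqdist x y + e)) y =
    F1 (sqdist x y + e) * (2 * (y ord0 i - x ord0 i)).
Proof.
move=> e0 dF cF1 Opos.
have dR y : 0 < sqdist x y + e -> is_derive y (e_ i) (fun z => F (sqdist x z + e))
    (F1 (sqdist x y + e) * (2 * (y ord0 i - x ord0 i))).
  by move=> ypos; apply: is_derive_radial; exact: dF.
split=> [y /Opos ypos|y /Opos /dR[_ //]]; split.
- exact: continuous_radial (is_derive_continuous (dF _ ypos)).
- by case: (dR y ypos).
apply: (@continuous_near_eq _ (fun z => F1 (sqdist x z + e) * (2 * (z ord0 i - x ord0 i)))).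
  have cq : {for y, continuous (fun z => sqdist x z + e)}.
    by apply: contD; [exact: continuous_sqdist|exact: cont_cst].
  have : nbhs y [set z | 0 < sqdist x z + e].
    by apply: (cq [set t | 0 < t]); apply: open_nbhs_nbhs; split; [exact: open_gt|].
  by apply: filterS => z /dR[_].
apply: contM; first exact: continuous_radial (cF1 _ ypos).
apply: contM; first exact: cont_cst.
by apply: contB; [exact: continuous_coord|exact: cont_cst].
Qed.

(** The Laplacian of [F(|y|^2)] is [4 s F'' + 2 m F'] at [s = |y|^2], so the fourth clause is the
    Helmholtz equation. The last clause says that near 0 the derivatives F' and F'' have the signs
    of those of the fundamental solution and at least the orders r^-m and r^-(m+2) at s = r^2. *)
Definition radial_profile (k : R) F F1 F2 :=
  [/\ forall s : R, 0 < s -> is_derive s 1 F (F1 s),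
      forall s : R, 0 < s -> is_derive s 1 F1 (F2 s),
      forall s : R, 0 < s -> {for s, continuous F2},
      forall s : R, 0 < s -> 4 * s * F2 s + 2 * m%:R * F1 s + k ^+ 2 * F s = 0 &
      exists c rho, [/\ 0 < c, 0 < rho & forall r : R, 0 < r -> r < rho ->
        F1 (r ^+ 2) * r ^+ m <= - c /\ c <= F2 (r ^+ 2) * r ^+ m.+2]].

Definition helmholtz_op (k : R) psi y : R :=
  \sum_(i < m) partial i (partial i psi) y + k ^+ 2 * psi y.

Lemma test_function_partial O psi i : test_function O psi -> test_function O (partial i psi).
Proof.
move=> [sp [K cK [KO p0]]]; split; first exact: smooth_partial.
by exists K => //; split=> //; apply: partial_zero_off => //; exact: compact_closed_rV.
Qed.

Lemma tf_integrable_mul f psi : continuous f -> test_function setT psi ->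
  mu.-integrable setT (EFin \o (fun y => f y * psi y)).
Proof.
move=> cf [sp [K cK [_ p0]]]; apply: (integrable_compact_support cK).
  by move=> y; apply: contM; [exact: cf|exact: smooth_continuous sp y].
by move=> y /p0 ->; rewrite mulr0.
Qed.

Lemma helmholtz_op_continuous k psi : test_function setT psi -> continuous (helmholtz_op k psi).
Proof.
move=> [sp _] y.
have h1 : {for y, continuous (fun y => \sum_(i < m) partial i (partial i psi) y)}.
  apply: cont_sum => i _.
  exact: smooth_continuous (smooth_partial i (smooth_partial i sp)) y.
have h2 : {for y, continuous (fun y => k ^+ 2 * psi y)}.
  by apply: contM; [exact: cont_cst|exact: smooth_continuous sp y].
exact: (contD h1 h2).
Qed.

(* [Delta + k^2] applied to [F (|y - x|^2 + e)] is [- 4 e F''], because of the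
   differential equation satisfied by [F]. *)
Lemma regularized_pairing k F F1 F2 (e : R) x psi : radial_profile k F F1 F2 -> 0 < e ->
  test_function setT psi ->
  \int[mu]_y (F (sqdist x y + e) * helmholtz_op k psi y) =
  - (4 * e) * \int[mu]_y (F2 (sqdist x y + e) * psi y).
Proof.
move=> [dF dF1 cF2 ode _] e0 tpsi.
have epos y : 0 < sqdist x y + e by rewrite ltr_wpDl// sqdist_ge0.
have cF1 s : 0 < s -> {for s, continuous F1} by move=> /dF1/is_derive_continuous.
have cF s : 0 < s -> {for s, continuous F} by move=> /dF/is_derive_continuous.
pose G y := F (sqdist x y + e); pose G1 y := F1 (sqdist x y + e); pose G2 y := F2 (sqdist x y + e).
have cG : continuous G by move=> y; apply: continuous_radial; exact: cF.
have cG1 : continuous G1 by move=> y; apply: continuous_radial; exact: cF1.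
have cG2 : continuous G2 by move=> y; apply: continuous_radial; exact: cF2.
have c1 i := @C1_on_radial F F1 e x setT i (ltW e0) dF cF1 (fun y _ => epos y).
have d i : continuous (fun y : E => y ord0 i - x ord0 i).
  by move=> y; apply: contB; [exact: continuous_coord|exact: cont_cst].
pose H i y := G1 y * (2 * (y ord0 i - x ord0 i)).
have pG i : partial i G = H i by apply/funext => y; exact: (c1 i).2.
pose HH i y := G2 y * (4 * (y ord0 i - x ord0 i) ^+ 2) + 2 * G1 y.
have dH i y : is_derive y (e_ i) (H i) (HH i y).
  have h1 : is_derive y (e_ i) G1 (G2 y * (2 * (y ord0 i - x ord0 i))).
    by apply: is_derive_radial; exact: dF1.
  have h2 : is_derive y (e_ i) (fun z : E => 2 * (z ord0 i - x ord0 i)) 2.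
    have := @is_derive_comp _ _ (fun t : R => 2 * (t - x ord0 i)) (fun z : E => z ord0 i)
      y (e_ i) 2 _ _ (@is_derive_coord _ _ y (e_ i) i).
    rewrite mxE !eqxx mulr1; apply.
    by apply: is_derive_eq; rewrite /GRing.scale/=; ring.
  have := @is_deriveM _ _ G1 (fun z : E => 2 * (z ord0 i - x ord0 i)) y (e_ i) _ _ h1 h2.
  by move=> h; apply: (is_derive_eq h); rewrite /GRing.scale/= /HH; ring.
have c2 i : C1_on setT (H i) i.
  move=> y _; split.
  - apply: contM; [exact: cG1|apply: contM; [exact: cont_cst|exact: d]].
  - by case: (dH i y).
  rewrite (_ : partial i (H i) = HH i); last by apply/funext => z; case: (dH i z).
  apply: contD; apply: contM; [exact: cG2| |exact: cont_cst|exact: cG1].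
  by apply: contM; [exact: cont_cst|apply: contX; exact: d].
have pH i : partial i (H i) = HH i by apply/funext => z; case: (dH i z).
have cHH i : continuous (HH i) by move=> y; have [_ _] := c2 i y I; rewrite pH.
have tp i := test_function_partial i tpsi.
have ibp i : \int[mu]_y (G y * partial i (partial i psi) y) = \int[mu]_y (HH i y * psi y).
  rewrite (integration_by_parts openT (c1 i).1 (tp i)) pG.
  by rewrite (integration_by_parts openT (c2 i) tpsi) opprK pH.
have iG i : mu.-integrable setT (EFin \o (fun y => G y * partial i (partial i psi) y)).
  by apply: tf_integrable_mul => //; exact: test_function_partial.
have iGp : mu.-integrable setT (EFin \o (fun y => G y * psi y)) by exact: tf_integrable_mul.
have iH i : mu.-integrable setT (EFin \o (fun y => HH i y * psi y)) by exact: tf_integrable_mul.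
have iG2 : mu.-integrable setT (EFin \o (fun y => G2 y * psi y)) by exact: tf_integrable_mul.
have [s1 s2] := integrable_sumR (index_enum 'I_m) (@measurableT _ E) iG.
have [t1 t2] := integrable_sumR (index_enum 'I_m) (@measurableT _ E) iH.
have ikG : mu.-integrable setT (EFin \o (fun y => k ^+ 2 * (G y * psi y))).
  by have := integrableZl measurableT (k ^+ 2) iGp.
transitivity (\int[mu]_y (\sum_i G y * partial i (partial i psi) y + k ^+ 2 * (G y * psi y))).
  by apply: eq_Rintegral => y _; rewrite /helmholtz_op -/(G y) mulrDr mulr_sumr; congr (_ + _); ring.
rewrite RintegralD// s2 (eq_bigr _ (fun i _ => ibp i)) -t2 -RintegralD// -RintegralZl//.
apply: eq_Rintegral => y _; rewrite -mulr_suml /HH big_split /= -mulr_sumr.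
rewrite sumr_const card_ord -/(G2 y).
have := ode _ (epos y); rewrite -/(G y) -/(G1 y) -/(G2 y).
have -> : \sum_(i < m) 4 * (y ord0 i - x ord0 i) ^+ 2 = 4 * sqdist x y.
  by rewrite -mulr_sumr; congr (_ * _); apply: eq_bigr => i _; rewrite !mxE expr2.
move=> h.
have h' : G2 y * (4 * sqdist x y) + 2 * G1 y *+ m = - (4 * e * G2 y) - k ^+ 2 * G y.
  by rewrite -mulr_natr; lra.
transitivity ((- (4 * e * G2 y) - k ^+ 2 * G y) * psi y + k ^+ 2 * (G y * psi y)); last by ring.
by rewrite -h'.
Qed.

Lemma bounded_on_segment F (a b : R) : 0 < a -> (forall s : R, 0 < s -> {for s, continuous F}) ->
  exists2 M, 0 < M & forall s, a <= s -> s <= b -> `|F s| <= M.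
Proof.
move=> a0 cF; have : compact (F @` `[a, b]).
  apply: continuous_compact; last exact: segment_compact.
  apply: continuous_in_subspaceT => s /set_mem /=; rewrite in_itv/= => /andP[as_ _].
  by apply: cF; exact: lt_le_trans as_.
move=> /compact_bounded[M [Mr MP]]; exists (`|M| + 1); first by rewrite ltr_wpDl.
move=> s a_s sb; apply: (MP (`|M| + 1)); last by exists s => //; rewrite /= in_itv/= a_s sb.
by rewrite (le_lt_trans (ler_norm _))// ltrDl.
Qed.

Lemma Rintegral_le A f g : measurable A -> mu.-integrable A (EFin \o f) ->
  mu.-integrable A (EFin \o g) -> (forall y, A y -> f y <= g y) ->
  \int[mu]_(y in A) f y <= \int[mu]_(y in A) g y.
Proof. by move=> mA iF ig fg; apply: le_Rintegral. Qed.

Lemma Rintegral_indicator A : measurable A -> (mu A < +oo)%E ->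
  mu.-integrable setT (EFin \o (\1_A : E -> R)) /\ \int[mu]_y (\1_A y : R) = fine (mu A).
Proof.
move=> mA Afin; have e : (\int[mu]_y (\1_A y)%:E = mu A)%E by rewrite integral_indic// setIT.
split; last by rewrite /Rintegral e.
apply/integrableP; split; first by apply/measurable_EFinP; exact: measurable_indic.
rewrite (_ : integral _ _ _ = mu A)// -e; apply: eq_integral => y _ /=.
by rewrite ger0_norm// indicE.
Qed.

(* As e goes to 0, e^2 F''(|y - x|^2 + e^2) concentrates at x, with positive mass. *)
Lemma fundamental_pairing_neq0 k F F1 F2 x psi (d : R) : radial_profile k F F1 F2 ->
  test_function setT psi -> 0 < d ->
  (forall y, `|x - y| < d -> helmholtz_op k psi y = 0 /\ 2^-1 <= psi y) ->
  \int[mu]_y (F (sqdist x y) * helmholtz_op k psi y) <> 0.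
Proof.
move=> prof tpsi d0 near_x; have [dF dF1 cF2 ode [c [rho [c0 rho0 bnd]]]] := prof.
have cF1 s : 0 < s -> {for s, continuous F1} by move=> /dF1/is_derive_continuous.
have cF s : 0 < s -> {for s, continuous F} by move=> /dF/is_derive_continuous.
set f := helmholtz_op k psi; have cf : continuous f by exact: helmholtz_op_continuous.
have [sp [L cL [_ p0]]] := tpsi.
have f0 y : ~ L y -> f y = 0.
  move=> nL; rewrite /f /helmholtz_op p0// mulr0 addr0 big1// => i _.
  have clL := compact_closed_rV cL.
  exact: (partial_zero_off i clL (partial_zero_off i clL p0) nL).
have [B B0 LB] := compact_bounded_rV cL.
pose mB : R := m%:R * (B + `|x|) ^+ 2 + 1.
have qL y : L y -> sqdist x y <= mB - 1.
  move=> Ly; rewrite /mB addrK; apply: le_trans (sqdist_le x y) _.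
  rewrite ler_wpM2l// lerXn2r ?nnegrE ?addr_ge0 ?(ltW B0)//.
  by apply: le_trans (ler_normB _ _) _; rewrite lerD2r; exact: LB.
(* Within [eta] of [x], [psi] is at least 1/2 and the operator vanishes on it, and for [ep <= eta]
   the radii [sqrt (|y - x|^2 + e)] remain below [rho]. *)
pose eta := Num.min d (rho / (2 * (m%:R + 1))).
have m1 : 0 < m%:R + 1 :> R by rewrite ltr_wpDl.
have eta0 : 0 < eta by rewrite lt_min d0 divr_gt0// mulr_gt0.
have etad : eta <= d by rewrite ge_min lexx.
have etar : (m%:R + 1) * eta < rho.
  have : eta <= rho / (2 * (m%:R + 1)) by rewrite ge_min lexx orbT.
  rewrite ler_pdivlMr ?mulr_gt0// => h; have : 0 < (m%:R + 1) * eta by rewrite mulr_gt0.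
  lra.
have eta2 : 0 < eta ^+ 2 by rewrite exprn_gt0.
have [K1 K10 hK1] := bounded_on_segment mB eta2 cF1.
have [K2 K20 hK2] := bounded_on_segment mB eta2 cF2.
have cpsi := smooth_continuous sp.
have [Mf Mf0 hMf] := continuous_bounded_on cL cf.
have [Mp Mp0 hMp] := continuous_bounded_on cL cpsi.
have mL := compact_measurable_rV cL; have Lfin := lebesgue_rV_compact cL.
pose V := fine (mu L); have V0 : 0 <= V by rewrite fine_ge0.
have intL (b : R) : \int[mu]_(y in L) b = b * V by rewrite Rintegral_cst.
(* The lower bound of [F2 psi] on the ball of radius [ep], times the measure [(2 ep)^m] of that
   ball, is [c3 / ep^2]. *)
pose c3 := c / 2 * 2 ^+ m / (m%:R + 1) ^+ m.+2.
have c30 : 0 < c3 by rewrite divr_gt0 ?exprn_gt0// mulr_gt0 ?exprn_gt0// divr_gt0.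
pose K := 4 * (K2 * Mp * V) + K1 * Mf * V.
have K0 : 0 <= K by rewrite addr_ge0// ?mulr_ge0// ltW.
(* So small that [K e <= c3] for [e = ep^2], whereas a vanishing pairing would give
   [4 c3 <= K e]. *)
pose ep := Num.min 1 (Num.min eta (c3 / (K + 1))).
have K10' : 0 < K + 1 by rewrite ltr_wpDl.
have ep0 : 0 < ep by rewrite lt_min ltr01 lt_min eta0 divr_gt0.
have ep1 : ep <= 1 by rewrite ge_min lexx.
have epeta : ep <= eta by rewrite ge_min; apply/orP; right; rewrite ge_min lexx.
have epK : K * ep ^+ 2 <= c3.
  have h : ep <= c3 / (K + 1).
    by rewrite ge_min; apply/orP; right; rewrite ge_min; apply/orP; right.
  rewrite ler_pdivlMr// in h; apply: le_trans h; rewrite mulrC expr2.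
  have : ep * ep <= ep * 1 by rewrite ler_wpM2l// ltW.
  rewrite mulr1 => h; apply: ler_pM => //; [by rewrite mulr_ge0// ltW|by rewrite lerDl].
pose e := ep ^+ 2; have e0 : 0 < e by rewrite exprn_gt0.
have e1 : e <= 1 by rewrite /e exprn_ile1// ltW.
have far y : eta <= `|x - y| -> eta ^+ 2 <= sqdist x y.
  move=> h; apply: le_trans (norm_le_sqdist x y); rewrite distrC in h.
  by rewrite lerXn2r ?nnegrE// ltW.
have near_r y (r : R) : 0 < r -> r <= eta -> ep <= r -> `|x - y| < r ->
    let t := Num.sqrt (sqdist x y + e) in
    [/\ 0 < t, t <= (m%:R + 1) * r, t < rho & t ^+ 2 = sqdist x y + e].
  move=> r0 reta epr xy t; have q0 : 0 < sqdist x y + e by rewrite ltr_wpDl// sqdist_ge0.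
  have tE : t ^+ 2 = sqdist x y + e by rewrite sqr_sqrtr// ltW.
  have t0 : 0 < t by rewrite sqrtr_gt0.
  have mr0 : 0 < (m%:R + 1) * r by rewrite mulr_gt0.
  have tr : t <= (m%:R + 1) * r.
    rewrite -(ger0_norm (ltW mr0)) -sqrtr_sqr /t ler_wsqrtr// exprMn.
    apply: (@le_trans _ _ (m%:R * r ^+ 2 + r ^+ 2)).
      apply: lerD; last by rewrite /e lerXn2r ?nnegrE// ltW.
      apply: le_trans (sqdist_le x y) _; rewrite ler_wpM2l// lerXn2r ?nnegrE ?(ltW r0)//.
      by rewrite distrC ltW.
    have -> : m%:R * r ^+ 2 + r ^+ 2 = (m%:R + 1) * r ^+ 2 by ring.
    rewrite ler_wpM2r ?sqr_ge0// expr2 ler_pMr// lerDr.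
    by [].
  split=> //; apply: le_lt_trans tr _; apply: le_lt_trans etar.
  by rewrite ler_wpM2l// ltW.
have F2lower y (r : R) : 0 < r -> r <= eta -> ep <= r -> `|x - y| < r ->
    c / ((m%:R + 1) * r) ^+ m.+2 <= F2 (sqdist x y + e).
  move=> r0 reta epr xy; have [t0 tr trho <-] := near_r y r r0 reta epr xy.
  set t := Num.sqrt _ in t0 tr trho *; have [_ h] := bnd t t0 trho.
  rewrite ler_pdivrMr; last by rewrite exprn_gt0// mulr_gt0.
  apply: le_trans h _; have F2p : 0 <= F2 (t ^+ 2).
    have := le_trans (ltW c0) (bnd t t0 trho).2.
    by rewrite pmulr_lge0// exprn_gt0.
  by rewrite ler_wpM2l// lerXn2r ?nnegrE ?(ltW t0)// mulr_ge0// ltW.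
have qe0 y : 0 < sqdist x y + e by rewrite ltr_wpDl// sqdist_ge0.
pose g y := F2 (sqdist x y + e) * psi y.
have cg : continuous g.
  move=> y; apply: contM; last exact: cpsi.
  by apply: continuous_radial; apply: cF2; exact: qe0.
have g0 y : ~ L y -> g y = 0 by move=> nL; rewrite /g p0 ?mulr0.
have ig : mu.-integrable setT (EFin \o g) := integrable_compact_support cL cg g0.
set Be := ball x ep; have mBe : measurable Be by exact: measurable_ball_rV.
have muBe : mu Be = ((2 * ep) ^+ m)%:E by exact: lebesgue_rV_ball.
have Befin : (mu Be < +oo)%E by rewrite muBe ltry.
pose b := c / ((m%:R + 1) * ep) ^+ m.+2 * 2^-1.
(* Within [ep] of [x] the large lower bound is used, between [ep] and [eta] the nonnegativity of the
   integrand, beyond [eta] its boundedness on [L]. *)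
have hg : c3 / e - K2 * Mp * V <= \int[mu]_y g y.
  have [iB eB] := Rintegral_indicator mBe Befin; have [iL eL] := Rintegral_indicator mL Lfin.
  have ibB : mu.-integrable setT (EFin \o (fun y => b * \1_Be y)).
    by have := integrableZl measurableT b iB.
  have ikL : mu.-integrable setT (EFin \o (fun y => K2 * Mp * \1_L y)).
    by have := integrableZl measurableT (K2 * Mp) iL.
  have -> : c3 / e - K2 * Mp * V = \int[mu]_y (b * \1_Be y - K2 * Mp * \1_L y).
    rewrite RintegralB// !RintegralZl// eB eL muBe /= /b /c3 /e; congr (_ - _).
    rewrite !exprMn !exprS expr0 mulr1.
    have p1 : ep != 0 by rewrite gt_eqF.
    have p2 : m%:R + 1 != 0 :> R by rewrite gt_eqF.
    have p3 := expf_neq0 m p1; have p4 := expf_neq0 m p2.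
    move: (ep ^+ m) ((m%:R + 1) ^+ m) p3 p4 => u v u0 v0.
    by field; rewrite ?p1 ?p2 ?u0 ?v0.
  apply: le_Rintegral => //; first by have := integrableB measurableT ibB ikL.
  move=> y _; have k0 : 0 <= K2 * Mp * \1_L y by rewrite !mulr_ge0 ?(ltW K20) ?(ltW Mp0)// indicE.
  have mm (r : R) : 0 < r -> 0 < ((m%:R + 1) * r) ^+ m.+2 by move=> r0; rewrite exprn_gt0// mulr_gt0.
  have [By|nBy] := pselect (Be y).
    move: (By); rewrite /Be ball_rVE => xy.
    have h1 := F2lower y ep ep0 epeta (lexx _) xy.
    have [_ h2] := near_x y (lt_le_trans xy (le_trans epeta etad)).
    rewrite [\1_Be y]indicE mem_set// mulr1; apply: (@le_trans _ _ b); first by lra.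
    by apply: ler_pM => //; rewrite ?invr_ge0// divr_ge0 ?(ltW c0) ?(ltW (mm _ ep0)).
  rewrite [\1_Be y]indicE memNset// mulr0 sub0r.
  have [Ly|nLy] := pselect (L y); last by rewrite g0// oppr_le0.
  have [xy|xy] := ltP `|x - y| eta.
    have h1 := F2lower y eta eta0 (lexx _) epeta xy.
    have [_ h2] := near_x y (lt_le_trans xy etad).
    apply: (@le_trans _ _ 0); first by rewrite oppr_le0.
    apply: mulr_ge0; last by apply: le_trans h2; rewrite invr_ge0.
    by apply: le_trans h1; rewrite divr_ge0 ?(ltW c0) ?(ltW (mm _ eta0)).
  rewrite indicE mem_set// mulr1 lerNl; apply: le_trans (ler_norm _) _.
  rewrite normrN normrM; apply: ler_pM => //; last exact: hMp.
  apply: hK2; first by apply: le_trans (far y xy) _; rewrite lerDl ltW.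
  by have := qL y Ly; lra.
pose h y := F (sqdist x y) * f y.
have h0 y : ~ L y -> h y = 0 by move=> nL; rewrite /h f0 ?mulr0.
have fnear y : `|x - y| < d -> f y = 0 by move=> /near_x[].
(* [F] is singular at [x], but [f] vanishes near [x]. *)
have ch : continuous h.
  pose A := [set y : E | d <= `|x - y|].
  have clA : closed A.
    rewrite (_ : A = (fun y => `|x - y|) @^-1` [set t | d <= t])//.
    by apply: preimage_closed; [move=> z _; exact: continuous_dist|exact: closed_ge].
  apply: (@continuous_zero_off _ _ h A [set y | 0 < sqdist x y] clA).
  - by move=> y nA; rewrite /h fnear ?mulr0// ltNge; apply/negP.
  - move=> y Ay; apply: sqdist_gt0 => yx; move: Ay; rewrite /A yx /= subrr normr0.
    by rewrite leNgt d0.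
  move=> y /= y0; apply: contM; last exact: cf.
  have := @continuous_radial F 0 x y; rewrite addr0 => hr.
  have := hr (cF _ y0); rewrite (_ : (fun z => F (sqdist x z + 0)) = (fun z => F (sqdist x z)))//.
  by apply/funext => z; rewrite addr0.
have ih : mu.-integrable setT (EFin \o h) := integrable_compact_support cL ch h0.
pose he y := F (sqdist x y + e) * f y.
have ihe : mu.-integrable setT (EFin \o he).
  apply: (integrable_compact_support cL); last by move=> y nL; rewrite /he f0 ?mulr0.
  move=> y; apply: contM; last exact: cf.
  by apply: continuous_radial; apply: cF; exact: qe0.
(* Where [f] may be nonzero, [y] is at distance at least [d] from [x], and the mean value theorem
   bounds the effect of the regularisation on [F] by [e K1]. *)
have diff : \int[mu]_y h y <= \int[mu]_y he y + e * (K1 * Mf * V).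
  have [iL eL] := Rintegral_indicator mL Lfin.
  have ikL : mu.-integrable setT (EFin \o (fun y => e * (K1 * Mf) * \1_L y)).
    by have := integrableZl measurableT (e * (K1 * Mf)) iL.
  rewrite (_ : e * (K1 * Mf * V) = \int[mu]_y (e * (K1 * Mf) * \1_L y)); last first.
    by rewrite RintegralZl// eL /V; ring.
  rewrite -RintegralD//; apply: le_Rintegral => //.
    by have := integrableD measurableT ihe ikL.
  move=> y _; rewrite -lerBlDl; have [Ly|nLy] := pselect (L y); last first.
    by rewrite h0// /he f0// mulr0 subrr indicE memNset// mulr0.
  rewrite indicE mem_set// mulr1; have [xy|xy] := ltP `|x - y| d.
    rewrite /h /he fnear// !mulr0 subrr; apply: mulr_ge0; first exact: ltW.
    by apply: mulr_ge0; exact: ltW.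
  rewrite /h /he -mulrBl; apply: le_trans (ler_norm _) _; rewrite normrM mulrA.
  apply: ler_pM => //; last exact: hMf.
  have q1 := far y (le_trans etad xy); have q2 := qL y Ly; have q0 : 0 < sqdist x y := lt_le_trans eta2 q1.
  have [|||s hs] := @MVT_segment R F F1 (sqdist x y) (sqdist x y + e).
  - by rewrite lerDl ltW.
  - by move=> s; rewrite in_itv/= => /andP[s1 _]; apply: dF; exact: lt_trans s1.
  - apply: continuous_in_subspaceT => s /set_mem /=; rewrite in_itv/= => /andP[s1 _].
    by apply: cF; exact: lt_le_trans s1.
  move: hs; rewrite in_itv/= => /andP[s1 s2].
  rewrite addrAC subrr add0r => FE.
  rewrite -normrN opprB FE normrM (ger0_norm (ltW e0)) mulrC ler_pM2l//.
  apply: hK1; first exact: le_trans q1 s1.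
  by apply: le_trans s2 _; lra.
have reg : \int[mu]_y he y = - (4 * e) * \int[mu]_y g y := regularized_pairing x prof e0 tpsi.
have e4 : 0 <= 4 * e by rewrite mulr_ge0// ltW.
have := ler_wpM2l e4 hg; rewrite mulrBr.
have -> : 4 * e * (c3 / e) = 4 * c3 by field; rewrite gt_eqF.
move=> hfin h00; move: diff; rewrite reg [X in X <= _]h00 => diff.
have : K * e <= c3 by [].
rewrite /K; move: (\int[mu]_y g y) hfin diff => G hfin diff hK; lra.
Qed.

End radial_functions.

(** * Power series with factorially decreasing coefficients *)

Section entire_series.
Context {R : realType}.
Implicit Types (c : nat -> R) (s x : R).

(** This bound is stable under termwise differentiation and implies convergence everywhere, so no
    radius of convergence has to be tracked. *)
Definition exponential_type c := exists A B : R, [/\ 0 <= A, 0 <= B &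
  forall j, `|c j| <= A * B ^+ j / j`!%:R].

Definition sum_pseries c x : R := limn (pseries c x).

Lemma exponential_type_cvg c : exponential_type c -> forall x, cvgn (pseries c x).
Proof.
move=> [A [B [A0 B0 cAB]]] x; apply: normed_cvg.
apply: (@series_le_cvg _ _ (fun j => A * exp_coeff (B * `|x|) j)) => [j|j|j|].
- exact: normr_ge0.
- by rewrite mulr_ge0// exp_coeff_ge0// mulr_ge0.
- rewrite /= normrM normrX /exp_coeff /= exprMn.
  apply: le_trans (ler_wpM2r (exprn_ge0 j (normr_ge0 x)) (cAB j)) _.
  rewrite le_eqVlt; apply/orP; left; apply/eqP; ring.
by apply: is_cvg_seriesZ; exact: is_cvg_series_exp_coeff.
Qed.

Lemma exponential_type_diffs c : exponential_type c -> exponential_type (pseries_diffs c).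
Proof.
move=> [A [B [A0 B0 cAB]]]; exists (A * B), B; split=> [||j] //; first exact: mulr_ge0.
rewrite /pseries_diffs normrM ger0_norm//.
apply: le_trans (ler_wpM2l (ler0n _ _) (cAB j.+1)) _.
rewrite le_eqVlt; apply/orP; left; apply/eqP; rewrite factS natrM exprS.
have f0 : j`!%:R != 0 :> R by rewrite pnatr_eq0 -lt0n fact_gt0.
move: (j`!%:R) f0 => f f0; have n0 : j.+1%:R != 0 :> R by rewrite pnatr_eq0.
by move: (j.+1%:R) n0 => n n0; field; rewrite ?n0 ?f0.
Qed.

Lemma is_derive_sum_pseries c s : exponential_type c ->
  is_derive s 1 (sum_pseries c) (sum_pseries (pseries_diffs c) s).
Proof.
move=> tc; have td := exponential_type_diffs tc; have tdd := exponential_type_diffs td.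
apply: (@pseries_snd_diffs _ c (`|s| + 1)); try exact: exponential_type_cvg.
by rewrite [ltRHS]ger0_norm ?addr_ge0// ltrDl.
Qed.

(** The Euler operator [s d/ds] multiplies the coefficients by [j]; through it Bessel's equation
    becomes a recursion. *)
Lemma sum_pseriesX c s : exponential_type c ->
  s * sum_pseries (pseries_diffs c) s = sum_pseries (fun j => j%:R * c j) s.
Proof.
move=> tc; have cd := @exponential_type_cvg _ (exponential_type_diffs tc) s.
apply/esym/cvg_lim => //.
rewrite -(cvg_shiftS (pseries (fun j => j%:R * c j) s)).
have -> : [sequence pseries (fun j => j%:R * c j) s n.+1]_n =
    (fun n => s * pseries (pseries_diffs c) s n).
  apply/funext => n /=; rewrite /pseries /series /= big_nat_recl// !mul0r add0r mulr_sumr.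
  by apply: eq_bigr => i _; rewrite /pseries_diffs exprS; ring.
by apply: cvgM; [exact: cvg_cst|exact: cd].
Qed.

Lemma sum_pseriesZD (a b : R) c c' s : exponential_type c -> exponential_type c' ->
  sum_pseries (fun j => a * c j + b * c' j) s = a * sum_pseries c s + b * sum_pseries c' s.
Proof.
move=> /exponential_type_cvg /(_ s) h1 /exponential_type_cvg /(_ s) h2; apply/cvg_lim => //.
rewrite (_ : pseries _ s = (fun n => a * pseries c s n + b * pseries c' s n)).
  by apply: cvgD; apply: cvgM; (try exact: cvg_cst); [exact: h1|exact: h2].
apply/funext => n; rewrite /pseries /series /= !mulr_sumr -big_split; apply: eq_bigr => i _ /=.
ring.
Qed.

Lemma sum_pseries0 c : sum_pseries c 0 = c 0%N.
Proof.
apply/cvg_lim => //; rewrite -(cvg_shiftS (pseries c 0)).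
rewrite (_ : [sequence _]_n = fun=> c 0%N); first exact: cvg_cst.
apply/funext => n /=; rewrite /pseries /series /= big_nat_recl// expr0 mulr1 big1 ?addr0// => i _.
by rewrite exprS mul0r mulr0.
Qed.

End entire_series.

(** * Radial profiles of the fundamental solutions *)

Section profiles.
Context {R : realType}.
Implicit Types (k q r s : R) (f g : R -> R).

(** The explicit formulas are simplest in [q = sqrt s], where [d/ds] is [d/dq] divided by [2 q]. *)
Lemma sqrt_chain f g : (forall q, 0 < q -> is_derive q 1 f (2 * q * g q)) ->
  forall s, 0 < s -> is_derive s 1 (fun s => f (Num.sqrt s)) (g (Num.sqrt s)).
Proof.
move=> fg s s0; have q0 : 0 < Num.sqrt s by rewrite sqrtr_gt0.
have := is_derive1_comp_real (fg _ q0) (is_derive1_sqrt s0).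
by move=> h; apply: (is_derive_eq h); field; rewrite gt_eqF.
Qed.

Lemma cont_lower (phi : R -> R) (a : R) : {for 0, continuous phi} -> a < phi 0 ->
  exists2 rho, 0 < rho & forall r, 0 < r -> r < rho -> a <= phi r.
Proof.
move=> cphi h; have : nbhs (0 : R) [set t | a < phi t].
  by apply: (cphi [set t | a < t]); apply: open_nbhs_nbhs; split; [exact: open_gt|].
move=> /nbhs_ballP[rho rho0 hr]; exists rho => // r r0 rr; apply/ltW/hr.
by rewrite /ball /= sub0r normrN ger0_norm// ltW.
Qed.

Lemma contV (f : R -> R) s : f s != 0 -> {for s, continuous f} -> {for s, continuous (fun t => (f t)^-1)}.
Proof. by move=> f0 cf; apply: cvgV. Qed.

Lemma cont_id s : {for s, continuous (fun t : R => t)}.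
Proof. exact: cvg_id. Qed.

Lemma continuous_trig k s : {for s, continuous (fun t => cos (k * t))} /\
  {for s, continuous (fun t => sin (k * t))}.
Proof.
have ck : {for s, continuous (fun t => k * t)} by apply: contM; [exact: cont_cst|exact: cont_id].
split; first by apply: (cont_comp ck); exact: continuous_cos.
by apply: (cont_comp ck); exact: continuous_sin.
Qed.

Lemma is_derive_trig k q : is_derive q 1 (fun t => cos (k * t)) (- (k * sin (k * q))) /\
  is_derive q 1 (fun t => sin (k * t)) (k * cos (k * q)).
Proof.
have dk : is_derive q 1 (fun t => k * t) k.
  by apply: is_derive_eq; rewrite /GRing.scale/=; ring.
split.
  have h := is_derive1_comp_real (is_derive_cos (k * q)) dk.
  by apply: (is_derive_eq h); ring.
have h := is_derive1_comp_real (is_derive_sin (k * q)) dk.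
by apply: (is_derive_eq h); ring.
Qed.

Lemma is_derive_div f (n : nat) (d : R) q : 0 < q -> is_derive q 1 f d ->
  is_derive q 1 (fun t => f t / t ^+ n) ((d - n%:R * f q / q) / q ^+ n).
Proof.
move=> q0 df.
have dX : is_derive q 1 (fun t : R => t ^+ n) (n%:R * q ^+ n.-1).
  have h := @is_deriveX R _ (fun t : R => t) n q 1 1 (is_derive_id q (1 : R)).
  rewrite exprfctE in h; by apply: (is_derive_eq h); rewrite /GRing.scale/= mulr1.
have qn : q ^+ n != 0 by rewrite expf_neq0// gt_eqF.
have dV : is_derive q 1 (fun t : R => (t ^+ n)^-1) (- (q ^+ n) ^- 2 *: (n%:R * q ^+ n.-1)).
  exact: is_deriveV.
have h := @is_deriveM _ _ f (fun t => (t ^+ n)^-1) q 1 _ _ df dV.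
apply: (is_derive_eq h); rewrite /GRing.scale/=.
case: n dX qn dV h => [|n] dX qn dV h; first by rewrite !mul0r !mulr0 subr0 add0r mulrC.
rewrite /= !exprS; have p0 : q ^+ n != 0 by rewrite expf_neq0// gt_eqF.
have q1 : q != 0 by rewrite gt_eqF.
by move: (q ^+ n) p0 => p p0; rewrite ?expr0; field; rewrite ?q1 ?p0.
Qed.

Lemma fundamental_radial3 k : 0 <= k -> exists F F1 F2 H H1,
  [/\ @radial_profile R 3 k F F1 F2, forall s, 0 < s -> is_derive s 1 H (H1 s),
      forall s, 0 < s -> {for s, continuous H1} &
      forall y : 'rV[R]_3, 0 < dot y y ->
        fundamental_solution k y = F (dot y y) +i* H (dot y y)].
Proof.
move=> k0; pose a : R := (4 * pi)^-1.
have pi0 : 0 < pi :> R := pi_gt0 R.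
have a0 : 0 < a by rewrite invr_gt0 mulr_gt0.
pose p1 q := k * q * sin (k * q) + cos (k * q).
pose p2 q := 3 * p1 q - k ^+ 2 * q ^+ 2 * cos (k * q).
pose p3 q := k * q * cos (k * q) - sin (k * q).
pose f q := a * cos (k * q) / q ^+ 1.
pose f1 q := - (a / 2) * p1 q / q ^+ 3.
pose f2 q := a / 4 * p2 q / q ^+ 5.
pose h q := a * sin (k * q) / q ^+ 1.
pose h1 q := a / 2 * p3 q / q ^+ 3.
have cc s : {for s, continuous (fun t => cos (k * t))} := (continuous_trig k s).1.
have cs s : {for s, continuous (fun t => sin (k * t))} := (continuous_trig k s).2.
have ck s : {for s, continuous (fun t => k * t)} by apply: contM; [exact: cont_cst|exact: cont_id].
have c1 s : {for s, continuous p1} by apply: contD; [apply: contM; [exact: ck|exact: cs]|exact: cc].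
have c3 s : {for s, continuous p3} by apply: contB; [apply: contM; [exact: ck|exact: cc]|exact: cs].
have c2 s : {for s, continuous p2}.
  apply: contB; first by apply: contM; [exact: cont_cst|exact: c1].
  apply: contM; last exact: cc.
  by apply: contM; [exact: cont_cst|apply: contX; exact: cont_id].
have csqrt s : {for s, continuous Num.sqrt} by exact: sqrt_continuous.
have cdiv (g : R -> R) n s : 0 < s -> (forall s, {for s, continuous g}) ->
    {for s, continuous (fun t => g (Num.sqrt t) / Num.sqrt t ^+ n)}.
  move=> s0 cg; apply: contM; first exact: (cont_comp (@csqrt s) (cg _)).
  apply: contV; last by apply: contX; exact: csqrt.
  by rewrite expf_neq0// gt_eqF// sqrtr_gt0.
have dc q := (is_derive_trig k q).1; have ds q := (is_derive_trig k q).2.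
have dp1 q : is_derive q 1 p1 (k ^+ 2 * q * cos (k * q)).
  have := dc q; have := ds q => d1 d2.
  have d3 : is_derive q 1 (fun t => k * t) k.
    by apply: is_derive_eq; rewrite /GRing.scale/=; ring.
  have d4 := is_deriveD (is_deriveM d3 d1) d2.
  by apply: (is_derive_eq d4); rewrite /GRing.scale/=; ring.
have df q : 0 < q -> is_derive q 1 f (2 * q * f1 q).
  move=> q0; have d1 : is_derive q 1 (fun t => a * cos (k * t)) (a * - (k * sin (k * q))).
    exact: (is_deriveZ a (dc q)).
  have d2 := is_derive_div 1 q0 d1.
  by apply: (is_derive_eq d2); rewrite /f1 /p1; field; rewrite gt_eqF.
have df1 q : 0 < q -> is_derive q 1 f1 (2 * q * f2 q).
  move=> q0; have d1 : is_derive q 1 (fun t => - (a / 2) * p1 t) (- (a / 2) * (k ^+ 2 * q * cos (k * q))).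
    exact: (is_deriveZ _ (dp1 q)).
  have d2 := is_derive_div 3 q0 d1.
  by apply: (is_derive_eq d2); rewrite /f2 /p2 /GRing.scale/=; field; rewrite gt_eqF.
have dh q : 0 < q -> is_derive q 1 h (2 * q * h1 q).
  move=> q0; have d1 : is_derive q 1 (fun t => a * sin (k * t)) (a * (k * cos (k * q))).
    exact: (is_deriveZ a (ds q)).
  have d2 := is_derive_div 1 q0 d1.
  by apply: (is_derive_eq d2); rewrite /h1 /p3; field; rewrite gt_eqF.
exists (fun s => f (Num.sqrt s)), (fun s => f1 (Num.sqrt s)), (fun s => f2 (Num.sqrt s)),
  (fun s => h (Num.sqrt s)), (fun s => h1 (Num.sqrt s)); split.
- split.
  + exact: sqrt_chain.
  + exact: sqrt_chain.
  + move=> s s0; apply: (cdiv (fun q => a / 4 * p2 q)) => // t.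
    by apply: contM; [exact: cont_cst|exact: c2].
  + move=> s s0; have q0 : 0 < Num.sqrt s by rewrite sqrtr_gt0.
    rewrite -{1}(sqr_sqrtr (ltW s0)); move: (Num.sqrt s) q0 => q q0.
    by rewrite /f /f1 /f2 /p2; field; rewrite gt_eqF.
  have p10 : p1 0 = 1 by rewrite /p1 mulr0 mul0r add0r cos0.
  have p20 : p2 0 = 3 by rewrite /p2 p10 mulr1 expr0n /= mulr0 mul0r subr0.
  have [|r1 r10 hr1] := @cont_lower p1 2^-1 (c1 0); first by rewrite p10 invf_lt1// ltr1n.
  have [|r2 r20 hr2] := @cont_lower p2 2^-1 (c2 0).
    by rewrite p20; apply: (@lt_trans _ _ 1); [rewrite invf_lt1// ltr1n|rewrite ltr1n].
  exists (a / 8), (Num.min r1 r2); split; first by rewrite divr_gt0.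
    by rewrite lt_min r10.
  move=> r r0; rewrite lt_min => /andP[/(hr1 r r0) h1r /(hr2 r r0) h2r].
  rewrite sqrtr_sqr ger0_norm ?(ltW r0)//; have rn : r != 0 by rewrite gt_eqF.
  rewrite /f1 /f2 !divfK ?expf_neq0//; split; nra.
- exact: sqrt_chain.
- move=> s s0; apply: (cdiv (fun q => a / 2 * p3 q)) => // t.
  by apply: contM; [exact: cont_cst|exact: c3].
move=> y y0; rewrite /fundamental_solution /= /enorm; set q := Num.sqrt _.
have q0 : 0 < q by rewrite sqrtr_gt0.
have qn : q != 0 by rewrite gt_eqF.
have pn : pi != 0 :> R by rewrite gt_eqF// pi_gt0.
rewrite -(fmorphV (real_complex R)); apply/eqP; rewrite eq_complex /=; apply/andP.
by split; apply/eqP; rewrite /f /h /a; move: (pi : R) pn (cos _) (sin _) => p pn cq sq; field; rewrite pn qn.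
Qed.

(** At [s = r^2], [ln (1/r) / (2 pi)] is [- ln s / (4 pi)]. *)
Lemma fundamental_radial2_static : exists F F1 F2 H H1,
  [/\ @radial_profile R 2 0 F F1 F2, forall s, 0 < s -> is_derive s 1 H (H1 s),
      forall s, 0 < s -> {for s, continuous H1} &
      forall y : 'rV[R]_2, 0 < dot y y ->
        fundamental_solution 0 y = F (dot y y) +i* H (dot y y)].
Proof.
have pi0 : 0 < pi :> R := pi_gt0 R.
pose a : R := (4 * pi)^-1; have a0 : 0 < a by rewrite invr_gt0 mulr_gt0.
exists (fun s => - a * ln s), (fun s => - a / s ^+ 1), (fun s => a / s ^+ 2), (fun=> 0), (fun=> 0).
split.
- split.
  + move=> s s0; have h := is_deriveZ (- a) (is_derive1_ln s0).
    by apply: (is_derive_eq h); rewrite /GRing.scale/= expr1.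
  + move=> s s0; have h := is_derive_div 1 s0 (is_derive_cst (- a) s (1 : R)).
    by apply: (is_derive_eq h); rewrite /cst /=; field; rewrite gt_eqF.
  + move=> s s0; apply: contM; first exact: cont_cst.
    by apply: contV; [rewrite expf_neq0// gt_eqF|apply: contX; exact: cont_id].
  + by move=> s s0; rewrite expr0n /= mul0r addr0; field; rewrite gt_eqF.
  exists a, 1; split=> // r r0 _; rewrite expr1 -!exprM.
  by rewrite !divfK ?expf_neq0 ?gt_eqF.
- by move=> s _; exact: is_derive_cst.
- by move=> s _; exact: cont_cst.
move=> y y0; rewrite /fundamental_solution /= eqxx /enorm; congr Complex.
set q := Num.sqrt _; have q0 : 0 < q by rewrite sqrtr_gt0.
have -> : dot y y = q ^+ 2 by rewrite sqr_sqrtr// ltW.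
rewrite lnV ?posrE// lnXn// /a mulr2n.
have pn : pi != 0 :> R by rewrite gt_eqF.
by move: (pi : R) pn => p pn; field.
Qed.

(** * The Hankel function: dimension 2 and k > 0 *)

Section bessel.
Variable k : R.
Hypothesis k0 : 0 < k.
(** As a function of s = r^2, J_0(k r) is the entire series [J] with coefficients [a], and [S] is
    the series with harmonic numbers in Y_0(k r). [J1] and [S1] are derivatives in s, not Bessel
    functions of order one. *)
Let kap : R := k ^+ 2 / 4.
Let a (j : nat) : R := (- kap) ^+ j / (j`!%:R ^+ 2).
Let har (j : nat) : R := series harmonic j.
Let b (j : nat) : R := har j * a j.
Let J := sum_pseries a.
Let J1 := sum_pseries (pseries_diffs a).
Let S := sum_pseries b.
Let S1 := sum_pseries (pseries_diffs b).

Let kap0 : 0 < kap.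
Proof. by rewrite divr_gt0// exprn_gt0. Qed.

Let fact0 j : j`!%:R != 0 :> R.
Proof. by rewrite pnatr_eq0 -lt0n fact_gt0. Qed.

Let fact1 j : 1 <= j`!%:R :> R.
Proof. by rewrite ler1n fact_gt0. Qed.

(** Bessel's equation in coefficients: [(s J')' = - kap J]. *)
Let aS j : j.+1%:R ^+ 2 * a j.+1 = - kap * a j.
Proof.
rewrite /a factS natrM [(- kap) ^+ j.+1]exprS; have := fact0 j; move: (j`!%:R) => f f0.
have n0 : j.+1%:R != 0 :> R by rewrite pnatr_eq0.
by move: (j.+1%:R) n0 ((- kap) ^+ j) => n n0 p; field; rewrite ?n0 ?f0.
Qed.

Let norm_a j : `|a j| = kap ^+ j / (j`!%:R ^+ 2).
Proof. by rewrite normrM normrX normrN (ger0_norm (ltW kap0)) ger0_norm// invr_ge0 sqr_ge0. Qed.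

Let har_le j : 0 <= har j <= j`!%:R.
Proof.
apply/andP; split; first by apply: sumr_ge0 => i _; rewrite invr_ge0.
apply: (@le_trans _ _ j%:R); last by rewrite ler_nat; case: j => // j; exact: fact_geq.
rewrite /har /series /= -[j in j%:R]subn0 -sumr_const_nat; apply: ler_sum => i _.
by rewrite /harmonic /= invf_le1// ler1n.
Qed.

Let type_a : exponential_type a.
Proof.
exists 1, kap; split=> // [|j]; first exact: ltW.
rewrite norm_a mul1r ler_wpM2l ?exprn_ge0 ?(ltW kap0)// lef_pV2 ?posrE ?exprn_gt0 ?ltr0n ?fact_gt0//.
by rewrite expr2 ler_peMl.
Qed.

Let type_b : exponential_type b.
Proof.
exists 1, kap; split=> // [|j]; first exact: ltW.
rewrite normrM norm_a mul1r; have /andP[h1 h2] := har_le j; rewrite ger0_norm// mulrCA.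
rewrite ler_wpM2l ?exprn_ge0 ?(ltW kap0)// ler_pdivrMr ?exprn_gt0 ?ltr0n ?fact_gt0//.
by rewrite expr2 mulKf.
Qed.

Let diffs_na : pseries_diffs (fun j => j%:R * a j) = (fun j => - kap * a j + 0 * a j).
Proof. by apply/funext => j; rewrite /pseries_diffs mulrA -expr2 aS mul0r addr0. Qed.

(** In coefficients, [(s S')' = - kap S + J']; the term J' comes from
    [har (j + 1) = har j + 1 / (j + 1)]. *)
Let diffs_nb : pseries_diffs (fun j => j%:R * b j) = (fun j => - kap * b j + 1 * pseries_diffs a j).
Proof.
apply/funext => j; rewrite /pseries_diffs /b mulrA -expr2 mulrCA aS.
rewrite (_ : har j.+1 = har j + j.+1%:R^-1); last by rewrite /har /series /= big_nat_recr.
rewrite mulrDl mul1r; congr (_ + _); first by ring.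
have n0 : j.+1%:R != 0 :> R by rewrite pnatr_eq0.
by rewrite -aS; field.
Qed.

Let type_n (c : nat -> R) : exponential_type c -> exponential_type (fun j => j%:R * c j).
Proof.
move=> [A [B [A0 B0 cAB]]]; exists A, (2 * B); split=> // [|j]; first exact: mulr_ge0.
rewrite normrM ger0_norm//; apply: le_trans (ler_wpM2l (ler0n _ _) (cAB j)) _.
rewrite exprMn !mulrA ler_wpM2r ?invr_ge0// ler_wpM2r ?exprn_ge0// mulrC ler_wpM2l//.
by rewrite -natrX ler_nat ltnW// ltn_expl.
Qed.

(** From [(s c')' = g] follows [c'' = (g - c') / s] for [s > 0], which expresses second derivatives
    by functions already at hand. *)
Let derive_aux (c : nat -> R) (g : R -> R) : exponential_type c ->
  (forall s, sum_pseries (pseries_diffs (fun j => j%:R * c j)) s = g s) ->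
  forall s, 0 < s -> is_derive s 1 (sum_pseries (pseries_diffs c))
    ((g s - sum_pseries (pseries_diffs c) s) / s).
Proof.
move=> tc hg s s0; have dP := is_derive_sum_pseries s (type_n tc); rewrite hg in dP.
have h1 := is_derive_div 1 s0 dP.
have e : \forall t \near s, sum_pseries (fun j => j%:R * c j) t / t ^+ 1 = sum_pseries (pseries_diffs c) t.
  have : nbhs s [set t : R | 0 < t] by apply: open_nbhs_nbhs; split; [exact: open_gt|].
  apply: filterS => t /= t0; rewrite -sum_pseriesX// expr1 mulrC mulKf//.
  by rewrite gt_eqF.
have := near_eq_is_derive e h1.
rewrite -sum_pseriesX// => h2; apply: (is_derive_eq h2).
by field; rewrite gt_eqF.
Qed.

Let dJ s : is_derive s 1 J (J1 s). Proof. exact: is_derive_sum_pseries. Qed.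
Let dS s : is_derive s 1 S (S1 s). Proof. exact: is_derive_sum_pseries. Qed.

Let dJ1 s : 0 < s -> is_derive s 1 J1 ((- kap * J s - J1 s) / s).
Proof.
apply: (@derive_aux a (fun s => - kap * J s)) => // t; rewrite diffs_na sum_pseriesZD//.
by rewrite mul0r addr0.
Qed.

Let dS1 s : 0 < s -> is_derive s 1 S1 ((- kap * S s + J1 s - S1 s) / s).
Proof.
apply: (@derive_aux b (fun s => - kap * S s + J1 s)) => // t; rewrite diffs_nb sum_pseriesZD//.
  by rewrite mul1r.
exact: exponential_type_diffs.
Qed.

(** The real part of (i/4)(J_0 + i Y_0) is - Y_0 / 4, and ln(k r / 2) = ln s / 2 + ln(k / 2). This
    yields the factor [w] and the constant [c0]. *)
Let c0 : R := ln (k / 2) + euler_gamma.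
Let w : R := - (2 * pi)^-1.
Let F s : R := w * ((ln s / 2 + c0) * J s - S s).
Let F1 s : R := w * (J s / (2 * s) + (ln s / 2 + c0) * J1 s - S1 s).
Let J2 s : R := (- kap * J s - J1 s) / s.
Let S2 s : R := (- kap * S s + J1 s - S1 s) / s.
Let F2 s : R := w * (J1 s / s - J s / (2 * s ^+ 2) + (ln s / 2 + c0) * J2 s - S2 s).

Let pi0 : 0 < pi :> R. Proof. exact: pi_gt0. Qed.

Let dL s : 0 < s -> is_derive s 1 (fun t => ln t / 2 + c0) (2 * s)^-1.
Proof.
move=> s0; have h := is_deriveD (is_deriveZ 2^-1 (is_derive1_ln s0)) (is_derive_cst c0 s (1 : R)).
rewrite (_ : (fun t => ln t / 2 + c0) = 2^-1 \*: @ln R + cst c0).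
  by apply: (is_derive_eq h); rewrite /GRing.scale/= addr0 invfM.
by apply/funext => t; rewrite !fctE /cst mulrC.
Qed.

Let dF s : 0 < s -> is_derive s 1 F (F1 s).
Proof.
move=> s0; have h := is_deriveZ w (is_deriveB (is_deriveM (dL s0) (dJ s)) (dS s)).
apply: (is_derive_eq h); rewrite /F1 /GRing.scale/=.
by field; rewrite gt_eqF.
Qed.

Let dF1 s : 0 < s -> is_derive s 1 F1 (F2 s).
Proof.
move=> s0; have h1 : is_derive s 1 (fun t => J t / (2 * t)) (J1 s / (2 * s) - J s / (2 * s ^+ 2)).
  have h := is_deriveZ 2^-1 (is_derive_div 1 s0 (dJ s)).
  rewrite (_ : (fun t => J t / (2 * t)) = 2^-1 \*: (fun t => J t / t ^+ 1)).
    by apply: (is_derive_eq h); rewrite /GRing.scale/=; field; rewrite gt_eqF.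
  by apply/funext => t; rewrite invfM; exact: mulrCA.
have h := is_deriveZ w (is_deriveB (is_deriveD h1 (is_deriveM (dL s0) (dJ1 s0))) (dS1 s0)).
apply: (is_derive_eq h); rewrite /F2 /J2 /S2 /GRing.scale/=.
by field; rewrite gt_eqF.
Qed.

Let cJ s : {for s, continuous J}. Proof. exact: is_derive_continuous (dJ s). Qed.
Let cS s : {for s, continuous S}. Proof. exact: is_derive_continuous (dS s). Qed.
Let cJ1 s : {for s, continuous J1}.
Proof. exact: is_derive_continuous (is_derive_sum_pseries s (exponential_type_diffs type_a)). Qed.
Let cS1 s : {for s, continuous S1}.
Proof. exact: is_derive_continuous (is_derive_sum_pseries s (exponential_type_diffs type_b)). Qed.

Let cJJ s : {for s, continuous (fun s => - kap * J s - J1 s)}.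
Proof. by apply: contB; [apply: contM; [exact: cont_cst|exact: cJ]|exact: cJ1]. Qed.
Let cSS s : {for s, continuous (fun s => - kap * S s + J1 s - S1 s)}.
Proof.
apply: contB; last exact: cS1.
by apply: contD; [apply: contM; [exact: cont_cst|exact: cS]|exact: cJ1].
Qed.

Let cF2 s : 0 < s -> {for s, continuous F2}.
Proof.
move=> s0; have cV : {for s, continuous (fun t : R => t^-1)}.
  by apply: contV; [rewrite gt_eqF|exact: cont_id].
have cL := is_derive_continuous (dL s0).
apply: contM; first exact: cont_cst.
apply: contB; last by apply: contM; [exact: cSS|exact: cV].
apply: contD; last by apply: contM; [exact: cL|apply: contM; [exact: cJJ|exact: cV]].
apply: contB; first by apply: contM; [exact: cJ1|exact: cV].
apply: contM; first exact: cJ.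
apply: contV; first by rewrite mulf_neq0// expf_neq0// gt_eqF.
by apply: contM; [exact: cont_cst|apply: contX; exact: cont_id].
Qed.

Let ode s : 0 < s -> 4 * s * F2 s + 2 * 2%:R * F1 s + k ^+ 2 * F s = 0.
Proof.
move=> s0; have -> : k ^+ 2 = 4 * kap by rewrite /kap; field.
by rewrite /F2 /F1 /F /J2 /S2; field; rewrite gt_eqF.
Qed.

(** In r^2 F'(r^2) and r^4 F''(r^2) the logarithm occurs only with the factor r^2. As [ln] is 0 on
    nonpositive numbers, continuity at 0 holds from both sides. *)
Let rln (r : R) : R := r ^+ 2 * ln r.

Let crln : {for 0, continuous rln}.
Proof.
have h (r : R) : `|r| <= 1 -> `|rln r| <= `|r|.
  move=> r1; rewrite /rln; have [r0|r0] := leP r 0.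
    by rewrite ln0// mulr0 normr0.
  rewrite (ger0_norm (ltW r0)) in r1 *; rewrite normrM ger0_norm ?sqr_ge0//.
  rewrite ler0_norm; last by rewrite ln_le0.
  have : ln (1 + (r^-1 - 1)) <= r^-1 - 1 by apply: le_ln1Dx; rewrite ltrBrDl subrr invr_gt0.
  rewrite addrC subrK lnV ?posrE// => hl.
  apply: (@le_trans _ _ (r ^+ 2 * r^-1)); last by rewrite expr2 mulfK// gt_eqF.
  by rewrite ler_wpM2l ?sqr_ge0//; lra.
have rln0 : rln 0 = 0 by rewrite /rln expr0n mul0r.
rewrite /prop_for /continuous_at rln0; apply/(@cvgrPdist_lt _ _ _ (nbhs (0 : R))) => e e0.
apply/nbhs_ballP; exists (Num.min 1 e); first by rewrite /= lt_min ltr01.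
move=> r; rewrite /ball /= sub0r normrN lt_min => /andP[r1 re].
by rewrite sub0r normrN; apply: le_lt_trans (h r (ltW r1)) re.
Qed.

Lemma fundamental_radial2_dynamic : exists F F1 F2 H H1,
  [/\ @radial_profile R 2 k F F1 F2, forall s, 0 < s -> is_derive s 1 H (H1 s),
      forall s, 0 < s -> {for s, continuous H1} &
      forall y : 'rV[R]_2, 0 < dot y y ->
        fundamental_solution k y = F (dot y y) +i* H (dot y y)].
Proof.
have J00 : J 0 = 1 by rewrite /J sum_pseries0 /a expr0 expr1n divr1.
have w0 : - w = (2 * pi)^-1 by rewrite /w opprK.
(* For [r > 0], [q1] is [- 2 pi r^2 F1(r^2)] and [q2] is [2 pi r^4 F2(r^2)]; both are continuous at
   0 with value 1/2. *)
pose q1 (r : R) := J (r ^+ 2) / 2 + (rln r + c0 * r ^+ 2) * J1 (r ^+ 2) - r ^+ 2 * S1 (r ^+ 2).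
pose q2 (r : R) := J (r ^+ 2) / 2 - r ^+ 2 * J1 (r ^+ 2) -
  (rln r + c0 * r ^+ 2) * (- kap * J (r ^+ 2) - J1 (r ^+ 2)) +
  r ^+ 2 * (- kap * S (r ^+ 2) + J1 (r ^+ 2) - S1 (r ^+ 2)).
have cX (r : R) : {for r, continuous (fun r => r ^+ 2)} by apply: contX; exact: cont_id.
have cc (g : R -> R) (r : R) : (forall s, {for s, continuous g}) -> {for r, continuous (fun r => g (r ^+ 2))}.
  by move=> cg; apply: (cont_comp (cX r)); exact: cg.
have crc : {for 0, continuous (fun r => rln r + c0 * r ^+ 2)}.
  by apply: contD; [exact: crln|apply: contM; [exact: cont_cst|exact: cX]].
have ch : {for 0, continuous (fun r => J (r ^+ 2) / 2)}.
  by apply: contM; [apply: cc; exact: cJ|exact: cont_cst].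
have cq1 : {for 0, continuous q1}.
  apply: contB; last by apply: contM; [exact: cX|apply: cc; exact: cS1].
  by apply: contD; [exact: ch|apply: contM; [exact: crc|apply: cc; exact: cJ1]].
have cq2 : {for 0, continuous q2}.
  apply: contD; last by apply: contM; [exact: cX|exact: (cc _ _ cSS)].
  apply: contB; last by apply: contM; [exact: crc|exact: (cc _ _ cJJ)].
  by apply: contB; [exact: ch|apply: contM; [exact: cX|apply: cc; exact: cJ1]].
have rln0 : rln 0 = 0 by rewrite /rln expr0n mul0r.
have q10 : q1 0 = 2^-1 by rewrite /q1 rln0 expr0n /= !(mulr0, mul0r, addr0, subr0) J00 div1r.
have q20 : q2 0 = 2^-1 by rewrite /q2 rln0 expr0n /= !(mulr0, mul0r, addr0, subr0) J00 div1r.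
have lt4 : 4^-1 < 2^-1 :> R by rewrite ltf_pV2 ?posrE// ltr_nat.
have [|r1 r10 h1] := @cont_lower q1 4^-1 cq1; first by rewrite q10.
have [|r2 r20 h2] := @cont_lower q2 4^-1 cq2; first by rewrite q20.
exists F, F1, F2, (fun s => J s / 4), (fun s => J1 s / 4); split.
- split; [exact: dF|exact: dF1|exact: cF2|exact: ode|].
  exists ((2 * pi)^-1 / 4), (Num.min r1 r2); split.
  + by rewrite divr_gt0// invr_gt0 mulr_gt0.
  + by rewrite lt_min r10.
  move=> r r0; rewrite lt_min => /andP[/(h1 r r0) e1 /(h2 r r0) e2].
  have rn : r != 0 by rewrite gt_eqF.
  have pn : pi != 0 :> R by rewrite gt_eqF.
  have lnr : ln (r ^+ 2) = 2 * ln r by rewrite lnXn// mulr_natl.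
  have p0 : 0 < (2 * pi)^-1 :> R by rewrite invr_gt0 mulr_gt0.
  have E1 : F1 (r ^+ 2) * r ^+ 2 = - ((2 * pi)^-1 * q1 r).
    by rewrite /F1 /q1 /w lnr /rln; move: (pi : R) pn => p pn; field; rewrite rn pn.
  have E2 : F2 (r ^+ 2) * r ^+ 4 = (2 * pi)^-1 * q2 r.
    by rewrite /F2 /q2 /w /J2 /S2 lnr /rln; move: (pi : R) pn => p pn; field; rewrite rn pn.
  by rewrite E1 E2; split; [rewrite lerN2|]; rewrite ler_pM2l.
- move=> s _; have h := is_deriveZ 4^-1 (dJ s).
  rewrite (_ : (fun s => J s / 4) = 4^-1 \*: J).
    by apply: (is_derive_eq h); rewrite /GRing.scale/= mulrC.
  by apply/funext => t; exact: mulrC.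
- by move=> s _; apply: contM; [exact: cJ1|exact: cont_cst].
move=> y y0; rewrite /fundamental_solution /= gt_eqF// /enorm.
set q := Num.sqrt _; have q0 : 0 < q by rewrite sqrtr_gt0.
have -> : dot y y = q ^+ 2 by rewrite sqr_sqrtr// ltW.
have powE j : (-1) ^+ j * (k * q / 2) ^+ (2 * j) / (j`!%:R ^+ 2) = a j * (q ^+ 2) ^+ j.
  rewrite exprM (_ : (k * q / 2) ^+ 2 = kap * q ^+ 2); last by rewrite /kap; field.
  rewrite exprMn /a [(- kap) ^+ j]exprNn; move: (j`!%:R ^+ 2)^-1 (kap ^+ j) => f p.
  by move: (_ ^+ j) (_ ^+ j) => u v; ring.
have JE : besselJ0 (k * q) = J (q ^+ 2).
  by rewrite /besselJ0 /J /sum_pseries /pseries; congr (limn (series _)); apply/funext => j; exact: powE.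
have YE : besselY0 (k * q) = 2 / pi * ((ln (q ^+ 2) / 2 + c0) * J (q ^+ 2) - S (q ^+ 2)).
  rewrite /besselY0 JE; congr (_ * (_ * _ - _)).
    have -> : k * q / 2 = (k / 2) * q by ring.
    by rewrite lnM ?posrE ?divr_gt0// lnXn// /c0 mulr2n; field.
  rewrite /S /sum_pseries /pseries; congr (limn (series _)); apply/funext => j.
  by rewrite /b /har -[RHS]mulrA -powE; ring.
rewrite /hankel0 JE YE; apply/eqP; rewrite eq_complex /=; apply/andP.
have pn : pi != 0 :> R by rewrite gt_eqF.
by split; apply/eqP; rewrite /F /w; move: (pi : R) pn => p pn; field.
Qed.

End bessel.

Lemma fundamental_radial (m : nat) k : m = 2%N \/ m = 3%N -> 0 <= k -> exists F F1 F2 H H1,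
  [/\ @radial_profile R m k F F1 F2, forall s, 0 < s -> is_derive s 1 H (H1 s),
      forall s, 0 < s -> {for s, continuous H1} &
      forall y : 'rV[R]_m, 0 < dot y y ->
        fundamental_solution k y = F (dot y y) +i* H (dot y y)].
Proof.
move=> [->|->] k0; last exact: fundamental_radial3.
move: k0; rewrite le_eqVlt => /orP[/eqP <-|]; first exact: fundamental_radial2_static.
exact: fundamental_radial2_dynamic.
Qed.

End profiles.

(** * Needle sequences *)

Section convergence_of_jets.
Context {R : realType} {m : nat}.
Local Notation E := 'rV[R]_m.
Local Notation C := R[i].
Local Notation mu := (@lebesgue_rV R m).
Local Notation J := ('I_m.+1 -> E -> R).
Local Notation Re := (@complex.Re R).
Local Notation Im := (@complex.Im R).
Implicit Types (f g h phi psi : E -> R) (K U A O Omega D S : set E) (W Z G : J) (v : E -> C).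

Lemma bounded_on_compact K h : compact K -> (forall y, K y -> {for y, continuous h}) ->
  exists2 M : R, 0 < M & forall y, K y -> `|h y| <= M.
Proof.
move=> cK ch; have : compact (h @` K).
  apply: continuous_compact => //; apply: continuous_in_subspaceT => y.
  by rewrite inE; exact: ch.
move=> /compact_bounded[M [Mr MP]]; exists (`|M| + 1); first by rewrite ltr_wpDl.
move=> y Ky; apply: (MP (`|M| + 1)); last by exists y.
by rewrite (le_lt_trans (ler_norm _))// ltrDl.
Qed.

Lemma continuous_L2r U K g : open U -> (forall y, U y -> {for y, continuous g}) -> compact K ->
  K `<=` U -> L2r mu K g.
Proof.
move=> oU cg cK KU; have [M M0 gM] := bounded_on_compact cK (fun y Ky => cg y (KU y Ky)).
apply: (@L2r_bounded _ _ _ _ _ (compact_measurable_rV cK) _ M) => //.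
- exact: lebesgue_rV_compact.
- by apply: measurable_funS KU (continuous_measurable_rV oU cg); exact: open_measurable_rV.
Qed.

Lemma continuous_L1c U g : open U -> (forall y, U y -> {for y, continuous g}) -> L1c U g.
Proof.
move=> oU cg K cK KU; have mK := compact_measurable_rV cK.
by apply: L2r_L1c (continuous_L2r oU cg cK KU) _ _ cK _.
Qed.

Lemma C1_L2jet U K g : open U -> (forall i, C1_on U g i) -> compact K -> K `<=` U ->
  (0 < m)%N -> L2jet K (jet g).
Proof.
move=> oU cg cK KU m0 j; rewrite /jet; case: unliftP => [i|] _.
  by apply: (continuous_L2r oU) => // y Uy; have [_ _] := cg i y Uy.
apply: (continuous_L2r oU) => // y Uy; have [+ _ _] := cg (Ordinal m0) y Uy; exact.
Qed.

Definition jets_converge U (Rn : nat -> J) G := forall K, compact K -> K `<=` U ->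
  forall e : R, 0 < e -> exists N, forall n, (N <= n)%N ->
    jform 1 K (Rn n - G) (Rn n - G) < e.

Lemma L1cB U f g : open U -> L1c U f -> L1c U g -> L1c U (fun y => f y - g y).
Proof.
move=> oU lf lg K cK KU; have mK := compact_measurable_rV cK.
have := integrableB mK (lf K cK KU) (lg K cK KU).
by apply: eq_integrable => // y _ /=.
Qed.

(** [Phi] is only C^1 in [U] and may be too singular at its boundary for the difference to lie in
    H^1(U), as happens for the fundamental solution at the tip. The weak derivatives are therefore
    verified in L^1_loc and identified almost everywhere. *)
Lemma weak_partial_difference U A (u : E -> C) gR gI (Phi : E -> C) : open U -> H1 U u ->
  (0 < m)%N ->
  (forall i, C1_on U gR i) -> (forall i, C1_on U gI i) ->
  (forall y, U y -> Phi y = gR y +i* gI y) ->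
  let d y := u y - Phi y in
  [/\ ae_jet U (Rej U d) (Rej U u - jet gR), ae_jet U (Imj U d) (Imj U u - jet gI),
      forall j, measurable_fun U (Rej U d j) & forall j, measurable_fun U (Imj U d j)].
Proof.
move=> oU hu m0 cR cI PhiE d; have mU := open_measurable_rV oU.
have [lR lI gradR gradI] := H1_jets oU hu.
have eR y : U y -> Re (d y) = Re (u y) - gR y by move=> Uy; rewrite /d PhiE//; case: (u y).
have eI y : U y -> Im (d y) = Im (u y) - gI y by move=> Uy; rewrite /d PhiE//; case: (u y).
have c0 g : (forall i, C1_on U g i) -> forall y, U y -> {for y, continuous g}.
  by move=> cg y Uy; have [+ _ _] := cg (Ordinal m0) y Uy.
have c1 g : (forall i, C1_on U g i) -> forall i y, U y -> {for y, continuous (partial i g)}.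
  by move=> cg i y Uy; have [_ _] := cg i y Uy.
have parts W g i phi : L2jet U W -> weak_gradient U W -> (forall i, C1_on U g i) ->
    test_function U phi -> \int[mu]_(y in U) ((W ord0 y - g y) * partial i phi y) =
    - \int[mu]_(y in U) ((W (lift ord0 i) y - partial i g y) * phi y).
  move=> lW gW cg tphi.
  have i1 := L1c_test_integrable oU (L2r_L1c (lW ord0) mU) (test_function_partial i tphi).
  have i2 := L1c_test_integrable oU (continuous_L1c oU (c0 g cg)) (test_function_partial i tphi).
  have i3 := L1c_test_integrable oU (L2r_L1c (lW (lift ord0 i)) mU) tphi.
  have i4 := L1c_test_integrable oU (continuous_L1c oU (c1 g cg i)) tphi.
  under eq_Rintegral do rewrite mulrBl.
  rewrite RintegralB// gW// integration_by_parts//.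
  under [in RHS]eq_Rintegral do rewrite mulrBl.
  by rewrite RintegralB//; ring.
have wp i : is_weak_partial U i d
    (fun y => (Rej U u (lift ord0 i) y - partial i gR y) +i*
              (Imj U u (lift ord0 i) y - partial i gI y)).
  apply/is_weak_partialP; split.
    by apply/L1locP; split; apply: L1cB => //;
      first [exact: L2r_L1c|apply: continuous_L1c => //; exact: c1].
  move=> phi tphi; split.
    rewrite -(parts _ _ _ _ lR gradR cR tphi); apply: eq_Rintegral => y.
    by rewrite inE => Uy; rewrite eR// Rej0.
  rewrite -(parts _ _ _ _ lI gradI cI tphi); apply: eq_Rintegral => y.
  by rewrite inE => Uy; rewrite eI// Imj0.
have [_ m1] : (forall j, measurable_fun U (Rej U u j)) /\ (forall j, measurable_fun U (Imj U u j)).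
  by split=> j; [exact: (lR j).1|exact: (lI j).1].
have mwp i : measurable_fun U (Re \o weak_partial U i d) /\ measurable_fun U (Im \o weak_partial U i d).
  have /is_weak_partialP[/L1locP[l1 l2] _] := weak_partialP (wp i).
  by split; exact: measurable_L1c.
split=> j.
- case: (unliftP ord0 j) => [i|] -> ; last first.
    apply: aeW => y Uy; transitivity (Rej U u ord0 y - jet gR ord0 y) => //.
    by rewrite !Rej0 jet_ord0 /= eR.
  have [h _] := weak_partial_ae_eq oU (wp i).
  by rewrite RejS; apply: filterS h => y h Uy; rewrite h//= -jet_lift.
- case: (unliftP ord0 j) => [i|] -> ; last first.
    apply: aeW => y Uy; transitivity (Imj U u ord0 y - jet gI ord0 y) => //.
    by rewrite !Imj0 jet_ord0 /= eI.
  have [_ h] := weak_partial_ae_eq oU (wp i).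
  by rewrite ImjS; apply: filterS h => y h Uy; rewrite h//= -jet_lift.
- case: (unliftP ord0 j) => [i|] -> ; first by rewrite RejS; exact: (mwp i).1.
  rewrite Rej0; apply: (eq_measurable_fun (fun y => Re (u y) - gR y)).
    by move=> y; rewrite inE => Uy /=; rewrite eR.
  apply: measurable_funB; first by have := (lR ord0).1; rewrite Rej0.
  by apply: continuous_measurable_rV => //; exact: c0.
- case: (unliftP ord0 j) => [i|] -> ; first by rewrite ImjS; exact: (mwp i).2.
  rewrite Imj0; apply: (eq_measurable_fun (fun y => Im (u y) - gI y)).
    by move=> y; rewrite inE => Uy /=; rewrite eI.
  apply: measurable_funB; first by have := (lI ord0).1; rewrite Imj0.
  by apply: continuous_measurable_rV => //; exact: c0.
Qed.

Lemma ae_jetS U A W Z : measurable A -> A `<=` U -> ae_jet U W Z -> ae_jet A W Z.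
Proof. by move=> mA AU WZ j; apply: filterS (WZ j) => y h /AU. Qed.

Lemma ae_jet_trans U W Z W' : ae_jet U W Z -> ae_jet U Z W' -> ae_jet U W W'.
Proof. by move=> h1 h2 j; apply: filterS2 (h1 j) (h2 j) => y a b Uy; rewrite a// b. Qed.

Lemma ae_jetBr U W W' Z : ae_jet U W W' -> ae_jet U (W - Z) (W' - Z).
Proof. by move=> h; apply: ae_jetB => // j; apply: aeW. Qed.

Lemma radial_C1 F F1 (x : E) O i :
  (forall s : R, 0 < s -> is_derive s 1 F (F1 s)) -> (forall s : R, 0 < s -> {for s, continuous F1}) ->
  (forall y, O y -> y <> x) ->
  C1_on O (fun y => F (sqdist x y)) i /\
  forall y, O y -> partial i (fun y => F (sqdist x y)) y =
    F1 (sqdist x y) * (2 * (y ord0 i - x ord0 i)).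
Proof.
move=> dF cF ne; have [] := C1_on_radial (x := x) (O := O) i (lexx 0) dF cF.
  by move=> y /ne yx; rewrite addr0; exact: sqdist_gt0.
rewrite (_ : (fun y => F (sqdist x y + 0)) = (fun y => F (sqdist x y))); last first.
  by apply/funext => y; rewrite addr0.
by move=> h1 h2; split=> // y /h2; rewrite addr0.
Qed.

(** In the definition of a needle sequence the gradient is taken in [Omega] minus the needle; the
    jets of [v n] taken in [Omega] agree with it there almost everywhere. *)
Lemma needle_sequence_jets (k : R) Omega (x : E) sigma (v : nat -> E -> C) F F1 H H1' :
  open Omega -> (0 < m)%N -> compact (sigma @` `[0, 1]) -> sigma 1 = x ->
  (forall s : R, 0 < s -> is_derive s 1 F (F1 s)) -> (forall s : R, 0 < s -> {for s, continuous F1}) ->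
  (forall s : R, 0 < s -> is_derive s 1 H (H1' s)) -> (forall s : R, 0 < s -> {for s, continuous H1'}) ->
  (forall y : E, 0 < dot y y -> fundamental_solution k y = F (dot y y) +i* H (dot y y)) ->
  needle_sequence k Omega x sigma v ->
  let U := Omega `\` sigma @` `[0, 1] in
  [/\ jets_converge U (fun n => Rej Omega (v n)) (jet (fun y => F (sqdist x y))),
      jets_converge U (fun n => Imj Omega (v n)) (jet (fun y => H (sqdist x y))),
      forall i, C1_on U (fun y => F (sqdist x y)) i & forall i, C1_on U (fun y => H (sqdist x y)) i].
Proof.
move=> oO m0 cS s1 dF cF dH cH fund [hel conv] U; have mO := open_measurable_rV oO.
have oU : open U by rewrite /U setDE; apply: openI => //; exact: closed_openC (compact_closed_rV cS).
have UO : U `<=` Omega by move=> y [].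
have ne y : U y -> y <> x by move=> [_ +] yx; apply; exists 1; rewrite ?yx//= in_itv /= ler01 lexx.
have CR i := (radial_C1 i dF cF ne).1; have CI i := (radial_C1 i dH cH ne).1.
have aux K : compact K -> K `<=` U -> forall e : R, 0 < e -> exists N, forall n, (N <= n)%N ->
    jform 1 K (Rej Omega (v n) - jet (fun y => F (sqdist x y))) (Rej Omega (v n) - jet (fun y => F (sqdist x y))) +
    jform 1 K (Imj Omega (v n) - jet (fun y => H (sqdist x y))) (Imj Omega (v n) - jet (fun y => H (sqdist x y))) < e.
  move=> cK KU; have mK := compact_measurable_rV cK.
  have lGR := C1_L2jet oU CR cK KU m0; have lGI := C1_L2jet oU CI cK KU m0.
  have mU := open_measurable_rV oU.
  have linK := @linear_L2jet R m K mK.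
  have key n : let d y := v n y - fundamental_solution k (y - x) in
      [/\ L2jet K (Rej Omega (v n) - jet (fun y => F (sqdist x y))),
          L2jet K (Imj Omega (v n) - jet (fun y => H (sqdist x y))),
          ae_jet K (Rej U d) (Rej Omega (v n) - jet (fun y => F (sqdist x y))) /\
          ae_jet K (Imj U d) (Imj Omega (v n) - jet (fun y => H (sqdist x y))) &
          L2jet K (Rej U d) /\ L2jet K (Imj U d)].
    move=> d; have [hO _] := hel n; have [hU aR aI] := H1S oO oU UO hO.
    have [lR lI _ _] := H1_jets oO hO.
    have lR' := L2jetS mO mK (subset_trans KU UO) lR.
    have lI' := L2jetS mO mK (subset_trans KU UO) lI.
    have lR2 := lsetB linK lR' lGR; have lI2 := lsetB linK lI' lGI.
    have [|dR dI mR mI] := weak_partial_difference (Phi := fun y => fundamental_solution k (y - x)) K oU hU m0 CR CI.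
      by move=> y /ne yx; rewrite fund//; exact: sqdist_gt0.
    have eR := ae_jetS mK KU (ae_jet_trans dR (ae_jetBr (jet (fun y => F (sqdist x y))) aR)).
    have eI := ae_jetS mK KU (ae_jet_trans dI (ae_jetBr (jet (fun y => H (sqdist x y))) aI)).
    split=> //; split.
      move=> j; apply: ae_eq_L2r (lR2 j) => //.
        by apply: measurable_funS (mR j).
      by apply: filterS (eR j) => y h Ky; rewrite h.
    move=> j; apply: ae_eq_L2r (lI2 j) => //.
      by apply: measurable_funS (mI j).
    by apply: filterS (eI j) => y h Ky; rewrite h.
  have := conv K cK KU.
  move/(norms_cvg0P (U := U) (d := fun n y => v n y - fundamental_solution k (y - x)) mK (fun n => let: And4 _ _ _ h := key n in h)).
  move=> h e /h[N hN]; exists N => n /hN.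
  have [a1 a2 [a3 a4] [a5 a6]] := key n.
  by rewrite (ae_eq_jform _ a5 a5 a1 a1 mK a3 a3) (ae_eq_jform _ a6 a6 a2 a2 mK a4 a4).
split=> // K cK KU e /(aux K cK KU)[N hN]; exists N => n /hN; apply: le_lt_trans.
  by rewrite lerDl jform_ge0.
by rewrite lerDr jform_ge0.
Qed.

End convergence_of_jets.

(** * Needles that avoid D *)

Section cutoff_estimate.
Context {R : realType} {m : nat}.
Local Notation E := 'rV[R]_m.
Local Notation mu := (@lebesgue_rV R m).
Local Notation J := ('I_m.+1 -> E -> R).
Implicit Types (f g h phi psi chi : E -> R) (K L U A O Omega D S : set E) (W Z G : J).

(** Expand [a] at [u n = d + w]; Young's inequality absorbs the cross term [2 a d w] at the price of
    [e / 2]. *)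
Lemma form_converges (X : lmodType R) (V : set X) (b a : X -> X -> R) (M : R) (u : nat -> X) w :
  linear_set V -> bilinear_form V a -> 0 <= M ->
  (forall x y, V x -> V y -> a x y ^+ 2 <= M * (b x x * b y y)) ->
  (forall x, V x -> 0 <= b x x) -> (forall n, V (u n)) -> V w -> converges_for b u w ->
  (fun n => a (u n) (u n)) @ \oo --> a w w.
Proof.
move=> linV bila M0 bound b0 Vu Vw cu.
apply/(@cvgrPdist_lt _ _ _ (nbhs \oo)) => e e0.
pose c := M + 1 + 2 * M * b w w / e.
have Mbw : 0 <= 2 * M * b w w / e by rewrite divr_ge0 ?(ltW e0)// mulr_ge0 ?b0// mulr_ge0.
have c0 : 0 < c by rewrite /c; lra.
have [N hN] := cu _ (divr_gt0 e0 (mulr_gt0 (ltr0n R 2) c0)); exists N => // n /= /hN.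
set d := u n - w => bd; have Vd : V d by exact: lsetB.
have -> : a w w - a (u n) (u n) = - (a d d + 2 * a d w).
  have -> : u n = d + w by rewrite /d subrK.
  by rewrite (form_sqrD linV bila)//; ring.
rewrite normrN; move: bd; rewrite ltr_pdivlMr ?mulr_gt0// => bd.
have h1 : `|a d d| <= (M + 1) * b d d.
  rewrite -ler_sqr ?nnegrE ?normr_ge0 ?mulr_ge0 ?b0 ?addr_ge0// real_normK ?num_real//.
  apply: le_trans (bound _ _ Vd Vd) _.
  by rewrite -expr2 exprMn ler_wpM2r ?sqr_ge0//; nra.
have h2 : 2 * `|a d w| <= e / 2 + 2 * M * b w w / e * b d d.
  have h3 : `|a d w| ^+ 2 <= M * (b d d * b w w) by rewrite real_normK ?num_real//; exact: bound.
  have e20 : 0 < 2 / e by rewrite divr_gt0.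
  have : 0 <= 2 / e * (`|a d w| - e / 2) ^+ 2 by rewrite mulr_ge0 ?sqr_ge0// ltW.
  have -> : 2 / e * (`|a d w| - e / 2) ^+ 2 = 2 / e * `|a d w| ^+ 2 - 2 * `|a d w| + e / 2.
    by field; rewrite gt_eqF.
  have : 2 / e * `|a d w| ^+ 2 <= 2 / e * (M * (b d d * b w w)) by rewrite ler_pM2l.
  have -> : 2 / e * (M * (b d d * b w w)) = 2 * M * b w w / e * b d d by ring.
  lra.
apply: le_lt_trans (ler_normD _ _) _; rewrite normrM (ger0_norm (ler0n _ 2)).
have : c * b d d = (M + 1) * b d d + 2 * M * b w w / e * b d d by rewrite /c; ring.
lra.
Qed.

Lemma ip_eq0 A f g : (forall y, A y -> g y = 0) -> ip mu A f g = 0.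
Proof.
by move=> g0; rewrite /ip /Rintegral integral0_eq// => y Ay; rewrite g0// mulr0.
Qed.

Lemma jform_eq0 c A W Z : (forall j y, A y -> Z j y = 0) -> jform c A W Z = 0.
Proof.
move=> Z0; rewrite /jform ip_eq0; last by move=> y; exact: Z0.
by rewrite mulr0 add0r big1// => i _; rewrite ip_eq0//; exact: Z0.
Qed.

Lemma jform1_subset U A W : measurable U -> measurable A -> A `<=` U -> L2jet U W ->
  jform 1 A W W <= jform 1 U W W.
Proof.
move=> mU mA AU lW; rewrite !jform1E; apply: lerD; first exact: ip_subset.
by apply: ler_sum => i _; exact: ip_subset.
Qed.

Lemma ip_mul_bounded U h f (M : R) : measurable U -> measurable_fun U h ->
  (forall y, U y -> `|h y| <= M) -> L2r mu U f ->
  L2r mu U (fun y => h y * f y) /\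
  ip mu U (fun y => h y * f y) (fun y => h y * f y) <= M ^+ 2 * ip mu U f f.
Proof.
move=> mU mh hM lf; have mf := lf.1.
have le y : U y -> (h y * f y) ^+ 2 <= M ^+ 2 * f y ^+ 2.
  move=> Uy; rewrite exprMn ler_wpM2r ?sqr_ge0// -[h y ^+ 2]real_normK ?num_real//.
  by rewrite ler_sqr ?nnegrE// ?hM//; exact: le_trans (hM y Uy).
have iM : mu.-integrable U (EFin \o (fun y => M ^+ 2 * f y ^+ 2)).
  by have := integrableZl mU (M ^+ 2) lf.2; apply: eq_integrable => // y _ /=; rewrite EFinM.
have lhf : L2r mu U (fun y => h y * f y).
  split; first exact: measurable_funM.
  apply: le_integrable iM => //.
    by apply/measurable_EFinP/measurable_funX/measurable_funM.
  move=> y Uy /=; rewrite lee_fin ger0_norm ?sqr_ge0//.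
  by apply: le_trans (le y Uy) _; rewrite ler_norm.
split=> //; rewrite /ip -RintegralZl//; last first.
  by have := lf.2; apply: eq_integrable => // y _ /=; rewrite expr2.
apply: Rintegral_le => //.
by have := lhf.2; apply: eq_integrable => // y _ /=; rewrite expr2.
Qed.

Lemma jet_eq0_open phi O : open O -> (forall y, O y -> phi y = 0) ->
  forall j y, O y -> jet phi j y = 0.
Proof.
move=> oO phi0 j y Oy; rewrite /jet; case: unliftP => [i|] _; last exact: phi0.
have z0 z : ~ (~` O) z -> phi z = 0 by move=> /contrapT; exact: phi0.
have nOy : ~ (~` O) y by move=> /(_ Oy).
by have [_ h] := partial_near0 i (open_closedC oO) z0 nOy.
Qed.

Lemma test_functionM O chi phi L : compact L -> L `<=` O -> smooth chi ->
  (forall y, ~ L y -> chi y = 0) -> smooth phi -> test_function O (fun y => chi y * phi y).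
Proof.
move=> cL LO sc c0 sp; split; first exact: smoothM.
by exists L => //; split=> // y nL; rewrite c0// mul0r.
Qed.

(** What matters is that [M] depends neither on [U] nor on [phi]: it involves only bounds of [chi]
    and its first derivatives. *)
Lemma jform_cutoff chi L : compact L -> smooth chi -> (forall y, 0 <= chi y <= 1) ->
  (forall y, ~ L y -> chi y = 0) ->
  exists2 M, 0 <= M & forall U phi, measurable U -> test_function setT phi ->
    jform 1 U (jet (fun y => chi y * phi y)) (jet (fun y => chi y * phi y)) <=
    M * jform 1 U (jet phi) (jet phi).
Proof.
move=> cL sc c01 c0.
have bd i : exists M, forall y, `|partial i chi y| <= M.
  have [M M0 hM] := continuous_bounded_on cL (smooth_continuous (smooth_partial i sc)).
  exists M => y; have [/hM//|nL] := pselect (L y).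
  by rewrite (partial_zero_off _ (compact_closed_rV cL) c0 nL) normr0 ltW.
have [B hB] := choice bd.
have B0 i : 0 <= B i by exact: le_trans (hB i 0).
exists (1 + 1 + \sum_(i < m) 2 * B i ^+ 2 + 1).
  rewrite addr_ge0// addr_ge0// sumr_ge0// => i _; exact: mulr_ge0 (sqr_ge0 _).
move=> U phi mU tphi; have [sp _] := tphi.
have lphi := L2jet_jet mU tphi.
have lp : L2r mu U phi by have := lphi ord0; rewrite jet_ord0.
have mf f : smooth f -> measurable_fun U f.
  by move=> sf; exact: measurable_funTS (continuous_measurable_rVT (smooth_continuous sf)).
have nchi y : `|chi y| <= 1 by have /andP[a b] := c01 y; rewrite ger0_norm.
have [l0 h0] := ip_mul_bounded mU (mf _ sc) (fun y _ => nchi y) lp.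
rewrite !jform1E !jet_ord0.
set P := ip mu U phi phi; set Q := \sum_(i < m) ip mu U (jet phi (lift ord0 i)) _.
have P0 : 0 <= P by exact: ip_ge0.
have Q0 : 0 <= Q by apply: sumr_ge0 => i _; exact: ip_ge0.
have hs : \sum_(i < m) ip mu U (jet (fun y => chi y * phi y) (lift ord0 i))
    (jet (fun y => chi y * phi y) (lift ord0 i)) <=
    2 * Q + (\sum_(i < m) 2 * B i ^+ 2) * P.
  rewrite /Q mulr_sumr mulr_suml -big_split /=; apply: ler_sum => i _.
  have ld : L2r mu U (partial i phi) by have := lphi (lift ord0 i); rewrite jet_lift.
  have [l1 h1] := ip_mul_bounded mU (mf _ sc) (fun y _ => nchi y) ld.
  have [l2 h2] := ip_mul_bounded mU (mf _ (smooth_partial i sc)) (fun y _ => hB i y) lp.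
  rewrite !jet_lift (_ : partial i (fun y => chi y * phi y) =
    fun y => chi y * partial i phi y + partial i chi y * phi y).
    apply: le_trans (ip_sqrD_le2 mU l1 l2) _.
    by move: h1 h2; rewrite -/P expr1n mul1r; lra.
  apply/funext => y.
  have [_ e] := partial_mul (i := i) (y := y) (smooth_derivable sc) (smooth_derivable sp).
  by transitivity (chi y * partial i phi y + phi y * partial i chi y); [exact: e|ring].
move: h0 hs; rewrite expr1n mul1r -/P; set T := \sum_(i < m) 2 * _.
have T0 : 0 <= T by apply: sumr_ge0 => i _; exact: mulr_ge0 (sqr_ge0 _).
move: (\sum_(i < m) _) => X; move: (ip mu U _ _) => Y h0 hs.
have : 0 <= T * Q by exact: mulr_ge0.
have -> : (1 + 1 + T + 1) * (P + Q) = 3 * P + 3 * Q + T * P + T * Q by ring.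
lra.
Qed.

Definition helmholtz_jet (k : R) Omega W := [/\ L2jet Omega W, weak_gradient Omega W &
  forall phi, test_function Omega phi -> jform (- k ^+ 2) Omega W (jet phi) = 0].

(* Replacing the test function [phi] by [chi * phi], where the cutoff [chi] is [1] near
   [closure D], does not change [a(W, phi)], because [(1 - chi) * phi] is a test function
   of the equation satisfied by [W] in the whole of [Omega]. *)
Lemma exterior_form_bound (k : R) Omega D O : open Omega -> compact (closure D) -> open O ->
  closure D `<=` O -> O `<=` Omega -> let U := Omega `\` closure D in
  exists L M, [/\ compact L, L `<=` O, 0 <= M & forall W Z, helmholtz_jet k Omega W ->
    Vjet Omega U Z ->
    jform (- k ^+ 2) U W Z ^+ 2 <= M * (jform 1 L W W * jform 1 U Z Z)].
Proof.
move=> oOm cD oO DO OOm U.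
have [chi sc [c01 [r r0 c1] [L cL [LO c0]]]] := smooth_cutoff cD oO DO.
have [M M0 hM] := jform_cutoff cL sc c01 c0.
have mOm := open_measurable_rV oOm; have mD := compact_measurable_rV cD.
have mL := compact_measurable_rV cL.
have mU : measurable U by exact: measurableD.
have UOm : U `<=` Omega by move=> y [].
have LOm := subset_trans LO OOm.
pose c := (`|- k ^+ 2 - 1| + 1) ^+ 2; have cc0 : 0 <= c by exact: sqr_ge0.
have bound W phi : helmholtz_jet k Omega W -> test_function Omega phi ->
    jform (- k ^+ 2) U W (jet phi) ^+ 2 <= c * M * (jform 1 L W W * jform 1 U (jet phi) (jet phi)).
  move=> [lW _ eqW] tphi; have [sp _] := tphi.
  pose phi1 y := chi y * phi y; pose phi2 y := - 1 * phi1 y + phi y.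
  have t1 : test_function Omega phi1 by exact: test_functionM LOm _ _ _.
  have t2 : test_function Omega phi2 by exact: test_function_lin.
  have [l0 l1 l2] : [/\ L2jet Omega (jet phi), L2jet Omega (jet phi1) & L2jet Omega (jet phi2)].
    by split; apply: L2jet_jet => //; eassumption.
  have OmE : Omega = U `|` closure D.
    apply/seteqP; split=> [y Oy|y [[]//|/DO/OOm//]].
    by have [h|h] := pselect (closure D y); [right|left].
  have dUD : [disjoint U & closure D] by apply/disj_set2P/seteqP; split=> // y [[]].
  have E1 : jform (- k ^+ 2) U W (jet phi2) = 0.
    have := eqW _ t2; rewrite {1}OmE jform_split -?OmE// [X in _ + X]jform_eq0 ?addr0//.
    move=> j y Dy; apply: (@jet_eq0_open _ (ball y r)) => //; first exact: ball_open.
      by move=> z; rewrite ball_rVE => yz; rewrite /phi2 /phi1 (c1 y z)//; ring.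
    exact: ballxx.
  have bilU := bilinear_jform (- k ^+ 2) mU; have linU := @linear_L2jet R m U mU.
  have lWU := L2jetS mOm mU UOm lW; have l0U := L2jetS mOm mU UOm l0.
  have l1U := L2jetS mOm mU UOm l1.
  have E2 : jform (- k ^+ 2) U W (jet phi) = jform (- k ^+ 2) U W (jet phi1).
    move: E1; rewrite /phi2 jet_lin//; last by have [] := t1.
    rewrite (formDr linU bilU)//; last exact: (lsetZ linU).
    by rewrite (formZr linU bilU)//; lra.
  pose A := U `&` L; have mA : measurable A by exact: measurableI.
  have AU : A `<=` U by move=> y [].
  (* [chi phi] vanishes off [L], so only the norm of [W] on [L] enters. *)
  have E3 : jform (- k ^+ 2) U W (jet phi1) = jform (- k ^+ 2) A W (jet phi1).
    have UE : U = A `|` (U `\` L) by apply/seteqP; split=> [y Uy|y [[]|[]]//]; have [h|h] := pselect (L y); [left|right].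
    rewrite {1}UE jform_split -?UE//; last 2 first.
    - exact: measurableD.
    - by apply/disj_set2P/seteqP; split=> // y [[_ a] [_ b]].
    rewrite [X in _ + X]jform_eq0 ?addr0// => j y [_ nL].
    rewrite /jet; case: unliftP => [i|] _; last by rewrite /phi1 c0// mul0r.
    apply: (partial_zero_off _ (compact_closed_rV cL)) nL => z nLz.
    by rewrite /phi1 c0// mul0r.
  rewrite E2 E3; have lWA := L2jetS mOm mA (subset_trans AU UOm) lW.
  apply: le_trans (jform_CS _ mA lWA (L2jetS mU mA AU l1U)) _.
  rewrite -/c -mulrA ler_wpM2l// mulrCA ler_pM ?jform_ge0//.
    by apply: jform1_subset => //; [move=> y []|exact: L2jetS lW].
  apply: le_trans (jform1_subset mU mA AU l1U) _; apply: hM => //.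
  exact: test_functionT tphi.
exists L, (4 * c * M); split=> //; first by rewrite mulr_ge0// mulr_ge0.
move=> W Z hW VZ; have [lW _ _] := hW; have lZ := VZ.1.
have bilU := bilinear_jform (- k ^+ 2) mU; have linU := @linear_L2jet R m U mU.
have bil1 := bilinear_jform 1 mU; have pos1 Y : L2jet U Y -> 0 <= jform 1 U Y Y by move=> _; exact: jform_ge0.
have lWU := L2jetS mOm mU UOm lW.
(* Density of test functions. The error contains the norm of [W] on all of [U], but it vanishes in
   the limit for fixed [W], so this norm is absent from the final bound. *)
apply: (@le_of_le_eps _ _ _ (2 * c * jform 1 U W W + 4 * c * M * jform 1 L W W)) => e e0.
have [phi tphi hphi] := VZ.2 e e0.
have lphi : L2jet U (jet phi) by exact: L2jet_jet tphi.
have lD := lsetB linU lZ lphi.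
have h1 := jform_CS (- k ^+ 2) mU lWU lD; rewrite -/c in h1.
have h2 := bound W phi hW tphi.
have h3 : jform 1 U (jet phi) (jet phi) <= 2 * jform 1 U Z Z + 2 * e.
  have := form_sqrB_le2 linU bil1 pos1 lZ lD; rewrite opprB addrC subrK; lra.
have -> : jform (- k ^+ 2) U W Z = jform (- k ^+ 2) U W (Z - jet phi) + jform (- k ^+ 2) U W (jet phi).
  by rewrite (formBr linU bilU)//; ring.
move: h1 h2; set p := jform _ U W (Z - _); set q := jform _ U W (jet phi) => h1 h2.
have w0 : 0 <= jform 1 U W W by exact: jform_ge0.
have wL : 0 <= jform 1 L W W by exact: jform_ge0.
move: h1 h2 h3 hphi; set d := jform 1 U (Z - _) _; set ww := jform 1 U W W; set wl := jform 1 L W W.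
set pp := jform 1 U (jet phi) _; set zz := jform 1 U Z Z => h1 h2 h3 hphi.
have h4 : c * (ww * d) <= c * (ww * e) by rewrite ler_wpM2l// ler_wpM2l// ltW.
have h5 : c * M * (wl * pp) <= c * M * (wl * (2 * zz + 2 * e)).
  by rewrite ler_wpM2l ?mulr_ge0// ler_wpM2l.
have : 0 <= (p - q) ^+ 2 by exact: sqr_ge0.
have -> : 4 * c * M * (wl * zz) + (2 * c * ww + 4 * c * M * wl) * e =
  2 * (c * (ww * e)) + 2 * (c * M * (wl * (2 * zz + 2 * e))) by ring.
have -> : (p - q) ^+ 2 = p ^+ 2 - 2 * (p * q) + q ^+ 2 by ring.
have -> : (p + q) ^+ 2 = p ^+ 2 + 2 * (p * q) + q ^+ 2 by ring.
lra.
Qed.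

Lemma helmholtz_jetB k Omega W Z : open Omega -> helmholtz_jet k Omega W -> helmholtz_jet k Omega Z ->
  helmholtz_jet k Omega (W - Z).
Proof.
move=> oO [lW gW eW] [lZ gZ eZ]; have mO := open_measurable_rV oO.
have linO := @linear_L2jet R m Omega mO; have bil := bilinear_jform (- k ^+ 2) mO.
split; [exact: (lsetB linO)|exact: weak_gradientB|move=> phi tphi].
by rewrite (formBl bil)// ?eW ?eZ ?subr0//; exact: L2jet_jet tphi.
Qed.

Definition correction k Omega U W w := Vjet Omega U w /\
  forall Z, Vjet Omega U Z -> jform (- k ^+ 2) U w Z = - jform (- k ^+ 2) U W Z.

(** The contribution of the real or of the imaginary part to the indicator. *)
Definition energy k Omega D W w :=
  jform (- k ^+ 2) (closure D) W W + jform (- k ^+ 2) (Omega `\` closure D) w w.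

(** For [w = w_i - w_j] and [W = R_i - R_j], coercivity and [exterior_form_bound] give [c |w|^2 <=
    a(w, w) = - a(W, w) <= sqrt(M) |W|_L |w|] with a compact set [L] on which the [R_n] converge.
    Hence the corrections form a Cauchy sequence. *)
Lemma energy_converges k Omega D O (c : R) (Rn : nat -> J) (wn : nat -> J) G :
  open Omega -> compact (closure D) -> open O ->
  closure D `<=` O -> O `<=` Omega -> let U := Omega `\` closure D in 0 < c ->
  (forall W, Vjet Omega U W -> c * jform 1 U W W <= jform (- k ^+ 2) U W W) ->
  (forall n, helmholtz_jet k Omega (Rn n)) -> (forall n, correction k Omega U (Rn n) (wn n)) ->
  (forall K, compact K -> K `<=` O -> L2jet K G) -> jets_converge O Rn G ->
  cvgn (fun n => energy k Omega D (Rn n) (wn n)).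
Proof.
move=> oOm cD oO DO OOm U c0 coer hR hw lG conv.
have [L [M [cL LO M0 bound]]] := exterior_form_bound k oOm cD oO DO OOm.
have mOm := open_measurable_rV oOm; have mD := compact_measurable_rV cD.
have mL := compact_measurable_rV cL; have LOm := subset_trans LO OOm.
have mU : measurable U by exact: measurableD.
have UOm : U `<=` Omega by move=> y [].
have linV := linear_Vjet Omega mU; have bilV := bilinear_Vjet (- k ^+ 2) Omega mU.
have linU := @linear_L2jet R m U mU; have bilU := bilinear_jform (- k ^+ 2) mU.
have linL := @linear_L2jet R m L mL; have bilL := bilinear_jform 1 mL.
pose a := jform (- k ^+ 2) U; pose b := jform 1 U.
have lR n : L2jet Omega (Rn n) by have [] := hR n.
have lRL n := L2jetS mOm mL LOm (lR n); have lRU n := L2jetS mOm mU UOm (lR n).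
have dist i j : b (wn i - wn j) (wn i - wn j) <= M / c ^+ 2 * jform 1 L (Rn i - Rn j) (Rn i - Rn j).
  have [V1 e1] := hw i; have [V2 e2] := hw j; set w := wn i - wn j; set W := Rn i - Rn j.
  have Vw : Vjet Omega U w by exact: lsetB.
  have e : a w w = - a W w.
    have lw : L2jet U w := Vw.1.
    by rewrite /a {1}/w (formBl bilV)// e1// e2// /W (formBl bilU)//; ring.
  have h := bound W w (helmholtz_jetB oOm (hR i) (hR j)) Vw.
  have h2 := coer w Vw; rewrite -/a -/b in h h2.
  have b0 : 0 <= b w w by exact: jform_ge0.
  have h3 : (c * b w w) ^+ 2 <= M * (jform 1 L W W * b w w).
    apply: le_trans h; rewrite -(sqrrN (a W w)) -e ler_sqr ?nnegrE//.
      by rewrite mulr_ge0// ltW.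
    by apply: le_trans h2; rewrite mulr_ge0// ltW.
  have [->|bn0] := eqVneq (b w w) 0.
    by rewrite mulr_ge0 ?jform_ge0// divr_ge0// sqr_ge0.
  have bp : 0 < b w w by rewrite lt_def bn0.
  rewrite mulrAC ler_pdivlMr ?exprn_gt0// -(ler_pM2r bp).
  by apply: le_trans (le_trans h3 _); rewrite ?exprMn ?expr2 ?le_eqVlt; apply/orP; left; apply/eqP; ring.
have lGL := lG L cL LO.
have cauchy : cauchy_for b wn.
  move=> e e0; pose d := e / (4 * (M / c ^+ 2 + 1)).
  have Mc : 0 <= M / c ^+ 2 by rewrite divr_ge0// sqr_ge0.
  have d0 : 0 < d by rewrite divr_gt0// mulr_gt0// ltr_wpDl.
  have [N hN] := conv L cL LO d d0; exists N => i j /hN hi /hN hj.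
  apply: le_lt_trans (dist i j) _.
  have posL Y : L2jet L Y -> 0 <= jform 1 L Y Y by move=> _; exact: jform_ge0.
  have := form_sqrB_le2 linL bilL posL (lsetB linL (lRL i) lGL) (lsetB linL (lRL j) lGL).
  rewrite opprB addrA subrK => h.
  have h2 : jform 1 L (Rn i - Rn j) (Rn i - Rn j) < 4 * d by lra.
  have pp := jform_ge0 L (Rn i - Rn j).
  have E1 : (M / c ^+ 2 + 1) * (4 * d) = e by rewrite /d; field; rewrite !gt_eqF ?ltr_wpDl ?exprn_gt0//; lra.
  have : (M / c ^+ 2 + 1) * jform 1 L (Rn i - Rn j) (Rn i - Rn j) < e.
    by rewrite -E1 ltr_pM2l// ltr_wpDl.
  by rewrite mulrDl mul1r; lra.
have [w Vw cw] := complete_Vjet (Omega := Omega) mU (fun n => (hw n).1) cauchy.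
apply: is_cvgD; apply/cvg_ex.
  exists (jform (- k ^+ 2) (closure D) G G).
  apply: (@form_converges _ (L2jet (closure D)) (jform 1 (closure D)) _ ((`|- k ^+ 2 - 1| + 1) ^+ 2)) => //.
  - exact: linear_L2jet.
  - exact: bilinear_jform.
  - by move=> W Z lW lZ; exact: jform_CS.
  - by move=> W _; exact: jform_ge0.
  - by move=> n; apply: (L2jetS mOm) (lR n) => //; exact: subset_trans OOm.
  - exact: lG.
  - by move=> e e0; have := conv _ cD DO e e0.
exists (a w w).
apply: (@form_converges _ (Vjet Omega U) b _ ((`|- k ^+ 2 - 1| + 1) ^+ 2)) => //.
- by move=> W Z [lW _] [lZ _]; exact: jform_CS.
- by move=> W _; exact: jform_ge0.
- by move=> n; exact: (hw n).1.
Qed.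

End cutoff_estimate.

(** * Needles that meet D *)

Section lower_bound.
Context {R : realType} {m : nat}.
Local Notation E := 'rV[R]_m.
Local Notation mu := (@lebesgue_rV R m).
Local Notation J := ('I_m.+1 -> E -> R).
Implicit Types (f g h phi psi chi : E -> R) (K L U A O Omega D S : set E) (W Z G : J).

(** As [S] is null, the exhaustion of [O] minus [S] fills [O] up to arbitrarily small measure. *)
Lemma compact_core O S (e : R) : open O -> bounded_set O -> compact S -> mu S = 0%E -> 0 < e ->
  exists2 A, compact A & A `<=` O `\` S /\ (mu (O `\` A) < e%:E)%E.
Proof.
move=> oO bO cS S0 e0; have clS := compact_closed_rV cS.
have oOS : open (O `\` S) by rewrite setDE; apply: openI => //; exact: closed_openC.
have [M M0 OM] := bounded_setP bO.
have mF n : measurable (exhaustion (O `\` S) n) by apply: compact_measurable_rV; exact: exhaustion_compact.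
have mO := open_measurable_rV oO; have mS := closed_measurable_rV clS.
have mOS := open_measurable_rV oOS.
have fin : (mu (O `\` S) < +oo)%E by apply: (@lebesgue_rV_bounded _ _ _ M) => // y [/OM].
have cov : O `\` S `<=` \bigcup_n exhaustion (O `\` S) n by rewrite bigcup_exhaustion.
have [n hn] := nondecreasing_measure_diff mF (@exhaustionS _ _ _) mOS cov fin e0.
exists (exhaustion (O `\` S) n); first exact: exhaustion_compact.
split; first exact: exhaustion_subset.
apply: le_lt_trans hn; rewrite -[leRHS]adde0 -S0.
apply: le_trans (measureU2 _ _ _); [|exact: measurableD|exact: mS].
apply: le_measure; rewrite ?inE; [exact: measurableD|by apply: measurableU => //; exact: measurableD|].
by move=> y [Oy nF]; have [Sy|nS] := pselect (S y); [right|left; split].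
Qed.

Lemma ip_cst A (M : R) : measurable A -> (mu A < +oo)%E ->
  L2r mu A (fun=> M) /\ ip mu A (fun=> M) (fun=> M) = M ^+ 2 * fine (mu A).
Proof.
move=> mA fin; split; last by rewrite /ip Rintegral_cst// expr2.
by apply: (@L2r_bounded _ _ _ _ _ mA _ `|M|).
Qed.

(** The mean [M] is controlled through [A]: [M^2 |O| <= 4/3 M^2 |A|] and
    [M^2 |A| <= 2 |W - M|^2 + 2 |W|_A^2]. With [|W|^2 <= 2 |W - M|^2 + 2 M^2 |O|] the constants are
    [2 + 16/3 = 22/3] and [16/3]. *)
Lemma poincare_core O (c : R) A W : open O -> (mu O < +oo)%E -> poincare_constant O c ->
  measurable A -> A `<=` O -> 3 * fine (mu O) <= 4 * fine (mu A) ->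
  L2jet O W -> weak_gradient O W ->
  ip mu O (W ord0) (W ord0) <=
  (22 / 3) * c ^+ 2 * gradip O W + (16 / 3) * ip mu A (W ord0) (W ord0).
Proof.
move=> oO fin pc mA AO hA lW gW; have mO := open_measurable_rV oO.
have := poincare_real oO fin pc lW gW; set M := _ * _ => /= hp.
have finA : (mu A < +oo)%E by apply: le_lt_trans fin; apply: le_measure; rewrite ?inE.
have [lM hM] := ip_cst M mO fin; have [lMA hMA] := ip_cst M mA finA.
have lA := L2rS mO mA AO (lW ord0).
have h1 := ip_le_sqr mO (lW ord0) lM.
have h2 := ip_le_sqr mA lMA lA.
have h3 : ip mu A (fun y => M - W ord0 y) (fun y => M - W ord0 y) <=
    ip mu O (fun y => W ord0 y - M) (fun y => W ord0 y - M).
  apply: le_trans (ip_subset mO mA AO (L2rB mO (lW ord0) lM)).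
  rewrite le_eqVlt; apply/orP; left; apply/eqP; rewrite /ip; apply: eq_Rintegral => y _.
  by ring.
move: hp h1 h2 h3; rewrite hM hMA.
move: (ip mu O _ _) (ip mu A _ _) (ip mu A _ _) (ip mu O _ _) => a b d e hp h1 h2 h3.
have h4 : 3 * (M ^+ 2 * fine (mu O)) <= 4 * (M ^+ 2 * fine (mu A)).
  by rewrite mulrCA [leRHS]mulrCA ler_wpM2l ?sqr_ge0.
have -> : 22 / 3 * c ^+ 2 * gradip O W = 22 / 3 * (c ^+ 2 * gradip O W) by ring.
lra.
Qed.

(** Each component keeps its own constant, and the weights come after the core [A]: they will be
    [q = k^2], [p = 11/12] for the energy, and [q = 1], [p] the sum of the constants, for comparing
    the L^2 norm with the gradient. *)
Lemma union_poincare (N : nat) (Dj : 'I_N -> set E) (c : 'I_N -> R) D S :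
  (forall j, lipschitz_domain (Dj j)) -> D = \bigcup_(j in [set: 'I_N]) Dj j ->
  (forall j l, j != l -> closure (Dj j) `&` closure (Dj l) = set0) ->
  (forall j, poincare_constant (Dj j) (c j)) -> compact S -> mu S = 0%E ->
  exists2 A, compact A /\ A `<=` D `\` S & forall q p : R, 0 <= q -> 0 <= p ->
    (forall j, q * (22 / 3 * c j ^+ 2) <= p) ->
    forall W, L2jet D W -> weak_gradient D W ->
    q * ip mu D (W ord0) (W ord0) <=
    p * gradip D W + 16 / 3 * q * ip mu A (W ord0) (W ord0).
Proof.
move=> lip DE disj pc cS S0.
have oDj j : open (Dj j) by have [] := lip j.
have bDj j : bounded_set (Dj j) by have [] := lip j.
have oD : open D by rewrite DE; exact: bigcup_open.
have mD := open_measurable_rV oD; have mDj j := open_measurable_rV (oDj j).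
have DjD j : Dj j `<=` D by rewrite DE => y; exists j.
have fin j : (mu (Dj j) < +oo)%E.
  by have [M M0 hM] := bounded_setP (bDj j); exact: lebesgue_rV_bounded hM.
have pos j : 0 < fine (mu (Dj j)).
  have [_ _ [p Dp] _ _] := lip j; have [r r0 hr] := open_ball_subset (oDj j) Dp.
  apply: (@lt_le_trans _ _ ((2 * r) ^+ m)); first by rewrite exprn_gt0// mulr_gt0.
  rewrite -lee_fin fineK ?ge0_fin_numE// -(lebesgue_rV_ball p r0).
  by apply: le_measure; rewrite ?inE//; exact: measurable_ball_rV.
have core j : exists A, [/\ compact A, A `<=` Dj j `\` S & 3 * fine (mu (Dj j)) <= 4 * fine (mu A)].
  have e0 : 0 < fine (mu (Dj j)) / 4 by rewrite divr_gt0.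
  have [A cA [AD hA]] := compact_core (oDj j) (bDj j) cS S0 e0.
  exists A; split=> //; have mA := compact_measurable_rV cA.
  have AI : Dj j `&` A = A by apply/setIidPr => y /AD[].
  have finA : mu A \is a fin_num by rewrite ge0_fin_numE//; exact: lebesgue_rV_compact.
  have h := measureDI mu (mDj j) mA; rewrite AI in h.
  have finD : mu (Dj j `\` A) \is a fin_num.
    by rewrite ge0_fin_numE//; apply: lt_trans hA _; rewrite ltry.
  have : fine (mu (Dj j)) = fine (mu (Dj j `\` A)) + fine (mu A) by rewrite h fineD.
  have : fine (mu (Dj j `\` A)) < fine (mu (Dj j)) / 4.
    by rewrite -lte_fin fineK.
  move: (fine _) (fine _) (fine _) => x y z; lra.
have [Aj hAj] := choice core.
have mAj j : measurable (Aj j) by have [cA _ _] := hAj j; exact: compact_measurable_rV.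
pose A := \bigcup_(j in [set: 'I_N]) Aj j.
have AE : A = \big[setU/set0]_j Aj j.
  rewrite -bigcup_seq; apply/seteqP; split=> y [j _ Ay]; exists j => //.
  by rewrite /= mem_index_enum.
have cA : compact A.
  by rewrite AE; elim/big_ind: _ => [|X Y|j _]; [exact: compact0|exact: compactU|have [] := hAj j].
have mA := compact_measurable_rV cA.
have AD : A `<=` D `\` S by move=> y [j _ Ay]; have [_ /(_ y Ay)[Dy nS] _] := hAj j; split=> //; exact: DjD Dy.
exists A => // q p q0 p0 hq W lW gW.
have disjD i j y : Dj i y -> Dj j y -> i = j.
  move=> Di Dj'; apply/eqP/negP => /negP ij; have := disj i j ij.
  by move=> /seteqP[/(_ y) + _]; apply; split; exact: subset_closure.
have h1 : ip mu D (W ord0) (W ord0) <= \sum_j ip mu (Dj j) (W ord0) (W ord0).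
  by apply: (@ip_cover _ _ _ _ _ _ D) => // y; rewrite {1}DE => -[j _ Dy]; exists j; split=> //.
have h2 : \sum_j gradip (Dj j) W <= gradip D W.
  by apply: gradip_disjoint_le => // i j y _ _; exact: disjD.
have lA : L2r mu A (W ord0) by apply: (L2rS mD mA) (lW ord0) => y /AD[].
have h3 : \sum_j ip mu (Aj j) (W ord0) (W ord0) <= ip mu A (W ord0) (W ord0).
  apply: ip_disjoint_le => //; first by move=> j _ y Ay; exists j.
  move=> i j y _ _ Ai Aj'; apply: (disjD _ _ y).
    by have [_ /(_ y Ai)[]] := hAj i.
  by have [_ /(_ y Aj')[]] := hAj j.
apply: (@le_trans _ _ (\sum_j (p * gradip (Dj j) W + 16 / 3 * q * ip mu (Aj j) (W ord0) (W ord0)))).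
  apply: le_trans (ler_wpM2l q0 h1) _; rewrite mulr_sumr; apply: ler_sum => j _.
  have [cAj AjD hfin] := hAj j.
  have AjDj : Aj j `<=` Dj j by move=> y /AjD[].
  have h := poincare_core (oDj j) (fin j) (pc j) (mAj j) AjDj hfin (L2jetS mD (mDj j) (DjD j) lW)
    (weak_gradientS (DjD j) gW).
  apply: le_trans (ler_wpM2l q0 h) _; rewrite mulrDr; apply: lerD; last first.
    by rewrite le_eqVlt; apply/orP; left; apply/eqP; ring.
  by rewrite mulrA ler_wpM2r// gradip_ge0.
rewrite big_split /= -!mulr_sumr; apply: lerD; first by rewrite ler_wpM2l.
by rewrite ler_wpM2l// mulr_ge0.
Qed.

Lemma jform_null c A W Z : measurable A -> mu A = 0%E -> L2jet A W -> L2jet A Z ->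
  jform c A W Z = 0.
Proof.
move=> mA A0 lW lZ; rewrite /jform.
have h j : ip mu A (W j) (Z j) = 0.
  rewrite /ip /Rintegral null_set_integral//.
  by apply/measurable_EFinP/measurable_funM; [exact: (lW j).1|exact: (lZ j).1].
by rewrite h mulr0 add0r big1.
Qed.

(** The boundary of [D] is null, so [closure D] may be replaced by [D]; the energy of the correction
    is dropped, and all but 1/12 of the gradient is spent on the term with [k^2]. *)
Lemma energy_ge k Omega D W w (c : R) : open Omega -> open D -> bounded_set D ->
  lipschitz_boundary D -> closure D `<=` Omega -> L2jet Omega W ->
  0 <= jform (- k ^+ 2) (Omega `\` closure D) w w ->
  k ^+ 2 * ip mu D (W ord0) (W ord0) <= 11 / 12 * gradip D W + c ->
  12^-1 * gradip D W - c <= energy k Omega D W w.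
Proof.
move=> oO oD bD lD DO lW w0 h; rewrite /energy.
have mD := open_measurable_rV oD; have mcD := closed_measurable_rV (@closed_closure _ D).
have mO := open_measurable_rV oO.
have DE : closure D = D `|` (closure D `\` D) by rewrite setDUK//; exact: subset_closure.
have mN : measurable (closure D `\` D) by exact: measurableD.
have lcD := L2jetS mO mcD DO lW.
rewrite {1}DE jform_split -?DE//; last by apply/disj_set2P/seteqP; split=> // y [? []].
rewrite [X in _ + X + _]jform_null//; last 3 first.
- exact: boundary_null.
- by apply: L2jetS lcD => // y [].
- by apply: L2jetS lcD => // y [].
by rewrite jformE; lra.
Qed.

End lower_bound.

(** * Blow-up of the gradient when x lies in the closure of D *)

Section gradient_blow_up.
Context {R : realType} {m : nat}.
Local Notation E := 'rV[R]_m.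
Local Notation mu := (@lebesgue_rV R m).
Local Notation J := ('I_m.+1 -> E -> R).
Implicit Types (f g h phi psi chi : E -> R) (K L U A O Omega D S : set E) (W Z G : J) (x y z : E).

Lemma enorm_le_norm z : enorm z <= (m%:R + 1) * `|z|.
Proof.
have m1 : 0 <= m%:R + 1 :> R by rewrite addr_ge0.
rewrite -ler_sqr ?nnegrE ?sqrtr_ge0 ?mulr_ge0// -dot_enorm exprMn.
apply: le_trans (dot_sup_bound (lexx _)) _; rewrite ler_wpM2r ?sqr_ge0//.
have : 0 <= m%:R :> R by []; nra.
Qed.

Lemma dot_le_enorm z e : enorm e = 1 -> `|dot z e| <= enorm z.
Proof.
move=> e1; rewrite -ler_sqr ?nnegrE ?sqrtr_ge0// real_normK ?num_real//.
apply: le_trans (sum_CS _ _) _.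
have ee : \sum_i e ord0 i ^+ 2 = 1.
  by rewrite -[RHS](expr1n _ 2) -[in RHS]e1 -dot_enorm; apply: eq_bigr => i _; rewrite expr2.
rewrite ee mulr1 -dot_enorm le_eqVlt; apply/orP; left; apply/eqP.
by apply: eq_bigr => i _; rewrite expr2.
Qed.

Lemma enorm1_gt0 (e : E) : enorm e = 1 -> 0 < `|e|.
Proof.
move=> e1; rewrite lt_def normr_ge0 andbT; apply/negP => /eqP e0.
have := enorm_le_norm e; rewrite e0 mulr0 e1; lra.
Qed.

(** The factors [m + 1] convert the sup norm, in which balls are measured, to the Euclidean norm. *)
Lemma height_lipschitz e (phi : E -> R) (L : R) : enorm e = 1 ->
  (forall y z, `|phi y - phi z| <= L * enorm (y - z)) ->
  let c := (m%:R + 1) + `|L| * ((m%:R + 1) * (1 + (m%:R + 1))) in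
  forall y z, height e phi y <= height e phi z + c * `|y - z|.
Proof.
move=> e1 hphi c y z; set M : R := m%:R + 1; have M0 : 0 <= M by rewrite /M addr_ge0.
set d := y - z; have hd : `|dot d e| <= M * `|d|.
  exact: le_trans (dot_le_enorm _ e1) (enorm_le_norm _).
have dE : dot y e = dot z e + dot d e by rewrite -dotDl addrC subrK.
have pE : (y - dot y e *: e) - (z - dot z e *: e) = d - dot d e *: e.
  by apply/rowP => i; rewrite dE !mxE; ring.
have h2 : enorm (d - dot d e *: e) <= M * (1 + M) * `|d|.
  apply: le_trans (enorm_le_norm _) _; rewrite -mulrA ler_wpM2l//.
  apply: le_trans (ler_normB _ _) _; rewrite mulrDl mul1r lerD2l normrZ.
  by apply: le_trans hd; rewrite ler_piMr// enorm1_norm.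
have h3 := hphi (z - dot z e *: e) (y - dot y e *: e).
have h4 : L * enorm ((z - dot z e *: e) - (y - dot y e *: e)) <= `|L| * (M * (1 + M) * `|d|).
  have -> : enorm ((z - dot z e *: e) - (y - dot y e *: e)) = enorm (d - dot d e *: e).
    rewrite -pE -[in LHS]opprB /enorm; congr (Num.sqrt _); rewrite /dot.
    by apply: eq_bigr => i _; rewrite !mxE; ring.
  apply: le_trans (ler_wpM2r (sqrtr_ge0 _) (ler_norm L)) _; exact: ler_wpM2l.
rewrite /height dE; move: h3 hd; rewrite !ler_norml => /andP[a b] /andP[a' b'].
rewrite -dE /c -/M mulrDl -mulrA; lra.
Qed.

(** From [x] to [x - t e] the height drops by [t], and it is Lipschitz, so a ball of radius
    proportional to [t] stays below the graph. The condition [3 kap <= |e|] will separate the balls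
    at scales [t] and [t / 4]. *)
Lemma interior_cone D x : (0 < m)%N -> open D -> lipschitz_boundary D -> closure D x ->
  exists e (kap rho : R), [/\ 0 < kap, 3 * kap <= `|e|, `|e| <= 1, 0 < rho &
    forall (t : R) y, 0 < t -> t < rho -> `|(x - t *: e) - y| < kap * t -> D y].
Proof.
move=> m0 oD lip cDx; have [Dx|nDx] := pselect (D x).
  have [r r0 hr] := open_ball_subset oD Dx.
  pose e : E := delta_mx ord0 (Ordinal m0).
  have e1 : `|e| = 1.
    apply/eqP; rewrite eq_le norm_delta; have := norm_coord e (Ordinal m0).
    by rewrite mxE !eqxx normr1.
  exists e, 3^-1, (r / 2); rewrite e1; split=> //; first by rewrite divff.
    by rewrite divr_gt0.
  move=> t y t0 tr h; apply: hr; rewrite ball_rVE.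
  have -> : x - y = t *: e + ((x - t *: e) - y) by rewrite addrA addrCA subrr addr0.
  apply: le_lt_trans (ler_normD _ _) _; rewrite normrZ e1 gtr0_norm//.
  by move: h tr; lra.
have [|e [phi [L [e1 hphi near_x]]]] := lip x cDx; first by move=> /interior_subset.
have [r r0 hr] : exists2 r : R, 0 < r & forall y, ball x r y -> (D y <-> height e phi y < 0).
  have /nbhs_ballP[r r0 hr] := near_x; exists r => // y /hr; rewrite /height.
  by rewrite subr_lt0.
have ch := continuous_height (e := e) (lipschitz_continuous_rV hphi).
have hx : height e phi x <= 0.
  rewrite leNgt; apply/negP => hx.
  have : \forall y \near x, 0 < height e phi y.
    exact: (cvgr_gt _ (ch x)).
  move=> /nbhs_ballP[r' r'0 hr'].
  have mr : 0 < Num.min r r' by rewrite lt_min r0.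
  have [y [Dy]] := cDx _ (nbhsx_ballx x (Num.min r r') mr).
  rewrite ball_rVE lt_min => /andP[yr yr'].
  have xy : ball x r y by rewrite ball_rVE.
  have := (hr y xy).1 Dy.
  by have : 0 < height e phi y; [apply: hr'; rewrite ball_rVE|lra].
have := height_lipschitz e1 hphi; set c := _ + _ => /= hc.
have c0 : 0 < c by rewrite /c ltr_wpDr// ?mulr_ge0// ?addr_ge0// ltr_wpDl.
have e0 := enorm1_gt0 e1; have le1 := enorm1_norm e1.
pose kap := Num.min (`|e| / 3) (2 * c)^-1.
have k1 : kap <= `|e| / 3 by rewrite /kap ge_min lexx.
have k2 : kap <= (2 * c)^-1 by rewrite /kap ge_min lexx orbT.
have k0 : 0 < kap by rewrite /kap lt_min divr_gt0//= invr_gt0 mulr_gt0.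
exists e, kap, (r / 2); split=> //; [by move: k1; lra|by rewrite divr_gt0|].
move=> t y t0 tr h; set z := x - t *: e.
have yz : `|y - z| < kap * t by rewrite distrC.
have kt : kap * t <= t by rewrite ler_piMl ?(ltW t0)//; lra.
apply/(hr y).
  rewrite ball_rVE.
  have -> : x - y = t *: e + (z - y) by rewrite /z addrA addrCA subrr addr0.
  apply: le_lt_trans (ler_normD _ _) _; rewrite normrZ gtr0_norm//.
  have : t * `|e| <= t by rewrite ler_piMr// ltW.
  by move: h; rewrite -/z; lra.
apply: le_lt_trans (hc y z) _.
have [z1 z2] := dot_shift x (- t) e1.
have hz : height e phi z = height e phi x - t.
  by rewrite /height /z -scaleNr z2 z1; ring.
rewrite hz.
have h5 : c * `|y - z| <= c * ((2 * c)^-1 * t).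
  by rewrite ler_wpM2l ?(ltW c0)//; apply: le_trans (ltW yz) _; rewrite ler_wpM2r// ltW.
have h6 : c * ((2 * c)^-1 * t) = t / 2 by field; rewrite gt_eqF.
lra.
Qed.

(** The squared gradient of the radial function is [4 F'^2 |y - x|^2], of order at least [t^-m] on
    the ball at scale [t] because [m >= 2]; the measure of the ball is of order [t^m]. Each scale
    thus contributes a constant. *)
Lemma gradient_blow_up k F F1 F2 D S x (M : R) : (1 < m)%N -> @radial_profile R m k F F1 F2 ->
  open D -> lipschitz_boundary D -> closure D x -> compact S -> mu S = 0%E -> S x ->
  exists2 K, compact K /\ K `<=` D `\` S & M <= gradip K (jet (fun y => F (sqdist x y))).
Proof.
move=> m1 [dF dF1 cF2 _ [c [rho [c0 rho0 prof]]]] oD lip cDx cS S0 Sx.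
have cF1 s : 0 < s -> {for s, continuous F1} by move=> /dF1/is_derive_continuous.
have m0 : (0 < m)%N by exact: ltn_trans m1.
have mR : 0 < m%:R :> R by rewrite ltr0n.
have mR1 : 1 <= m%:R :> R by rewrite ler1n.
have [e [kap [rho' [k0 ke e1 rho'0 cone]]]] := interior_cone m0 oD lip cDx.
have e0 : 0 < `|e| by move: ke; lra.
pose tau := Num.min (rho' / 2) (Num.min (rho / (4 * m%:R)) (2 * m%:R)^-1).
have tau0 : 0 < tau.
  by rewrite /tau lt_min divr_gt0//= lt_min divr_gt0 ?mulr_gt0//= invr_gt0 mulr_gt0.
have tau1 : tau < rho' by apply: (@le_lt_trans _ _ (rho' / 2)); [rewrite /tau ge_min lexx|lra].
have tau23 : tau <= Num.min (rho / (4 * m%:R)) (2 * m%:R)^-1 by rewrite /tau ge_min lexx orbT.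
have tau2 : 2 * m%:R * tau < rho.
  have : tau <= rho / (4 * m%:R) by apply: le_trans tau23 _; rewrite ge_min lexx.
  rewrite ler_pdivlMr ?mulr_gt0//; lra.
have tau3 : 2 * m%:R * tau <= 1.
  have : tau <= (2 * m%:R)^-1 by apply: le_trans tau23 _; rewrite ge_min lexx orbT.
  by rewrite -[X in _ <= X]mul1r ler_pdivlMr ?mulr_gt0//; lra.
clear tau23.
(* Ratio 4: in the ball at scale [t] the distance to [x] lies between [2/3 t |e|] and [4/3 t |e|],
   so the balls at distinct scales are disjoint. *)
pose t (j : nat) : R := tau / 4 ^+ j.
have p4 (j : nat) : 0 < 4 ^+ j :> R by rewrite exprn_gt0.
have t0 j : 0 < t j by rewrite divr_gt0.
have tle j : t j <= tau by rewrite ler_pdivrMr// ler_peMr ?(ltW tau0)// exprn_ege1// ler1n.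
pose B j := ball (x - t j *: e) (kap * t j).
have kt0 j : 0 < kap * t j by rewrite mulr_gt0.
have BD j : B j `<=` D.
  by move=> y; rewrite /B ball_rVE; apply: cone => //; exact: le_lt_trans tau1.
have dist j y : B j y -> t j * (`|e| - kap) < `|y - x| /\ `|y - x| < t j * (`|e| + kap).
  rewrite /B ball_rVE; set d := _ - y => hd.
  have -> : `|y - x| = `|t j *: e + d|.
    by rewrite /d distrC addrA; congr (`| _ - y |); rewrite addrCA subrr addr0.
  have te : `|t j *: e| = t j * `|e| by rewrite normrZ gtr0_norm.
  split; last by apply: le_lt_trans (ler_normD _ _) _; rewrite te; lra.
  by have := lerB_normD (t j *: e) d; rewrite te; lra.
have disj i j y : B i y -> B j y -> i = j.
  have aux a b : (a < b)%N -> B a y -> B b y -> False.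
    move=> ab /dist[h1 _] /dist[_ h2].
    have h3 : t b <= t a / 4.
      rewrite /t -mulrA -invfM -exprSr ler_wpM2l ?(ltW tau0)// lef_pV2 ?posrE// ?exprn_gt0//.
      by rewrite ler_eXn2l ?ltr1n.
    have h4 : t b * (`|e| + kap) <= t a / 4 * (`|e| + kap) by rewrite ler_wpM2r//; lra.
    have h5 : t a * (3 * kap) <= t a * `|e| by rewrite ler_wpM2l// ltW.
    move: (t0 a); nra.
  move=> Bi Bj; have [h|h|//] := ltngtP i j.
    by case: (aux _ _ h Bi Bj).
  by case: (aux _ _ h Bj Bi).
have core j : exists A, [/\ compact A, A `<=` B j `\` S & (2 * (kap * t j)) ^+ m / 2 <= fine (mu A)].
  have mB := lebesgue_rV_ball (x - t j *: e) (kt0 j).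
  have V0 : 0 < (2 * (kap * t j)) ^+ m / 2 by rewrite divr_gt0// exprn_gt0// mulr_gt0.
  have bB : bounded_set (B j).
    apply: (@bounded_setI _ _ (`|x - t j *: e| + kap * t j)) => y.
    rewrite /B ball_rVE distrC => h; rewrite -[y](subrK (x - t j *: e)) addrC.
    by apply: le_trans (ler_normD _ _) _; rewrite lerD2l ltW.
  have oB : open (B j) by exact: ball_open.
  have [A cA [AB hA]] := compact_core oB bB cS S0 V0.
  exists A; split=> //; have mA := compact_measurable_rV cA.
  have AI : B j `&` A = A by apply/setIidPr => y /AB[].
  have finA : mu A \is a fin_num by rewrite ge0_fin_numE//; exact: lebesgue_rV_compact.
  have h : ((2 * (kap * t j)) ^+ m)%:E = (mu (B j `\` A) + mu A)%E.
    by rewrite -mB -[in X in (_ + X)%E]AI; apply: measureDI => //; exact: measurable_ball_rV.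
  have finD : mu (B j `\` A) \is a fin_num.
    by rewrite ge0_fin_numE//; apply: lt_trans hA _; rewrite ltry.
  have : (2 * (kap * t j)) ^+ m = fine (mu (B j `\` A)) + fine (mu A) by rewrite -fineD// -h.
  have : fine (mu (B j `\` A)) < (2 * (kap * t j)) ^+ m / 2 by rewrite -lte_fin fineK.
  move: (fine _) (fine _) (_ ^+ m) => a b v; lra.
have [A hA] := choice core.
pose O := D `\` S; have clS := compact_closed_rV cS.
have oO : open O by rewrite /O setDE; apply: openI => //; exact: closed_openC.
have ne y : O y -> y <> x by move=> [_ nS] yx; apply: nS; rewrite yx.
have rad i := radial_C1 i dF cF1 ne.
have AO j : A j `<=` O by have [_ h _] := hA j; move=> y /h[/BD By nS].
pose g y := F (sqdist x y).
(* With [T = 2 m t_j], the lower bound [4 c^2 / T^m] of the squared gradient times the lower bound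
   [(kap T / m)^m / 2] of the measure of the core does not depend on [j]. *)
pose cst := 2 * c ^+ 2 * (kap / m%:R) ^+ m.
have cst0 : 0 < cst by rewrite !mulr_gt0 ?exprn_gt0// divr_gt0.
have lower j : cst <= gradip (A j) (jet g).
  have [cA AB hm] := hA j; have mA := compact_measurable_rV cA.
  have lg := C1_L2jet oO (fun i => (rad i).1) cA (AO j) m0.
  have [ig eg] := jform_Rintegral 0 mA lg lg; rewrite -jform0E -eg.
  pose T := 2 * m%:R * t j; have T0 : 0 < T by rewrite !mulr_gt0.
  have T1 : T <= 1 by apply: le_trans tau3; rewrite ler_wpM2l ?mulr_ge0.
  have Tr : T < rho by apply: le_lt_trans tau2; rewrite ler_wpM2l ?mulr_ge0.
  have Tm : 0 < T ^+ m by rewrite exprn_gt0.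
  apply: (@le_trans _ _ (\int[mu]_(y in A j) (4 * c ^+ 2 / T ^+ m))).
    rewrite Rintegral_cst//.
    apply: le_trans (ler_wpM2l _ hm); last first.
      by apply: divr_ge0; [apply: mulr_ge0 => //; exact: sqr_ge0|exact: ltW].
    have -> : 2 * (kap * t j) = kap / m%:R * T by rewrite /T; field; rewrite gt_eqF.
    rewrite [(kap / m%:R * T) ^+ m]exprMn /cst le_eqVlt; apply/orP; left; apply/eqP.
    by move: (T ^+ m) Tm ((kap / m%:R) ^+ m) => a a0 b; field; rewrite gt_eqF.
  apply: Rintegral_le => //.
    by apply: integrable_bounded_on (4 * c ^+ 2 / T ^+ m) mA (lebesgue_rV_compact cA) _ _ => // y _; rewrite ger0_norm// divr_ge0 ?(ltW Tm)// mulr_ge0// sqr_ge0.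
  move=> y Ay; have Oy := AO j y Ay; have [By _] := AB y Ay.
  set q := sqdist x y; have q0 : 0 < q by apply: sqdist_gt0; exact: ne.
  have -> : jdensity 0 (jet g) (jet g) y = 4 * F1 q ^+ 2 * q.
    transitivity (4 * F1 q ^+ 2 * \sum_i (y - x) ord0 i * (y - x) ord0 i) => //.
    rewrite /jdensity mul0r add0r mulr_sumr; apply: eq_bigr => i _.
    by rewrite jet_lift (rad i).2// -/q !mxE; ring.
  pose r := Num.sqrt q; have r0 : 0 < r by rewrite sqrtr_gt0.
  have rq : r ^+ 2 = q by rewrite sqr_sqrtr// ltW.
  have rT : r <= T.
    rewrite -ler_sqr ?nnegrE ?(ltW r0) ?(ltW T0)// rq.
    apply: le_trans (sqdist_le x y) _.
    have h : `|y - x| <= 2 * t j.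
      have [_ h] := dist j y By; apply: le_trans (ltW h) _.
      by rewrite mulrC ler_wpM2r ?(ltW (t0 j))//; lra.
    have h2 : `|y - x| ^+ 2 <= (2 * t j) ^+ 2 by rewrite lerXn2r ?nnegrE// mulr_ge0// ltW.
    have -> : T ^+ 2 = m%:R * (m%:R * (2 * t j) ^+ 2) by rewrite /T; ring.
    rewrite ler_wpM2l//; apply: le_trans h2 _; rewrite ler_peMl// sqr_ge0//.
  have [h _] := prof r r0 (le_lt_trans rT Tr); rewrite rq in h.
  have h2 : c ^+ 2 <= (F1 q * r ^+ m) ^+ 2.
    have h1 : c <= - (F1 q * r ^+ m) by rewrite lerNr.
    by rewrite -[leRHS]sqrrN ler_sqr ?nnegrE ?(ltW c0)//; exact: le_trans (ltW c0) h1.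
  (* Here [r^(2 m) = r^2 r^(m - 2) r^m] and [r <= T <= 1]. *)
  have h3 : (F1 q * r ^+ m) ^+ 2 <= F1 q ^+ 2 * q * T ^+ m.
    rewrite exprMn -mulrA ler_wpM2l ?sqr_ge0// -rq.
    have [n mn] : exists n, m = n.+2 by case: (m) m1 => [|[|n]] // _; exists n.
    have -> : (r ^+ m) ^+ 2 = r ^+ 2 * (r ^+ n * r ^+ m).
      by rewrite -exprM -!exprD; congr (r ^+ _); rewrite mn muln2 -addnn !addSn add0n.
    rewrite ler_wpM2l ?sqr_ge0// -[leRHS]mul1r; apply: ler_pM.
    - by rewrite exprn_ge0// ltW.
    - by rewrite exprn_ge0// ltW.
    - by rewrite exprn_ile1 ?(ltW r0)// (le_trans rT).
    - by rewrite lerXn2r ?nnegrE ?(ltW r0) ?(ltW T0).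
  by rewrite ler_pdivrMr//; lra.
pose n := (Num.truncn (`|M| / cst)).+1.
pose K := \bigcup_(i in [set: 'I_n]) A i.
have cK : compact K.
  rewrite (_ : K = \big[setU/set0]_(i < n) A i); last first.
    rewrite -bigcup_seq; apply/seteqP; split=> y [i _ Ay]; exists i => //.
    by rewrite /= mem_index_enum.
  by elim/big_ind: _ => [|X Y|j _]; [exact: compact0|exact: compactU|have [] := hA j].
have KO : K `<=` O by move=> y [i _]; exact: AO.
exists K => //.
have lg := C1_L2jet oO (fun i => (rad i).1) cK KO m0.
have mA i : measurable (A i) by have [cA _ _] := hA i; exact: compact_measurable_rV.
apply: (@le_trans _ _ (\sum_(i < n) gradip (A i) (jet g))); last first.
  apply: gradip_disjoint_le => //; first exact: compact_measurable_rV.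
    by move=> i _ y Ay; exists i.
  move=> i j y _ _ Ai Aj; apply/val_inj/(disj _ _ y).
    by have [_ /(_ y Ai)[]] := hA i.
  by have [_ /(_ y Aj)[]] := hA j.
apply: (@le_trans _ _ (\sum_(i < n) cst)); last by apply: ler_sum.
rewrite sumr_const card_ord -mulr_natl -ler_pdivrMr//.
apply: (@le_trans _ _ (`|M| / cst)); first by rewrite ler_wpM2r ?invr_ge0 ?(ltW cst0)// ler_norm.
by apply/ltW/Num.Theory.truncnS_gt.
Qed.

End gradient_blow_up.

(** * Blow-up in L^2(D) when the needle crosses D before x *)

Section domain_blow_up.
Context {R : realType} {m : nat}.
Local Notation E := 'rV[R]_m.
Local Notation e_ i := (delta_mx ord0 i : E).
Local Notation mu := (@lebesgue_rV R m).
Local Notation J := ('I_m.+1 -> E -> R).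
Implicit Types (f g h phi psi chi : E -> R) (K L U A O Omega D S : set E) (W Z G : J) (x y z : E).

Lemma partial_eq_open O f g i : open O -> (forall y, O y -> f y = g y) ->
  forall y, O y -> partial i f y = partial i g y.
Proof.
move=> oO fg y Oy; rewrite /partial; apply: near_eq_derive.
by apply: filterS (open_nbhs_nbhs (conj oO Oy)) => z /fg.
Qed.

Lemma helmholtz_op_eq_open O f g k : open O -> (forall y, O y -> f y = g y) ->
  forall y, O y -> helmholtz_op k f y = helmholtz_op k g y.
Proof.
move=> oO fg y Oy.
have d2 i : partial i (partial i f) y = partial i (partial i g) y.
  have d1 := partial_eq_open i oO fg.
  exact: (partial_eq_open i oO d1 Oy).
by rewrite /helmholtz_op (fg y Oy) (eq_bigr _ (fun i _ => d2 i)).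
Qed.

Lemma helmholtz_op_cos k (i0 : 'I_m) (b : R) y :
  helmholtz_op k (fun y => cos (k * y ord0 i0 + b)) y = 0.
Proof.
pose u (y : E) : R := k * y ord0 i0 + b.
have du i (z : E) : is_derive z (e_ i) u (k * (i == i0)%:R).
  have h := is_deriveD (is_deriveZ k (is_derive_coord z (e_ i) i0)) (is_derive_cst b z (e_ i)).
  by apply: (is_derive_eq h); rewrite addr0 /GRing.scale/= !mxE eqxx eq_sym.
have p1 i : partial i (fun y => cos (u y)) = fun z => - (k * (i == i0)%:R) * sin (u z).
  apply/funext => z; have [_ h] := is_derive_comp (is_derive_cos (u z)) (du i z).
  by rewrite /partial h; ring.
have p2 i (z : E) : partial i (partial i (fun y => cos (u y))) z =
    - (k * (i == i0)%:R) * (cos (u z) * (k * (i == i0)%:R)).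
  rewrite p1; have h := is_deriveZ (- (k * (i == i0)%:R)) (is_derive_comp (is_derive_sin (u z)) (du i z)).
  by have [_ h2] := h; exact: h2.
rewrite /helmholtz_op (eq_bigr (fun i => if i == i0 then - k ^+ 2 * cos (u y) else 0)); last first.
  by move=> i _; rewrite p2; case: eqP => _ /=; ring.
by rewrite -big_mkcond /= big_pred1_eq /u; ring.
Qed.

(* The localised plane wave [chi * cos (k (y_0 - x_0))]. *)
Lemma localized_wave k K O x : (0 < m)%N -> compact K -> open O -> K `<=` O -> K x ->
  exists psi (r d : R), [/\ test_function O psi, 0 < r, 0 < d, d <= r &
    (forall y z, K y -> `|y - z| < r -> helmholtz_op k psi z = 0) /\
    (forall y, `|x - y| < d -> 2^-1 <= psi y)].
Proof.
move=> m0 cK oO KO Kx; have [chi sc [c01 [r r0 c1] [L cL [LO c0]]]] := smooth_cutoff cK oO KO.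
pose i0 := Ordinal m0; pose b := - (k * x ord0 i0).
pose h (y : E) := cos (k * y ord0 i0 + b).
have sh : smooth h by have [] := smooth_trig i0 k b.
have hx : h x = 1 by rewrite /h /b subrr cos0.
have [d d0 hd] : exists2 d : R, 0 < d & forall y, `|x - y| < d -> 2^-1 <= h y.
  have ch := smooth_continuous sh.
  have /nbhs_ballP[d d0 hd] : \forall y \near x, 2^-1 < h y.
    by apply: (cvgr_gt _ (ch x)); rewrite hx invf_lt1// ltr1n.
  by exists d => // y yd; apply/ltW/hd; rewrite ball_rVE.
exists (fun y => chi y * h y), r, (Num.min r d); split=> //.
- exact: test_functionM cL LO sc c0 sh.
- by rewrite lt_min r0.
- by rewrite ge_min lexx.
split=> [y z Ky yz|y]; last first.
  by rewrite lt_min => /andP[yr yd]; rewrite (c1 x y)// mul1r; exact: hd.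
have zB : ball y r z by rewrite ball_rVE.
rewrite (@helmholtz_op_eq_open (ball y r) _ h)//; first exact: helmholtz_op_cos.
  exact: ball_open.
by move=> w; rewrite ball_rVE => yw; rewrite (c1 y w)// mul1r.
Qed.

(** One more integration by parts moves the whole operator to the test function, so that only the
    values of [W] are involved. *)
Lemma helmholtz_jet_pairing k Omega W psi : open Omega -> helmholtz_jet k Omega W ->
  test_function Omega psi -> \int[mu]_(y in Omega) (W ord0 y * helmholtz_op k psi y) = 0.
Proof.
move=> oO [lW gW eW] tpsi; have mO := open_measurable_rV oO.
have lp : L2r mu Omega psi by have := L2jet_jet mO tpsi ord0; rewrite jet_ord0.
have tdd i := test_function_partial i (test_function_partial i tpsi).
have ldd i : L2r mu Omega (partial i (partial i psi)).
  by have := L2jet_jet mO (tdd i) ord0; rewrite jet_ord0.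
have i1 i := L2r_integrableM mO (lW ord0) (ldd i).
have [i2 e2] := integrable_sumR (index_enum 'I_m) mO i1.
have i3 := L2r_integrableM mO (lW ord0) (L2rZ mO (k ^+ 2) lp).
transitivity (\int[mu]_(y in Omega) (\sum_i W ord0 y * partial i (partial i psi) y +
   W ord0 y * (k ^+ 2 * psi y))).
  by apply: eq_Rintegral => y _; rewrite /helmholtz_op mulrDr mulr_sumr.
rewrite RintegralD// e2 -[X in _ + X]/(ip mu Omega (W ord0) (fun y => k ^+ 2 * psi y)).
rewrite ipC ipZl// ipC; have := eW _ tpsi; rewrite /jform jet_ord0.
rewrite [X in _ = 0 -> X + _ = 0](_ : _ =
  - \sum_(i < m) ip mu Omega (W (lift ord0 i)) (jet psi (lift ord0 i))); first lra.
rewrite -sumrN; apply: eq_bigr => i _; rewrite jet_lift gW//.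
exact: test_function_partial.
Qed.

Lemma ip_bounded A f (M : R) : measurable A -> (mu A < +oo)%E -> measurable_fun A f ->
  (forall y, A y -> `|f y| <= M) -> L2r mu A f /\ ip mu A f f <= M ^+ 2 * fine (mu A).
Proof.
move=> mA fin mf hM; have [l1 e1] := ip_cst 1 mA fin.
have [h1 h2] := ip_mul_bounded mA mf hM l1.
have fE : (fun y => f y * 1) = f by apply/funext => y; rewrite mulr1.
by move: h1 h2; rewrite fE e1 expr1n mul1r.
Qed.

Lemma within_segment_compact (sigma : R -> E) (a b : R) : 0 <= a -> b <= 1 ->
  {within `[0, 1], continuous sigma} -> compact (sigma @` `[a, b]).
Proof.
move=> a0 b1 cs; apply: continuous_compact; last exact: segment_compact.
apply: continuous_subspaceW cs => t /=; rewrite !in_itv /= => /andP[h1 h2].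
by rewrite (le_trans a0 h1) (le_trans h2 b1).
Qed.

(* Testing the equation of [Rn n] with a wave localised around the part of the needle
   after its point [sigma t0] in [D], one sees that, if the [Rn n] were bounded in
   [L^2(D)], the fundamental solution would satisfy the same identity, in contradiction
   with its singularity at [x]. *)
Lemma domain_blow_up k F F1 F2 Omega D (sigma : R -> E) x (t0 : R) (Rn : nat -> J) (M : R) :
  (1 < m)%N -> @radial_profile R m k F F1 F2 -> open Omega -> open D -> D `<=` Omega ->
  {within `[0, 1], continuous sigma} -> {in `[0, 1] &, injective sigma} -> sigma 1 = x ->
  {in `]0, 1[, forall t, Omega (sigma t)} -> Omega x -> ~ D x ->
  mu (sigma @` `[0, 1]) = 0%E -> 0 < t0 -> t0 <= 1 -> D (sigma t0) ->
  (forall n, helmholtz_jet k Omega (Rn n)) ->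
  jets_converge (Omega `\` sigma @` `[0, 1]) Rn (jet (fun y => F (sqdist x y))) ->
  exists N, forall n, (N <= n)%N -> M <= ip mu D (Rn n ord0) (Rn n ord0).
Proof.
move=> m1 prof oO oD DO cs inj s1 sO Ox nDx S0 t00 t01 Dt hR conv.
apply: contrapT => /forallNP nN.
have {nN} often N : exists2 n, (N <= n)%N & ip mu D (Rn n ord0) (Rn n ord0) < M.
  have /existsNP[n /not_implyP[Nn /negP]] := nN N.
  by rewrite -ltNge => h; exists n.
have [dF dF1 _ _ _] := prof.
have cF1 s : 0 < s -> {for s, continuous F1} by move=> /dF1/is_derive_continuous.
have m0 : (0 < m)%N by exact: ltn_trans m1.
pose g y := F (sqdist x y); pose S := sigma @` `[0, 1].
have cS : compact S by exact: within_segment_compact.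
have clS := compact_closed_rV cS; have mS := compact_measurable_rV cS.
have mO := open_measurable_rV oO; have mD := open_measurable_rV oD.
pose U := Omega `\` S.
have oU : open U by rewrite /U setDE; apply: openI => //; exact: closed_openC.
have Sx : S x by exists 1; rewrite ?s1//= in_itv /= ler01 lexx.
have neU y : U y -> y <> x by move=> [_ nS] yx; apply: nS; rewrite yx.
have CU i := (radial_C1 i dF cF1 neU).1.
have neD y : D y -> y <> x by move=> Dy yx; apply: nDx; rewrite -yx.
have CD i := (radial_C1 i dF cF1 neD).1.
have cgD y : D y -> {for y, continuous g}.
  by move=> Dy; have [+ _ _] := CD (Ordinal m0) y Dy.
have cgU y : U y -> {for y, continuous g}.
  by move=> Uy; have [+ _ _] := CU (Ordinal m0) y Uy.
set p := sigma t0 in Dt.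
have [d1 d10 hd1] := open_ball_subset oD Dt.
pose d := d1 / 2; have d0 : 0 < d by rewrite divr_gt0.
pose B := ball p d; pose Bc := [set y | `|p - y| <= d].
have cBc : compact Bc by exact: closed_ball_rV_compact.
have BcD : Bc `<=` D by move=> y /= h; apply: hd1; rewrite ball_rVE; apply: le_lt_trans h _; rewrite /d; lra.
have BBc : B `<=` Bc by move=> y; rewrite /B ball_rVE /Bc /= => /ltW.
have oB : open B by exact: ball_open.
have mB := open_measurable_rV oB.
pose K1 := sigma @` `[t0, 1]; pose S1 := sigma @` `[0, t0].
have cK1 : compact K1 by apply: within_segment_compact => //; exact: ltW.
have clS1 : closed S1 by apply: compact_closed_rV; exact: within_segment_compact.
(* The part of the needle before [t0] is removed, except inside the ball [B] around [sigma t0];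
   injectivity keeps the remaining part [K1] in [O]. *)
pose O := Omega `&` ~` (S1 `&` ~` B).
have oOO : open O by apply: openI => //; apply: closed_openC; apply: closedI => //; exact: open_closedC.
have t0in : t0 \in `[0, 1] by rewrite in_itv /= (ltW t00).
have K1O : K1 `<=` O.
  move=> y [t]; rewrite /= in_itv /= => /andP[ht0 ht1] <-; split.
    have [t1|t1] := eqVneq t 1; first by rewrite t1 s1.
    by apply: sO; rewrite in_itv /= (lt_le_trans t00 ht0) lt_neqAle t1.
  move=> [[t']]; rewrite /= in_itv /= => /andP[h0 ht'] tt' []; rewrite /B ball_rVE.
  have e : t' = t.
    by apply: inj tt'; rewrite in_itv /=; [rewrite h0 (le_trans ht')|rewrite (le_trans (ltW t00))].
  have -> : t = t0 by apply/eqP; rewrite eq_le -{1}e ht'.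
  by rewrite subrr normr0.
have K1x : K1 x by exists 1; rewrite ?s1//= in_itv /= t01 lexx.
have [psi [r [d' [tpsi r0 d'0 d'r [van near_x]]]]] := localized_wave k m0 cK1 oOO K1O K1x.
have tO : test_function Omega psi by apply: test_functionS tpsi => y [].
have tT := test_functionT tpsi.
have [sp [L cL [LO p0]]] := tpsi.
pose f := helmholtz_op k psi; have cf : continuous f by exact: helmholtz_op_continuous.
have clL := compact_closed_rV cL.
have f0 y : ~ L y -> f y = 0.
  move=> nL; rewrite /f /helmholtz_op p0// mulr0 addr0 big1// => i _.
  exact: (partial_zero_off i clL (partial_zero_off i clL p0) nL).
pose V := \bigcup_(y in K1) ball y r.
have oV : open V by apply: bigcup_open => y _; exact: ball_open.
(* [f] vanishes off [L] and on [V], a neighbourhood of [K1]. It is thus supported in [B] and [Q],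
   and [Q] is a compact set that misses the needle. *)
pose Q := L `&` (~` V `&` ~` B).
have cQ : compact Q by apply: compact_closedI => //; apply: closedI; exact: open_closedC.
have QU : Q `<=` U.
  move=> y [Ly [nV nB]]; have [Oy nS1] := LO y Ly; split=> // -[t].
  rewrite /= in_itv /= => /andP[h0 h1] ty; have [tt|tt] := leP t t0.
    by apply: nS1; split=> //; exists t => //=; rewrite in_itv /= h0.
  apply: nV; exists y; last exact: ballxx.
  by exists t => //=; rewrite in_itv /= (ltW tt).
have [N0 QN0] := compact_exhaustion oU cQ QU.
pose I := \int[mu]_y (g y * f y).
have I0 : I <> 0.
  apply: (fundamental_pairing_neq0 prof tT d'0) => y xy; split; last exact: near_x.
  by apply: (van x) => //; exact: lt_le_trans d'r.
pose fT := ip mu setT f f.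
have lfT : L2r mu setT f by apply: L2r_compact_support => //; exists L.
have fT0 : 0 <= fT by exact: ip_ge0.
have [Mf Mf0 hMf] := bounded_on_compact cBc (fun y _ => cf y).
have [Mg Mg0 hMg] := bounded_on_compact cBc (fun y By => cgD y (BcD y By)).
have M0 : 0 < M by have [n _] := often 0%N; apply: le_lt_trans; exact: ip_ge0.
pose c := I ^+ 2; have c0 : 0 < c by rewrite lt_def sqr_ge0 andbT expf_neq0//; apply/eqP.
(* Collects the constants of the two error terms on [A2]: if the measure of [A2] is below
   [c / (4 X)], these terms contribute at most [c / 4]. *)
pose X := 3 * (M * Mf ^+ 2) + 3 * (Mg ^+ 2 * fT) + 1.
have X0 : 0 < X.
  by rewrite ltr_wpDl// addr_ge0// !mulr_ge0 ?sqr_ge0// ltW.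
pose eta := c / (4 * X); have eta0 : 0 < eta by rewrite divr_gt0// mulr_gt0.
have mE n : measurable (exhaustion U n) by apply: compact_measurable_rV; exact: exhaustion_compact.
have mBS : measurable (B `\` S) by exact: measurableD.
have finB : (mu B < +oo)%E by apply: le_lt_trans (lebesgue_rV_compact cBc); apply: le_measure; rewrite ?inE//; exact: compact_measurable_rV.
have finBS : (mu (B `\` S) < +oo)%E.
  by apply: le_lt_trans finB; apply: le_measure; rewrite ?inE// => y [].
have BSU : B `\` S `<=` \bigcup_n exhaustion U n.
  by rewrite bigcup_exhaustion// => y [By nS]; split=> //; apply/DO/BcD/BBc.
have [N1 hN1] := nondecreasing_measure_diff mE (@exhaustionS _ _ U) mBS BSU finBS eta0.
(* [A1] contains [Q] and almost all of [B]. On the small remainder [A2] the assumed bound in L^2(D)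
   replaces convergence. *)
pose N := maxn N0 N1; pose A1 := exhaustion U N; pose A2 := B `\` A1.
have cA1 : compact A1 by exact: exhaustion_compact.
have A1U : A1 `<=` U by exact: exhaustion_subset.
have mA1 : measurable A1 by exact: mE.
have mA2 : measurable A2 by exact: measurableD.
have A2B : A2 `<=` B by move=> y [].
have A2D := subset_trans A2B (subset_trans BBc BcD).
have hA2 : (mu A2 < eta%:E)%E.
  apply: le_lt_trans hN1; rewrite -[leRHS]adde0 -S0.
  apply: le_trans (measureU2 _ _ _); [|exact: measurableD|exact: mS].
  apply: le_measure; rewrite ?inE//; first by apply: measurableU => //; exact: measurableD.
  move=> y [By nA1]; have [Sy|nS] := pselect (S y); [by right|left; split=> //].
  by move=> /(@exhaustionS _ _ U _ _ (leq_maxr N0 N1)); exact: nA1.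
have finA2 : (mu A2 < +oo)%E by apply: lt_trans hA2 _; rewrite ltry.
have fA2 : fine (mu A2) < eta by rewrite -lte_fin fineK// ge0_fin_numE.
have fA20 : 0 <= fine (mu A2) by rewrite fine_ge0.
have disj : [disjoint A1 & A2] by apply/disj_set2P/seteqP; split=> // y [? []].
have zero y : ~ (A1 `|` A2) y -> f y = 0.
  move=> /not_orP[n1 n2]; have [Ly|nL] := pselect (L y); last exact: f0.
  have [Vy|nV] := pselect (V y).
    by have [z K1z] := Vy; rewrite ball_rVE => zy; exact: (van z).
  have [By|nB] := pselect (B y); first by case: n2.
  by case: n1; apply: (@exhaustionS _ _ U _ _ (leq_maxl N0 N1)); apply: QN0.
have AO : A1 `|` A2 `<=` Omega by move=> y [/A1U[]//|/A2D/DO].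
have mA := measurableU _ _ mA1 mA2.
have lf A : measurable A -> L2r mu A f by move=> mA'; exact: L2rS lfT.
have pairR n : ip mu A1 (Rn n ord0) f + ip mu A2 (Rn n ord0) f = 0.
  have [lR _ _] := hR n.
  rewrite -ip_setU//; [|exact: L2rS (lR ord0)|exact: lf].
  rewrite -[RHS](helmholtz_jet_pairing oO (hR n) tO) /ip.
  have z1 y : ~ (A1 `|` A2) y -> Rn n ord0 y * f y = 0 by move=> /zero ->; rewrite mulr0.
  have z2 y : ~ Omega y -> Rn n ord0 y * f y = 0 by move=> nO; apply: z1 => /AO.
  by rewrite (zero_off_Rintegral z1) (zero_off_Rintegral z2).
have lg1 : L2r mu A1 g by have := C1_L2jet oU CU cA1 A1U m0 ord0; rewrite jet_ord0.
have mcg : measurable_fun A2 g.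
  by apply: measurable_funS A2D (continuous_measurable_rV oD cgD).
have [lg2 hg2] := ip_bounded mA2 finA2 mcg (fun y A2y => hMg y (BBc _ (A2B _ A2y))).
have [lf2 hf2] := ip_bounded mA2 finA2 (lf A2 mA2).1 (fun y A2y => hMf y (BBc _ (A2B _ A2y))).
have pairG : I = ip mu A1 g f + ip mu A2 g f.
  have lgA : L2r mu (A1 `|` A2) g.
    have [Mg1 Mg10 hMg1] := bounded_on_compact cA1 (fun y Ay => cgU y (A1U y Ay)).
    apply: (@L2r_bounded _ _ _ _ _ mA _ (Mg + Mg1)).
    - by apply: le_lt_trans (measureU2 mu mA1 mA2) _; rewrite lte_add_pinfty// lebesgue_rV_compact.
    - by apply/measurable_funU => //; split=> //; exact: lg1.1.
    - move=> y [Ay|Ay].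
        by apply: le_trans (hMg1 y Ay) _; rewrite lerDr ltW.
      by apply: le_trans (hMg y (BBc _ (A2B _ Ay))) _; rewrite lerDl ltW.
  rewrite -ip_setU//; last exact: lf.
  rewrite /I /ip -(@zero_off_Rintegral _ _ (A1 `|` A2))// => y /zero ->.
  by rewrite mulr0.
have e10 : 0 < c / (12 * (fT + 1)) by rewrite divr_gt0// mulr_gt0// ltr_wpDl.
have [N2 hN2] := conv A1 cA1 A1U _ e10.
have [n /hN2 hn hM] := often N2; have [lR _ _] := hR n.
have lR1 : L2r mu A1 (Rn n ord0) by apply: L2rS (lR ord0) => // y /A1U[].
have lR2 : L2r mu A2 (Rn n ord0) by apply: L2rS (lR ord0) => // y /A2D/DO.
(* The pairing of [Rn n] is zero, so [I] consists of a convergence error on [A1] and two small terms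
   on [A2]. Three times the sum of their squares is at most [c / 2], while [I^2 = c]. *)
have IE : I = ip mu A2 g f - ip mu A1 (fun y => Rn n ord0 y - g y) f - ip mu A2 (Rn n ord0) f.
  by rewrite pairG ipBl//; [have := pairR n; lra|exact: lf].
have q1 : ip mu A1 (fun y => Rn n ord0 y - g y) f ^+ 2 <= c / (12 * (fT + 1)) * fT.
  apply: le_trans (ip_discr mA1 (L2rB mA1 lR1 lg1) (lf A1 mA1)) _.
  apply: ler_pM; [exact: ip_ge0|exact: ip_ge0| |exact: ip_subset].
  apply: le_trans (ltW hn); have := ip_le_jform A1 (Rn n - jet g) ord0.
  by rewrite (_ : (Rn n - jet g) ord0 = fun y => Rn n ord0 y - g y)// -[in RHS](jet_ord0 g).
have q2 : ip mu A2 (Rn n ord0) f ^+ 2 <= M * (Mf ^+ 2 * fine (mu A2)).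
  apply: le_trans (ip_discr mA2 lR2 (lf A2 mA2)) _.
  apply: ler_pM; [exact: ip_ge0|exact: ip_ge0| |exact: hf2].
  apply: le_trans (ltW hM); apply: ip_subset => //.
  by apply: L2rS (lR ord0).
have q3 : ip mu A2 g f ^+ 2 <= Mg ^+ 2 * fine (mu A2) * fT.
  apply: le_trans (ip_discr mA2 lg2 (lf A2 mA2)) _.
  by apply: ler_pM; [exact: ip_ge0|exact: ip_ge0|exact: hg2|exact: ip_subset].
have q4 : I ^+ 2 <= 3 * (ip mu A2 g f ^+ 2 + ip mu A1 (fun y => Rn n ord0 y - g y) f ^+ 2 +
    ip mu A2 (Rn n ord0) f ^+ 2).
  rewrite IE; set u := ip mu A2 g f; set v := ip mu A1 _ f; set w := ip mu A2 (Rn n ord0) f.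
  rewrite -subr_ge0 (_ : _ - _ = (u + v) ^+ 2 + (u + w) ^+ 2 + (v - w) ^+ 2); last by ring.
  by rewrite !addr_ge0 ?sqr_ge0.
have q5 : 3 * (c / (12 * (fT + 1)) * fT) <= c / 4.
  have -> : 3 * (c / (12 * (fT + 1)) * fT) = c / 4 * (fT / (fT + 1)).
    by field; rewrite gt_eqF// ltr_wpDl.
  by rewrite ler_piMr ?divr_ge0 ?(ltW c0)// ler_pdivrMr ?ltr_wpDl// mul1r lerDl.
have q6 : 3 * (M * (Mf ^+ 2 * fine (mu A2))) + 3 * (Mg ^+ 2 * fine (mu A2) * fT) <= c / 4.
  have -> : 3 * (M * (Mf ^+ 2 * fine (mu A2))) + 3 * (Mg ^+ 2 * fine (mu A2) * fT) =
    (X - 1) * fine (mu A2) by rewrite /X; ring.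
  have -> : c / 4 = X * eta by rewrite /eta; field; rewrite gt_eqF.
  have : (X - 1) * fine (mu A2) <= X * fine (mu A2) by rewrite ler_wpM2r//; lra.
  by move/le_trans; apply; rewrite ler_pM2l// ltW.
rewrite -/c in q4; suff : c < c by rewrite ltxx.
lra.
Qed.

End domain_blow_up.

(** * Energies bounded below by the gradient on D *)

Section energy_estimates.
Context {R : realType} {m : nat}.
Local Notation E := 'rV[R]_m.
Local Notation mu := (@lebesgue_rV R m).
Local Notation J := ('I_m.+1 -> E -> R).
Implicit Types (K U A O Omega D S : set E) (W Z G : J) (x y : E).

Lemma gradip_subset U A W : measurable U -> measurable A -> A `<=` U -> L2jet U W ->
  gradip A W <= gradip U W.
Proof. by move=> mU mA AU lW; apply: ler_sum => i _; exact: ip_subset. Qed.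

Lemma gradip_le_sqr A W G : measurable A -> L2jet A W -> L2jet A G ->
  gradip A G <= 2 * gradip A (W - G) + 2 * gradip A W.
Proof.
move=> mA lW lG; have linA := @linear_L2jet R m A mA; have bilA := bilinear_jform 0 mA.
have pos Y : L2jet A Y -> 0 <= jform 0 A Y Y by rewrite jform0E gradip_ge0.
have := form_sqrB_le2 linA bilA pos lW (lsetB linA lW lG).
by rewrite opprB addrC subrK !jform0E; lra.
Qed.

Lemma gradip_le_jform A W : gradip A W <= jform 1 A W W.
Proof. by rewrite jformE lerDr mul1r ip_ge0. Qed.

(** The smallness condition [8 k^2 C_j^2 < 1] gives [22/3 k^2 C_j^2 <= 11/12]. Norms on the core [A]
    stay bounded because [A] misses [S]. The second bound turns a blow-up in L^2(D) into one of the
    gradient. *)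
Lemma energy_bounds k Omega D (N : nat) (Dj : 'I_N -> set E) (C : 'I_N -> R) S
    (Rn wn : nat -> J) G :
  open Omega -> open D -> bounded_set D -> lipschitz_boundary D -> closure D `<=` Omega ->
  (forall j, lipschitz_domain (Dj j)) -> D = \bigcup_(j in [set: 'I_N]) Dj j ->
  (forall j l, j != l -> closure (Dj j) `&` closure (Dj l) = set0) ->
  (forall j, poincare_constant (Dj j) (C j)) ->
  (forall j, 0 < 1 - 2 * k ^+ 2 * C j ^+ 2 * (1 + 1) ^+ 2) ->
  compact S -> mu S = 0%E -> (forall n, helmholtz_jet k Omega (Rn n)) ->
  (forall n, 0 <= jform (- k ^+ 2) (Omega `\` closure D) (wn n) (wn n)) ->
  (forall K, compact K -> K `<=` Omega `\` S -> L2jet K G) ->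
  jets_converge (Omega `\` S) Rn G ->
  exists (p c : R) (N0 : nat), 0 <= p /\ forall n, (N0 <= n)%N ->
    12^-1 * gradip D (Rn n) - c <= energy k Omega D (Rn n) (wn n) /\
    ip mu D (Rn n ord0) (Rn n ord0) <= p * gradip D (Rn n) + c.
Proof.
move=> oO oD bD lD DO lip DE disj hC hk cS S0 hR hw lG conv.
have mO := open_measurable_rV oO; have mD := open_measurable_rV oD.
have D1 : D `<=` Omega by move=> y Dy; apply: DO; exact: subset_closure.
have [A [cA AD] hA] := union_poincare lip DE disj hC cS S0.
have mA := compact_measurable_rV cA.
have AO : A `<=` Omega `\` S by move=> y /AD[/D1].
have [N0 hN0] := conv A cA AO 1 ltr01; have lGA := lG A cA AO.
pose p : R := \sum_j 22 / 3 * C j ^+ 2.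
have p0 : 0 <= p by apply: sumr_ge0 => j _; rewrite mulr_ge0// sqr_ge0.
pose c1 := 16 / 3 * (2 + 2 * ip mu A (G ord0) (G ord0)).
have c10 : 0 <= c1 by rewrite mulr_ge0// addr_ge0// mulr_ge0// ip_ge0.
have k20 : 0 <= k ^+ 2 by exact: sqr_ge0.
exists p, (k ^+ 2 * c1 + c1), N0; split=> // n /hN0 hn; have [lR gR _] := hR n.
have lRD := L2jetS mO mD D1 lR; have gRD := weak_gradientS D1 gR.
have lRA : L2jet A (Rn n) by apply: L2jetS lR => // y /AO[].
have ipA : 16 / 3 * ip mu A (Rn n ord0) (Rn n ord0) <= c1.
  rewrite /c1 ler_wpM2l//; apply: le_trans (ip_le_sqr mA (lRA ord0) (lGA ord0)) _.
  rewrite lerD2r; have := ip_le_jform A (Rn n - G) ord0.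
  by rewrite (_ : (Rn n - G) ord0 = fun y => Rn n ord0 y - G ord0 y)//; lra.
split.
  apply: energy_ge => //.
  have h := hA (k ^+ 2) (11 / 12) k20 ltac:(by []) _ _ lRD gRD.
  apply: le_trans (h _) _.
    by move=> j; have := hk j; rewrite !expr2; lra.
  rewrite lerD2l mulrAC mulrC; have := ler_wpM2l k20 ipA; lra.
have h := hA 1 p ler01 p0 _ _ lRD gRD.
have : 1 * ip mu D (Rn n ord0) (Rn n ord0) <= p * gradip D (Rn n) + 16 / 3 * 1 * ip mu A (Rn n ord0) (Rn n ord0).
  apply: h => j; rewrite mul1r /p (bigD1 j)//= lerDl; apply: sumr_ge0 => i _.
  by rewrite mulr_ge0// sqr_ge0.
have := mulr_ge0 k20 c10; rewrite mul1r mulr1; lra.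
Qed.

(** On the compact set [K], where the squared error is below 1, [gradip_le_sqr] passes from
    [2 M + 2] for the fundamental solution to [M] for [Rn n]. *)
Lemma boundary_gradient_blow_up k F F1 F2 Omega D S x (Rn : nat -> J) (M : R) :
  (1 < m)%N -> @radial_profile R m k F F1 F2 -> open Omega ->
  open D -> lipschitz_boundary D -> D `<=` Omega -> closure D x -> compact S -> mu S = 0%E -> S x ->
  (forall n, helmholtz_jet k Omega (Rn n)) ->
  jets_converge (Omega `\` S) Rn (jet (fun y => F (sqdist x y))) ->
  exists N, forall n, (N <= n)%N -> M <= gradip D (Rn n).
Proof.
move=> m1 prof oO oD lD DO cDx cS S0 Sx hR conv.
have mO := open_measurable_rV oO; have mD := open_measurable_rV oD.
have [K [cK KD] hK] := gradient_blow_up (2 * M + 2) m1 prof oD lD cDx cS S0 Sx.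
have mK := compact_measurable_rV cK.
have KO : K `<=` Omega `\` S by move=> y /KD[/DO].
have [N hN] := conv K cK KO 1 ltr01; exists N => n /hN hn; have [lR _ _] := hR n.
have oOS : open (Omega `\` S).
  by rewrite setDE; apply: openI => //; exact: closed_openC (compact_closed_rV cS).
have ne y : (Omega `\` S) y -> y <> x by move=> [_ nS] yx; apply: nS; rewrite yx.
have [dF dF1 _ _ _] := prof.
have cF1 s : 0 < s -> {for s, continuous F1} by move=> /dF1/is_derive_continuous.
have lG : L2jet K (jet (fun y => F (sqdist x y))).
  by apply: (C1_L2jet oOS) => //; [move=> i; exact: (radial_C1 i dF cF1 ne).1|exact: ltn_trans m1].
have lRK : L2jet K (Rn n) by apply: L2jetS lR => // y /KO[].
have h1 := gradip_le_sqr mK lRK lG.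
have h2 := gradip_le_jform K (Rn n - jet (fun y => F (sqdist x y))).
have h3 : gradip K (Rn n) <= gradip D (Rn n).
  by apply: gradip_subset => //; [move=> y /KD[]|exact: L2jetS lR].
lra.
Qed.

End energy_estimates.

(** Made for an energy of the real part that tends to infinity and an energy of the imaginary part
    that is merely bounded below. *)
Lemma diverges_toP {R : realType} (c : nat -> R[i]) (r s : nat -> R) (B : R) (N0 : nat) :
  (forall n, c n = (r n + s n)%:C) ->
  (forall n, (N0 <= n)%N -> B <= s n) ->
  (forall M : R, exists N, forall n, (N <= n)%N -> M <= r n) -> diverges_to_infinity c.
Proof.
move=> cE hs hr; exists (fun n => r n + s n) => //; apply/cvgryPge => M.
have [N hN] := hr (M - B); exists (maxn N N0) => // n /=; rewrite geq_max => /andP[n1 n2].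
by have := hN n n1; have := hs n n2; lra.
Qed.

Theorem theorem2p1 (R : realType) (m : nat) (hm : m = 2%N \/ m = 3%N)
  (Omega D : set 'rV[R]_m)
  (hOmega : lipschitz_domain Omega)
  (openD : open D) (lipD : lipschitz_boundary D)
  (DOmega : closure D `<=` Omega)
  (connOD : connected (Omega `\` closure D))
  (k : R) (k_ge0 : 0 <= k)
  (hDirichlet : not_eigenvalue k Omega Omega)
  (hMixed : not_eigenvalue k Omega (Omega `\` closure D))
  (N : nat) (hN : (0 < N)%N) (Dj : 'I_N -> set 'rV[R]_m)
  (hDj : forall j, lipschitz_domain (Dj j))
  (hD : D = \bigcup_(j in [set: 'I_N]) Dj j)
  (disjDj : forall j l, j != l -> closure (Dj j) `&` closure (Dj l) = set0)
  (C0 : R) (hC0 : poincare_constant0 Omega (Omega `\` closure D) C0)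
  (C : 'I_N -> R) (hC : forall j, poincare_constant (Dj j) (C j))
  (hk0 : k ^+ 2 * C0 ^+ 2 <= 1)
  (hk : forall j, 0 < 1 - 2 * k ^+ 2 * C j ^+ 2 * (1 + 1) ^+ 2)
  (x : 'rV[R]_m) (hx : Omega x)
  (sigma : R -> 'rV[R]_m) (hsigma : needle Omega x sigma) :
  [/\ (Omega `\` closure D) x -> sigma @` `]0, 1] `&` closure D = set0 ->
      forall v, needle_sequence k Omega x sigma v ->
        converges (indicator k Omega D v),
      (Omega `\` closure D) x -> sigma @` `]0, 1] `&` D !=set0 ->
      forall v, needle_sequence k Omega x sigma v ->
        diverges_to_infinity (indicator k Omega D v) &
      closure D x ->
      forall v, needle_sequence k Omega x sigma v ->
        diverges_to_infinity (indicator k Omega D v)].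
Proof.
have m1 : (1 < m)%N by case: hm => ->.
have m0 : (0 < m)%N by exact: ltn_trans m1.
have [oO _ _ bO _] := hOmega; have mO := open_measurable_rV oO.
have [M M0 OM] := bounded_setP bO.
have D1 : D `<=` Omega by move=> y Dy; apply: DOmega; exact: subset_closure.
have bD : bounded_set D by apply: (@bounded_setI _ _ M) => y /D1/OM.
have cD : compact (closure D).
  by apply: (@compact_rV _ _ _ M); [exact: closed_closure|move=> y /DOmega/OM].
set U := Omega `\` closure D.
have oU : open U.
  by rewrite /U setDE; apply: openI => //; apply: closed_openC; exact: closed_closure.
have mU := open_measurable_rV oU; have UO : U `<=` Omega by move=> y [].
have [[cs pl] inj [_ n0] s1 sO] := hsigma.
have [cS S0] := needle_null m1 cs pl; set S := sigma @` `[0, 1] in cS S0.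
have Sx : S x by exists 1; rewrite ?s1//= in_itv /= ler01 lexx.
have [c c0 coer] := helmholtz_coercive oO bO openD lipD DOmega hMixed hC0 hk0.
have [F [F1 [F2 [H [H1' [prof dH cH fund]]]]]] := fundamental_radial hm k_ge0.
have [dF dF1 _ _ _] := prof.
have cF1 s : 0 < s -> {for s, continuous F1} by move=> /dF1/is_derive_continuous.
pose GR : 'I_m.+1 -> 'rV[R]_m -> R := jet (fun y => F (sqdist x y)).
pose GI : 'I_m.+1 -> 'rV[R]_m -> R := jet (fun y => H (sqdist x y)).
have oOS : open (Omega `\` S).
  by rewrite setDE; apply: openI => //; exact: closed_openC (compact_closed_rV cS).
have common v : needle_sequence k Omega x sigma v -> exists wR wI : nat -> 'I_m.+1 -> 'rV[R]_m -> R,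
    [/\ [/\ jets_converge (Omega `\` S) (fun n => Rej Omega (v n)) GR,
         jets_converge (Omega `\` S) (fun n => Imj Omega (v n)) GI,
         forall K, compact K -> K `<=` Omega `\` S -> L2jet K GR &
         forall K, compact K -> K `<=` Omega `\` S -> L2jet K GI],
        forall n, helmholtz_jet k Omega (Rej Omega (v n)) /\ helmholtz_jet k Omega (Imj Omega (v n)),
        forall n, correction k Omega U (Rej Omega (v n)) (wR n) /\
          correction k Omega U (Imj Omega (v n)) (wI n) &
        forall n, indicator k Omega D v n =
          (energy k Omega D (Rej Omega (v n)) (wR n) + energy k Omega D (Imj Omega (v n)) (wI n))%:C].
  move=> nv; have [convR convI CR CI] := needle_sequence_jets oO m0 cS s1 dF cF1 dH cH fund nv.
  have hel n := nv.1 n.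
  have helj n : helmholtz_jet k Omega (Rej Omega (v n)) /\ helmholtz_jet k Omega (Imj Omega (v n)).
    have [hv eqv] := (weak_helmholtzP _ _ _ oO).1 (hel n).
    have [lR lI gR gI] := H1_jets oO hv.
    by split; split=> // phi tphi; have [] := eqv _ (Vjet_jet mO tphi).
  have exR n : exists w, correction k Omega U (Rej Omega (v n)) w.
    have [[lR _ _] _] := helj n.
    by have [w Vw hw] := correction_exists mU c0 coer (L2jetS mO mU UO lR); exists w.
  have exI n : exists w, correction k Omega U (Imj Omega (v n)) w.
    have [_ [lI _ _]] := helj n.
    by have [w Vw hw] := correction_exists mU c0 coer (L2jetS mO mU UO lI); exists w.
  have [wR hwR] := choice exR; have [wI hwI] := choice exI.
  exists wR, wI; split=> //; first by split=> // K cK KO; exact: (C1_L2jet oOS).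
  by move=> n; exact: indicatorE oO DOmega (hel n) (hwR n).1 (hwI n).1 (hwR n).2 (hwI n).2.
have nonneg W w : correction k Omega U W w -> 0 <= jform (- k ^+ 2) U w w.
  by move=> [Vw _]; exact: helmholtz_nonneg oU hC0 hk0 Vw.
split.
- move=> _ sD v /common[wR [wI [[convR convI lGR lGI] hel hw E]]].
  have DS : closure D `<=` Omega `\` S.
    move=> y cDy; split; first exact: DOmega.
    move=> [t]; rewrite /= in_itv /= => /andP[t0 t1] ty.
    (* The hypothesis on the needle omits its starting point. That point lies outside the interior
       of [Omega], hence off [closure D]. *)
    have [t00|tn] := eqVneq t 0.
      by apply: n0; rewrite -t00 ty; exact: open_nbhs_nbhs (conj oO (DOmega _ cDy)).
    suff : (sigma @` `]0, 1] `&` closure D) y by rewrite sD.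
    by split=> //; exists t => //=; rewrite in_itv /= lt_neqAle eq_sym tn t0.
  have OSO : Omega `\` S `<=` Omega by move=> y [].
  have cR := energy_converges oO cD oOS DS OSO c0 coer (fun n => (hel n).1) (fun n => (hw n).1) lGR convR.
  have cI := energy_converges oO cD oOS DS OSO c0 coer (fun n => (hel n).2) (fun n => (hw n).2) lGI convI.
  by exists (fun n => energy k Omega D (Rej Omega (v n)) (wR n) +
    energy k Omega D (Imj Omega (v n)) (wI n)) => //; exact: is_cvgD cR cI.
- move=> [_ nDx] [p [[t + tp] Dp]] v nv; rewrite /= in_itv /= => /andP[t0 t1].
  have [wR [wI [[convR convI lGR lGI] hel hw E]]] := common v nv.
  have [pR [bR [NR [pR0 hR]]]] := energy_bounds oO openD bD lipD DOmega hDj hD disjDj hC hk cS S0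
    (fun n => (hel n).1) (fun n => nonneg _ _ (hw n).1) lGR convR.
  have [pI [bI [NI [_ hI]]]] := energy_bounds oO openD bD lipD DOmega hDj hD disjDj hC hk cS S0
    (fun n => (hel n).2) (fun n => nonneg _ _ (hw n).2) lGI convI.
  apply: (diverges_toP (B := - bI) (N0 := NI) E) => [n /hI[h _]|B].
    by apply: le_trans h; rewrite -[leLHS]add0r lerD2r mulr_ge0 ?gradip_ge0//.
  have nDx' : ~ D x by move=> /subset_closure.
  have Dt : D (sigma t) by rewrite tp.
  (* The threshold is inserted in the bound of the L^2(D) norm by [pR] times the gradient plus [bR]:
     the gradient is then at least [12 (|B| + |bR|)], and the energy at least [B]. *)
  have [N1 hN1] := domain_blow_up (12 * (pR + 1) * (`|B| + `|bR|) + bR) m1 prof oO openD D1 cs inj s1 sO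
    hx nDx' S0 t0 t1 Dt (fun n => (hel n).1) convR.
  exists (maxn N1 NR) => n; rewrite geq_max => /andP[/hN1 h1 /hR[h2 h3]].
  have g0 := gradip_ge0 D (Rej Omega (v n)).
  have h4 : (pR + 1) * (12 * (`|B| + `|bR|)) <= (pR + 1) * gradip D (Rej Omega (v n)).
    rewrite mulrDl mul1r; move: h1 h3; have := mulr_ge0 pR0 g0; lra.
  rewrite ler_pM2l ?ltr_wpDl// in h4.
  by have := ler_norm B; have := ler_norm bR; lra.
- move=> cDx v nv.
  have [wR [wI [[convR convI lGR lGI] hel hw E]]] := common v nv.
  have [pR [bR [NR [pR0 hR]]]] := energy_bounds oO openD bD lipD DOmega hDj hD disjDj hC hk cS S0
    (fun n => (hel n).1) (fun n => nonneg _ _ (hw n).1) lGR convR.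
  have [pI [bI [NI [_ hI]]]] := energy_bounds oO openD bD lipD DOmega hDj hD disjDj hC hk cS S0
    (fun n => (hel n).2) (fun n => nonneg _ _ (hw n).2) lGI convI.
  apply: (diverges_toP (B := - bI) (N0 := NI) E) => [n /hI[h _]|B].
    by apply: le_trans h; rewrite -[leLHS]add0r lerD2r mulr_ge0 ?gradip_ge0//.
  have [N1 hN1] := boundary_gradient_blow_up (12 * (B + bR)) m1 prof oO openD lipD D1 cDx cS S0 Sx
    (fun n => (hel n).1) convR.
  exists (maxn N1 NR) => n; rewrite geq_max => /andP[/hN1 h1 /hR[h2 _]].
  lra.
Qed.
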